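(* Let the setting, spaces, forms, eigenvalue problems, finite element spaces, Assumption (A) and the Multigrid Scheme be as defined in the context; in particular $\lambda_i$ is an eigenvalue of the primal problem with algebraic multiplicity $q$ and ascent $1$, and $\lambda_i^*=\overline{\lambda_i}$. Suppose that at the levels $m=1,\dots,N-1$ of the Multigrid Scheme Assumption (A) is valid and the ascent of $\lambda_{j,h_m}$ is $1$ for $j=i,\dots,i+q-1$. Let $(\lambda_{j,h_N},u_{j,h_N},w_{j,h_N},u^*_{j,h_N},w^*_{j,h_N})$, $j=i,i+1,\dots,i+q-1$, be the numerical eigenpairs obtained by the Multigrid Scheme. Then for each $j=i,\dots,i+q-1$ there exist a primal eigenfunction $(u_j,w_j)$ corresponding to $\lambda_i$ and a dual eigenfunction $(u_j^*,w_j^* )$ corresponding to $\lambda_i^*$ such that $$\|(u_{j,h_N},w_{j,h_N})-(u_j,w_j)\|_{\mathbf{H}}\lesssim\delta_{h_N}(\lambda_i),$$ $$\|(u_{j,h_N},w_{j,h_N})-(u_j,w_j)\|_{\mathbf{H}_s}\lesssim H^{r_s}\delta_{h_N}(\lambda_i),\quad s=0,1,$$ $$\|(u^*_{j,h_N},w^*_{j,h_N})-(u^*_j,w^*_j)\|_{\mathbf{H}}\lesssim\delta^*_{h_N}(\lambda_i^* ),$$ $$\|(u^*_{j,h_N},w^*_{j,h_N})-(u^*_j,w^*_j)\|_{\mathbf{H}_s}\lesssim H^{r_s}\delta^*_{h_N}(\lambda_i^* ),\quad s=0,1,$$ $$|\lambda_i-\lambda_{j,h_N}|\lesssim\delta_{h_N}(\lambda_i)\,\delta^*_{h_N}(\lambda_i^*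 ).$$
   Context: **Domain and coefficient.** $D\subset\mathbb{R}^2$ or $D\subset\mathbb{R}^3$ is a bounded simply connected domain with unit outward normal $\nu$. The (real-valued) index of refraction $n\in W^{2,\infty}(D)$ satisfies $1+\delta\le\inf_D n\le n(x)\le\sup_D n<\infty$ for some constant $\delta>0$. $(\cdot,\cdot)_0$ is the (complex) $L^2(D)$ inner product (extended as a duality pairing where needed), $\|\cdot\|_s$ is the norm of the Sobolev space $H^s(D)$, and $H^2_0(D)=\{v\in H^2(D): v=\partial v/\partial\nu=0\text{ on }\partial D\}$. **Spaces.** $\mathbf{H}=H_0^2(D)\times L^2(D)$ with norm $\|(u,w)\|_{\mathbf{H}}=\|u\|_2+\|w\|_0$; for $s=0,1$, $\mathbf{H}_s=H^s(D)\times H^{s-2}(D)$ with norm $\|(u,w)\|_{\mathbf{H}_s}=\|u\|_s+\|w\|_{s-2}$. **Forms.** $A((u,w),(v,z))=(\frac{1}{n-1}\Delta u,\Delta v)_0+(w,z)_0$, an inner product on $\mathbf{H}$ whose norm $\|\cdot\|_A$ is equivalent to $\|\cdot\|_{\mathbf{H}}$; $B((u,w),(v,z))=(\nabla(\frac{1}{n-1}u),\nabla v)_0+(\nabla u,\nabla(\frac{n}{n-1}v))_0-(\frac{n}{n-1}w,v)_0+(u,z)_0$. **Eigenvalue problems.** Primal: find $\lambda\in\mathbb{C}$ and nonzero $(u,w)\in\mathbf{H}$ with $A((u,w),(v,z))=\lambda B((u,w),(v,z))$ for all $(v,z)\in\mathbf{H}$. Dual: find $\lambda^*\in\mathbb{C}$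 and nonzero $(u^*,w^* )\in\mathbf{H}$ with $A((v,z),(u^*,w^* ))=\overline{\lambda^*}B((v,z),(u^*,w^* ))$ for all $(v,z)\in\mathbf{H}$. Primal and dual eigenvalues are related by $\lambda=\overline{\lambda^*}$. Algebraic multiplicity and ascent of an eigenvalue $\lambda$ are those of the eigenvalue $\lambda^{-1}$ of the solution operator $T:\mathbf{H}\to\mathbf{H}$ defined by $A(T(f,g),(v,z))=B((f,g),(v,z))$ for all $(v,z)\in\mathbf{H}$ (and analogously for discrete problems on subspaces of $\mathbf{H}$). $\lambda_i$ is the $i$-th primal eigenvalue, assumed to have algebraic multiplicity $q$ and ascent $1$ (so $\lambda_i=\dots=\lambda_{i+q-1}$). $M(\lambda_i)$ (resp. $M^*(\lambda_i^* )$) is the space spanned by all eigenfunctions of the primal (resp. dual) problem corresponding to $\lambda_i$ (resp. $\lambda_i^*=\overline{\lambda_i}$). **Regularity assumption R(D)** (standing). For any $\xi\in H^{-s}(D)$ ($s=0,1$) there exists $\psi\in H^{2+r_s}(D)$ with $\Delta(\frac{1}{n-1}\Delta\psi)=\xi$ in $D$, $\psi=\partial\psi/\partial\nu=0$ on $\partial D$, and $\|\psi\|_{2+r_s}\le C_p\|\xi\|_{-s}$, where $r_1\in(0,1]$, $r_0\in(0,2]$ and $C_p$ does not depend on $\xi$. **Finite element spaces.** $S^h\subset H_0^2(D)$ is a conforming finite element space of piecewise polynomials on a mesh of size $h$, and $\mathbf{H}_h=S^h\times S^h\subset\mathbf{H}$. Put $$\delta_h(\lambda_i)=\sup_{(v,z)\in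 M(\lambda_i),\ \|(v,z)\|_{\mathbf{H}}=1}\ \inf_{(v_h,z_h)\in\mathbf{H}_h}\|(v,z)-(v_h,z_h)\|_{\mathbf{H}},$$ $$\delta^*_h(\lambda^*_i)=\sup_{(v,z)\in M^*(\lambda^*_i),\ \|(v,z)\|_{\mathbf{H}}=1}\ \inf_{(v_h,z_h)\in\mathbf{H}_h}\|(v,z)-(v_h,z_h)\|_{\mathbf{H}}.$$ **Approximate eigenpairs at level $m$.** $\lambda_{j,h_m}$ ($j=i,\dots,i+q-1$) are the $q$ discrete eigenvalues approximating (converging to) $\lambda_i$ of the problem obtained by restricting the primal problem to a subspace $\mathbf{V}_m$, where $\mathbf{V}_1=\mathbf{H}_{h_1}$ and, for $m\ge2$, $\mathbf{V}_m=\mathbf{H}_{H,h_m}$ is the space chosen in Step 2 of the correction step from level $m-1$ to level $m$; $\lambda^*_{j,h_m}=\overline{\lambda_{j,h_m}}$. $M_{h_m}(\lambda_i)$ is the span of all generalized eigenfunctions of this discrete problem corresponding to $\{\lambda_{j,h_m}\}_{j=i}^{i+q-1}$, and $M^*_{h_m}(\lambda_i^* )$ is the analogous space for the discrete dual problem. $\{(u_{j,h_m},w_{j,h_m})\}_{j=i}^{i+q-1}$ is a basis of $M_{h_m}(\lambda_i)$ made of discrete primal eigenfunctions with $\|\cdot\|_A$-norm $1$, and $\{(u^*_{j,h_m},w^*_{j,h_m})\}_{j=i}^{i+q-1}$ is a basis of $M^*_{h_m}(\lambda^*_i)$ made of discrete dual eigenfunctions with $\|\cdot\|_A$-norm $1$.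 **One correction step** (from level $m$ to level $m+1$). Step 1. For $j=i,\dots,i+q-1$ find $(\widehat{u}_{j,h_{m+1}},\widehat{w}_{j,h_{m+1}})\in\mathbf{H}_{h_{m+1}}$ and $(\widehat{u}^*_{j,h_{m+1}},\widehat{w}^*_{j,h_{m+1}})\in\mathbf{H}_{h_{m+1}}$ such that for all $(v,z)\in\mathbf{H}_{h_{m+1}}$ $$A((\widehat{u}_{j,h_{m+1}},\widehat{w}_{j,h_{m+1}}),(v,z))=\lambda_{j,h_m}B((u_{j,h_m},w_{j,h_m}),(v,z)),$$ $$A((v,z),(\widehat{u}^*_{j,h_{m+1}},\widehat{w}^*_{j,h_{m+1}}))=\lambda_{j,h_m}B((v,z),(u^*_{j,h_m},w^*_{j,h_m})).$$ Step 2. Choose a space $\mathbf{H}_{H,h_{m+1}}\subset\mathbf{H}_{h_{m+1}}$ with $\mathbf{H}_{H,h_{m+1}}\supseteq\mathbf{H}_H+\mathrm{span}\{(\widehat{u}_{j,h_{m+1}},\widehat{w}_{j,h_{m+1}}),(\widehat{u}^*_{j,h_{m+1}},\widehat{w}^*_{j,h_{m+1}}): j=i,\dots,i+q-1\}$ and, for $j=i,\dots,i+q-1$, find $\lambda_{j,h_{m+1}}\in\mathbb{C}$ and nonzero $(u_{j,h_{m+1}},w_{j,h_{m+1}}),(u^*_{j,h_{m+1}},w^*_{j,h_{m+1}})\in\mathbf{H}_{H,h_{m+1}}$ such that for all $(v,z)\in\mathbf{H}_{H,h_{m+1}}$ $$A((u_{j,h_{m+1}},w_{j,h_{m+1}}),(v,z))=\lambda_{j,h_{m+1}}B((u_{j,h_{m+1}},w_{j,h_{m+1}}),(v,z)),$$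 $$A((v,z),(u^*_{j,h_{m+1}},w^*_{j,h_{m+1}}))=\lambda_{j,h_{m+1}}B((v,z),(u^*_{j,h_{m+1}},w^*_{j,h_{m+1}})).$$ The output is $\{\lambda_{j,h_{m+1}}\}_{j=i}^{i+q-1}$ together with bases $\{(u_{j,h_{m+1}},w_{j,h_{m+1}})\}_{j=i}^{i+q-1}$ of $M_{h_{m+1}}(\lambda_i)$ and $\{(u^*_{j,h_{m+1}},w^*_{j,h_{m+1}})\}_{j=i}^{i+q-1}$ of $M^*_{h_{m+1}}(\lambda_i^* )$, all of $\|\cdot\|_A$-norm $1$; $\lambda^*_{j,h_{m+1}}=\overline{\lambda_{j,h_{m+1}}}$. **Multigrid Scheme.** (1) Construct nested finite element spaces $\mathbf{H}_H=\mathbf{H}_{h_1}\subset\mathbf{H}_{h_2}\subset\cdots\subset\mathbf{H}_{h_N}$ ($H=h_1$) such that $\delta_{h_{m+1}}(\lambda_i)\approx\frac1\beta\delta_{h_m}(\lambda_i)$ and $\delta^*_{h_{m+1}}(\lambda_i^* )\approx\frac1\beta\delta^*_{h_m}(\lambda_i^* )$, with a constant $\beta>1$ depending only on the smoothness of the eigenfunctions corresponding to $\lambda_i$ and the polynomial degree; here $\approx$ means equality up to upper and lower constant factors independent of mesh size and level. (2) For $j=i,\dots,i+q-1$ find $\lambda_{j,h_1}\in\mathbb{C}$ and $(u_{j,h_1},w_{j,h_1}),(u^*_{j,h_1},w^*_{j,h_1})\in\mathbf{H}_{h_1}$ of $\|\cdot\|_A$-norm $1$ such that, for all $(v,z)\in\mathbf{H}_{h_1}$,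 $A((u_{j,h_1},w_{j,h_1}),(v,z))=\lambda_{j,h_1}B((u_{j,h_1},w_{j,h_1}),(v,z))$ and $A((v,z),(u^*_{j,h_1},w^*_{j,h_1}))=\lambda_{j,h_1}B((v,z),(u^*_{j,h_1},w^*_{j,h_1}))$; here $\lambda_{j,h_1}$ ($j=i,\dots,i+q-1$) are the $q$ eigenvalues, converging to $\lambda_i$, of the primal problem restricted to $\mathbf{H}_{h_1}$, $\lambda^*_{j,h_1}=\overline{\lambda_{j,h_1}}$, $\{(u_{j,h_1},w_{j,h_1})\}_{j=i}^{i+q-1}$ is a basis of $M_{h_1}(\lambda_i)$, and $\{(u^*_{j,h_1},w^*_{j,h_1})\}_{j=i}^{i+q-1}$ is a basis of $M^*_{h_1}(\lambda_i^* )$. (3) For $m=1,2,\dots,N-1$, apply one correction step to the level-$m$ approximate eigenpairs to obtain the level-$(m+1)$ approximate eigenpairs. **Assumption (A) (quasi-biorthogonality) at level $m$.** There are $\{(\widetilde{u}_{j,h_m},\widetilde{w}_{j,h_m})\}_{j=i}^{i+q-1}\subset M_{h_m}(\lambda_i)$ and $\{(\widetilde{u}^*_{j,h_m},\widetilde{w}^*_{j,h_m})\}_{j=i}^{i+q-1}\subset M^*_{h_m}(\lambda_i^* )$, all of $\|\cdot\|_{\mathbf{H}}$-norm $1$, such that $$|A((u_{j,h_m},w_{j,h_m}),(\widetilde{u}^*_{l,h_m},\widetilde{w}^*_{l,h_m}))|+|A((\widetilde{u}_{j,h_m},\widetilde{w}_{j,h_m}),(u^*_{l,h_m},w^*_{l,h_m}))|\lesssim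 H^{r_0}$$ for $j,l=i,\dots,i+q-1$, $j\ne l$, and such that for $j=i,\dots,i+q-1$ the quantity $$|A((u_{j,h_m},w_{j,h_m}),(\widetilde{u}^*_{j,h_m},\widetilde{w}^*_{j,h_m}))|+|A((\widetilde{u}_{j,h_m},\widetilde{w}_{j,h_m}),(u^*_{j,h_m},w^*_{j,h_m}))|$$ has a positive lower bound uniform with respect to $h_m$. **Notation.** $x\lesssim y$ means $x\le Cy$ with a constant $C$ independent of the mesh sizes and of the number of iterations (levels), possibly different at different occurrences.
   Formalization: The finite element spaces are assumed to have the usual uniform approximation rates in the mesh size (orders r_s in H^2 for H^{2+r_s} functions, order k in L^2 for H^k_0, k=1,2), and the estimates are stated for H below a threshold H_0 independent of meshes and levels. *)

(* Defs.v *)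
From HB Require Import structures.
From mathcomp Require Import all_boot all_order all_algebra.
From mathcomp Require Import all_classical all_reals all_analysis.
From mathcomp Require Import complex.

Set Implicit Arguments.
Unset Strict Implicit.
Unset Printing Implicit Defensive.

Import Order.TTheory GRing.Theory Num.Theory.
Import numFieldNormedType.Exports.

Local Open Scope classical_set_scope.
Local Open Scope ring_scope.
Local Open Scope complex_scope.

Definition rV_display : measure_display. Proof. exact. Qed.

Section measurable_rV.
Context {R : realType} (d : nat).

Definition rV_coord (i : 'I_d) (v : 'rV[R]_d) : measurableTypeR R := v ord0 i.

Let rV_set0 : g_sigma_preimage rV_coord set0.
Proof. exact: sigma_algebra0. Qed.

Let rV_setC A : g_sigma_preimage rV_coord A -> g_sigma_preimage rV_coord (~` A).
Proof. exact: sigma_algebraC. Qed.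

Let rV_bigcup (F : (set 'rV[R]_d)^nat) :
  (forall i, g_sigma_preimage rV_coord (F i)) ->
  g_sigma_preimage rV_coord (\bigcup_i F i).
Proof. exact: sigma_algebra_bigcup. Qed.

HB.instance Definition _ := @isMeasurable.Build rV_display
  'rV[R]_d (g_sigma_preimage rV_coord) rV_set0 rV_setC rV_bigcup.

Lemma measurable_rV_coord i : measurable_fun [set: 'rV[R]_d] (rV_coord i).
Proof.
move=> _ Y mY; rewrite setTI; apply: sub_sigma_algebra => /=.
rewrite -bigcup_seq/=; exists i => /=; first by rewrite mem_index_enum.
by exists Y => //; rewrite setTI.
Qed.

End measurable_rV.


Section lebesgue_rV.
Context {R : realType}.

Lemma measurable_fun_rV d' (T : measurableType d') d (f : T -> 'rV[R]_d) :
  (forall i, measurable_fun [set: T] (fun x => f x ord0 i)) ->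
  measurable_fun [set: T] f.
Proof.
move=> mf.
apply: (@measurability _ _ _ _ _ _
  (\big[setU/set0]_(i < d) preimage_set_system setT (@rV_coord R d i) measurable)) => //.
move=> _ [B + <-]; rewrite -bigcup_seq/= => -[i _ [Y mY <-]].
by rewrite setTI -comp_preimage; exact: mf.
Qed.

Definition rV_cons d (p : R * 'rV[R]_d) : 'rV[R]_d.+1 :=
  \row_i if unlift ord0 i is Some j then p.2 ord0 j else p.1.

Definition rV_uncons d (v : 'rV[R]_d.+1) : R * 'rV[R]_d :=
  (v ord0 ord0, \row_j v ord0 (lift ord0 j)).

Lemma rV_consK d : cancel (@rV_cons d) (@rV_uncons d).
Proof.
move=> [x v]; rewrite /rV_uncons mxE unlift_none; congr pair.
by apply/rowP => j; rewrite !mxE liftK.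
Qed.

Lemma measurable_rV_cons d : measurable_fun [set: R * 'rV[R]_d] (@rV_cons d).
Proof.
apply: measurable_fun_rV => i; rewrite /rV_cons.
case: (unliftP ord0 i) => [j ->|->].
  rewrite [X in measurable_fun _ X](_ : _ = @rV_coord R d j \o snd); last first.
    by apply/funext => p; rewrite !mxE liftK.
  exact: (measurableT_comp (measurable_rV_coord j) measurable_snd).
rewrite [X in measurable_fun _ X](_ : _ = fst); first exact: measurable_fst.
by apply/funext => p; rewrite mxE unlift_none.
Qed.

Lemma measurable_rV_uncons d : measurable_fun [set: 'rV[R]_d.+1] (@rV_uncons d).
Proof.
apply/measurable_fun_pairP; split; first exact: (measurable_rV_coord ord0).
apply: measurable_fun_rV => i; 
rewrite [X in measurable_fun _ X](_ : _ = @rV_coord R d.+1 (lift ord0 i)).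
  exact: measurable_rV_coord.
by apply/funext => v; rewrite !mxE.
Qed.


HB.instance Definition _ d := isMeasurableFun.Build _ _ _ _ (@rV_cons d)
  (@measurable_rV_cons d).

Section lebesgueS.
Context (d : nat) (mu : {sigma_finite_measure set 'rV[R]_d -> \bar R}).

Definition lebesgueS : set 'rV[R]_d.+1 -> \bar R :=
  pushforward (@lebesgue_measure R \x mu)%E (@rV_cons d).

Let lebesgueS0 : lebesgueS set0 = 0%E.
Proof. by rewrite /lebesgueS /pushforward preimage_set0 measure0. Qed.

Let lebesgueS_ge0 A : (0 <= lebesgueS A)%E.
Proof. by rewrite /lebesgueS /pushforward measure_ge0. Qed.

Let lebesgueS_sigma_additive : semi_sigma_additive lebesgueS.
Proof.
apply: (@measure_semi_sigma_additive _ _ _ (pushforward _ _)).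
exact: measurable_rV_cons.
Qed.

HB.instance Definition _ := isMeasure.Build _ _ _ lebesgueS
  lebesgueS0 lebesgueS_ge0 lebesgueS_sigma_additive.

Let lebesgueS_sigma_finite : sigma_finite setT lebesgueS.
Proof.
have /sigma_finiteP[F [TF ndF Foo]] := sigma_finiteT (@lebesgue_measure R).
have /sigma_finiteP[G [TG ndG Goo]] := sigma_finiteT mu.
exists (fun n => @rV_uncons d @^-1` (F n `*` G n)).
  rewrite -preimage_bigcup -[LHS](@preimage_setT _ _ (@rV_uncons d)); congr preimage.
  apply/seteqP; split => // -[x y] _.
  have : (\bigcup_i F i) x by rewrite -TF.
  have : (\bigcup_i G i) y by rewrite -TG.
  move=> [n _ Gny] [m _ Fmx]; exists (maxn m n) => //; split => /=.
    exact: (subsetPset _ _ (ndF _ _ (leq_maxl m n))).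
  exact: (subsetPset _ _ (ndG _ _ (leq_maxr m n))).
move=> n; have [mF Fn] := Foo n; have [mG Gn] := Goo n.
have mFG : measurable (F n `*` G n) by exact: measurableX.
split; first by rewrite -[X in measurable X]setTI; exact: measurable_rV_uncons.
rewrite /lebesgueS /pushforward -comp_preimage.
rewrite (_ : _ \o _ = id) ?preimage_id; last first.
  by apply/funext => p /=; rewrite rV_consK.
by rewrite product_measure1E// lte_mul_pinfty// ge0_fin_numE.
Qed.

HB.instance Definition _ := Measure_isSigmaFinite.Build _ _ _ lebesgueS
  lebesgueS_sigma_finite.

End lebesgueS.

(* Lebesgue measure on the space of row vectors, as an iterated product. *)
Fixpoint lebesgue_rV d : {sigma_finite_measure set 'rV[R]_d -> \bar R} :=
  if d is d'.+1 then lebesgueS (lebesgue_rV d') else \d_(0 : 'rV[R]_0).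

End lebesgue_rV.

Section domain.
Context {R : realType} {d : nat}.
Local Notation pt := 'rV[R]_d.

Definition enorm (x : pt) : R := Num.sqrt (\sum_i x ord0 i ^+ 2).

Definition simply_connected (D : set pt) :=
  [/\ D !=set0,
      forall x y, D x -> D y -> exists g : R -> pt,
        [/\ {within `[0, 1], continuous g}, g @` `[0, 1] `<=` D,
            g 0 = x & g 1 = y] &
      forall g : R -> pt,
        {within `[0, 1], continuous g} -> g @` `[0, 1] `<=` D -> g 0 = g 1 ->
        exists F : R * R -> pt,
          [/\ {within `[0, 1] `*` `[0, 1], continuous F},
              F @` (`[0, 1] `*` `[0, 1]) `<=` D,
              forall t, F (t, 0) = g t,
              forall t, F (t, 1) = g 0 &
              forall s, F (0, s) = g 0 /\ F (1, s) = g 0]].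

Definition domain (D : set pt) :=
  [/\ open D, bounded_set D & simply_connected D].

End domain.

Section sobolev.
Context {R : realType} {d : nat}.
Local Notation pt := 'rV[R]_d.
Local Notation C := R[i].
Local Notation fct := ('rV[R]_d -> R[i]).
Local Notation mu := (lebesgue_rV d : set 'rV[R]_d -> \bar R).
Local Notation Re := complex.Re.
Local Notation Im := complex.Im.

Implicit Types (D : set pt) (u v w : fct) (s : seq 'I_d) (k : nat).

(* Functions are defined on the whole space, but only their restriction to [D]
   matters; they are identified when they agree almost everywhere on [D]. *)

Definition cintegral D u : C :=
  (\int[mu]_(x in D) Re (u x)) +i* (\int[mu]_(x in D) Im (u x)).

Definition l2ip D u v : C := cintegral D (fun x => u x * conjc (v x)).

Definition L2 D u :=
  [/\ measurable_fun D (fun x => Re (u x)), measurable_fun D (fun x => Im (u x)) &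
      (\int[mu]_(x in D) (Normc.normc (u x) ^+ 2)%:E < +oo)%E].

Definition l2norm D u : R :=
  Num.sqrt (\int[mu]_(x in D) Normc.normc (u x) ^+ 2).

(* A finite sequence [s] of indices stands for the iterated partial derivative
   along the coordinates listed in [s]. *)
Definition partial s (phi : pt -> R) : pt -> R :=
  foldr (fun i g x => 'D_(delta_mx ord0 i) g x) phi s.

Definition smooth (phi : pt -> R) := forall s,
  continuous (partial s phi) /\
  forall i x, derivable (partial s phi) x (delta_mx ord0 i).

Definition test_fun D (phi : pt -> R) :=
  [/\ smooth phi, compact (closure [set x | phi x != 0]) &
      closure [set x | phi x != 0] `<=` D].

Definition ctest_fun D : set fct := [set phi |
  test_fun D (fun x => Re (phi x)) /\ test_fun D (fun x => Im (phi x))].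

Definition is_wderiv D s u g := forall phi, test_fun D phi ->
  cintegral D (fun x => u x * (partial s phi x)%:C) =
  (-1) ^+ size s * cintegral D (fun x => g x * (phi x)%:C).

Definition wderiv D s u : fct := xget 0 [set g | L2 D g /\ is_wderiv D s u g].

Definition Hk D k : set fct := [set u | L2 D u /\
  forall s, (size s <= k)%N -> exists g, L2 D g /\ is_wderiv D s u g].

Definition mindex_seq k (a : {ffun 'I_d -> 'I_k.+1}) : seq 'I_d :=
  flatten [seq nseq (a i) i | i <- enum 'I_d].

Definition mindex_deg k (a : {ffun 'I_d -> 'I_k.+1}) : nat := \sum_i a i.

Definition Hnorm D k u : R := Num.sqrt
  (\sum_(a : {ffun 'I_d -> 'I_k.+1} | (mindex_deg a <= k)%N)
     l2norm D (wderiv D (mindex_seq a) u) ^+ 2).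

(* Closure of the compactly supported smooth functions: the functions of
   [H^k(D)] whose normal derivatives of order less than [k] vanish on the
   boundary. *)
Definition Hk0 D k : set fct := [set u | Hk D k u /\
  forall e, 0 < e -> exists phi, ctest_fun D phi /\ Hnorm D k (u - phi) < e].

(* Fractional spaces are the Sobolev-Slobodeckij spaces. *)
Definition gagliardo D (t : R) u : \bar R :=
  (\int[mu]_(x in D) \int[mu]_(y in D)
     (Normc.normc (u x - u y) ^+ 2 / enorm (x - y) `^ (d%:R + 2 * t))%:E)%E.

Definition Hfrac D (sigma : R) : set fct := [set u |
  let k := Num.truncn sigma in let t := sigma - k%:R in
  Hk D k u /\ (0 < t -> forall a : {ffun 'I_d -> 'I_k.+1}, mindex_deg a = k ->
    (gagliardo D t (wderiv D (mindex_seq a) u) < +oo)%E)].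

Definition Hfrac_norm D (sigma : R) u : R :=
  let k := Num.truncn sigma in let t := sigma - k%:R in
  Num.sqrt (Hnorm D k u ^+ 2 +
    if t == 0 then 0 else
    \sum_(a : {ffun 'I_d -> 'I_k.+1} | mindex_deg a == k)
       fine (gagliardo D t (wderiv D (mindex_seq a) u))).

(* [H^{-k}(D)] is the space of bounded antilinear functionals on [H^k_0(D)];
   antilinear, so that [w] in [L^2(D)] is identified with [v |-> (w, v)_0]. *)
Definition Hneg D k : set (fct -> C) := [set xi |
  (forall a u v, Hk0 D k u -> Hk0 D k v ->
     xi ((fun x => a * u x) + v) = conjc a * xi u + xi v) /\
  exists K, forall v, Hk0 D k v -> Normc.normc (xi v) <= K * Hnorm D k v].

Definition Hneg_norm D k (xi : fct -> C) : R :=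
  sup [set Normc.normc (xi v) | v in [set v | Hk0 D k v /\ Hnorm D k v <= 1]].

Definition laplacian D u : fct := \sum_(i < d) wderiv D [:: i; i] u.

Definition grad_ip D u v : C :=
  \sum_(i < d) l2ip D (wderiv D [:: i] u) (wderiv D [:: i] v).

Definition rmul (c : pt -> R) u : fct := fun x => (c x)%:C * u x.

Definition W2inf D (n : pt -> R) :=
  measurable_fun D n /\
  forall s, (size s <= 2)%N -> exists g : pt -> R,
    [/\ measurable_fun D g, exists K, {ae mu, forall x, D x -> `|g x| <= K} &
        is_wderiv D s (fun x => (n x)%:C) (fun x => (g x)%:C)].

Definition refraction_index D (n : pt -> R) (delta : R) :=
  [/\ W2inf D n, forall x, D x -> 1 + delta <= n x &
      exists K, forall x, D x -> n x <= K].

Definition regularity D (n : pt -> R) (r : nat -> R) (Cp : R) :=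
  forall k, (k < 2)%N -> forall xi, Hneg D k xi -> exists psi,
    [/\ Hfrac D (2 + r k) psi, Hk0 D 2 psi,
        forall phi, ctest_fun D phi ->
          l2ip D (rmul (fun x => (n x - 1)^-1) (laplacian D psi))
            (laplacian D phi) = xi phi &
        Hfrac_norm D (2 + r k) psi <= Cp * Hneg_norm D k xi].

End sobolev.

Section transmission.
Context {R : realType} {d : nat}.
Local Notation pt := 'rV[R]_d.
Local Notation C := R[i].
Local Notation fct := ('rV[R]_d -> R[i]).
Local Notation fpair := (fct * fct)%type.
Local Notation Re := complex.Re.
Local Notation Im := complex.Im.

Context (D : set pt) (n : pt -> R).
Implicit Types (f g h : fpair) (V M : set fpair) (T : fpair -> fpair -> Prop).

Definition formA f g : C :=
  l2ip D (rmul (fun x => (n x - 1)^-1) (laplacian D f.1)) (laplacian D g.1) +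
  l2ip D f.2 g.2.

Definition formB f g : C :=
  grad_ip D (rmul (fun x => (n x - 1)^-1) f.1) g.1 +
  grad_ip D f.1 (rmul (fun x => n x / (n x - 1)) g.1) -
  l2ip D (rmul (fun x => n x / (n x - 1)) f.2) g.1 +
  l2ip D f.1 g.2.

Definition normA f : R := Num.sqrt (Re (formA f f)).

Definition Hprod : set fpair := [set f | Hk0 D 2 f.1 /\ L2 D f.2].

Definition normH f : R := Hnorm D 2 f.1 + Hnorm D 0 f.2.

Definition normHs k f : R :=
  Hnorm D k f.1 + Hneg_norm D (2 - k) (fun v => l2ip D f.2 v).

Definition null f := normH f = 0.

Definition pscale (a : C) f : fpair := (fun x => a * f.1 x, fun x => a * f.2 x).

Definition subspace V := V 0 /\ forall a f g, V f -> V g -> V (pscale a f + g).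

Definition cspan (X : set fpair) : set fpair := [set f |
  exists (k : nat) (c : 'I_k -> C) (b : 'I_k -> fpair),
    (forall j, X (b j)) /\ f = \sum_j pscale (c j) (b j)].

Definition is_basis q (b : 'I_q -> fpair) M :=
  [/\ forall j, M (b j),
      forall c : 'I_q -> C, null (\sum_j pscale (c j) (b j)) -> forall j, c j = 0 &
      forall f, M f -> exists c : 'I_q -> C, null (f - \sum_j pscale (c j) (b j))].

Definition has_dim M q := exists b : 'I_q -> fpair, is_basis b M.

Definition eigenfunction V (l : C) f :=
  [/\ V f, ~ null f & forall g, V g -> formA f g = l * formB f g].

Definition dual_eigenfunction V (ls : C) f :=
  [/\ V f, ~ null f & forall g, V g -> formA g f = conjc ls * formB g f].

(* Graphs of the solution operators of the primal and of the dual problem. *)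
Definition sol V f g := V g /\ forall h, V h -> formA g h = formB f h.

Definition dual_sol V f g := V g /\ forall h, V h -> formA h g = formB h f.

(* [ker_pow V T m k] is the kernel of the [k]-th power of [T - m]. *)
Fixpoint ker_pow V T (m : C) k : set fpair :=
  if k is k'.+1 then
    [set f | V f /\ exists g, T f g /\ ker_pow V T m k' (g - pscale m f)]
  else [set f | V f /\ null f].

Definition gen_eigenspace V T (m : C) : set fpair :=
  \bigcup_(k in setT) ker_pow V T m k.

Definition alg_multiplicity V T (m : C) q := has_dim (gen_eigenspace V T m) q.

Definition has_ascent V T (m : C) a :=
  ker_pow V T m a.+1 `<=` ker_pow V T m a /\
  forall k, (k < a)%N -> ~ (ker_pow V T m k.+1 `<=` ker_pow V T m k).

Definition eigenspace (l : C) : set fpair := cspan (eigenfunction Hprod l).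

Definition dual_eigenspace (ls : C) : set fpair :=
  cspan (dual_eigenfunction Hprod ls).

Definition approx_dist V M : R :=
  sup [set inf [set normH (f - g) | g in V] | f in [set f | M f /\ normH f = 1]].

(* [rho] isolates [l] from the rest of the primal spectrum and from [0]. *)
Definition isolating (l : C) (rho : R) :=
  [/\ 0 < rho, rho < Normc.normc l &
      forall m f, eigenfunction Hprod m f -> m != l -> rho < Normc.normc (m - l)].

(* The [lam j] are the eigenvalues, counted with algebraic multiplicity, of the
   problem restricted to [V] that lie in the disc of radius [rho] around [l]:
   those that converge to [l]. *)
Definition approx_eigenvalues V (l : C) (rho : R) q (lam : 'I_q -> C) :=
  (forall j, Normc.normc (lam j - l) <= rho) /\
  forall m, Normc.normc (m - l) <= rho ->
    alg_multiplicity V (sol V) m^-1 #|[set j | lam j == m]%SET|.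

Definition approx_space V q (lam : 'I_q -> C) : set fpair :=
  cspan [set f | exists j, gen_eigenspace V (sol V) (lam j)^-1 f].

Definition dual_approx_space V q (lam : 'I_q -> C) : set fpair :=
  cspan [set f | exists j, gen_eigenspace V (dual_sol V) (conjc (lam j))^-1 f].

Definition polynomial_fun p (P : fct) :=
  exists c : {ffun 'I_d -> 'I_p.+1} -> C, forall x,
    P x = \sum_a c a * (\prod_i x ord0 i ^+ a i)%:C.

(* The elements may be curved: they are only required to be regular closed sets
   with negligible boundary that tile the closure of the domain. *)
Definition mesh (h : R) m (K : 'I_m -> set pt) :=
  [/\ forall k, [/\ compact (K k), (K k)° !=set0, closure (K k)° = K k &
                    lebesgue_rV d (K k `\` (K k)°) = 0%E],
      forall k l, k != l -> (K k)° `&` (K l)° = set0,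
      \bigcup_k K k = closure D,
      forall k x y, K k x -> K k y -> enorm (x - y) <= h &
      exists k x y, [/\ K k x, K k y & enorm (x - y) = h]].

Definition piecewise_polynomial p m (K : 'I_m -> set pt) (v : fct) :=
  forall k, exists P, polynomial_fun p P /\
    forall x, D x -> (K k)° x -> v x = P x.

(* A family of conforming finite element spaces: [S i] consists of piecewise
   polynomials of bounded degree on a mesh of size [h i], and has the
   approximation power of [H^2]-conforming elements, uniformly in [i]. *)
Definition fe_family (I : Type) (S : I -> set fct) (h : I -> R) (p : nat)
    (r : nat -> R) (Cap : R) := forall i,
  [/\ S i `<=` Hk0 D 2,
      S i 0 /\
        forall a u v, S i u -> S i v -> S i ((fun x => a * u x) + v),
      exists (m : nat) (K : 'I_m -> set pt),
        mesh (h i) K /\ S i `<=` piecewise_polynomial p K,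
      forall s v, (s < 2)%N -> Hk0 D 2 v -> Hfrac D (2 + r s) v ->
        exists vh, S i vh /\
          Hnorm D 2 (v - vh) <= Cap * h i `^ r s * Hfrac_norm D (2 + r s) v &
      forall k v, (0 < k <= 2)%N -> Hk0 D k v ->
        exists vh, S i vh /\ Hnorm D 0 (v - vh) <= Cap * h i ^+ k * Hnorm D k v].

Definition fe_pairs (S : set fct) : set fpair := S `*` S.

(* Levels are numbered from 1 to [levels]; [pr_at] and [du_at] are the primal
   and dual approximate eigenfunctions, [prhat_at] and [duhat_at] the solutions
   of the linear problems by which they are corrected, and [level_space m] is
   the space on which the eigenvalue problem of level [m] is solved. *)
Record mg_data (I : Type) (q : nat) := MgData {
  levels : nat;
  mesh_at : nat -> I;
  level_space : nat -> set fpair;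
  lam_at : nat -> 'I_q -> C;
  pr_at : nat -> 'I_q -> fpair;
  du_at : nat -> 'I_q -> fpair;
  prhat_at : nat -> 'I_q -> fpair;
  duhat_at : nat -> 'I_q -> fpair }.

Section scheme.
Context (I : Type) (q : nat) (S : I -> set fct) (h : I -> R) (X : mg_data I q).

Definition fe_at m : set fpair := fe_pairs (S (mesh_at X m)).
Definition delta_at (l : C) m : R := approx_dist (fe_at m) (eigenspace l).
Definition dual_delta_at (l : C) m : R :=
  approx_dist (fe_at m) (dual_eigenspace (conjc l)).
Definition coarse_size : R := h (mesh_at X 1).

Definition level_solution (l : C) (rho : R) m :=
  [/\ approx_eigenvalues (level_space X m) l rho (lam_at X m),
      forall j, [/\ eigenfunction (level_space X m) (lam_at X m j) (pr_at X m j),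
        dual_eigenfunction (level_space X m) (conjc (lam_at X m j)) (du_at X m j),
        normA (pr_at X m j) = 1 & normA (du_at X m j) = 1],
      is_basis (pr_at X m) (approx_space (level_space X m) (lam_at X m)) &
      is_basis (du_at X m) (dual_approx_space (level_space X m) (lam_at X m))].

Definition correction_step m :=
  [/\ forall j, fe_at m.+1 (prhat_at X m.+1 j) /\
        forall g, fe_at m.+1 g ->
          formA (prhat_at X m.+1 j) g = lam_at X m j * formB (pr_at X m j) g,
      forall j, fe_at m.+1 (duhat_at X m.+1 j) /\
        forall g, fe_at m.+1 g ->
          formA g (duhat_at X m.+1 j) = lam_at X m j * formB g (du_at X m j),
      subspace (level_space X m.+1), level_space X m.+1 `<=` fe_at m.+1 &
      [set f + g | f in fe_at 1 & g in
        cspan (range (prhat_at X m.+1) `|` range (duhat_at X m.+1))]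
      `<=` level_space X m.+1].

Definition multigrid (l : C) (rho beta c1 c2 : R) :=
  [/\ (1 <= levels X)%N,
      forall m, (1 <= m < levels X)%N ->
        [/\ fe_at m `<=` fe_at m.+1,
            c1 * (beta^-1 * delta_at l m) <= delta_at l m.+1 <=
              c2 * (beta^-1 * delta_at l m) &
            c1 * (beta^-1 * dual_delta_at l m) <= dual_delta_at l m.+1 <=
              c2 * (beta^-1 * dual_delta_at l m)],
      level_space X 1 = fe_at 1,
      forall m, (1 <= m <= levels X)%N -> level_solution l rho m &
      forall m, (1 <= m < levels X)%N -> correction_step m].

Definition quasi_biorthogonal (r0 CA cA : R) m :=
  exists tpr tdu : 'I_q -> fpair,
    [/\ forall j, approx_space (level_space X m) (lam_at X m) (tpr j) /\ normH (tpr j) = 1,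
        forall j,
          dual_approx_space (level_space X m) (lam_at X m) (tdu j) /\ normH (tdu j) = 1,
        forall j k, j != k ->
          Normc.normc (formA (pr_at X m j) (tdu k)) +
          Normc.normc (formA (tpr j) (du_at X m k)) <= CA * coarse_size `^ r0 &
        forall j, cA <= Normc.normc (formA (pr_at X m j) (tdu j)) +
                        Normc.normc (formA (tpr j) (du_at X m j))].

End scheme.
End transmission.

(* Main.v *)
Require Import Defs.
From HB Require Import structures.
From mathcomp Require Import all_boot all_order all_algebra.
From mathcomp Require Import all_classical all_reals all_analysis.
From mathcomp Require Import measurable_realfun complex ring lra.
(* restores the form [formB] over its namesake on sesquilinear forms *)
Import Defs.

Set Implicit Arguments.
Unset Strict Implicit.
Unset Printing Implicit Defensive.

Import Order.TTheory GRing.Theory Num.Theory.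
Import numFieldNormedType.Exports.

Local Open Scope classical_set_scope.
Local Open Scope ring_scope.
Local Open Scope complex_scope.

(** Pairs modulo null elements form a Hilbert space for the inner product [A]
    (quotient_exists). There the primal problem reads [T x = l^-1 *: x], with
    [T] the solution operator, and the dual problem concerns the adjoint [Ts].
    Regularity and the approximation property make [T x] and [Ts x] finite
    element functions up to [C h^r |x|] (operators), so [T] is compact.

    Since [mu = l^-1] has ascent one, its primal and dual eigenspaces have
    biorthogonal bases, which define a spectral projection [Q]. On the
    complement of the eigenspace [T - z] and its adjoint are bounded below,
    uniformly for [z^-1] in the disc around [l] (spectral_gap_exists).

    On a level with space [V] and orthogonal projection [P], a discrete
    eigenfunction satisfies [P (T u) = z u], so [T - z] maps [u - Q u] to the
    complementary part of the defect [T u - P (T u)]. On the exact eigenspace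
    this defect is governed by the distance [a] of the eigenspace to [V], and
    off it by the small number [eps = C H^r]; hence [u - Q u] is [O(a)], and
    this for the whole span of the discrete eigenfunctions
    (invariant_subspace_error). By dimension, [Q] maps that span onto the
    eigenspace.

    From level to level, the space of level [m + 1] contains the projections of
    all [T y] with [y] in the discrete span of level [m]. An exact eigenvector
    is [x = Q y] for such a [y], and [x = mu^-1 T x] differs from
    [mu^-1 P (T y)] by a finite element error and by [T (x - y)], which is
    [eps] times the error of the previous level. As the distances [delta_m]
    shrink by a fixed factor only, [a_m <= 2 delta_m] follows by induction once
    [H] is small (multilevel_approx).

    The eigenvalue error is a product of a primal and a dual defect, because
    [(mu - z) (u, g) = ((1 - P) T u, (1 - P) g)] for a dual eigenvector [g]; the
    weak norms gain [H^r] by the duality argument of Aubin and Nitsche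
    (eigenfunction_error, galerkin_duality). The dual half of the theorem is
    the primal half for the form [fun f e => conjc (B e f)] (scheme_error).

    The analysis behind this is: completeness of the Sobolev spaces, Green's
    formula and ellipticity of the Laplacian on [H^2_0(D)], invariance of
    [H^2_0(D)] under multiplication by [1 / (n - 1)], proved by mollification
    (multiplier), and finite dimension of spaces of piecewise polynomials. *)

Local Notation Re := complex.Re.
Local Notation Im := complex.Im.
Local Notation normc := Normc.normc.

(** * Complex numbers and semi-inner products *)

Section complex_numbers.
Context {R : realType}.
Local Notation C := R[i].
Implicit Types (x y z : C) (a : R).

Lemma complexP x y : Re x = Re y -> Im x = Im y -> x = y.
Proof. by case: x y => [a b] [c d] /= -> ->. Qed.

Lemma ReD x y : Re (x + y) = Re x + Re y. Proof. by case: x; case: y. Qed.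
Lemma ImD x y : Im (x + y) = Im x + Im y. Proof. by case: x; case: y. Qed.
Lemma ReN x : Re (- x) = - Re x. Proof. by case: x. Qed.
Lemma ImN x : Im (- x) = - Im x. Proof. by case: x. Qed.
Lemma ReB x y : Re (x - y) = Re x - Re y. Proof. by rewrite ReD ReN. Qed.
Lemma ImB x y : Im (x - y) = Im x - Im y. Proof. by rewrite ImD ImN. Qed.
Lemma cReM x y : Re (x * y) = Re x * Re y - Im x * Im y.
Proof. by case: x; case: y. Qed.
Lemma cImM x y : Im (x * y) = Re x * Im y + Im x * Re y.
Proof. by case: x; case: y. Qed.
Lemma cRe_conj x : Re (conjc x) = Re x. Proof. by case: x. Qed.
Lemma cIm_conj x : Im (conjc x) = - Im x. Proof. by case: x. Qed.
Lemma conjcD x y : conjc (x + y) = conjc x + conjc y. Proof. exact: rmorphD. Qed.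
Lemma conjcM x y : conjc (x * y) = conjc x * conjc y. Proof. exact: rmorphM. Qed.
Lemma conjcN x : conjc (- x) = - conjc x. Proof. exact: rmorphN. Qed.
Lemma conjcV x : conjc x^-1 = (conjc x)^-1. Proof. exact: fmorphV. Qed.
Lemma conjc_sum (J : Type) (s : seq J) (P : pred J) (F : J -> C) :
  conjc (\sum_(j <- s | P j) F j) = \sum_(j <- s | P j) conjc (F j).
Proof. exact: rmorph_sum. Qed.
Lemma Re_sum (J : Type) (s : seq J) (P : pred J) (F : J -> C) :
  Re (\sum_(j <- s | P j) F j) = \sum_(j <- s | P j) Re (F j).
Proof. by elim/big_rec2: _ => // j a x _ <-; rewrite ReD. Qed.

Lemma normcE2 x : normc x ^+ 2 = Re x ^+ 2 + Im x ^+ 2.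
Proof. by case: x => a b /=; rewrite sqr_sqrtr// addr_ge0// sqr_ge0. Qed.
Lemma normc_ge0 x : 0 <= normc x. Proof. by case: x => a b; exact: sqrtr_ge0. Qed.
Lemma normcB x y : normc (x - y) = normc (y - x).
Proof. by rewrite -normcN opprB. Qed.
Lemma normc_conj x : normc (conjc x) = normc x.
Proof. by case: x => a b /=; rewrite sqrrN. Qed.
Lemma normcR a : normc a%:C = `|a|.
Proof. by rewrite /= expr0n addr0 sqrtr_sqr. Qed.
Lemma mul_conjc x : x * conjc x = (normc x ^+ 2)%:C.
Proof. by apply: complexP; rewrite ?cReM ?cImM ?cRe_conj ?cIm_conj ?normcE2/=; ring. Qed.
Lemma normc_eq0 x : (normc x == 0) = (x == 0).
Proof. by apply/eqP/eqP => [/Normc.eq0_normc//|->]; exact: Normc.normc0. Qed.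
Lemma normc_gt0 x : (0 < normc x) = (x != 0).
Proof. by rewrite lt_neqAle normc_ge0 andbT eq_sym normc_eq0. Qed.
Lemma Re_le_normc x : `|Re x| <= normc x.
Proof.
by rewrite -(@ler_pXn2r _ 2) ?nnegrE ?normc_ge0// real_normK ?num_real// normcE2 lerDl sqr_ge0.
Qed.
Lemma Im_le_normc x : `|Im x| <= normc x.
Proof.
by rewrite -(@ler_pXn2r _ 2) ?nnegrE ?normc_ge0// real_normK ?num_real// normcE2 lerDr sqr_ge0.
Qed.
Lemma normc_le_ReIm x : normc x <= `|Re x| + `|Im x|.
Proof.
rewrite -(@ler_pXn2r _ 2) ?nnegrE ?normc_ge0 ?addr_ge0//.
rewrite normcE2 sqrrD !real_normK ?num_real// -addrA lerD2l lerDr.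
by rewrite mulrn_wge0// mulr_ge0.
Qed.
Lemma normc_triangle x y : normc x <= normc (x - y) + normc y.
Proof. by have := le_normcD (x - y) y; rewrite subrK. Qed.

(** Optimising over the complex parameter in a nonnegative quadratic
    expression bounds its cross term. *)
Lemma discriminant_le (p q : R) w : 0 <= p -> 0 <= q ->
  (forall a : C, 0 <= p + 2 * Re (a * w) + normc a ^+ 2 * q) ->
  normc w <= Num.sqrt p * Num.sqrt q.
Proof.
move=> p0 q0 pq; rewrite -sqrtrM//.
rewrite -[leLHS](@ger0_norm R) ?normc_ge0// -sqrtr_sqr ler_wsqrtr//.
have [w0|w0] := eqVneq (normc w) 0; first by rewrite w0 expr0n mulr_ge0.
have H (t : R) : 0 <= p - 2 * t * normc w ^+ 2 + t ^+ 2 * normc w ^+ 2 * q.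
  have := pq (- t%:C * conjc w).
  have -> : - t%:C * conjc w * w = - t%:C * (normc w ^+ 2)%:C.
    by rewrite -mul_conjc mulrAC mulrA.
  rewrite Normc.normcM normcN normcR normc_conj.
  rewrite exprMn real_normK ?num_real// cReM ReN ImN /= oppr0 mul0r subr0.
  by rewrite mulNr mulrN !mulrA.
have [q00|q00] := eqVneq q 0.
  have := H ((p + 1) / (2 * normc w ^+ 2)).
  rewrite q00 mulr0 addr0.
  have -> : p - 2 * ((p + 1) / (2 * normc w ^+ 2)) * normc w ^+ 2 = -1 by field.
  by rewrite ler0N1.
have qp : 0 < q by rewrite lt_neqAle eq_sym q00.
have := H q^-1.
have -> : p - 2 * q^-1 * normc w ^+ 2 + q^-1 ^+ 2 * normc w ^+ 2 * q
  = p - normc w ^+ 2 / q by field.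
by rewrite subr_ge0 ler_pdivrMr.
Qed.

End complex_numbers.

(** Semi-inner products live on a subset [W] of a group of functions, with an
    explicit scaling [sc]: Lebesgue and Sobolev spaces are such subsets, and
    their inner products only see functions up to null sets. *)
Section semi_inner_product.
Context {R : realType} {U : zmodType}.
Local Notation C := R[i].

Record semi_ip (W : set U) (sc : C -> U -> U) (ip : U -> U -> C) : Prop := SemiIp {
  sip_sc1 : forall f, sc 1 f = f;
  sip_scN1 : forall f, sc (-1) f = - f;
  sip_sc0 : forall a, sc a 0 = 0;
  sip_W0 : W 0;
  sip_W : forall a f g, W f -> W g -> W (sc a f + g);
  sip_lin : forall a f g h, W f -> W g -> W h ->
    ip (sc a f + g) h = a * ip f h + ip g h;
  sip_conj : forall f g, W f -> W g -> ip g f = conjc (ip f g);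
  sip_ge0 : forall f, W f -> 0 <= Re (ip f f) }.

Definition sip_norm (ip : U -> U -> C) (f : U) : R := Num.sqrt (Re (ip f f)).

Context (W : set U) (sc : C -> U -> U) (ip : U -> U -> C).
Hypothesis HS : semi_ip W sc ip.
Local Notation nrm := (sip_norm ip).
Implicit Types (f g h : U) (a : C).

Lemma sipWD f g : W f -> W g -> W (f + g).
Proof. by move=> Wf Wg; rewrite -(sip_sc1 HS f); exact: (sip_W HS). Qed.
Lemma sipWZ a f : W f -> W (sc a f).
Proof. by move=> Wf; rewrite -[X in W X]addr0; apply: (sip_W HS) => //; exact: (sip_W0 HS). Qed.
Lemma sipWN f : W f -> W (- f).
Proof. by rewrite -(sip_scN1 HS); exact: sipWZ. Qed.
Lemma sipWB f g : W f -> W g -> W (f - g).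
Proof. by move=> Wf Wg; apply: sipWD => //; exact: sipWN. Qed.
Lemma sipW_sum (J : Type) (s : seq J) (P : pred J) (F : J -> U) :
  (forall j, P j -> W (F j)) -> W (\sum_(j <- s | P j) F j).
Proof. by move=> WF; elim/big_rec: _ => [|j x Pj Wx]; [exact: (sip_W0 HS)|exact: sipWD (WF _ Pj) Wx]. Qed.

Lemma sipDl f g h : W f -> W g -> W h -> ip (f + g) h = ip f h + ip g h.
Proof. by move=> *; rewrite -{1}(sip_sc1 HS f) (sip_lin HS)// mul1r. Qed.
Lemma sip0l h : W h -> ip 0 h = 0.
Proof.
move=> Wh; have := sipDl (sip_W0 HS) (sip_W0 HS) Wh.
by rewrite addr0 => /eqP; rewrite -subr_eq0 opprD addrA subrr sub0r oppr_eq0 => /eqP.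
Qed.
Lemma sipZl a f h : W f -> W h -> ip (sc a f) h = a * ip f h.
Proof.
move=> Wf Wh; rewrite -[sc a f]addr0 (sip_lin HS)//; last exact: (sip_W0 HS).
by rewrite sip0l// addr0.
Qed.
Lemma sipNl f h : W f -> W h -> ip (- f) h = - ip f h.
Proof. by move=> *; rewrite -(sip_scN1 HS) sipZl// mulN1r. Qed.
Lemma sipBl f g h : W f -> W g -> W h -> ip (f - g) h = ip f h - ip g h.
Proof. by move=> *; rewrite sipDl ?sipNl//; exact: sipWN. Qed.
Lemma sipDr f g h : W f -> W g -> W h -> ip h (f + g) = ip h f + ip h g.
Proof.
by move=> *; rewrite (sip_conj HS) ?sipDl ?conjcD -?(sip_conj HS)//; exact: sipWD.
Qed.
Lemma sip0r h : W h -> ip h 0 = 0.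
Proof. by move=> *; rewrite (sip_conj HS) ?sip0l ?conjc0//; exact: (sip_W0 HS). Qed.
Lemma sipZr a f h : W f -> W h -> ip h (sc a f) = conjc a * ip h f.
Proof.
by move=> *; rewrite (sip_conj HS) ?sipZl ?conjcM -?(sip_conj HS)//; exact: sipWZ.
Qed.
Lemma sipNr f h : W f -> W h -> ip h (- f) = - ip h f.
Proof. by move=> *; rewrite -(sip_scN1 HS) sipZr// conjcN conjc1 mulN1r. Qed.
Lemma sipBr f g h : W f -> W g -> W h -> ip h (f - g) = ip h f - ip h g.
Proof. by move=> *; rewrite sipDr ?sipNr//; exact: sipWN. Qed.

Lemma sip_Im f : W f -> Im (ip f f) = 0.
Proof.
by move=> Wf; have := congr1 (@complex.Im R) (sip_conj HS Wf Wf); rewrite cIm_conj; lra.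
Qed.
Lemma sip_norm_ge0 f : 0 <= nrm f. Proof. exact: sqrtr_ge0. Qed.
Lemma sip_norm2 f : W f -> nrm f ^+ 2 = Re (ip f f).
Proof. by move=> Wf; rewrite sqr_sqrtr// (sip_ge0 HS). Qed.
Lemma sip_normE f : W f -> ip f f = (nrm f ^+ 2)%:C.
Proof. by move=> Wf; apply: complexP => /=; rewrite ?sip_norm2// sip_Im. Qed.

Lemma sip_normD2 a f g : W f -> W g ->
  nrm (f + sc a g) ^+ 2
  = nrm f ^+ 2 + 2 * Re (a * ip g f) + normc a ^+ 2 * nrm g ^+ 2.
Proof.
move=> Wf Wg; have Wa := sipWZ a Wg.
rewrite !sip_norm2//; last exact: sipWD.
rewrite sipDl ?sipDr//; [|exact: sipWD].
rewrite !sipZl ?sipZr// mulrA mul_conjc (sip_normE Wg) [ip f g](sip_conj HS)//.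
by rewrite !ReD -conjcM cRe_conj (cReM (_ ^+ 2)%:C) /= mul0r subr0 mulr2n; ring.
Qed.

Lemma sip_normDr2 f g : W f -> W g ->
  nrm (f + g) ^+ 2 = nrm f ^+ 2 + 2 * Re (ip g f) + nrm g ^+ 2.
Proof.
by move=> Wf Wg; rewrite -{1}(sip_sc1 HS g) sip_normD2// mul1r Normc.normc1 expr1n mul1r.
Qed.

Lemma sip_CS f g : W f -> W g -> normc (ip f g) <= nrm f * nrm g.
Proof.
move=> Wf Wg; rewrite mulrC; apply: discriminant_le; rewrite ?(sip_ge0 HS)// => a.
by rewrite -!sip_norm2// -sip_normD2// sqr_ge0.
Qed.

Lemma sip_normD f g : W f -> W g -> nrm (f + g) <= nrm f + nrm g.
Proof.
move=> Wf Wg.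
rewrite -(@ler_pXn2r _ 2) ?nnegrE ?addr_ge0 ?sip_norm_ge0// sip_normDr2// sqrrD.
rewrite lerD2r lerD2l mulr2n mulrC mulr2n mulrDr mulr1.
have : Re (ip g f) <= nrm f * nrm g.
  by rewrite mulrC; apply: le_trans (sip_CS Wg Wf); exact: le_trans (ler_norm _) (Re_le_normc _).
by move=> le; rewrite lerD.
Qed.

Lemma sip_normZ a f : W f -> nrm (sc a f) = normc a * nrm f.
Proof.
move=> Wf; apply/eqP; have W0 := sip_W0 HS.
rewrite -(@eqrXn2 _ 2) ?sip_norm_ge0 ?mulr_ge0 ?normc_ge0 ?sip_norm_ge0//.
have := sip_normD2 a W0 Wf; rewrite add0r => ->.
rewrite sip0r// mulr0 [nrm 0 ^+ 2]sip_norm2 ?sip0l//=.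
by rewrite exprMn mulr0 !add0r.
Qed.
Lemma sip_normN f : W f -> nrm (- f) = nrm f.
Proof. by move=> Wf; rewrite -(sip_scN1 HS) sip_normZ// normcN Normc.normc1 mul1r. Qed.
Lemma sip_norm0 : nrm 0 = 0.
Proof. by rewrite /sip_norm sip0l ?sqrtr0//; exact: (sip_W0 HS). Qed.
Lemma sip_normB f g : W f -> W g -> nrm (f - g) <= nrm f + nrm g.
Proof. by move=> Wf Wg; rewrite -(sip_normN Wg); apply: sip_normD => //; exact: sipWN. Qed.
Lemma sip_normBC f g : W f -> W g -> nrm (f - g) = nrm (g - f).
Proof. by move=> Wf Wg; rewrite -opprB sip_normN//; exact: sipWB. Qed.
Lemma sip_norm_dist f g h : W f -> W g -> W h -> nrm (f - h) <= nrm (f - g) + nrm (g - h).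
Proof.
by move=> *; rewrite -(subrKA g f (-h)); apply: sip_normD; exact: sipWB.
Qed.
Lemma sip_norm_sum (J : Type) (s : seq J) (P : pred J) (F : J -> U) :
  (forall j, P j -> W (F j)) ->
  nrm (\sum_(j <- s | P j) F j) <= \sum_(j <- s | P j) nrm (F j).
Proof.
move=> WF; elim: s => [|j s IH]; first by rewrite !big_nil sip_norm0.
rewrite !big_cons; case: ifP => // Pj.
apply: le_trans (sip_normD (WF _ Pj) _) _; first exact: sipW_sum.
by rewrite lerD2l.
Qed.
Lemma sip_norm0_ip f g : W f -> W g -> nrm f = 0 -> ip f g = 0.
Proof.
move=> Wf Wg f0; have := sip_CS Wf Wg; rewrite f0 mul0r => le0.
by apply/eqP; rewrite -normc_eq0 eq_le le0 normc_ge0.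
Qed.
End semi_inner_product.

(** * Compact operators on a Hilbert space *)

Record hilbert {R : realType} {E : lmodType R[i]} (ip : E -> E -> R[i]) : Prop := Hilbert {
  hilbert_ip : semi_ip [set: E] (fun a x => a *: x) ip;
  hilbert_def : forall x, sip_norm ip x = 0 -> x = 0;
  hilbert_complete : forall x : nat -> E,
    (forall e, 0 < e -> exists N, forall m k, (N <= m)%N -> (N <= k)%N ->
       sip_norm ip (x m - x k) < e) ->
    exists y, forall e, 0 < e -> exists N, forall k, (N <= k)%N ->
       sip_norm ip (x k - y) < e }.

Section hilbert_basics.
Context {R : realType} {E : lmodType R[i]} (ip : E -> E -> R[i]).
Local Notation C := R[i].
Local Notation nrm := (sip_norm ip).
Hypothesis HH : hilbert ip.
Let HS := hilbert_ip HH.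
Implicit Types (x y z : E) (a : C).

Lemma ipDl x y z : ip (x + y) z = ip x z + ip y z. Proof. exact: (sipDl HS). Qed.
Lemma ipDr x y z : ip z (x + y) = ip z x + ip z y. Proof. exact: (sipDr HS). Qed.
Lemma ipBl x y z : ip (x - y) z = ip x z - ip y z. Proof. exact: (sipBl HS). Qed.
Lemma ipBr x y z : ip z (x - y) = ip z x - ip z y. Proof. exact: (sipBr HS). Qed.
Lemma ipZl a x z : ip (a *: x) z = a * ip x z. Proof. exact: (sipZl HS). Qed.
Lemma ipZr a x z : ip z (a *: x) = conjc a * ip z x. Proof. exact: (sipZr HS). Qed.
Lemma ip0l z : ip 0 z = 0. Proof. exact: (sip0l HS). Qed.
Lemma ip0r z : ip z 0 = 0. Proof. exact: (sip0r HS). Qed.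
Lemma ipC x y : ip y x = conjc (ip x y). Proof. exact: (sip_conj HS). Qed.
Lemma ip_suml (J : Type) (s : seq J) (P : pred J) (F : J -> E) z :
  ip (\sum_(j <- s | P j) F j) z = \sum_(j <- s | P j) ip (F j) z.
Proof. by elim/big_rec2: _ => [|j a x _ <-]; rewrite ?ip0l// ipDl. Qed.
Lemma ip_sumr (J : Type) (s : seq J) (P : pred J) (F : J -> E) z :
  ip z (\sum_(j <- s | P j) F j) = \sum_(j <- s | P j) ip z (F j).
Proof. by elim/big_rec2: _ => [|j a x _ <-]; rewrite ?ip0r// ipDr. Qed.
Lemma nrm_ge0 x : 0 <= nrm x. Proof. exact: sip_norm_ge0. Qed.
Lemma nrm_eq0 x : (nrm x == 0) = (x == 0).
Proof.
by apply/eqP/eqP => [/(hilbert_def HH)//|->]; exact: (sip_norm0 HS).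
Qed.
Lemma nrm0 : nrm 0 = 0. Proof. exact: (sip_norm0 HS). Qed.
Lemma nrm_gt0 x : (0 < nrm x) = (x != 0).
Proof. by rewrite lt_neqAle nrm_ge0 andbT eq_sym nrm_eq0. Qed.
Lemma nrm2 x : ip x x = (nrm x ^+ 2)%:C. Proof. exact: (sip_normE HS). Qed.
Lemma nrmD x y : nrm (x + y) <= nrm x + nrm y. Proof. exact: (sip_normD HS). Qed.
Lemma nrmB x y : nrm (x - y) <= nrm x + nrm y. Proof. exact: (sip_normB HS). Qed.
Lemma nrmN x : nrm (- x) = nrm x. Proof. exact: (sip_normN HS). Qed.
Lemma nrmBC x y : nrm (x - y) = nrm (y - x). Proof. exact: (sip_normBC HS). Qed.
Lemma nrmZ a x : nrm (a *: x) = normc a * nrm x. Proof. exact: (sip_normZ HS). Qed.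
Lemma nrm_dist y x z : nrm (x - z) <= nrm (x - y) + nrm (y - z).
Proof. exact: (sip_norm_dist HS). Qed.
Lemma nrm_CS x y : normc (ip x y) <= nrm x * nrm y. Proof. exact: (sip_CS HS). Qed.
Lemma nrm_sum (J : Type) (s : seq J) (P : pred J) (F : J -> E) :
  nrm (\sum_(j <- s | P j) F j) <= \sum_(j <- s | P j) nrm (F j).
Proof. exact: (sip_norm_sum HS). Qed.
Lemma nrm_triangle x y : nrm x <= nrm (x - y) + nrm y.
Proof. by have := nrmD (x - y) y; rewrite subrK. Qed.
Lemma ip_eq0 x : (forall y, ip x y = 0) -> x = 0.
Proof.
by move=> x0; apply/eqP; rewrite -nrm_eq0 /sip_norm x0 /= sqrtr0.
Qed.
Lemma ip_inj x y : (forall z, ip x z = ip y z) -> x = y.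
Proof.
by move=> xy; apply/eqP; rewrite -subr_eq0; apply/eqP/ip_eq0 => z; rewrite ipBl xy subrr.
Qed.
Lemma nrm_normalize x : x != 0 -> nrm ((nrm x)^-1%:C *: x) = 1.
Proof.
move=> x0; rewrite nrmZ normcR ger0_norm ?invr_ge0 ?nrm_ge0// mulVf//.
by rewrite nrm_eq0.
Qed.
Lemma nrm_pythagoras x y : ip x y = 0 -> nrm (x + y) ^+ 2 = nrm x ^+ 2 + nrm y ^+ 2.
Proof.
by move=> xy; rewrite (sip_normDr2 HS)// [ip y x]ipC xy conjc0 mulr0 addr0.
Qed.
Lemma nrm_parallelogram x y :
  nrm (x - y) ^+ 2 = 2 * nrm x ^+ 2 + 2 * nrm y ^+ 2 - nrm (x + y) ^+ 2.
Proof.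
rewrite !(sip_normDr2 HS)// nrmN.
have -> : ip (- y) x = - ip y x by rewrite (sipNl HS).
by rewrite ReN; ring.
Qed.

(** ** Finite-dimensional subspaces *)

Definition lsub (V : set E) := V 0 /\ forall a x y, V x -> V y -> V (a *: x + y).

Definition dim_le (V : set E) M := forall v : 'I_M.+1 -> E, (forall i, V (v i)) ->
  exists c : 'I_M.+1 -> C, (exists i, c i != 0) /\ \sum_i c i *: v i = 0.

Lemma lsubD V x y : lsub V -> V x -> V y -> V (x + y).
Proof. by move=> [_ VD] Vx Vy; rewrite -[x]scale1r; exact: VD. Qed.
Lemma lsubZ V a x : lsub V -> V x -> V (a *: x).
Proof. by move=> [V0 VD] Vx; rewrite -[_ *: _]addr0; exact: VD. Qed.
Lemma lsubB V x y : lsub V -> V x -> V y -> V (x - y).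
Proof. by move=> VL Vx Vy; apply: lsubD => //; rewrite -scaleN1r; exact: lsubZ. Qed.
Lemma lsub_sum V (J : Type) (s : seq J) (P : pred J) (F : J -> E) :
  lsub V -> (forall j, P j -> V (F j)) -> V (\sum_(j <- s | P j) F j).
Proof.
by move=> VL VF; elim/big_rec: _ => [|j x Pj Vx]; [exact: VL.1|exact: lsubD (VF _ Pj) Vx].
Qed.

Definition lspan k (u : 'I_k -> E) : set E :=
  [set x | exists c : 'I_k -> C, x = \sum_i c i *: u i].

Lemma lsub_span k (u : 'I_k -> E) : lsub (lspan u).
Proof.
split; first by exists (fun=> 0); rewrite big1// => i _; rewrite scale0r.
move=> a _ _ [c ->] [b ->]; exists (fun i => a * c i + b i).
rewrite scaler_sumr -big_split/=; apply: eq_bigr => i _.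
by rewrite scalerDl scalerA.
Qed.

Lemma lspan_gen k (u : 'I_k -> E) i : lspan u (u i).
Proof.
exists (fun j => (j == i)%:R); rewrite (bigD1 i)//= eqxx scale1r big1 ?addr0// => j ji.
by rewrite (negPf ji) scale0r.
Qed.

Lemma nontrivial_relation M (A : 'M[C]_(M.+1, M)) : exists2 c : 'rV[C]_M.+1, c != 0 & c *m A = 0.
Proof.
have kA : kermx A != 0.
  by rewrite -mxrank_eq0 mxrank_ker subn_eq0 -ltnNge ltnS rank_leq_col.
have [i ci] : exists i, row i (kermx A) != 0.
  apply: contrapT => H; move/eqP: kA; apply; apply/row_matrixP => i; rewrite row0.
  by apply/eqP/negPn/negP => Hi; apply: H; exists i.
by exists (row i (kermx A)) => //; rewrite -row_mul mulmx_ker row0.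
Qed.

Lemma dim_le_span M (e : 'I_M -> E) V : V `<=` lspan e -> dim_le V M.
Proof.
move=> Ve v Vv; have /choice[A vA] i : exists c : 'I_M -> C, v i = \sum_j c j *: e j.
  exact/Ve.
have [c c0 cA] := nontrivial_relation (\matrix_(i, j) A i j).
exists (fun i => c ord0 i); split.
  apply: contrapT => H; move/eqP: c0; apply; apply/rowP => i; rewrite mxE.
  by apply/eqP/negPn/negP => ci; apply: H; exists i.
under eq_bigr => i _ do rewrite vA scaler_sumr.
rewrite exchange_big/= big1// => j _.
have cAj : \sum_i c ord0 i * A i j = 0.
  have /matrixP/(_ ord0 j) := cA; rewrite !mxE => cAj; rewrite -[RHS]cAj.
  by apply: eq_bigr => i _; rewrite mxE.
by under eq_bigr do rewrite scalerA; rewrite -scaler_suml cAj scale0r.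
Qed.

Definition orthonormal k (v : 'I_k -> E) := forall i j, ip (v i) (v j) = (i == j)%:R.

Definition oproj k (v : 'I_k -> E) x := \sum_i ip x (v i) *: v i.

Definition is_proj (V : set E) (P : E -> E) :=
  (forall x, V (P x)) /\ forall x v, V v -> ip (x - P x) v = 0.

Lemma oproj_orth k (v : 'I_k -> E) x i : orthonormal v -> ip (x - oproj v x) (v i) = 0.
Proof.
move=> ov; rewrite ipBl ip_suml (bigD1 i)//= ipZl ov eqxx mulr1 big1 ?addr0 ?subrr// => j ji.
by rewrite ipZl ov (negPf ji) mulr0.
Qed.

Lemma oprojP k (v : 'I_k -> E) : orthonormal v -> is_proj (lspan v) (oproj v).
Proof.
move=> ov; split; first by move=> x; exists (fun i => ip x (v i)).
move=> x _ [c ->]; rewrite ip_sumr big1// => i _.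
by rewrite ipZr oproj_orth// mulr0.
Qed.

(** A maximal orthonormal family in [V] spans [V]. *)
Lemma onb_exists V M : lsub V -> dim_le V M ->
  exists k (v : 'I_k -> E), orthonormal v /\ V = lspan v.
Proof.
move=> VL VM.
pose P k := `[< exists v : 'I_k -> E, orthonormal v /\ forall i, V (v i) >].
have P0 : exists k, P k by exists 0%N; apply/asboolP; exists (fun=> 0); split; case.
have PM k : P k -> (k <= M)%N.
  move=> /asboolP[v [ov Vv]]; rewrite leqNgt; apply/negP => Mk.
  have [c [[i ci] c0]] := VM (fun i => v (widen_ord Mk i)) (fun i => Vv _).
  have := congr1 (fun x => ip x (v (widen_ord Mk i))) c0.
  rewrite ip0l ip_suml (bigD1 i)//= ipZl ov eqxx mulr1 big1 ?addr0.
    by move=> /eqP; rewrite (negPf ci).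
  move=> j ji; rewrite ipZl ov (_ : (_ == _) = false) ?mulr0//.
  by apply/eqP => /(congr1 val)/= /val_inj ij; rewrite ij eqxx in ji.
case: (ex_maxnP P0 PM) => k /asboolP[v [ov Vv]] kmax.
exists k, v; split=> //; apply/seteqP; split; last first.
  by move=> _ [c ->]; apply: lsub_sum => // i _; exact: lsubZ.
move=> x Vx; suff -> : x = oproj v x by exact: (oprojP ov).1.
apply/eqP; rewrite -subr_eq0; apply/negPn/negP => y0.
set y := x - oproj v x in y0.
have Vy : V y by apply: lsubB => //; apply: lsub_sum => // i _; exact: lsubZ.
have yv i : ip y (v i) = 0 by exact: oproj_orth.
pose w (i : 'I_k.+1) := if unlift ord_max i is Some j then v j else (nrm y)^-1%:C *: y.
suff : P k.+1 by move=> /kmax; rewrite ltnn.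
apply/asboolP; exists w; split; last first.
  by move=> i; rewrite /w; case: unliftP => [j _|_]//; exact: lsubZ.
move=> i j; rewrite /w; case: unliftP => [i' ->|->]; case: unliftP => [j' ->|->].
- by rewrite ov (inj_eq lift_inj).
- by rewrite ipZr ipC yv conjc0 mulr0 eq_sym (negPf (neq_lift _ _)).
- by rewrite ipZl yv mulr0 (negPf (neq_lift _ _)).
- by rewrite eqxx nrm2 nrm_normalize// expr1n.
Qed.

Lemma proj_exists V M : lsub V -> dim_le V M -> exists P, is_proj V P.
Proof.
by move=> VL /(onb_exists VL)[k [v [ov ->]]]; exists (oproj v); exact: oprojP.
Qed.

Section projection.
Variables (V : set E) (P : E -> E).
Hypotheses (VL : lsub V) (HP : is_proj V P).

Lemma proj_uniq x y : V y -> (forall v, V v -> ip (x - y) v = 0) -> P x = y.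
Proof.
move=> Vy xy; apply/eqP; rewrite -subr_eq0 -nrm_eq0 -sqrf_eq0.
have VPy : V (P x - y) by apply: lsubB => //; exact: HP.1.
have : ip (P x - y) (P x - y) = 0.
  have -> : ip (P x - y) (P x - y) = ip (x - y) (P x - y) - ip (x - P x) (P x - y).
    by rewrite -ipBl opprB [x - y + _]addrC subrKA.
  by rewrite xy// HP.2// subr0.
by rewrite nrm2 => -[->].
Qed.
Lemma proj_id v : V v -> P v = v.
Proof. by move=> Vv; apply: proj_uniq => // w _; rewrite subrr ip0l. Qed.
Lemma projD x y : P (x + y) = P x + P y.
Proof.
apply: proj_uniq; first by apply: lsubD => //; exact: HP.1.
by move=> v Vv; rewrite opprD addrACA ipDl !HP.2// addr0.
Qed.
Lemma projZ a x : P (a *: x) = a *: P x.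
Proof.
apply: proj_uniq; first by apply: lsubZ => //; exact: HP.1.
by move=> v Vv; rewrite -scalerBr ipZl HP.2// mulr0.
Qed.
Lemma projB x y : P (x - y) = P x - P y.
Proof. by rewrite -scaleN1r projD projZ scaleN1r. Qed.
Lemma proj_pyth x : nrm x ^+ 2 = nrm (x - P x) ^+ 2 + nrm (P x) ^+ 2.
Proof. by rewrite -nrm_pythagoras ?subrK//; apply: HP.2; exact: HP.1. Qed.
Lemma proj_nrm x : nrm (P x) <= nrm x.
Proof. by rewrite -(@ler_pXn2r _ 2) ?nnegrE ?nrm_ge0// [leRHS]proj_pyth lerDr sqr_ge0. Qed.
Lemma proj_nrmC x : nrm (x - P x) <= nrm x.
Proof. by rewrite -(@ler_pXn2r _ 2) ?nnegrE ?nrm_ge0// [leRHS]proj_pyth lerDl sqr_ge0. Qed.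
Lemma proj_best x v : V v -> nrm (x - P x) <= nrm (x - v).
Proof.
move=> Vv; have := proj_nrmC (x - v).
by rewrite projB (proj_id Vv) opprB addrA subrK.
Qed.
Lemma proj_orthr x v : V v -> ip v (x - P x) = 0.
Proof. by move=> Vv; rewrite ipC HP.2// conjc0. Qed.
End projection.
End hilbert_basics.

Lemma ultra_real_lim {R : realType} (U : set_system nat) (a : nat -> R) B :
  UltraFilter U -> (forall k, `|a k| <= B) ->
  exists l, forall e, 0 < e -> U [set k | `|a k - l| < e].
Proof.
move=> UU aB; pose S := [set x | U [set k | x <= a k]].
have SB : has_sup S.
  split; first by exists (- B); rewrite /S/=; apply: filterS filterT => k _ /=;
    have := aB k; rewrite ler_norml => /andP[].
  exists B => x /filter_ex[k /= xk]; apply: le_trans xk _.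
  exact: le_trans (ler_norm _) (aB k).
exists (sup S) => e e0.
have [x Sx xl] := sup_adherent e0 SB.
have : ~ S (sup S + e / 2).
  by move=> /(ub_le_sup SB.2); apply/negP; rewrite -ltNge ltrDl divr_gt0.
have [//|Sn _] := in_ultra_setVsetC [set k | sup S + e / 2 <= a k] UU.
apply: filterS (filterI Sx Sn) => k /= [xk /negP]; rewrite -ltNge => ak.
rewrite ltr_norml; apply/andP; split; first by rewrite ltrBrDl; exact: lt_le_trans xk.
rewrite ltrBlDl; apply: lt_le_trans ak _.
by rewrite lerD2l; lra.
Qed.

Lemma ultra_complex_lim {R : realType} (U : set_system nat) (a : nat -> R[i]) B :
  UltraFilter U -> (forall k, Normc.normc (a k) <= B) ->
  exists l, forall e, 0 < e -> U [set k | Normc.normc (a k - l) < e].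
Proof.
move=> UU aB.
have [x Hx] := @ultra_real_lim _ _ (fun k => complex.Re (a k)) B UU
  (fun k => le_trans (Re_le_normc _) (aB k)).
have [y Hy] := @ultra_real_lim _ _ (fun k => complex.Im (a k)) B UU
  (fun k => le_trans (Im_le_normc _) (aB k)).
exists (x +i* y) => e e0; have e20 : 0 < e / 2 by rewrite divr_gt0.
apply: filterS (filterI (Hx _ e20) (Hy _ e20)) => k /= [kx ky].
apply: le_lt_trans (normc_le_ReIm _) _.
by rewrite ReB ImB/= [ltRHS]splitr ltrD.
Qed.

Section compact_operators.
Context {R : realType} {E : lmodType R[i]} (ip : E -> E -> R[i]).
Local Notation C := R[i].
Local Notation nrm := (sip_norm ip).
Hypothesis HH : hilbert ip.
Implicit Types (x y : E) (a : C) (T Ts : E -> E).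

Definition adjoint T Ts := forall x y, ip (T x) y = ip x (Ts y).

Definition bounded_op T (M : R) := 0 <= M /\ forall x, nrm (T x) <= M * nrm x.

Definition approximable T Ts := forall e : R, 0 < e ->
  exists M (v : 'I_M -> E), [/\ orthonormal ip v,
    forall x, nrm (T x - oproj ip v (T x)) <= e * nrm x &
    forall x, nrm (Ts x - oproj ip v (Ts x)) <= e * nrm x].

Lemma adjointC T Ts : adjoint T Ts -> adjoint Ts T.
Proof. by move=> TT x y; rewrite (ipC HH) -TT -(ipC HH). Qed.

Section linear.
Variables (T Ts : E -> E).
Hypothesis TT : adjoint T Ts.
Lemma opD x y : T (x + y) = T x + T y.
Proof. by apply: (ip_inj HH) => z; rewrite (ipDl HH) !TT (ipDl HH). Qed.
Lemma opZ a x : T (a *: x) = a *: T x.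
Proof. by apply: (ip_inj HH) => z; rewrite (ipZl HH) !TT (ipZl HH). Qed.
Lemma opB x y : T (x - y) = T x - T y.
Proof. by rewrite -scaleN1r opD opZ scaleN1r. Qed.
Lemma op0 : T 0 = 0.
Proof. by have := opB 0 0; rewrite !subrr. Qed.
Lemma op_sum (J : Type) (s : seq J) (P : pred J) (F : J -> E) :
  T (\sum_(j <- s | P j) F j) = \sum_(j <- s | P j) T (F j).
Proof. exact: (big_morph T opD op0). Qed.
End linear.

Lemma bounded_adjoint T Ts M : adjoint T Ts -> bounded_op T M -> bounded_op Ts M.
Proof.
move=> TT [M0 TM]; split=> // x.
have [->|Tx0] := eqVneq (Ts x) 0; first by rewrite (nrm0 HH) mulr_ge0// nrm_ge0.
have Tx : 0 < nrm (Ts x) by rewrite (nrm_gt0 HH).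
rewrite -(ler_pM2l Tx) -expr2.
have -> : nrm (Ts x) ^+ 2 = Re (ip (T (Ts x)) x) by rewrite TT (nrm2 HH).
apply: le_trans (ler_norm _) _; apply: le_trans (Re_le_normc _) _.
apply: le_trans (nrm_CS HH _ _) _.
by rewrite mulrA [nrm (Ts x) * M]mulrC ler_wpM2r ?nrm_ge0.
Qed.

(** Along an ultrafilter every bounded scalar sequence converges, hence so do
    the projections of [T (x k)] on finite-dimensional spaces; approximability
    turns this into a Cauchy condition for [T (x k)] itself. *)
Lemma compact_lim T Ts (U : set_system nat) (x : nat -> E) B :
  approximable T Ts -> UltraFilter U -> (forall k, nrm (x k) <= B) ->
  (exists M, bounded_op T M) ->
  exists y, forall e, 0 < e -> U [set k | nrm (T (x k) - y) < e].
Proof.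
move=> TT UU xB [K [K0 TK]].
have B0 : 0 <= B by exact: le_trans (nrm_ge0 _ _) (xB 0%N).
have cauchy e : 0 < e -> exists2 W, U W &
    forall k l, W k -> W l -> nrm (T (x k) - T (x l)) < e.
  move=> e0; pose e1 := e / (4 * (B + 1)).
  have e10 : 0 < e1 by rewrite divr_gt0// mulr_gt0// ltr_wpDl.
  have [M [v [ov vT _]]] := TT _ e10.
  have /choice[l Hl] (i : 'I_M) : exists l, forall e, 0 < e ->
      U [set k | normc (ip (T (x k)) (v i) - l) < e].
    apply: (@ultra_complex_lim _ _ _ (K * B * nrm (v i))) => // k.
    apply: le_trans (nrm_CS HH _ _) _; rewrite ler_wpM2r ?nrm_ge0//.
    by apply: le_trans (TK _) _; rewrite ler_wpM2l.
  pose e2 := e / (8 * M.+1%:R).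
  have e20 : 0 < e2 by rewrite divr_gt0// mulr_gt0.
  exists [set k | forall i, normc (ip (T (x k)) (v i) - l i) < e2].
    by apply: filter_forall => i; exact: Hl.
  move=> k k' Wk Wk'; have Be : e1 * B <= e / 4.
    have : e1 * (4 * (B + 1)) = e by rewrite /e1 divfK// lt0r_neq0// mulr_gt0// ltr_wpDl.
    lra.
  have half j : nrm (T (x j) - oproj ip v (T (x j))) <= e / 4.
    by apply: le_trans (vT _) (le_trans _ Be); rewrite ler_wpM2l// ltW.
  have mid : nrm (oproj ip v (T (x k)) - oproj ip v (T (x k'))) < e / 4 + e / 4.
    rewrite /oproj -sumrB; apply: le_lt_trans (nrm_sum HH _ _ _) _.
    have : \sum_(i < M) nrm (ip (T (x k)) (v i) *: v i - ip (T (x k')) (v i) *: v i)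
        <= \sum_(i < M) (e2 + e2).
      apply: ler_sum => i _; rewrite -scalerBl (nrmZ HH).
      have -> : nrm (v i) = 1 by rewrite /sip_norm ov eqxx sqrtr1.
      rewrite mulr1 -(subrKA (l i)); apply: le_trans (le_normcD _ _) _.
      by apply: lerD; apply: ltW; [exact: Wk|rewrite normcB; exact: Wk'].
    move=> /le_lt_trans; apply; rewrite sumr_const card_ord -mulr_natl.
    have : e2 * (8 * (M%:R + 1)) = e by rewrite natr1 /e2 divfK// mulf_neq0.
    lra.
  have := nrm_dist HH (oproj ip v (T (x k))) (T (x k)) (T (x k')).
  have := nrm_dist HH (oproj ip v (T (x k'))) (oproj ip v (T (x k))) (T (x k')).
  have := half k; have := half k'; rewrite (nrmBC HH (T (x k'))) => *; lra.
have /choice[W HW] (j : nat) : exists W, U W /\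
    forall k l, W k -> W l -> nrm (T (x k) - T (x l)) < j.+1%:R^-1.
  by have [|W UW HW] := cauchy j.+1%:R^-1; [rewrite invr_gt0|exists W].
have UWs j : U (\bigcap_(i in [set i | (i <= j)%N]) W i).
  elim: j => [|j IH].
    by apply: filterS (HW 0%N).1 => k Wk i /=; rewrite leqn0 => /eqP ->.
  apply: filterS (filterI IH (HW j.+1).1) => k [Wk Wj] i /=.
  by rewrite leq_eqVlt => /predU1P[->//|]; exact: Wk.
have /choice[K' HK'] j : exists k, forall i, (i <= j)%N -> W i k.
  by have /filter_ex[k Hk] := UWs j; exists k.
have [|y Hy] := hilbert_complete HH (x := fun j => T (x (K' j))).
  move=> e e0; have [N _ Ne] := near_infty_natSinv_lt (PosNum e0).
  exists N => m k Nm Nk; apply: lt_trans ((HW N).2 _ _ _ _) (Ne _ _) => //=; exact: HK'.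
exists y => e e0; have e20 : 0 < e / 2 by rewrite divr_gt0.
have [N Hy'] := Hy _ e20.
have [N' _ Ne] := near_infty_natSinv_lt (PosNum e20).
apply: filterS (HW N').1 => k Wk /=; pose j := maxn N N'.
apply: le_lt_trans (nrm_dist HH (T (x (K' j))) _ _) _; rewrite [ltRHS]splitr ltrD//.
  by apply: lt_trans ((HW N').2 _ _ _ _) (Ne _ _) => //=; apply: HK'; exact: leq_maxr.
by apply: Hy'; exact: leq_maxl.
Qed.

(** Compactness along ultrafilters avoids extracting subsequences. *)
Definition ultra_compact (Z : set C) := forall (U : set_system nat) (z : nat -> C),
  UltraFilter U -> (forall k, Z (z k)) ->
  exists2 z0, Z z0 & forall e, 0 < e -> U [set k | normc (z k - z0) < e].

Lemma ultra_eq (U : set_system nat) (y : nat -> E) x x' : UltraFilter U ->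
  (forall e, 0 < e -> U [set k | nrm (y k - x) < e]) ->
  (forall e, 0 < e -> U [set k | nrm (y k - x') < e]) -> x = x'.
Proof.
move=> UU yx yx'; apply/eqP; rewrite -subr_eq0 -(nrm_eq0 HH); apply/negPn/negP => n0.
have e0 : 0 < nrm (x - x') / 2 by rewrite divr_gt0// lt_neqAle eq_sym n0 nrm_ge0.
have /filter_ex[k [/= h1 h2]] : U ([set k | nrm (y k - x) < nrm (x - x') / 2] `&`
    [set k | nrm (y k - x') < nrm (x - x') / 2]).
  exact: filterI (yx _ e0) (yx' _ e0).
have := nrm_dist HH (y k) x x'; rewrite (nrmBC HH x (y k)) leNgt => /negP; apply.
by rewrite [ltRHS]splitr ltrD.
Qed.

(** Riesz: a violating sequence of unit vectors would, by compactness,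
    accumulate at an eigenvector. *)
Lemma uniform_lower_bound T Ts (Z : set C) (G : set E) :
  adjoint T Ts -> approximable T Ts -> (exists M, bounded_op T M) ->
  ultra_compact Z -> (forall z, Z z -> z != 0) ->
  (forall z x, Z z -> (forall g, G g -> ip x g = 0) -> T x = z *: x -> x = 0) ->
  exists2 c : R, 0 < c & forall z x, Z z -> (forall g, G g -> ip x g = 0) ->
    c * nrm x <= nrm (T x - z *: x).
Proof.
move=> Tadj Tap Tb Zc Z0 Tinj; apply: contrapT => H.
have bad (k : nat) : exists p : C * E, [/\ Z p.1, forall g, G g -> ip p.2 g = 0,
    nrm p.2 = 1 & nrm (T p.2 - p.1 *: p.2) < k.+1%:R^-1].
  apply: contrapT => Hk; apply: H; exists k.+1%:R^-1; first by rewrite invr_gt0.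
  move=> z x Zz xG; rewrite leNgt; apply/negP => xlt; apply: Hk.
  have x0 : x != 0.
    by apply: contra_ltN xlt => /eqP ->; rewrite (nrm0 HH) mulr0 nrm_ge0.
  exists (z, (nrm x)^-1%:C *: x) => /=; split=> //.
  - by move=> g Gg; rewrite (ipZl HH) xG// mulr0.
  - by rewrite (nrm_normalize HH).
  rewrite (opZ Tadj) scalerA mulrC -scalerA -scalerBr (nrmZ HH) normcR.
  rewrite ger0_norm ?invr_ge0 ?nrm_ge0// mulrC ltr_pdivrMr//.
  by rewrite (nrm_gt0 HH).
have /choice[p Hp] := bad; pose x k := (p k).2; pose z k := (p k).1.
have x1 k : nrm (x k) = 1 by have [] := Hp k.
have Zz k : Z (z k) by have [] := Hp k.
have xG k g : G g -> ip (x k) g = 0 by have [_ + _ _] := Hp k; apply.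
have Txz k : nrm (T (x k) - z k *: x k) < k.+1%:R^-1 by have [] := Hp k.
have [U [UU sU]] := ultraFilterLemma eventually_filter.
have [z0 Zz0 zz0] := Zc U z UU Zz.
have [|y Hy] := compact_lim Tap UU _ Tb (x := x) (B := 1); first by move=> k; rewrite x1.
have z00 := Z0 _ Zz0; pose w := z0^-1 *: y.
have nz0 : 0 < normc z0 by rewrite normc_gt0.
have xw e : 0 < e -> U [set k | nrm (x k - w) < e].
  move=> e0; have e1 : 0 < e * normc z0 / 3 by rewrite divr_gt0// mulr_gt0.
  have := near_infty_natSinv_lt (PosNum e1) => /sU Uk.
  apply: filterS (filterI (filterI (zz0 _ e1) (Hy _ e1)) Uk) => k /= [[h1 h2] h3].
  have -> : x k - w = z0^-1 *: (z0 *: x k - y).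
    by rewrite scalerBr scalerA mulVf// scale1r.
  rewrite (nrmZ HH) Normc.normcV mulrC ltr_pdivrMr//.
  have -> : z0 *: x k - y = (z0 - z k) *: x k + (z k *: x k - T (x k)) + (T (x k) - y).
    by rewrite scalerBl !subrKA.
  apply: le_lt_trans (nrmD HH _ _) _.
  have := nrmD HH ((z0 - z k) *: x k) (z k *: x k - T (x k)).
  rewrite (nrmZ HH) x1 mulr1 (nrmBC HH (z k *: _)) (normcB z0).
  by have := lt_trans (Txz k) h3 => /=; lra.
have [K [K0 TK]] := Tb.
have Tw : T w = z0 *: w.
  rewrite {2}/w scalerA mulfV// scale1r; apply: (@ultra_eq U (T \o x)) => // e e0.
  have e1 : 0 < e / (K + 1) by rewrite divr_gt0// ltr_wpDl.
  apply: filterS (xw _ e1) => k /= xwk; rewrite -(opB Tadj).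
  apply: le_lt_trans (TK _) _; rewrite ltr_pdivlMr ?ltr_wpDl// in xwk.
  apply: le_lt_trans xwk; rewrite mulrC ler_wpM2l ?nrm_ge0//.
  by rewrite lerDl.
have wG g : G g -> ip w g = 0.
  move=> Gg; apply/eqP; rewrite -normc_eq0; apply/negPn/negP => n0.
  have g0 : 0 < normc (ip w g) by rewrite lt_neqAle eq_sym n0 normc_ge0.
  have e1 : 0 < normc (ip w g) / (nrm g + 1) by rewrite divr_gt0// ltr_wpDl// nrm_ge0.
  have /filter_ex[k /= xwk] := xw _ e1.
  rewrite ltr_pdivlMr ?ltr_wpDl ?nrm_ge0// in xwk.
  have := nrm_CS HH (x k - w) g; rewrite (ipBl HH) xG// sub0r normcN leNgt => /negP; apply.
  by apply: le_lt_trans xwk; rewrite ler_wpM2l ?nrm_ge0// lerDl.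
have w0 := Tinj _ _ Zz0 wG Tw.
have /filter_ex[k /=] := xw 1 ltr01; rewrite w0 subr0 x1 ltxx//.
Qed.
End compact_operators.

(** * The spectral gap around a semisimple eigenvalue *)

Section spectral.
Context {R : realType} {E : lmodType R[i]} (ip : E -> E -> R[i]).
Local Notation C := R[i].
Local Notation nrm := (sip_norm ip).
Hypothesis HH : hilbert ip.
Implicit Types (x y : E) (a : C) (T Ts : E -> E).

Lemma subr_cross (V : zmodType) (a b c d : V) : (a - b) - (c - d) = (a - c) - (b - d).
Proof. by rewrite !opprB addrACA [RHS]addrACA [- b - c]addrC. Qed.

(** In finite dimension an operator and its adjoint have the same lower bound,
    because an injective endomorphism is onto. *)
Lemma compression_lower_bound T Ts M (v : 'I_M -> E) (z : C) (c : R) :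
  adjoint ip T Ts -> orthonormal ip v -> 0 < c ->
  (forall x, lspan v x -> c * nrm x <= nrm (oproj ip v (T x) - z *: x)) ->
  forall x, lspan v x -> c * nrm x <= nrm (oproj ip v (Ts x) - conjc z *: x).
Proof.
move=> TT ov c0 lb x Vx.
have HP := oprojP HH ov; have VL := lsub_span v.
pose A : 'M[C]_M := \matrix_(i, j) (ip (T (v i)) (v j) - z * (i == j)%:R).
have AE (b : 'rV[C]_M) : \sum_j (b *m A) ord0 j *: v j =
    oproj ip v (T (\sum_i b ord0 i *: v i)) - z *: \sum_i b ord0 i *: v i.
  rewrite /oproj scaler_sumr -sumrB; apply: eq_bigr => j _.
  rewrite scalerA -scalerBl; congr (_ *: _); rewrite mxE (op_sum HH TT) (ip_suml HH).
  have -> : z * b ord0 j = \sum_i b ord0 i * (z * (i == j)%:R).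
    by rewrite (bigD1 j)//= eqxx mulr1 mulrC big1 ?addr0// => i /negPf ->; rewrite !mulr0.
  rewrite -sumrB; apply: eq_bigr => i _.
  by rewrite mxE (opZ HH TT) (ipZl HH) mulrBr.
have uA : A \in unitmx.
  rewrite -row_free_unit -kermx_eq0; apply/eqP/row_matrixP => i; rewrite row0.
  set b := row i _; have bA : b *m A = 0 by rewrite -row_mul mulmx_ker row0.
  pose w := \sum_i b ord0 i *: v i.
  have w0 : w = 0.
    apply/eqP; rewrite -(nrm_eq0 HH); apply/eqP/le_anti; rewrite nrm_ge0 andbT.
    rewrite -(ler_pM2l c0) mulr0; apply: le_trans (lb w _) _; first by exists (b ord0).
    by rewrite -AE bA big1 ?(nrm0 HH)// => j _; rewrite mxE scale0r.
  apply/rowP => j; rewrite [RHS]mxE.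
  have := congr1 (fun y => ip y (v j)) w0; rewrite (ip0l HH) (ip_suml HH).
  rewrite (bigD1 j)//= (ipZl HH) ov eqxx mulr1 big1 ?addr0// => k kj.
  by rewrite (ipZl HH) ov (negPf kj) mulr0.
have [x' Vx' xE] : exists2 x', lspan v x' & oproj ip v (T x') - z *: x' = x.
  have [b bE] := Vx.
  pose b' := (\row_i b i) *m invmx A.
  exists (\sum_i b' ord0 i *: v i); first by exists (b' ord0).
  rewrite -AE /b' mulmxKV// bE; apply: eq_bigr => i _; by rewrite mxE.
have [->|x0] := eqVneq x 0; first by rewrite (nrm0 HH) mulr0 nrm_ge0.
have nx : 0 < nrm x by rewrite (nrm_gt0 HH).
have key : nrm x ^+ 2 <= nrm x' * nrm (oproj ip v (Ts x) - conjc z *: x).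
  have -> : nrm x ^+ 2 = Re (ip x' (oproj ip v (Ts x) - conjc z *: x)).
    have h1 : ip x' (oproj ip v (Ts x)) = ip x' (Ts x).
      by apply/eqP; rewrite eq_sym -subr_eq0 -(ipBr HH) (proj_orthr HH HP).
    have h2 : ip (T x') x = ip (oproj ip v (T x')) x.
      by apply/eqP; rewrite -subr_eq0 -(ipBl HH) HP.2.
    by rewrite (ipBr HH) (ipZr HH) conjcK h1 -TT h2 -(ipZl HH) -(ipBl HH) xE (nrm2 HH).
  apply: le_trans (ler_norm _) _; apply: le_trans (Re_le_normc _) _.
  exact: nrm_CS.
have x'x : c * nrm x' <= nrm x by rewrite -{1}xE; exact: lb.
rewrite -(ler_pM2l nx) mulrCA -expr2; apply: le_trans (ler_wpM2l (ltW c0) key) _.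
by rewrite mulrA ler_wpM2r// nrm_ge0.
Qed.

(** A lower bound for [T - z] passes to [Ts - conj z] through a
    finite-dimensional space on which both operators are nearly exact. *)
Lemma adjoint_lower_bound T Ts (Z : set C) (c zmin : R) :
  adjoint ip T Ts -> approximable ip T Ts -> (exists M, bounded_op ip T M) ->
  0 < c -> 0 < zmin -> (forall z, Z z -> zmin <= normc z) ->
  (forall z x, Z z -> c * nrm x <= nrm (T x - z *: x)) ->
  exists2 c', 0 < c' & forall z x, Z z -> c' * nrm x <= nrm (Ts x - conjc z *: x).
Proof.
move=> TT Tap [K TK] c0 zm0 Zm lb.
have [K0 TsK] := bounded_adjoint HH TT TK.
pose L := (2 * K / c + 1) / zmin.
have L0 : 0 < L by rewrite divr_gt0// ltr_wpDl// divr_ge0// ?mulr_ge0// ltW.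
pose e := Num.min (c / 2) (L^-1 / 2).
have e0 : 0 < e by rewrite lt_min !divr_gt0// invr_gt0.
have ec : e <= c / 2 by rewrite ge_min lexx.
have eL : e * L <= 1 / 2.
  have le : e <= L^-1 / 2 by rewrite ge_min lexx orbT.
  apply: le_trans (ler_wpM2r (ltW L0) le) _.
  by rewrite mulrAC mulVf ?lt0r_neq0.
have [M [v [ov vT vTs]]] := Tap _ e0.
have cL : 0 < 2 * (2 / c + L) by rewrite mulr_gt0// addr_gt0// divr_gt0.
exists (2 * (2 / c + L))^-1; first by rewrite invr_gt0.
move=> z x Zz; have VL := lsub_span v.
rewrite ler_pdivrMl//.
pose P := oproj ip v; have HP : is_proj ip (lspan v) P := oprojP HH ov; pose r := Ts x - conjc z *: x; rewrite -/r.
have lbV w : lspan v w -> c / 2 * nrm w <= nrm (P (T w) - z *: w).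
  move=> Vw; have := lb z w Zz; have := vT w; rewrite -/P.
  have := nrm_dist HH (P (T w)) (T w) (z *: w).
  by have := ler_wpM2r (nrm_ge0 ip w) ec; lra.
have lbVs := compression_lower_bound TT ov (divr_gt0 c0 (ltr0n R 2)) lbV.
have VP : lspan v (P x) by exact: HP.1.
have h1 : zmin * nrm (x - P x) <= e * nrm x + nrm r.
  apply: le_trans (ler_wpM2r (nrm_ge0 _ _) (Zm z Zz)) _.
  rewrite -normc_conj -(nrmZ HH).
  have -> : conjc z *: (x - P x) = (Ts x - P (Ts x)) - (r - P r).
    by rewrite /r (projB HH VL HP) (projZ HH VL HP) scalerBr [_ - (P _ - _)]subr_cross subKr.
  apply: le_trans (nrmB HH _ _) _; rewrite lerD//; exact: (proj_nrmC HH HP).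
have h2 : c / 2 * nrm (P x) <= nrm r + K * nrm (x - P x).
  apply: le_trans (lbVs _ VP) _; rewrite -/P.
  have -> : P (Ts (P x)) - conjc z *: P x = P r - P (Ts (x - P x)).
    rewrite /r (opB HH (adjointC HH TT)) !(projB HH VL HP) (projZ HH VL HP).
    by rewrite subr_cross subrr sub0r opprB addrC.
  apply: le_trans (nrmB HH _ _) _; rewrite lerD ?(proj_nrm HH HP)//.
  by apply: le_trans (proj_nrm HH HP _) (TsK _).
have h3 : nrm x <= nrm (x - P x) + nrm (P x) by exact: nrm_triangle.
have h4 : nrm x <= (e * nrm x + nrm r) * L + 2 / c * nrm r.
  have d : nrm (x - P x) <= (e * nrm x + nrm r) / zmin.
    by rewrite ler_pdivlMr// mulrC.
  have p : nrm (P x) <= 2 / c * (nrm r + K * nrm (x - P x)).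
    by rewrite -ler_pdivrMl ?divr_gt0// invf_div.
  have dp : 0 <= 2 / c * K by rewrite mulr_ge0// divr_ge0// ltW.
  have d' := ler_wpM2l dp d.
  have -> : (e * nrm x + nrm r) * L =
      2 / c * K * ((e * nrm x + nrm r) / zmin) + (e * nrm x + nrm r) / zmin.
    by rewrite /L; field; rewrite !lt0r_neq0.
  by rewrite mulrDr mulrA in p; lra.
have := ler_wpM2l (nrm_ge0 ip x) eL.
have := nrm_ge0 ip r.
by move: h4; rewrite mulrDl; set t := 2 / c; lra.
Qed.
End spectral.

Section spectral_gap.
Context {R : realType} {E : lmodType R[i]} (ip : E -> E -> R[i]).
Local Notation C := R[i].
Local Notation nrm := (sip_norm ip).
Hypothesis HH : hilbert ip.
Implicit Types (x y : E) (a : C) (T Ts : E -> E).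

(** Orthogonal projection on the closure of a subspace, by minimising the
    distance. *)
Lemma closure_projection (Y : set E) x : lsub Y ->
  exists y, (forall e, 0 < e -> exists2 y', Y y' & nrm (y' - y) < e) /\
            forall y', Y y' -> ip (x - y) y' = 0.
Proof.
move=> YL; pose D := [set nrm (x - y') ^+ 2 | y' in Y].
have DI : has_inf D.
  split; first by exists (nrm (x - 0) ^+ 2), 0 => //; exact: YL.1.
  by exists 0 => _ [y' _ <-]; exact: sqr_ge0.
have dle y' : Y y' -> inf D <= nrm (x - y') ^+ 2.
  by move=> Yy'; apply: ge_inf; [exact: DI.2|exists y'].
have /choice[s Hs] (k : nat) : exists y', Y y' /\ nrm (x - y') ^+ 2 < inf D + k.+1%:R^-1.
  have k0 : 0 < k.+1%:R^-1 :> R by rewrite invr_gt0.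
  by have [_ [y' Yy' <-] lt] := inf_adherent k0 DI; exists y'.
have Ys k : Y (s k) := (Hs k).1.
have close m k : nrm (s m - s k) ^+ 2 < 2 * m.+1%:R^-1 + 2 * k.+1%:R^-1.
  have -> : s m - s k = (x - s k) - (x - s m).
    by rewrite subr_cross subrr sub0r opprB.
  rewrite (nrm_parallelogram HH).
  have mid : 4 * inf D <= nrm (x - s k + (x - s m)) ^+ 2.
    have -> : x - s k + (x - s m) = 2%:R *: (x - 2^-1 *: (s k + s m)).
      by rewrite scalerBr scalerA mulfV ?pnatr_eq0// scale1r scaler_nat mulr2n addrACA opprD.
    rewrite (nrmZ HH) exprMn.
    have -> : normc 2%:R ^+ 2 = 4 :> R by rewrite normcE2 /= addr0 expr0n addr0 expr2; ring.
    by rewrite ler_pM2l// dle//; apply: lsubZ => //; exact: lsubD.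
  by move: (Hs m).2 (Hs k).2; move: (m.+1%:R^-1) (k.+1%:R^-1) => p1 p2; lra.
have [|y Hy] := hilbert_complete HH (x := s).
  move=> e e0; have e2 : 0 < e ^+ 2 / 4 by rewrite divr_gt0// exprn_gt0.
  have [N _ Ne] := near_infty_natSinv_lt (PosNum e2).
  exists N => m k Nm Nk; rewrite -(@ltr_pXn2r _ 2) ?nnegrE ?nrm_ge0 ?ltW//.
  by apply: lt_trans (close m k) _; move: (Ne _ Nm) (Ne _ Nk) => /=; move: (m.+1%:R^-1) (k.+1%:R^-1) => p1 p2; lra.
exists y; split.
  by move=> e /Hy[N HN]; exists (s N) => //; exact: HN.
move=> y' Yy'; apply/eqP; rewrite -normc_eq0 eq_le normc_ge0 andbT.
have bnd k : normc (ip y' (x - s k)) <= Num.sqrt k.+1%:R^-1 * nrm y'.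
  have -> : nrm y' = Num.sqrt (nrm y' ^+ 2) by rewrite sqrtr_sqr ger0_norm ?nrm_ge0.
  apply: discriminant_le; rewrite ?invr_ge0 ?sqr_ge0// => a.
  have := dle (s k - a *: y') (lsubB YL (Ys k) (lsubZ a YL Yy')).
  rewrite opprB addrA addrAC (sip_normD2 (hilbert_ip HH))//.
  by move: (Hs k).2; move: (k.+1%:R^-1) => p1; lra.
apply/ler_addgt0Pl => e e0; rewrite addr0.
pose e1 := e / (2 * (nrm y' + 1)).
have d0 : 0 < 2 * (nrm y' + 1) by rewrite mulr_gt0// ltr_wpDl ?nrm_ge0.
have e10 : 0 < e1 by rewrite divr_gt0.
have e1E : e1 * (2 * (nrm y' + 1)) = e by rewrite divfK// lt0r_neq0.
have e12 : 0 < e1 ^+ 2 by rewrite exprn_gt0.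
have [N1 HN1] := Hy _ e10; have [N2 _ HN2] := near_infty_natSinv_lt (PosNum e12).
pose k := maxn N1 N2.
have h1 := HN1 k (leq_maxl _ _).
have h2 : Num.sqrt k.+1%:R^-1 <= e1.
  rewrite -(ger0_norm (ltW e10)) -sqrtr_sqr ler_wsqrtr//.
  by apply/ltW/HN2; exact: leq_maxr.
have -> : ip (x - y) y' = ip (x - s k) y' + ip (s k - y) y'.
  by rewrite -(ipDl HH) subrKA.
apply: le_trans (le_normcD _ _) _; rewrite (ipC HH) normc_conj.
have := bnd k; have := nrm_CS HH (s k - y) y'.
have := ler_wpM2r (nrm_ge0 ip y') h2; have := ler_wpM2r (nrm_ge0 ip y') (ltW h1).
by have := nrm_ge0 ip y'; lra.
Qed.

Record spectral_gap T Ts (mu : C) q (f g : 'I_q -> E) (Z : set C) (c : R) : Prop :=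
  SpectralGap {
  gap_adj : adjoint ip T Ts;
  gap_f : forall i, T (f i) = mu *: f i;
  gap_g : forall i, Ts (g i) = conjc mu *: g i;
  gap_bior : forall i j, ip (f i) (g j) = (i == j)%:R;
  gap_kerf : forall x, T x = mu *: x -> x = \sum_i ip x (g i) *: f i;
  gap_kerg : forall x, Ts x = conjc mu *: x -> x = \sum_i ip x (f i) *: g i;
  gap_gt0 : 0 < c;
  gap_lbf : forall z y, Z z -> (forall i, ip y (g i) = 0) ->
    c * nrm y <= nrm (T y - z *: y);
  gap_lbg : forall z y, Z z -> (forall i, ip y (f i) = 0) ->
    c * nrm y <= nrm (Ts y - conjc z *: y) }.

Lemma spectral_gapC T Ts mu q (f g : 'I_q -> E) Z c :
  spectral_gap T Ts mu f g Z c ->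
  spectral_gap Ts T (conjc mu) g f [set conjc z | z in Z] c.
Proof.
case=> h1 h2 h3 h4 h5 h6 h7 h8 h9; split; rewrite ?conjcK//.
- exact: adjointC.
- by move=> i j; rewrite (ipC HH) h4 eq_sym; case: (_ == _); rewrite ?conjc0 ?conjc1.
- by move=> _ y [z Zz <-]; exact: h9.
- by move=> _ y [z Zz <-]; rewrite conjcK; exact: h8.
Qed.

Section existence.
Variables (T Ts : E -> E) (mu : C) (q : nat) (f : 'I_q -> E).
Hypotheses (TT : adjoint ip T Ts) (Tap : approximable ip T Ts)
  (Tb : exists M, bounded_op ip T M) (mu0 : mu != 0)
  (Tf : forall i, T (f i) = mu *: f i)
  (f_free : forall c : 'I_q -> C, \sum_i c i *: f i = 0 -> forall i, c i = 0)
  (f_span : forall x, T x = mu *: x -> lspan f x)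
  (asc : forall x, T (T x - mu *: x) = mu *: (T x - mu *: x) -> T x = mu *: x).

Lemma ker_dim : dim_le [set x | T x = mu *: x] q.
Proof. exact: (dim_le_span (e := f)). Qed.

Lemma ker_lsub : lsub [set x | T x = mu *: x].
Proof.
split; first by rewrite /= (op0 HH TT) scaler0.
move=> a x y /= Tx Ty; rewrite (opD HH TT) (opZ HH TT) Tx Ty.
by rewrite scalerDr !scalerA mulrC.
Qed.

(** Ascent one makes the kernel of [T - mu] transversal to the closure of its
    range: on the orthogonal of the kernel [T - mu] is bounded below, so limits
    of its values are values. *)
Lemma ker_range_disjoint x : T x = mu *: x ->
  (forall e, 0 < e -> exists y, nrm (T y - mu *: y - x) < e) -> x = 0.
Proof.
move=> Tx xR; have [P HP] := proj_exists HH ker_lsub ker_dim.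
have [|||c c0 lb] := uniform_lower_bound HH (Z := [set mu]) (G := [set y | T y = mu *: y]) TT Tap Tb.
- move=> U z UU zmu; exists mu => // e e0; apply: filterS filterT => k _ /=.
  by rewrite zmu subrr Normc.normc0.
- by move=> _ ->.
- move=> _ y -> yK Ty; apply/eqP; rewrite -(nrm_eq0 HH) -sqrf_eq0.
  by have := yK y Ty; rewrite (nrm2 HH) => -[->].
have /choice[s Hs] (k : nat) : exists y, (forall g, T g = mu *: g -> ip y g = 0) /\
    nrm (T y - mu *: y - x) < k.+1%:R^-1.
  have k0 : 0 < k.+1%:R^-1 :> R by rewrite invr_gt0.
  have [y ylt] := xR _ k0; exists (y - P y); split; first by move=> g Tg; exact: HP.2.
  rewrite (opB HH TT) scalerBr subr_cross.
  by have -> : T (P y) = mu *: P y := HP.1 y; rewrite subrr subr0.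
have close m k : c * nrm (s m - s k) < m.+1%:R^-1 + k.+1%:R^-1.
  apply: le_lt_trans (lb mu _ _ _) _ => //.
    by move=> g Gg; rewrite (ipBl HH) (Hs m).1// (Hs k).1// subrr.
  rewrite (opB HH TT) scalerBr subr_cross.
  apply: le_lt_trans (nrm_dist HH x _ _) _; rewrite ltrD ?(Hs m).2//.
  by rewrite (nrmBC HH) (Hs k).2.
have [|y Hy] := hilbert_complete HH (x := s).
  move=> e e0; have e2 : 0 < c * e / 2 by rewrite divr_gt0// mulr_gt0.
  have [N _ Ne] := near_infty_natSinv_lt (PosNum e2).
  exists N => m k Nm Nk; rewrite -(ltr_pM2l c0); apply: lt_trans (close m k) _.
  by move: (Ne _ Nm) (Ne _ Nk) => /=; move: (m.+1%:R^-1) (k.+1%:R^-1) => p1 p2; lra.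
have xE : T y - mu *: y = x.
  apply/eqP; rewrite -subr_eq0 -(nrm_eq0 HH) eq_le nrm_ge0 andbT.
  apply/ler_addgt0Pl => e e0; rewrite addr0.
  have [K [K0 TK]] := Tb; pose L := K + normc mu + 1.
  have L0 : 0 < L by rewrite ltr_wpDl// addr_ge0// normc_ge0.
  have e1 : 0 < e / (2 * L) by rewrite divr_gt0// mulr_gt0.
  have e2 : 0 < e / 2 by rewrite divr_gt0.
  have [N1 HN1] := Hy _ e1; have [N2 _ HN2] := near_infty_natSinv_lt (PosNum e2).
  pose k := maxn N1 N2.
  have h1 := HN1 k (leq_maxl _ _); have h2 := lt_trans (Hs k).2 (HN2 k (leq_maxr _ _)).
  have : nrm (T (s k - y) - mu *: (s k - y)) <= L * nrm (s k - y).
    apply: le_trans (nrmB HH _ _) _; rewrite (nrmZ HH) /L mulrDl mul1r mulrDl -addrA lerD//.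
    by rewrite lerDl nrm_ge0.
  rewrite (opB HH TT) scalerBr subr_cross => h3.
  have h4 : L * nrm (s k - y) <= e / 2.
    by rewrite mulrC -ler_pdivlMr// -mulrA -invfM; exact: ltW.
  have := nrm_dist HH (T (s k) - mu *: s k) (T y - mu *: y) x.
  rewrite (nrmBC HH (T y - _) (T (s k) - _)); rewrite /= in h2; lra.
rewrite -xE (asc (x := y)) ?subrr// xE.
exact: Tx.
Qed.

(** The part [h i] of [f i] that is orthogonal to the range of [T - mu] is a dual
    eigenvector. The Gram matrix of the [f i] and [h j] is invertible, since an
    eigenvector orthogonal to all [h j] lies in the closure of the range. *)
Lemma biorthogonal_exists : exists g : 'I_q -> E,
  (forall i, Ts (g i) = conjc mu *: g i) /\ forall i j, ip (f i) (g j) = (i == j)%:R.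
Proof.
pose Y := [set y | exists x, y = T x - mu *: x].
have YL : lsub Y.
  split; first by exists 0; rewrite (op0 HH TT) scaler0 subrr.
  move=> a _ _ [x ->] [y ->]; exists (a *: x + y).
  rewrite (opD HH TT) (opZ HH TT) scalerBr [in RHS]scalerDr opprD addrACA !scalerA.
  by rewrite [mu * a]mulrC.
have /choice[y Hy] i := closure_projection (f i) YL.
pose h i := f i - y i.
have hK i : Ts (h i) = conjc mu *: h i.
  apply: (ip_inj HH) => x; rewrite (ipC HH) -TT [RHS](ipC HH) (ipZr HH) conjcK.
  congr conjc; apply/eqP; rewrite -subr_eq0 -(ipZl HH) -(ipBl HH) (ipC HH) /h.
  by rewrite (Hy i).2 ?conjc0//; exists x.
pose G : 'M[C]_q := \matrix_(i, j) ip (f i) (h j).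
have uG : G \in unitmx.
  rewrite -row_free_unit -kermx_eq0; apply/eqP/row_matrixP => i; rewrite row0.
  set b := row i _; have bG : b *m G = 0 by rewrite -row_mul mulmx_ker row0.
  pose x := \sum_i b ord0 i *: f i; pose w := \sum_i b ord0 i *: h i.
  have xh j : ip x (h j) = 0.
    have /matrixP/(_ ord0 j) := bG; rewrite !mxE => <-.
    rewrite (ip_suml HH); by apply: eq_bigr => k _; rewrite (ipZl HH) [G k j]mxE.
  have xw : ip x w = 0.
    by rewrite (ip_sumr HH) big1// => k _; rewrite (ipZr HH) xh mulr0.
  have wY y' : Y y' -> ip w y' = 0.
    by move=> Yy'; rewrite (ip_suml HH) big1// => k _; rewrite (ipZl HH) (Hy k).2// mulr0.
  have xwE : x - w = \sum_i b ord0 i *: y i.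
    by rewrite -sumrB; apply: eq_bigr => k _; rewrite -scalerBr subKr.
  have cl e : 0 < e -> exists2 y', Y y' & nrm (y' - (x - w)) < e.
    move=> e0; pose B := \sum_i normc (b ord0 i) + 1.
    have B0 : 0 < B by rewrite ltr_wpDl// sumr_ge0// => *; exact: normc_ge0.
    have eB : 0 < e / B by rewrite divr_gt0.
    have /choice[y' Hy'] k : exists y', Y y' /\ nrm (y' - y k) < e / B.
      by have [y' ? ?] := (Hy k).1 _ eB; exists y'.
    exists (\sum_i b ord0 i *: y' i).
      by apply: lsub_sum => // k _; apply: lsubZ => //; exact: (Hy' k).1.
    rewrite xwE -sumrB; apply: le_lt_trans (nrm_sum HH _ _ _) _.
    apply: (@le_lt_trans _ _ (\sum_i normc (b ord0 i) * (e / B))).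
      apply: ler_sum => k _; rewrite -scalerBr (nrmZ HH) ler_wpM2l ?normc_ge0//.
      exact/ltW/(Hy' k).2.
    rewrite -mulr_suml mulrCA -ltr_pdivlMl// mulVf ?lt0r_neq0//.
    by rewrite ltr_pdivrMr// mul1r ltrDl.
  have w0 : w = 0.
    have wxw : ip w (x - w) = 0.
      apply/eqP; rewrite -normc_eq0 eq_le normc_ge0 andbT.
      apply/ler_addgt0Pl => e e0; rewrite addr0.
      have d0 : 0 < nrm w + 1 by rewrite ltr_wpDl ?nrm_ge0.
      have [y' Yy' lt] := cl _ (divr_gt0 e0 d0).
      have -> : ip w (x - w) = - ip w (y' - (x - w)) by rewrite [ip w (y' - _)](ipBr HH) (wY _ Yy') sub0r opprK.
      rewrite normcN; apply: le_trans (nrm_CS HH _ _) _.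
      rewrite ltr_pdivlMr// in lt; apply: le_trans (ltW lt).
      by rewrite mulrC ler_wpM2l ?nrm_ge0// lerDl.
    have : ip w w = 0.
      move: wxw; rewrite (ipBr HH) (ipC HH x) xw conjc0 sub0r => /eqP.
      by rewrite oppr_eq0 => /eqP.
    by rewrite (nrm2 HH) => -[/eqP]; rewrite sqrf_eq0 (nrm_eq0 HH) => /eqP.
  have x0 : x = 0.
    apply: ker_range_disjoint.
      have : [set y | T y = mu *: y] x; last by [].
      by apply: (lsub_sum _ ker_lsub) => k _; apply: (lsubZ _ ker_lsub); exact: Tf.
    by move=> e /cl[_ [z ->]]; rewrite w0 subr0 => ?; exists z.
  by apply/rowP => j; rewrite [RHS]mxE; exact: (f_free x0).
exists (fun j => \sum_k conjc (invmx G k j) *: h k); split.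
  move=> j; rewrite (op_sum HH (adjointC HH TT)) scaler_sumr; apply: eq_bigr => k _.
  by rewrite (opZ HH (adjointC HH TT)) hK !scalerA mulrC.
move=> i j; rewrite (ip_sumr HH).
have /matrixP/(_ i j) := mulmxV uG; rewrite !mxE => <-.
by apply: eq_bigr => k _; rewrite (ipZr HH) conjcK [G i k]mxE mulrC.
Qed.

(** Subtracting [mu] times the spectral projection moves the eigenvalue [mu] to
    zero.  The resulting operator has no eigenvalue left in [Z], hence is
    uniformly bounded below there together with its adjoint; it agrees with [T]
    on the complement of the eigenspace. *)
Theorem spectral_gap_exists (Z : set C) (zmin : R) :
  ultra_compact Z -> 0 < zmin -> (forall z, Z z -> zmin <= normc z) ->
  Z mu -> (forall z x, Z z -> z != mu -> T x = z *: x -> x = 0) ->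
  exists (g : 'I_q -> E) c, spectral_gap T Ts mu f g Z c.
Proof.
move=> Zc zm0 Zm Zmu Zinj; have [g [Tg fg]] := biorthogonal_exists.
have TTc := adjointC HH TT.
pose Q x := \sum_i ip x (g i) *: f i; pose Qs x := \sum_i ip x (f i) *: g i.
have QQ : adjoint ip Q Qs.
  move=> x y; rewrite (ip_suml HH) (ip_sumr HH); apply: eq_bigr => i _.
  by rewrite (ipZl HH) (ipZr HH) -(ipC HH) mulrC.
have Qf x : T x = mu *: x -> Q x = x.
  move=> /f_span[b ->]; apply: eq_bigr => i _; congr (_ *: _).
  rewrite (ip_suml HH) (bigD1 i)//= (ipZl HH) fg eqxx mulr1 big1 ?addr0// => j ji.
  by rewrite (ipZl HH) fg (negPf ji) mulr0.
have TQ x : T (Q x) = mu *: Q x.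
  rewrite (op_sum HH TT) scaler_sumr; apply: eq_bigr => i _.
  by rewrite (opZ HH TT) Tf !scalerA mulrC.
have QQx x : Q (Q x) = Q x by exact/Qf/TQ.
have QT x : Q (T x) = mu *: Q x.
  rewrite scaler_sumr; apply: eq_bigr => i _.
  by rewrite TT Tg (ipZr HH) conjcK scalerA.
pose T' x := T x - mu *: Q x; pose Ts' x := Ts x - conjc mu *: Qs x.
have TT' : adjoint ip T' Ts'.
  by move=> x y; rewrite (ipBl HH) (ipBr HH) (ipZl HH) (ipZr HH) conjcK TT QQ.
pose F := \sum_i nrm (f i) * nrm (g i).
have F0 : 0 <= F by rewrite sumr_ge0// => i _; rewrite mulr_ge0 ?nrm_ge0.
have Tb' : exists M, bounded_op ip T' M.
  have [K [K0 TK]] := Tb; exists (K + normc mu * F); split.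
    by rewrite addr_ge0// mulr_ge0// normc_ge0.
  move=> x; apply: le_trans (nrmB HH _ _) _; rewrite mulrDl lerD// (nrmZ HH) -mulrA.
  rewrite ler_wpM2l ?normc_ge0//; apply: le_trans (nrm_sum HH _ _ _) _.
  rewrite mulr_suml; apply: ler_sum => i _; rewrite (nrmZ HH) mulrC -[leRHS]mulrA.
  by rewrite ler_wpM2l ?nrm_ge0// [leRHS]mulrC; exact: nrm_CS.
have Tap' : approximable ip T' Ts'.
  move=> e e0; pose e1 := e / (1 + F).
  have F1 : 0 < 1 + F by rewrite ltr_pwDl.
  have e10 : 0 < e1 by rewrite divr_gt0.
  have e1E : e1 * (1 + F) = e by rewrite divfK// lt0r_neq0.
  have [M [v [ov vT vTs]]] := Tap e10; exists M, v; split=> // x.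
  (* an eigenvector is mu^-1 times its image, hence also nearly in the span *)
  - have VL := lsub_span v; have HP := oprojP HH ov.
    rewrite /T' (projB HH VL HP) (projZ HH VL HP) subr_cross -scalerBr.
    apply: le_trans (nrmB HH _ _) _.
    have -> : e * nrm x = e1 * nrm x + F * e1 * nrm x.
      by rewrite -[in LHS]e1E; ring.
    rewrite lerD//; rewrite /Q (big_morph _ (projD HH VL HP) (proj_id HH VL HP VL.1)) -sumrB scaler_sumr.
    apply: le_trans (nrm_sum HH _ _ _) _; rewrite !mulr_suml; apply: ler_sum => i _.
    rewrite (projZ HH VL HP) -scalerBr scalerA mulrC -scalerA scalerBr.
    rewrite -(projZ HH VL HP) -Tf (nrmZ HH).
    apply: le_trans (ler_pM (normc_ge0 _) (nrm_ge0 _ _) (nrm_CS HH _ _) (vT _)) _.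
    by rewrite le_eqVlt; apply/orP; left; apply/eqP; ring.
  - have VL := lsub_span v; have HP := oprojP HH ov.
    rewrite /Ts' (projB HH VL HP) (projZ HH VL HP) subr_cross -scalerBr.
    apply: le_trans (nrmB HH _ _) _.
    have -> : e * nrm x = e1 * nrm x + F * e1 * nrm x.
      by rewrite -[in LHS]e1E; ring.
    rewrite lerD//; rewrite /Qs (big_morph _ (projD HH VL HP) (proj_id HH VL HP VL.1)) -sumrB scaler_sumr.
    apply: le_trans (nrm_sum HH _ _ _) _; rewrite !mulr_suml; apply: ler_sum => i _.
    rewrite (projZ HH VL HP) -scalerBr scalerA mulrC -scalerA scalerBr.
    rewrite -(projZ HH VL HP) -Tg (nrmZ HH).
    apply: le_trans (ler_pM (normc_ge0 _) (nrm_ge0 _ _) (nrm_CS HH _ _) (vTs _)) _.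
    by rewrite le_eqVlt; apply/orP; left; apply/eqP; ring.
have Z0 z : Z z -> z != 0 by move=> /Zm zz; rewrite -normc_gt0; exact: lt_le_trans zz.
have inj' z x : Z z -> (forall y, set0 y -> ip x y = 0) -> T' x = z *: x -> x = 0.
  move=> Zz _ T'x.
  have Qx : Q x = 0.
    have : z *: Q x = 0.
      rewrite -(opZ HH QQ) -T'x (opB HH QQ) (opZ HH QQ) QQx QT subrr//.
    by move=> /eqP; rewrite scaler_eq0 (negPf (Z0 _ Zz)) => /eqP.
  have Tx : T x = z *: x by rewrite -T'x /T' Qx scaler0 subr0.
  have [zmu|zmu] := eqVneq z mu; last exact: Zinj Tx.
  by rewrite -(Qf x)// Tx zmu.
have [c c0 lb] := uniform_lower_bound HH TT' Tap' Tb' Zc Z0 inj'.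
have [|c' c'0 lb'] := adjoint_lower_bound HH TT' Tap' Tb' c0 zm0 Zm (c := c) (Z := Z).
  by move=> z x Zz; apply: lb => // y; case.
exists g, (Num.min c c'); split=> //.
- by move=> x /Qf.
- move=> y Ty; pose w := y - Qs y.
  have w0 : w = 0.
    have fw i : ip w (f i) = 0.
      have gf j : ip (g j) (f i) = (j == i)%:R.
        by rewrite (ipC HH) fg eq_sym; case: (_ == _); rewrite ?conjc0 ?conjc1.
      rewrite (ipBl HH) (ip_suml HH) (bigD1 i)//= (ipZl HH) gf eqxx mulr1.
      rewrite big1 ?addr0 ?subrr// => j ji.
      by rewrite (ipZl HH) gf (negPf ji) mulr0.
    have Tw : Ts w = conjc mu *: w.
      rewrite (opB HH TTc) Ty scalerBr; congr (_ - _).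
      rewrite (op_sum HH TTc) scaler_sumr; apply: eq_bigr => i _.
      by rewrite (opZ HH TTc) Tg !scalerA mulrC.
    have := lb' mu w Zmu; rewrite /Ts' Tw /Qs big1; last by move=> i _; rewrite fw scale0r.
    rewrite scaler0 subr0 subrr (nrm0 HH) pmulr_rle0// => le0.
    by apply/eqP; rewrite -(nrm_eq0 HH) eq_le le0 nrm_ge0.
  by apply/eqP; rewrite -subr_eq0 -/(Qs y) -/w w0.
- by rewrite lt_min c0.
- move=> z y Zz yg; apply: le_trans (_ : c * nrm y <= _).
    by rewrite ler_wpM2r ?nrm_ge0// ge_min lexx.
  have := lb z y Zz; rewrite /T' /Q big1 ?scaler0 ?subr0; first by apply=> h; case.
  by move=> i _; rewrite yg scale0r.
- move=> z y Zz yf; apply: le_trans (_ : c' * nrm y <= _).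
    by rewrite ler_wpM2r ?nrm_ge0// ge_min lexx orbT.
  have := lb' z y Zz; rewrite /Ts' /Qs big1 ?scaler0 ?subr0//.
  by move=> i _; rewrite yf scale0r.
Qed.
End existence.
End spectral_gap.

(** * Galerkin eigenvalue approximation on one level and across levels *)

Section levels.
Context {R : realType} {E : lmodType R[i]} (ip : E -> E -> R[i]).
Local Notation C := R[i].
Local Notation nrm := (sip_norm ip).
Hypothesis HH : hilbert ip.
Implicit Types (x y : E) (a : R).

Section one_sided.
Variables (T Ts : E -> E) (mu : C) (q : nat) (f g : 'I_q -> E) (Z : set C) (c : R).
Hypothesis gap : spectral_gap ip T Ts mu f g Z c.
Variables (K zmin zmax : R).
Hypotheses (TK : bounded_op ip T K) (mu0 : mu != 0) (zmin0 : 0 < zmin)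
  (Zmin : forall z, Z z -> zmin <= normc z) (Zmax : forall z, Z z -> normc z <= zmax)
  (zmax0 : 0 <= zmax).

Let TT := gap_adj gap.
Let c0 := gap_gt0 gap.

Definition eigproj (f0 g0 : 'I_q -> E) x := \sum_i ip x (g0 i) *: f0 i.
Local Notation Q := (eigproj f g).
Definition eigproj_bound (f0 g0 : 'I_q -> E) := \sum_i nrm (f0 i) * nrm (g0 i).
Local Notation F := (eigproj_bound f g).

Lemma F_ge0 : 0 <= F.
Proof. by rewrite sumr_ge0// => i _; rewrite mulr_ge0 ?nrm_ge0. Qed.
Lemma eigprojD x y : Q (x + y) = Q x + Q y.
Proof. by rewrite -big_split; apply: eq_bigr => i _; rewrite (ipDl HH) scalerDl. Qed.
Lemma eigprojZ (b : C) x : Q (b *: x) = b *: Q x.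
Proof. by rewrite scaler_sumr; apply: eq_bigr => i _; rewrite (ipZl HH) scalerA. Qed.
Lemma eigprojB x y : Q (x - y) = Q x - Q y.
Proof. by rewrite -scaleN1r eigprojD eigprojZ scaleN1r. Qed.
Lemma T_eigproj x : T (Q x) = mu *: Q x.
Proof.
rewrite (op_sum HH TT) scaler_sumr; apply: eq_bigr => i _.
by rewrite (opZ HH TT) (gap_f gap) !scalerA mulrC.
Qed.
Lemma eigproj_T x : Q (T x) = mu *: Q x.
Proof.
rewrite scaler_sumr; apply: eq_bigr => i _.
by rewrite TT (gap_g gap) (ipZr HH) conjcK scalerA.
Qed.
Lemma eigproj_orth x i : ip (x - Q x) (g i) = 0.
Proof.
rewrite (ipBl HH) (ip_suml HH) (bigD1 i)//= (ipZl HH) (gap_bior gap) eqxx mulr1.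
rewrite big1 ?addr0 ?subrr// => j ji.
by rewrite (ipZl HH) (gap_bior gap) (negPf ji) mulr0.
Qed.
Lemma eigproj_id x : T x = mu *: x -> Q x = x.
Proof. by move=> /(gap_kerf gap). Qed.
Lemma eigproj_nrm_sum x : nrm (Q x) <= \sum_i normc (ip x (g i)) * nrm (f i).
Proof.
apply: le_trans (nrm_sum HH _ _ _) _.
by apply: ler_sum => i _; rewrite (nrmZ HH).
Qed.
Lemma eigproj_nrm x : nrm (Q x) <= F * nrm x.
Proof.
apply: le_trans (eigproj_nrm_sum _) _; rewrite mulr_suml; apply: ler_sum => i _.
rewrite mulrC -[leRHS]mulrA ler_wpM2l ?nrm_ge0// [leRHS]mulrC; exact: nrm_CS.
Qed.

Record disc_level (V : set E) (P : E -> E) (eps : R) k (u : 'I_k -> E) (z : 'I_k -> C)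
    : Prop := DiscLevel {
  dl_sub : lsub V;
  dl_proj : is_proj ip V P;
  dl_eps0 : 0 <= eps;
  dl_T : forall x, nrm (T x - P (T x)) <= eps * nrm x;
  dl_Ts : forall x, nrm (Ts x - P (Ts x)) <= eps * nrm x;
  dl_u : forall j, V (u j);
  dl_z : forall j, Z (z j);
  dl_eig : forall j, P (T (u j)) = z j *: u j }.

Definition approx_ker (P : E -> E) (a : R) := 0 <= a /\
  forall x, T x = mu *: x -> nrm (x - P x) <= a * nrm x.

Section defect.
Variables (V : set E) (P : E -> E) (eps a : R).
Hypotheses (VL : lsub V) (HP : is_proj ip V P) (eps0 : 0 <= eps)
  (TV : forall x, nrm (T x - P (T x)) <= eps * nrm x)
  (TsV : forall x, nrm (Ts x - P (Ts x)) <= eps * nrm x)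
  (Pa : approx_ker P a).

Lemma defect_nrm x : nrm (T x - P (T x)) <= normc mu * F * a * nrm x + eps * nrm (x - Q x).
Proof.
have -> : T x - P (T x) = mu *: (Q x - P (Q x)) + (T (x - Q x) - P (T (x - Q x))).
  rewrite (opB HH TT) (projB HH VL HP) T_eigproj (projZ HH VL HP) scalerBr.
  by rewrite subr_cross [RHS]addrC subrK.
apply: le_trans (nrmD HH _ _) _; rewrite lerD// (nrmZ HH) -!mulrA ler_wpM2l ?normc_ge0//.
apply: le_trans (Pa.2 _ (T_eigproj x)) _.
by rewrite mulrCA ler_wpM2l ?Pa.1// eigproj_nrm.
Qed.

(** By duality: [w] is orthogonal to [V], while [Ts (T w)] is nearly in [V]. *)
Lemma T_orth_nrm w : (forall v, V v -> ip w v = 0) -> nrm (T w) <= eps * nrm w.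
Proof.
move=> wV; have [->|Tw0] := eqVneq (T w) 0; first by rewrite (nrm0 HH) mulr_ge0 ?nrm_ge0.
have Tw : 0 < nrm (T w) by rewrite (nrm_gt0 HH).
rewrite -(ler_pM2r Tw) -expr2.
have -> : nrm (T w) ^+ 2 = Re (ip w (Ts (T w) - P (Ts (T w)))).
  by rewrite (ipBr HH) [X in _ - X]wV ?subr0 -?TT ?(nrm2 HH)//; exact: HP.1.
apply: le_trans (ler_norm _) _; apply: le_trans (Re_le_normc _) _.
apply: le_trans (nrm_CS HH _ _) _.
by rewrite [leRHS]mulrAC [eps * _ * _]mulrC mulrC mulrC ler_wpM2l ?nrm_ge0// TsV.
Qed.

Lemma g_near i : nrm (g i - P (g i)) <= eps / normc mu * nrm (g i).
Proof.
have nmu : 0 < normc mu by rewrite normc_gt0.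
have gE : g i = (conjc mu)^-1 *: Ts (g i).
  by rewrite (gap_g gap) scalerA mulVf ?scale1r// conjc_eq0.
rewrite {1 2}gE (projZ HH VL HP) -scalerBr (nrmZ HH) Normc.normcV normc_conj.
by rewrite mulrAC [leRHS]mulrC ler_wpM2l ?invr_ge0 ?normc_ge0.
Qed.

Lemma Q_orth_nrm w : (forall v, V v -> ip w v = 0) ->
  nrm (Q w) <= eps * F / normc mu * nrm w.
Proof.
move=> wV; apply: le_trans (eigproj_nrm_sum _) _.
rewrite mulrAC [eps * F]mulrC -!mulrA mulr_suml; apply: ler_sum => i _.
have -> : ip w (g i) = ip w (g i - P (g i)).
  by rewrite (ipBr HH) [ip w (P _)]wV ?subr0//; exact: HP.1.
rewrite mulrC -[leRHS]mulrA ler_wpM2l ?nrm_ge0//.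
apply: le_trans (nrm_CS HH _ _) _.
apply: le_trans (ler_wpM2l (nrm_ge0 _ _) (g_near i)) _.
by rewrite le_eqVlt; apply/orP; left; apply/eqP; ring.
Qed.
End defect.

Definition small_eps := c / (2 * (1 + F)).

Lemma small_eps_gt0 : 0 < small_eps.
Proof. by rewrite divr_gt0// mulr_gt0// ltr_wpDr// F_ge0. Qed.

(** Error of the whole discrete invariant subspace, by induction along the flag
    of spans of the first eigenfunctions. Only the orthogonal splitting of [x]
    along the flag enters, so the constant is independent of the conditioning
    of the eigenfunctions. *)
Lemma invariant_subspace_error k : exists2 D : R, 0 <= D &
  forall V P eps a (u : 'I_k -> E) z, disc_level V P eps u z -> eps <= small_eps ->
    approx_ker P a -> forall x, lspan u x ->
    nrm (x - Q x) <= D * a * nrm x /\ nrm (T (x - Q x)) <= D * eps * a * nrm x.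
Proof.
have F0 := F_ge0; have [K0 TK'] := TK.
have nmu : 0 < normc mu by rewrite normc_gt0.
have TsK := (bounded_adjoint HH TT TK).2.
elim: k => [|k [D D0 IH]].
  exists 0 => // V P eps a u z _ _ _ x [b ->]; rewrite big_ord0.
  have -> : Q 0 = 0 by have := eigprojB 0 0; rewrite !subrr.
  by rewrite subr0 (op0 HH TT) (nrm0 HH) !mulr0.
pose Kz := K + zmax; pose m1 := normc mu * F.
pose D1 := (D * Kz + (1 + F) * m1) * (2 / c).
have Kz0 : 0 <= Kz by exact: addr_ge0.
have m10 : 0 <= m1 by apply: mulr_ge0 => //; exact: ltW.
have F1 : 0 <= 1 + F by exact: addr_ge0.
have D10 : 0 <= D1.
  by apply: mulr_ge0; [apply: addr_ge0; apply: mulr_ge0|apply: divr_ge0 => //; exact: ltW].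
pose D2 := (D * Kz + (1 + K * F / normc mu) * (m1 + small_eps * D1)) / c.
have se := small_eps_gt0.
have KF0 : 0 <= 1 + K * F / normc mu.
  by apply: addr_ge0 => //; apply: divr_ge0; [exact: mulr_ge0|exact: ltW].
have D20 : 0 <= D2.
  apply: divr_ge0; last exact: ltW.
  apply: addr_ge0; first exact: mulr_ge0.
  by apply: mulr_ge0 => //; apply: addr_ge0 => //; apply: mulr_ge0 => //; exact: ltW.
exists (D + D1 + D2); first by rewrite !addr_ge0.
move=> V P eps a u z L epss Pa x ux.
have [VL HP eps0 TV TsV uV uZ uE] := L; have a0 := Pa.1.
pose u' (i : 'I_k) := u (widen_ord (leqnSn k) i).
pose z' (i : 'I_k) := z (widen_ord (leqnSn k) i).
have L' : disc_level V P eps u' z' by split=> // i; [exact: uV|exact: uZ|exact: uE].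
have {}IH := IH _ _ _ _ _ _ L' epss Pa.
have [P' HP'] := proj_exists HH (lsub_span u') (dim_le_span (fun x => id)).
have M'L := lsub_span u'.
pose v := x - P' x.
have [b xE] := ux; pose zk := z ord_max.
have [w w' vE] : exists2 w, lspan u' w & v = b ord_max *: u ord_max + w.
  have [b' P'E] := HP'.1 x.
  exists (\sum_i b (widen_ord (leqnSn k) i) *: u' i - P' x).
    by apply: lsubB => //; [exists (fun i => b (widen_ord (leqnSn k) i))|exact: HP'.1].
  by rewrite /v xE big_ord_recr/= addrAC addrC.
have PT y1 y2 (b1 : C) : P (T (b1 *: y1 + y2)) = b1 *: P (T y1) + P (T y2).
  by rewrite (opD HH TT) (opZ HH TT) (projD HH VL HP) (projZ HH VL HP).
pose m := P (T v) - zk *: v.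
have mE : m = P (T w) - zk *: w.
  rewrite /m vE PT uE scalerDr !scalerA [zk * _]mulrC -/zk opprD addrACA subrr add0r//.
have mM : lspan u' m.
  rewrite mE; apply: lsubB => //; last exact: lsubZ.
  have [bw ->] := w'; exists (fun i => bw i * z' i).
  rewrite (op_sum HH TT) (big_morph P (projD HH VL HP) (proj_id HH VL HP VL.1)).
  apply: eq_bigr => i _; by rewrite (opZ HH TT) (projZ HH VL HP) uE scalerA.
have vx : nrm v <= nrm x by exact: (proj_nrmC HH HP').
have mv : nrm m <= Kz * nrm v.
  apply: le_trans (nrmB HH _ _) _; rewrite mulrDl lerD//.
    by apply: le_trans (proj_nrm HH HP _) (TK' _).
  by rewrite (nrmZ HH) ler_wpM2r ?nrm_ge0//; apply: Zmax; exact: uZ.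
pose e := v - Q v; pose wv := T v - P (T v).
have wvV y : V y -> ip wv y = 0 by exact: HP.2.
have eE : T e - zk *: e = (m - Q m) + (wv - Q wv).
  have -> : m - Q m + (wv - Q wv) = (m + wv) - Q (m + wv).
    by rewrite eigprojD opprD addrACA.
  have -> : m + wv = T v - zk *: v by rewrite /m /wv addrC addrA subrK.
  by rewrite eigprojB eigprojZ eigproj_T /e (opB HH TT) T_eigproj scalerBr subr_cross.
have [IHm1 IHm2] := IH _ mM.
have defect : nrm wv <= m1 * a * nrm v + eps * nrm e by exact: (defect_nrm VL HP TV Pa).
have ev : nrm e <= D1 * a * nrm v.
  have h1 : c * nrm e <= D * a * (Kz * nrm v) + (1 + F) * (m1 * a * nrm v + eps * nrm e).
    apply: le_trans (gap_lbf gap (uZ ord_max) (eigproj_orth v)) _.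
    rewrite -/zk eE; apply: le_trans (nrmD HH _ _) _; rewrite lerD//.
      by apply: le_trans IHm1 _; rewrite ler_wpM2l// mulr_ge0.
    apply: le_trans (nrmB HH _ _) _; apply: le_trans (lerD (lexx _) (eigproj_nrm _)) _.
    by rewrite -{1}[nrm wv]mul1r -mulrDl ler_wpM2l ?addr_ge0.
  have h2 : (1 + F) * eps * nrm e <= c / 2 * nrm e.
    rewrite ler_wpM2r ?nrm_ge0//; have := epss.
    rewrite /small_eps ler_pdivlMr ?mulr_gt0 ?ltr_wpDr//; lra.
  have h3 : c / 2 * nrm e <= (D * Kz + (1 + F) * m1) * (a * nrm v) by lra.
  have c2 : 0 < c / 2 by rewrite divr_gt0.
  by rewrite /D1 -(ler_pM2l c2); apply: le_trans h3 _; rewrite le_eqVlt; apply/orP; left;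
    apply/eqP; field; exact: lt0r_neq0.
have Tev : nrm (T e) <= D2 * eps * a * nrm v.
  have wva : nrm wv <= (m1 + small_eps * D1) * (a * nrm v).
    by have := ler_pM eps0 (nrm_ge0 _ _) epss ev; lra.
  have Teg i : ip (T e) (g i) = 0.
    by rewrite TT (gap_g gap) (ipZr HH) eigproj_orth mulr0.
  have h1 : c * nrm (T e) <= D * eps * a * (Kz * nrm v)
      + eps * (1 + K * F / normc mu) * nrm wv.
    apply: le_trans (gap_lbf gap (uZ ord_max) Teg) _.
    have -> : T (T e) - z ord_max *: T e = T (m - Q m) + T (wv - Q wv).
      by rewrite -(opD HH TT) -eE (opB HH TT (T e)) (opZ HH TT zk e).
    apply: le_trans (nrmD HH _ _) _; rewrite lerD//.
      by apply: le_trans IHm2 _; rewrite ler_wpM2l// !mulr_ge0.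
    rewrite (opB HH TT); apply: le_trans (nrmB HH _ _) _.
    rewrite mulrDr mulr1 mulrDl lerD//; first exact: (T_orth_nrm HP eps0 TsV).
    apply: le_trans (TK' _) _; apply: le_trans (ler_wpM2l K0 (Q_orth_nrm VL HP TsV wvV)) _.
    by rewrite le_eqVlt; apply/orP; left; apply/eqP; ring.
  have h2 : eps * (1 + K * F / normc mu) * nrm wv <=
      eps * (1 + K * F / normc mu) * ((m1 + small_eps * D1) * (a * nrm v)).
    by rewrite ler_wpM2l// mulr_ge0// addr_ge0// divr_ge0 ?mulr_ge0// ltW.
  rewrite -(ler_pM2l c0); apply: le_trans h1 _; apply: le_trans (lerD (lexx _) h2) _.
  by rewrite le_eqVlt; apply/orP; left; apply/eqP; rewrite /D2; field; rewrite !lt0r_neq0.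
have xvE : x - Q x = (P' x - Q (P' x)) + e.
  by rewrite /e /v eigprojB subr_cross [RHS]addrC subrK.
have [IHx1 IHx2] := IH _ (HP'.1 x); have Px := proj_nrm HH HP' x.
have Da := mulr_ge0 D0 a0; have D1a := mulr_ge0 D10 a0; have D2a := mulr_ge0 D20 a0.
have nx := nrm_ge0 ip x.
have h1 := ler_wpM2l Da Px; have h2 := ler_wpM2l D1a vx; have h3 := ler_wpM2l D2a vx.
have h4 := mulr_ge0 D2a nx; have h5 := mulr_ge0 D1a nx.
split; rewrite xvE.
  by apply: le_trans (nrmD HH _ _) _; lra.
rewrite (opD HH TT); apply: le_trans (nrmD HH _ _) _.
by have := ler_wpM2l eps0 h1; have := ler_wpM2l eps0 h3; have := mulr_ge0 eps0 h5; lra.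
Qed.
End one_sided.
End levels.

Section multilevel.
Context {R : realType} {E : lmodType R[i]} (ip : E -> E -> R[i]).
Local Notation C := R[i].
Local Notation nrm := (sip_norm ip).
Hypothesis HH : hilbert ip.
Implicit Types (x y : E) (a : R).
Variables (T Ts : E -> E) (mu : C) (q : nat) (f g : 'I_q -> E) (Z : set C) (c : R).
Hypothesis gap : spectral_gap ip T Ts mu f g Z c.
Variables (K zmin zmax : R).
Hypotheses (TK : bounded_op ip T K) (mu0 : mu != 0) (zmin0 : 0 < zmin)
  (Zmin : forall z, Z z -> zmin <= normc z) (Zmax : forall z, Z z -> normc z <= zmax)
  (zmax0 : 0 <= zmax).
Let TT := gap_adj gap.
Local Notation Q := (eigproj ip f g).
Local Notation F := (eigproj_bound ip f g).
Let nmu : 0 < normc mu. Proof. by rewrite normc_gt0. Qed.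

(** The spectral projection is injective on a nearly invariant space of the
    right dimension, hence onto. *)
Lemma eigproj_onto (u : 'I_q -> E) :
  (forall b : 'I_q -> C, \sum_j b j *: u j = 0 -> forall j, b j = 0) ->
  (forall x, lspan u x -> nrm (x - Q x) <= 1 / 2 * nrm x) ->
  forall x, T x = mu *: x -> exists y, [/\ lspan u y, Q y = x & nrm y <= 2 * nrm x].
Proof.
move=> u_free uQ x Tx.
pose G : 'M[C]_q := \matrix_(j, i) ip (u j) (g i).
have GE (b : 'rV[C]_q) i : ip (\sum_j b ord0 j *: u j) (g i) = (b *m G) ord0 i.
  rewrite (ip_suml HH) mxE; apply: eq_bigr => j _.
  by rewrite (ipZl HH) [G j i]mxE.
have uG : G \in unitmx.
  rewrite -row_free_unit -kermx_eq0; apply/eqP/row_matrixP => i; rewrite row0.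
  set b := row i _; have bG : b *m G = 0 by rewrite -row_mul mulmx_ker row0.
  pose y := \sum_j b ord0 j *: u j.
  have y0 : y = 0.
    have Qy : Q y = 0.
      by rewrite /eigproj big1// => k _; rewrite GE bG mxE scale0r.
    have := uQ y; rewrite Qy subr0 => yle.
    apply/eqP; rewrite -(nrm_eq0 HH) eq_le nrm_ge0 andbT.
    have : nrm y <= 1 / 2 * nrm y by apply: yle; exists (b ord0).
    lra.
  by apply/rowP => j; rewrite [RHS]mxE; exact: (u_free (b ord0)).
pose b := (\row_i ip x (g i)) *m invmx G; pose y := \sum_j b ord0 j *: u j.
have uy : lspan u y by exists (b ord0).
have Qy : Q y = x.
  rewrite -[RHS](eigproj_id gap Tx); apply: eq_bigr => i _; congr (_ *: _).
  by rewrite GE /b mulmxKV// mxE.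
exists y; split => //.
by have := uQ y uy; rewrite Qy; have := nrm_triangle HH y x; lra.
Qed.

Lemma approx_ker_eps (V : set E) (P : E -> E) eps : lsub V -> is_proj ip V P -> 0 <= eps ->
  (forall x, nrm (T x - P (T x)) <= eps * nrm x) -> approx_ker ip T mu P (eps / normc mu).
Proof.
move=> VL HP eps0 TV; split; first by rewrite divr_ge0// ltW.
move=> x Tx; rewrite mulrAC ler_pdivlMr// mulrC -(nrmZ HH) scalerBr.
by rewrite -(projZ HH VL HP) -Tx.
Qed.

(** One correction step reproduces [P (T y)] for every [y] in the previous
    discrete invariant subspace.  Since [T] damps the error of [y] by [eps],
    the new space is as good as the full finite element space, up to a fraction
    of the previous error. *)
Lemma multilevel_approx (B : R) : 0 < B -> exists2 e0 : R, 0 < e0 &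
  forall (N : nat) (Fs Vs : nat -> set E) (PF PV : nat -> E -> E)
    (u : nat -> 'I_q -> E) (z : nat -> 'I_q -> C) (dl : nat -> R) eps,
  eps <= e0 ->
  (forall m, (1 <= m <= N)%N -> disc_level ip T Ts Z (Vs m) (PV m) eps (u m) (z m)) ->
  (forall m, (1 <= m <= N)%N -> forall b : 'I_q -> C,
     \sum_j b j *: u m j = 0 -> forall j, b j = 0) ->
  (forall m, (1 <= m <= N)%N -> [/\ lsub (Fs m), is_proj ip (Fs m) (PF m) &
     approx_ker ip T mu (PF m) (dl m)]) ->
  Vs 1 = Fs 1 ->
  (forall m, (1 <= m < N)%N -> dl m <= B * dl m.+1 /\
     forall j, Vs m.+1 (PF m.+1 (T (u m j)))) ->
  forall m, (1 <= m <= N)%N -> approx_ker ip T mu (PV m) (2 * dl m).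
Proof.
move=> B0; have [D D0 HD] := invariant_subspace_error HH gap TK mu0 Zmax zmax0 q.
have se := small_eps_gt0 gap.
pose e1 := normc mu / (2 * (D + 1)); pose e2 := normc mu / (4 * D * B + 1).
have D1 : 0 < 2 * (D + 1) by rewrite mulr_gt0// ltr_wpDl.
have D2 : 0 < 4 * D * B + 1 by rewrite ltr_wpDl// mulr_ge0// ?mulr_ge0// ltW.
exists (Num.min (small_eps ip f g c) (Num.min e1 e2)).
  by rewrite !lt_min se !divr_gt0.
move=> N Fs Vs PF PV u z dl eps; rewrite !le_min => /and3P[epss eps1 eps2] L u_free FF V1 step.
elim=> [//|m IH] /andP[_ mN].
have [FL HF [dl0 Fa]] := FF m.+1 mN.
have [m0|m0] := posnP m.
  rewrite m0 in FL HF dl0 Fa mN *; have [VL HV _ _ _ _ _ _] := L 1%N mN.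
  split; first by rewrite mulr_ge0.
  move=> x Tx; apply: le_trans (_ : nrm (x - PF 1%N x) <= _).
    by apply: (proj_best HH VL HV); rewrite V1; exact: HF.1.
  apply: le_trans (Fa x Tx) _; rewrite ler_wpM2r ?nrm_ge0//; lra.
have mN' : (1 <= m <= N)%N by rewrite m0 ltnW.
have [dlB hat] : dl m <= B * dl m.+1 /\ forall j, Vs m.+1 (PF m.+1 (T (u m j))).
  by apply: step; rewrite m0.
have Lm := L _ mN'; have [VLm HVm eps0 TVm _ _ _ _] := Lm.
have [VL HV _ _ _ _ _ _] := L m.+1 mN.
have PVm := IH mN'.
split; first by rewrite mulr_ge0.
move=> x Tx.
have [||y [uy Qy yx]] := eigproj_onto (u := u m) _ _ Tx.
- exact: u_free.
- move=> y uy; have [h _] := HD _ _ _ _ _ _ Lm epss (approx_ker_eps VLm HVm eps0 TVm) y uy.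
  apply: le_trans h _; rewrite ler_wpM2r ?nrm_ge0//.
  rewrite mulrA ler_pdivrMr//; move: eps1; rewrite /e1 ler_pdivlMr// => h1; lra.
have [_ h2] := HD _ _ _ _ _ _ Lm epss PVm y uy.
pose y' := mu^-1 *: PF m.+1 (T y).
have Vy' : Vs m.+1 y'.
  apply: lsubZ => //; have [b ->] := uy.
  rewrite (op_sum HH TT) (big_morph _ (projD HH FL HF) (proj_id HH FL HF FL.1)).
  apply: (lsub_sum _ VL) => j _; rewrite (opZ HH TT) (projZ HH FL HF).
  by apply: lsubZ => //; exact: hat.
apply: le_trans (proj_best HH VL HV x Vy') _.
have -> : x - y' = (x - PF m.+1 x) - mu^-1 *: PF m.+1 (T (y - Q y)).
  rewrite Qy (opB HH TT) (projB HH FL HF) scalerBr Tx (projZ HH FL HF).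
  by rewrite scalerA mulVf// scale1r opprB addrA subrK.
apply: le_trans (nrmB HH _ _) _.
have h3 : nrm (mu^-1 *: PF m.+1 (T (y - Q y))) <= dl m.+1 * nrm x.
  rewrite (nrmZ HH) Normc.normcV ler_pdivrMl//.
  apply: le_trans (proj_nrm HH HF _) _; apply: le_trans h2 _.
  have nx := nrm_ge0 ip x; have dlm : 0 <= dl m by have := PVm.1; lra.
  have h : D * eps * (2 * dl m) * nrm y <= D * eps * (2 * (B * dl m.+1)) * (2 * nrm x).
    by apply: ler_pM => //; rewrite ?nrm_ge0// ?mulr_ge0// ler_wpM2l// ?mulr_ge0// ler_pM2l.
  apply: le_trans h _.
  have : eps * (4 * D * B + 1) <= normc mu by rewrite -ler_pdivlMr.
  move=> /(ler_wpM2r (mulr_ge0 dl0 nx)); have := mulr_ge0 eps0 (mulr_ge0 dl0 nx); lra.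
by have := Fa x Tx; lra.
Qed.

Definition seminorm_on (N : E -> R) (CN : R) :=
  [/\ 0 <= CN, forall x y, N (x + y) <= N x + N y,
      forall (b : C) x, N (b *: x) = normc b * N x & forall x, N x <= CN * nrm x].

(** Energy, eigenvalue and weak-norm estimates for one discrete eigenfunction.
    For the weak norms write [z e = T e - w + Q w], where [e] is the error
    and [w] the Galerkin defect: the first and third terms are damped by [T],
    while duality applies to [w]. *)
Lemma eigenfunction_error : exists D e0 : R, [/\ 0 <= D, 0 < e0 &
  forall V P eps a (u : 'I_q -> E) z, disc_level ip T Ts Z V P eps u z -> eps <= e0 ->
    approx_ker ip T mu P a -> forall j, nrm (u j) = 1 ->
    [/\ nrm (u j - Q (u j)) <= D * a,
        Q (u j) != 0,
        forall as_, 0 <= as_ -> (forall y, Ts y = conjc mu *: y -> nrm (y - P y) <= as_ * nrm y) ->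
          normc (mu - z j) <= D * a * as_ &
        forall N CN, seminorm_on N CN ->
          (forall w, (forall v, V v -> ip w v = 0) -> N w <= CN * eps * nrm w) ->
          N (u j - Q (u j)) <= CN * (D * eps * a)]].
Proof.
have [D D0 HD] := invariant_subspace_error HH gap TK mu0 Zmax zmax0 q.
have se := small_eps_gt0 gap; have F0 := F_ge0 ip f g.
pose e1 := normc mu / (2 * (D + 1)).
have D1 : 0 < 2 * (D + 1) by rewrite mulr_gt0// ltr_wpDl.
have e10 : 0 < e1 by rewrite divr_gt0.
pose W := normc mu * F + e1 * D.
have W0 : 0 <= W by rewrite addr_ge0// mulr_ge0// ltW.
pose Dw := (D + W + F / normc mu * W) / zmin.
have Dw0 : 0 <= Dw.
  apply: divr_ge0; last exact: ltW.
  by apply: addr_ge0; [exact: addr_ge0|apply: mulr_ge0 => //; apply: divr_ge0 => //; exact: ltW].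
have FW0 : 0 <= 2 * F * W by rewrite !mulr_ge0.
exists (D + 2 * F * W + Dw), (Num.min (small_eps ip f g c) e1); split.
- by rewrite !addr_ge0.
- by rewrite lt_min se.
move=> V P eps a u z L; rewrite le_min => /andP[epss eps1] Pa j uj1.
have [VL HP eps0 TV TsV uV uZ uE] := L; have a0 := Pa.1.
have uj := lspan_gen u j.
have [hu hTu] := HD _ _ _ _ _ _ L epss Pa _ uj; rewrite uj1 !mulr1 in hu hTu.
have half : nrm (u j - Q (u j)) <= 1 / 2.
  have [h _] := HD _ _ _ _ _ _ L epss (approx_ker_eps VL HP eps0 TV) _ uj.
  apply: le_trans h _; rewrite uj1 mulr1 mulrA ler_pdivrMr//.
  by move: eps1; rewrite /e1 ler_pdivlMr// => h1; lra.
have Qu : 1 / 2 <= nrm (Q (u j)) by have := nrm_triangle HH (u j) (Q (u j)); lra.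
pose w := T (u j) - P (T (u j)).
have wa : nrm w <= W * a.
  apply: le_trans (defect_nrm HH gap VL HP TV Pa _) _; rewrite uj1 mulr1 /W mulrDl lerD//.
  by rewrite -mulrA; apply: ler_pM => //; exact: nrm_ge0.
have wV v : V v -> ip w v = 0 by exact: HP.2.
split.
- by apply: le_trans hu _; rewrite ler_wpM2r// -addrA lerDl addr_ge0.
- by rewrite -(nrm_gt0 HH); apply: lt_le_trans Qu; lra.
- move=> b b0 Pb.
  have h i : normc (mu - z j) * normc (ip (u j) (g i)) <= nrm w * (b * nrm (g i)).
    rewrite -Normc.normcM.
    have -> : (mu - z j) * ip (u j) (g i) = ip w (g i - P (g i)).
      rewrite (ipBr HH) [ip w (P _)]wV ?subr0; last exact: HP.1.
      rewrite (ipBl HH) TT (gap_g gap) (ipZr HH) conjcK uE (ipZl HH).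
      by rewrite mulrBl.
    apply: le_trans (nrm_CS HH _ _) _; rewrite ler_wpM2l ?nrm_ge0//.
    exact/Pb/(gap_g gap).
  have h1 : normc (mu - z j) * nrm (Q (u j)) <= nrm w * b * F.
    apply: le_trans (ler_wpM2l (normc_ge0 _) (eigproj_nrm_sum HH _ _ _)) _.
    rewrite !mulr_sumr; apply: ler_sum => i _.
    have := ler_wpM2r (nrm_ge0 ip (f i)) (h i); lra.
  have h2 := ler_wpM2l (normc_ge0 (mu - z j)) Qu.
  have h3 := ler_wpM2r (mulr_ge0 b0 F0) wa.
  have h4 := mulr_ge0 (mulr_ge0 D0 a0) b0.
  have h5 := mulr_ge0 (mulr_ge0 Dw0 a0) b0.
  lra.
move=> N CN [CN0 ND NZ NC] Nw; set e := u j - Q (u j).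
have zj : 0 < normc (z j) by apply: lt_le_trans (Zmin (uZ j)).
have NB x y : N (x - y) <= N x + N y.
  by rewrite -scaleN1r; apply: le_trans (ND _ _) _; rewrite NZ normcN Normc.normc1 mul1r.
have eE : z j *: e = T e - w + Q w.
  rewrite /w uE (eigprojB HH) (eigprojZ HH) (eigproj_T HH gap) (opB HH TT (u j)).
  by rewrite (T_eigproj HH gap) subr_cross subrr sub0r opprB addrA subrK scalerBr.
have h1 : N (z j *: e) <= CN * (D * eps * a) + CN * eps * (W * a) +
    CN * (eps * F / normc mu * (W * a)).
  rewrite eE; apply: le_trans (ND _ _) _; apply: lerD.
    apply: le_trans (NB _ _) _; apply: lerD.
      by apply: le_trans (NC _) _; rewrite ler_wpM2l.
    by apply: le_trans (Nw _ wV) _; rewrite ler_wpM2l// mulr_ge0.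
  apply: le_trans (NC _) _; rewrite ler_wpM2l//.
  apply: le_trans (Q_orth_nrm HH gap mu0 VL HP TsV wV) _.
  by rewrite ler_wpM2l// divr_ge0// ?mulr_ge0// ltW.
have Ne : 0 <= N e.
  by have := ND e (-1 *: e); rewrite scaleN1r subrr -(scale0r e) NZ Normc.normc0 mul0r
    -scaleN1r NZ normcN Normc.normc1 mul1r; lra.
have h2 : zmin * N e <= N (z j *: e) by rewrite NZ ler_wpM2r// Zmin.
have h3 : N e <= CN * (Dw * eps * a).
  rewrite -(ler_pM2l zmin0); apply: le_trans h2 _; apply: le_trans h1 _.
  by rewrite le_eqVlt; apply/orP; left; apply/eqP; rewrite /Dw; field; rewrite !lt0r_neq0.
apply: le_trans h3 _; rewrite ler_wpM2l// ler_wpM2r// ler_wpM2r// lerDr addr_ge0//.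
Qed.
End multilevel.

(** * Lebesgue measure on row vectors *)

Section rV_measure.
Context {R : realType}.
Local Notation leb d := (@lebesgue_rV R d).
Implicit Types d : nat.

Lemma rV_openP d (A : set 'rV[R]_d) : open A <->
  forall x, A x -> exists2 e : R, 0 < e &
    forall y : 'rV[R]_d, (forall i, `|x ord0 i - y ord0 i| < e) -> A y.
Proof.
split=> [oA x Ax|H].
  have : nbhs x A by rewrite nbhsE; exists A.
  move=> /nbhs_ballP[e /= e0 sA]; exists e => // y xy; apply: sA.
  by split=> // i j; rewrite ord1; exact: xy.
rewrite openE => x Ax; have [e e0 sA] := H x Ax.
apply/nbhs_ballP; exists e => // y [_ xy]; apply: sA => i; exact: (xy ord0 i).
Qed.

Definition rbox d (c : 'rV[R]_d) (r : R) : set 'rV[R]_d :=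
  [set y | forall i, `|c ord0 i - y ord0 i| < r].

Definition cbox d (c : 'rV[R]_d) (r : R) : set 'rV[R]_d :=
  [set y | forall i, `|c ord0 i - y ord0 i| <= r].

Lemma measurable_coord d (i : 'I_d) : measurable_fun [set: 'rV[R]_d] (fun x => x ord0 i).
Proof. exact: (measurable_rV_coord i). Qed.

Lemma measurable_coord_set d (i : 'I_d) (Y : set R) : measurable Y ->
  measurable [set y : 'rV[R]_d | Y (y ord0 i)].
Proof.
by move=> mY; rewrite -[X in measurable X]setTI; exact: (measurable_coord i _ mY).
Qed.

Lemma eq_measurable (disp : measure_display) (T : measurableType disp) (A B : set T) :
  measurable A -> A = B -> measurable B.
Proof. by move=> mA <-. Qed.

Lemma measurable_forall d (P : 'I_d -> set 'rV[R]_d) :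
  (forall i, measurable (P i)) -> measurable [set y | forall i, P i y].
Proof.
move=> mP; have -> : [set y | forall i, P i y] = \big[setI/setT]_(i < d) P i.
  rewrite -bigcap_seq; apply/seteqP; split=> y /= Py i //.
  by apply: Py; rewrite /= mem_index_enum.
by apply: bigsetI_measurable => i _; exact: mP.
Qed.

Lemma measurable_rbox d (c : 'rV[R]_d) r : measurable (rbox c r).
Proof.
apply: measurable_forall => i.
apply: eq_measurable (measurable_coord_set i (measurable_itv `]c ord0 i - r, c ord0 i + r[)) _.
by apply/seteqP; split=> y; rewrite /= in_itv/= ltr_norml => /andP[? ?]; apply/andP; split; lra.
Qed.

Lemma rat_between (x y : R) : x < y -> exists q : rat, x < ratr q < y.
Proof. by move=> /rat_in_itvoo[q]; rewrite in_itv/=; exists q. Qed.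

(** Every neighbourhood of a point contains a rational box around that point,
    together with the closed box. *)
Lemma rational_box d (A : set 'rV[R]_d) x : open A -> A x ->
  exists (c : 'rV[rat]_d) (r : rat),
    rbox (map_mx ratr c) (ratr r) x /\ cbox (map_mx ratr c) (ratr r) `<=` A.
Proof.
move=> /rV_openP oA Ax; have [e e0 sA] := oA x Ax.
have [r /andP[r0 re]] := @rat_between 0 (e / 2) (divr_gt0 e0 (ltr0n R 2)).
have /choice[c Hc] (i : 'I_d) : exists q : rat, `|ratr q - x ord0 i| < ratr r :> R.
  have [q /andP[q1 q2]] := @rat_between (x ord0 i - ratr r) (x ord0 i + ratr r) ltac:(lra).
  by exists q; rewrite ltr_norml; apply/andP; split; lra.
exists (\row_i c i), r; split=> [i|y cy]; first by rewrite !mxE.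
apply: sA => i; have := cy i; have := Hc i; rewrite !mxE ltr_norml ler_norml ltr_norml.
by move=> /andP[? ?] /andP[? ?]; apply/andP; split; lra.
Qed.

Lemma open_measurable_rV d (A : set 'rV[R]_d) : open A -> measurable A.
Proof.
move=> oA.
pose B (p : 'rV[rat]_d * rat) : set 'rV[R]_d :=
  if `[< cbox (map_mx ratr p.1) (ratr p.2) `<=` A >]
  then rbox (map_mx ratr p.1) (ratr p.2) else set0.
have -> : A = \bigcup_p B p.
  apply/seteqP; split=> x.
    move=> /(rational_box oA)[c [r [cx cA]]]; exists (c, r) => //.
    by rewrite /B/=; case: asboolP.
  move=> [p _]; rewrite /B; case: asboolP => // pA px; apply: pA => i.
  exact/ltW/px.
apply: countable_bigcupT_measurable; first exact: countableP.
by move=> p; rewrite /B; case: ifP => // _; exact: measurable_rbox.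
Qed.

Lemma continuous_measurable_rV d (f : 'rV[R]_d -> R) :
  continuous f -> measurable_fun [set: 'rV[R]_d] f.
Proof.
move=> /continuousP cf; apply: (measurability _ (RGenOInfty.measurableE R)) => //.
move=> _ [_ [a ->] <-]; rewrite setTI; apply: open_measurable_rV.
by apply: cf; exact: interval_open.
Qed.

Lemma lebesgue_rV_box_fin d (L : R) : (leb d [set x | forall i, (`|x ord0 i| <= L)%R] < +oo)%E.
Proof.
elim: d => [|d IH].
  by apply: le_lt_trans (_ : (1 < +oo)%E); rewrite ?ltry// /= diracE lee_fin; case: (_ \in _).
rewrite /= /lebesgueS /pushforward.
have -> : rV_cons (d := d) @^-1` [set x | forall i, `|x ord0 i| <= L] =
    `[- L, L]%classic `*` [set x : 'rV[R]_d | forall i, `|x ord0 i| <= L].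
  apply/seteqP; split=> -[t y] /=.
    move=> H; split; last by move=> i; have := H (lift ord0 i); rewrite mxE liftK.
    by have := H ord0; rewrite mxE unlift_none in_itv/= ler_norml.
  move=> [tL yL] i; rewrite mxE; case: unliftP => [j _|_]; first exact: yL.
  by move: tL; rewrite in_itv/= ler_norml.
rewrite product_measure1E//; last first.
  apply: measurable_forall => i.
  apply: eq_measurable (measurable_coord_set i (measurable_itv `[- L, L])) _.
  by apply/seteqP; split=> y; rewrite /= in_itv/= ler_norml.
have fin : @lebesgue_measure R `[- L, L]%classic \is a fin_num.
  by rewrite lebesgue_measure_itv/=; case: ifP.
by rewrite lte_mul_pinfty.
Qed.

Lemma lebesgue_translation (a : R) (A : set R) : measurable A ->
  @lebesgue_measure R ((fun x => x + a) @^-1` A) = @lebesgue_measure R A.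
Proof.
move=> mA; pose f (x : measurableTypeR R) : measurableTypeR R := x + a.
have mf : measurable_fun [set: measurableTypeR R] f.
  by apply: measurable_funD => //; exact: measurable_cst.
rewrite -[LHS]/(pushforward (@lebesgue_measure R) f A); apply/esym.
apply: (@lebesgue_measure_unique R (pushforward (@lebesgue_measure R) f)) => //.
move=> _ [[x y] _ <-]; rewrite /pushforward.
have fE : f @^-1` `]x, y]%classic = `]x - a, y - a]%classic.
  by apply/seteqP; split=> t; rewrite /f /= !in_itv/= => /andP[? ?]; apply/andP; split; lra.
rewrite [RHS](congr1 (@lebesgue_measure R) fE) !lebesgue_measure_itv/= !lte_fin ltrD2r; case: ifP => // _.
by rewrite -!EFinB; congr EFin; lra.
Qed.

(** The measure is an iterated product, so this reduces to the translation
    invariance of Lebesgue measure on the line. *)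
Lemma lebesgue_rV_translation d (v : 'rV[R]_d) (A : set 'rV[R]_d) : measurable A ->
  leb d ((fun x => x + v) @^-1` A) = leb d A.
Proof.
elim: d v A => [|d IH] v A mA.
  by congr (leb 0%N _); apply/seteqP; split=> x; rewrite /= !thinmx0.
pose v' : 'rV[R]_d := \row_j v ord0 (lift ord0 j).
pose s (p : measurableTypeR R * 'rV[R]_d) : measurableTypeR R * 'rV[R]_d :=
  (p.1 + v ord0 ord0, p.2 + v').
have ms : measurable_fun [set: measurableTypeR R * 'rV[R]_d] s.
  apply/measurable_fun_pairP; split.
    by apply: measurable_funD; [exact: measurable_fst|exact: measurable_cst].
  apply: measurable_fun_rV => i; rewrite /s /=.
  under eq_fun do rewrite mxE.
  apply: measurable_funD; last exact: measurable_cst.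
  exact: (measurableT_comp (measurable_coord i) measurable_snd).
rewrite /= /lebesgueS /pushforward.
have -> : rV_cons (d := d) @^-1` ((fun x => x + v) @^-1` A) = s @^-1` (rV_cons (d := d) @^-1` A).
  apply/seteqP; split=> -[t y] /=; rewrite /s /=.
    move=> H; congr (A _): H; apply/rowP => i; rewrite !mxE; by case: unliftP => [j ->|->]; rewrite ?mxE.
  move=> H; congr (A _): H; apply/rowP => i; rewrite !mxE; by case: unliftP => [j ->|->]; rewrite ?mxE.
apply/esym.
apply: (@product_measure_unique _ _ _ _ _ (@lebesgue_measure R) (leb d)
  (pushforward (@lebesgue_measure R \x leb d)%E s)) => //.
- move=> A1 B1 mA1 mB1.
  rewrite -[LHS]/((@lebesgue_measure R \x leb d)%E (s @^-1` (A1 `*` B1))).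
  have -> : s @^-1` (A1 `*` B1) =
    ((fun x => x + v ord0 ord0) @^-1` A1) `*` ((fun x => x + v') @^-1` B1) by [].
  have m1 : measurable ((fun x : measurableTypeR R => x + v ord0 ord0) @^-1` A1).
    rewrite -[X in measurable X]setTI.
    by apply: (measurable_funD (@measurable_id _ _ _) (@measurable_cst _ _ _ _ _ _)).
  have m2 : measurable ((fun x => x + v') @^-1` B1).
    rewrite -[X in measurable X]setTI; suff : measurable_fun [set: 'rV[R]_d] (fun x => x + v') by exact.
    apply: measurable_fun_rV => i; under eq_fun do rewrite mxE.
    by apply: measurable_funD; [exact: measurable_coord|exact: measurable_cst].
  by rewrite product_measure1E//; congr (_ * _)%E; [exact: lebesgue_translation|exact: IH].
rewrite -[X in measurable X]setTI; exact: measurable_rV_cons.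
Qed.
End rV_measure.

(** * Smooth functions *)

Section lines.
Context {R : realType} {d : nat}.
Local Notation pt := 'rV[R]_d.
Implicit Types (x v : pt) (f g : pt -> R) (i j : 'I_d).

Definition ev i : pt := delta_mx ord0 i.

Lemma line_quotient f x v (t0 : R) :
  (fun h : R => h^-1 *: (((fun t : R => f (t *: v + x)) \o shift t0) (h *: 1) - f (t0 *: v + x)))
  = (fun h => h^-1 *: ((f \o shift (t0 *: v + x)) (h *: v) - f (t0 *: v + x))).
Proof.
apply/funext => h /=; congr (_ *: (f _ - _)).
by rewrite [h *: 1]mulr1 scalerDl addrA.
Qed.

Lemma is_derive_line f x v (t0 df : R) : is_derive (t0 *: v + x) v f df ->
  is_derive t0 1 (fun t : R => f (t *: v + x)) df.
Proof.
by case=> h1 h2; split; [rewrite /derivable|rewrite /derive]; rewrite line_quotient.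
Qed.

Lemma is_derive_of_line f x v (df : R) : is_derive (0 : R) 1 (fun t : R => f (t *: v + x)) df ->
  is_derive x v f df.
Proof.
have E := line_quotient f x v 0.
case=> h1 h2; split; [move: h1; rewrite /derivable|move: h2; rewrite /derive];
  by rewrite E scale0r add0r.
Qed.

Lemma is_derive_coord (h : R -> R) (a b dh : R) i x v :
  is_derive (a * x ord0 i + b) 1 h dh ->
  is_derive x v (fun y : pt => h (a * y ord0 i + b)) (a * v ord0 i * dh).
Proof.
move=> Dh; apply: is_derive_of_line.
under eq_fun do rewrite !mxE.
have Daff : is_derive (0 : R) 1 (fun t : R => a * (t * v ord0 i + x ord0 i) + b) (a * v ord0 i).
  by apply: is_derive_eq; rewrite ?scaler0 ?addr0 ?add0r /GRing.scale/= ?mulr1.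
rewrite mulrC; apply: (@is_derive1_comp _ h (fun t : R => a * (t * v ord0 i + x ord0 i) + b)).
by rewrite mul0r add0r.
Qed.

Lemma ev_coord i j : (ev i) ord0 j = (j == i)%:R.
Proof. by rewrite mxE eqxx. Qed.

(** ** Bump functions *)

(** The factor [t^-1 ^+ k] makes the family stable under derivation: the
    derivative of a bump is a combination of bumps. *)
Definition bump (k : nat) (t : R) : R := if 0 < t then t^-1 ^+ k * expR (- t^-1) else 0.

Lemma bump_ge0 k t : 0 <= bump k t.
Proof.
by rewrite /bump; case: ltP => // t0; rewrite mulr_ge0 ?expR_ge0// exprn_ge0// invr_ge0 ltW.
Qed.
Lemma bump0_le1 t : bump 0 t <= 1.
Proof.
rewrite /bump; case: ltP => // t0; rewrite expr0 mul1r -expR0 ler_expR.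
by rewrite oppr_le0 invr_ge0 ltW.
Qed.
Lemma bump_le0 k t : t <= 0 -> bump k t = 0.
Proof. by rewrite /bump ltNge => ->. Qed.

Lemma bump_small k t : `|t^-1 * bump k t| <= (k.+2)`!%:R * `|t|.
Proof.
have [t0|t0] := leP t 0; first by rewrite bump_le0// mulr0 normr0 mulr_ge0.
rewrite ger0_norm ?mulr_ge0 ?invr_ge0 ?(ltW t0) ?bump_ge0// ger0_norm ?(ltW t0)//.
rewrite /bump t0 mulrA -exprS expRN ler_pdivrMr ?expR_gt0//.
have := expR_ge1Dxn k.+1 (ltW (_ : 0 < t^-1)); rewrite invr_gt0 => /(_ t0) h.
have F0 : 0 < (k.+2)`!%:R :> R by rewrite ltr0n fact_gt0.
have h2 : t^-1 ^+ k.+2 / (k.+2)`!%:R <= expR t^-1 by apply: le_trans h; rewrite lerDr.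
have Ft : 0 < (k.+2)`!%:R * t by rewrite mulr_gt0.
apply: le_trans (ler_wpM2l (ltW Ft) h2).
rewrite le_eqVlt; apply/orP; left; apply/eqP.
by rewrite [t^-1 ^+ k.+2]exprSr; field; rewrite !lt0r_neq0.
Qed.

Lemma is_derive_bump k (t : R) : is_derive t (1 : R) (bump k) (bump k.+2 t - k%:R * bump k.+1 t).
Proof.
have [t0|t0|->] := ltgtP t 0.
- rewrite !(@bump_le0 _ t) ?(ltW t0)// mulr0 subr0.
  apply: (@near_eq_is_derive _ _ _ (cst 0)).
  have : nbhs t [set s | s < 0] by apply: open_nbhs_nbhs; split => //; exact: open_lt.
  by apply: filterS => s /= s0; rewrite bump_le0// ltW.
- apply: (@near_eq_is_derive R R R (fun s : R => s^-1 ^+ k * expR (- s^-1) : R)).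
  + have : nbhs t [set s | 0 < s] by apply: open_nbhs_nbhs; split => //; exact: open_gt.
    by apply: filterS => s /= s0; rewrite /bump s0.
  have tn0 : t != 0 by rewrite lt0r_neq0.
  have DV : is_derive t 1 (fun s : R => s^-1) (- t ^- 2).
    have := @is_deriveV _ id t 1 1 tn0 (is_derive_id _ _).
    by rewrite /= [_ *: 1]mulr1.
  have DE : is_derive t 1 (fun s : R => expR (- s^-1)) (t ^- 2 * expR (- t^-1)).
    rewrite mulrC; apply: (@is_derive1_comp _ expR (fun s : R => - s^-1)).
    by apply: is_derive_eq; rewrite opprK.
  have DX : is_derive t 1 (fun s : R => s^-1 ^+ k) (k%:R * t^-1 ^+ k.-1 * (- t ^- 2)).
    by have := is_deriveX k DV; rewrite exprfctE.
  apply: (is_derive_eq (is_deriveM DX DE)); rewrite /bump t0 /GRing.scale /=.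
  rewrite -exprVn; case: k {DX} => [|k]; first by rewrite !expr0 !mul0r !mulr0 /=; ring.
  by rewrite succnK !exprS; ring.
rewrite !(@bump_le0 _ 0)// mulr0 subr0.
have lim0 : (fun h : R => h^-1 *: ((bump k \o shift 0) (h *: 1) - bump k 0)) @ 0^' --> (0 : R).
  apply/cvgrPdist_le => e e0; near=> h.
  rewrite /= addr0 [h *: 1]mulr1 (@bump_le0 _ 0)// subr0 sub0r normrN.
  apply: le_trans (bump_small k h) _.
  have F0 : 0 < (k.+2)`!%:R :> R by rewrite ltr0n fact_gt0.
  rewrite mulrC -ler_pdivlMr//.
  near: h; apply: nbhs_dnbhs.
  apply/nbhs_ballP; exists (e / (k.+2)`!%:R) => /=; first exact: divr_gt0.
  by move=> y /=; rewrite /ball/= sub0r normrN => /ltW.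
by split; [apply/cvg_ex; exists 0|exact/cvg_lim].
Unshelve. all: by end_near. Qed.
End lines.

Section smooth_algebra.
Context {R : realType} {d : nat}.
Local Notation pt := 'rV[R]_d.
Implicit Types (x v : pt) (f g : pt -> R) (i j : 'I_d).
Local Notation e := (@ev R d).
Local Notation D i f := (fun x => 'D_(e i) f x).

(** Closure of the smooth functions under the constructions used below.  Each
    constructor is stable under partial derivatives within the inductive, which
    is what makes its members smooth. *)
Inductive smooth_expr : (pt -> R) -> Prop :=
| SmoothBase f of smooth f : smooth_expr f
| SmoothCst (a : R) : smooth_expr (fun=> a)
| SmoothCoord i : smooth_expr (fun x => x ord0 i)
| SmoothBump k (a b : R) i : smooth_expr (fun x => bump k (a * x ord0 i + b))
| SmoothAdd f g of smooth_expr f & smooth_expr g : smooth_expr (fun x => f x + g x)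
| SmoothMul f g of smooth_expr f & smooth_expr g : smooth_expr (fun x => f x * g x)
| SmoothInv f of smooth_expr f & (forall x, f x != 0) : smooth_expr (fun x => (f x)^-1).

Lemma smooth_partial f i : smooth f -> smooth (D i f).
Proof.
by move=> sf s; have := sf (rcons s i); rewrite /partial foldr_rcons.
Qed.

Lemma smooth_derive f i x : smooth f -> is_derive x (e i) f ('D_(e i) f x).
Proof. by move=> /(_ [::])[_ df]; apply: derivableP; exact: df. Qed.
Lemma smooth_continuous f : smooth f -> continuous f.
Proof. by move=> /(_ [::])[]. Qed.

Lemma bump_continuous k : continuous (@bump R k).
Proof.
move=> t; apply/differentiable_continuous/derivable1_diffP.
by have [] := is_derive_bump k t.
Qed.

Lemma smooth_expr_continuous f : smooth_expr f -> continuous f.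
Proof.
elim=> {f}[f /smooth_continuous//|a|i|k a b i|f g _ cf _ cg|f g _ cf _ cg|f _ cf f0] x.
- exact: cst_continuous.
- exact: coord_continuous.
- apply: (@continuous_comp _ _ _ (fun x : pt => a * x ord0 i + b) (bump k)); last exact: bump_continuous.
  apply: (@continuousD _ _ _ (fun x : pt => a * x ord0 i) (fun=> b)); last exact: cst_continuous.
  apply: (@continuousM _ _ (fun=> a) (fun x : pt => x ord0 i)); first exact: cst_continuous.
  exact: coord_continuous.
- exact: cvgD (cf x) (cg x).
- exact: cvgM (cf x) (cg x).
- exact: cvgV (f0 x) (cf x).
Qed.

Lemma smooth_expr_derive f i : smooth_expr f ->
  exists2 g, smooth_expr g & forall x, is_derive x (e i) f (g x).
Proof.
elim=> {f}[f sf|a|j|k a b j|f g sf [f' sf' Df] sg [g' sg' Dg]|f g sf [f' sf' Df] sg [g' sg' Dg]|f sf [f' sf' Df] f0].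
- by exists (D i f); [exact/SmoothBase/smooth_partial|move=> x; exact: smooth_derive].
- by exists (fun=> 0); [exact: SmoothCst|move=> x; exact: is_derive_cst].
- exists (fun=> (j == i)%:R); first exact: SmoothCst.
  move=> x; have := @is_derive_coord R d id 1 0 1 j x (e i) (is_derive_id _ _).
  by rewrite mul1r mulr1 ev_coord; under eq_fun do rewrite mul1r addr0.
- exists (fun x => (a * (j == i)%:R) *
      (bump k.+2 (a * x ord0 j + b) + (- k%:R) * bump k.+1 (a * x ord0 j + b))).
    apply: SmoothMul; first exact: SmoothCst.
    apply: SmoothAdd; first exact: SmoothBump.
    by apply: SmoothMul; [exact: SmoothCst|exact: SmoothBump].
  move=> x; rewrite -ev_coord mulNr; apply: is_derive_coord; exact: is_derive_bump.
- by exists (fun x => f' x + g' x); [exact: SmoothAdd|move=> x; exact: is_deriveD].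
- exists (fun x => f x * g' x + g x * f' x).
    by apply: SmoothAdd; exact: SmoothMul.
  by move=> x; exact: is_deriveM.
- exists (fun x => - 1 * ((f x)^-1 * ((f x)^-1 * f' x))).
    by repeat apply: SmoothMul => //; [exact: SmoothCst|exact: SmoothInv|exact: SmoothInv].
  move=> x; have [df dv] := Df x; split; first exact: derivableV.
  by rewrite deriveV// dv /GRing.scale/= expr2 invfM mulN1r mulNr mulrA.
Qed.

Lemma smooth_expr_smooth f : smooth_expr f -> smooth f.
Proof.
move=> sf s; have : smooth_expr (partial s f).
  elim: s => [//|i s IH]; have [g sg Dg] := smooth_expr_derive i IH.
  rewrite (_ : partial (i :: s) f = g)//; apply/funext => x /=.
  by have [] := Dg x.
move=> sp; split; first exact: smooth_expr_continuous.
by move=> i x; have [g _ Dg] := smooth_expr_derive i sp; have [] := Dg x.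
Qed.

Lemma smoothM f g : smooth f -> smooth g -> smooth (fun x => f x * g x).
Proof. by move=> sf sg; apply/smooth_expr_smooth/SmoothMul; exact: SmoothBase. Qed.
Lemma smoothD f g : smooth f -> smooth g -> smooth (fun x => f x + g x).
Proof. by move=> sf sg; apply/smooth_expr_smooth/SmoothAdd; exact: SmoothBase. Qed.
Lemma smoothZ a f : smooth f -> smooth (fun x => a * f x).
Proof.
by move=> sf; apply/smooth_expr_smooth/SmoothMul; [exact: SmoothCst|exact: SmoothBase].
Qed.
Lemma smoothV f : smooth f -> (forall x, f x != 0) -> smooth (fun x => (f x)^-1).
Proof. by move=> sf f0; apply/smooth_expr_smooth/SmoothInv => //; exact: SmoothBase. Qed.

Lemma partialM f g i x : smooth f -> smooth g ->
  'D_(e i) (fun x => f x * g x) x = f x * 'D_(e i) g x + g x * 'D_(e i) f x.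
Proof.
move=> sf sg.
by have [_ ->] := is_deriveM (smooth_derive i x sf) (smooth_derive i x sg).
Qed.
Lemma partialD f g i x : smooth f -> smooth g ->
  'D_(e i) (fun x => f x + g x) x = 'D_(e i) f x + 'D_(e i) g x.
Proof.
move=> sf sg.
by have [_ ->] := is_deriveD (smooth_derive i x sf) (smooth_derive i x sg).
Qed.
Lemma partial_cst (a : R) i x : 'D_(e i) (fun=> a) x = 0.
Proof. exact: derive_cst. Qed.
Lemma partialZ a f i x : smooth f ->
  'D_(e i) (fun x => a * f x) x = a * 'D_(e i) f x.
Proof.
move=> sf; rewrite partialM//; last by apply/smooth_expr_smooth/SmoothCst.
by rewrite partial_cst mulr0 addr0.
Qed.
Lemma partialV f i x : smooth f -> (forall x, f x != 0) ->
  'D_(e i) (fun x => (f x)^-1) x = - ((f x)^-1 ^+ 2 * 'D_(e i) f x).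
Proof.
move=> sf f0; rewrite deriveV//; last by have [] := smooth_derive i x sf.
by rewrite /GRing.scale/= mulNr exprVn.
Qed.

(** ** Increments along the coordinate axes *)

Lemma mvt f i x (h : R) : smooth f ->
  exists2 t : R, `|t| <= `|h| & f (h *: e i + x) - f x = h * 'D_(e i) f (t *: e i + x).
Proof.
move=> sf; pose g (t : R) := f (t *: e i + x).
have Dg (t : R) : is_derive t (1 : R) g ('D_(e i) f (t *: e i + x)).
  by apply: is_derive_line; exact: smooth_derive.
have cg a b : {within `[a, b], continuous g}.
  by apply: derivable_within_continuous => t _; have [] := Dg t.
have g0 : g 0 = f x by rewrite /g scale0r add0r.
have [h0|h0] := leP 0 h.
  have [t] := MVT_segment h0 (fun t _ => Dg t) (cg _ _).
  rewrite in_itv/= g0 subr0 => /andP[t0 th] E; exists t; first by rewrite !ger0_norm.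
  by rewrite E mulrC.
have [t] := MVT_segment (ltW h0) (fun t _ => Dg t) (cg _ _).
rewrite in_itv/= g0 sub0r => /andP[ht t0] E; exists t.
  by rewrite !ler0_norm ?lerN2// ltW.
by rewrite -[LHS]opprB E mulrN opprK mulrC.
Qed.

Lemma lipschitz f i (L : R) x h : smooth f -> (forall x, `|'D_(e i) f x| <= L) ->
  `|f (h *: e i + x) - f x| <= L * `|h|.
Proof.
move=> sf fL; have [t _ ->] := mvt i x h sf.
by rewrite normrM mulrC ler_wpM2r.
Qed.

Lemma taylor f i (L : R) x h : smooth f -> (forall x, `|'D_(e i) (D i f) x| <= L) ->
  `|f (h *: e i + x) - f x - h * 'D_(e i) f x| <= L * h ^+ 2.
Proof.
move=> sf fL; have [t th ->] := mvt i x h sf.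
rewrite -mulrBr normrM -real_normK ?num_real// expr2 mulrCA ler_wpM2l//.
have L0 : 0 <= L := le_trans (normr_ge0 _) (fL x).
apply: le_trans (lipschitz (i := i) x t (smooth_partial i sf) fL) _.
by rewrite ler_wpM2l.
Qed.

Lemma shift_quotient f v x w :
  (fun h : R => h^-1 *: (((fun y => f (v + y)) \o shift x) (h *: w) - f (v + x)))
  = (fun h => h^-1 *: ((f \o shift (v + x)) (h *: w) - f (v + x))).
Proof. by apply/funext => h /=; rewrite addrCA. Qed.

Lemma partial_shift f i v x : 'D_(e i) (fun x => f (v + x)) x = 'D_(e i) f (v + x).
Proof.
by rewrite /derive shift_quotient. Qed.

Lemma smooth_shift f v : smooth f -> smooth (fun x => f (v + x)).
Proof.
move=> sf s.
have -> : partial s (fun x => f (v + x)) = (fun x => partial s f (v + x)).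
  by elim: s => [//|i s IH]; apply/funext => x /=; rewrite IH partial_shift.
have [c Df] := sf s; split.
  move=> x; apply: (@continuous_comp _ _ _ (fun x => v + x) (partial s f)); last exact: c.
  by apply: (@continuousD _ _ _ (fun=> v) id); [exact: cst_continuous|exact: cvg_id].
move=> i x; have := Df i (v + x).
by rewrite /derivable -(shift_quotient (partial s f)).
Qed.

Lemma derivative_limit (a b C : R) : (forall h, 0 < h -> h <= 1 -> `|a - b| <= C * h) -> a = b.
Proof.
move=> H; apply/eqP; rewrite -subr_eq0 -normr_eq0 eq_le normr_ge0 andbT.
apply/ler_addgt0Pl => e0 e00; rewrite addr0.
have [C0|C0] := leP C 0.
  by apply: le_trans (H 1 ltr01 (lexx _)) _; rewrite mulr1; lra.
pose h := Num.min 1 (e0 / C).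
have h0 : 0 < h by rewrite lt_min ltr01 divr_gt0.
apply: le_trans (H h h0 _) _; first by rewrite ge_min lexx.
by rewrite mulrC -ler_pdivlMr// ge_min lexx orbT.
Qed.

(** Symmetry of second derivatives, by comparing the two expansions of the
    double increment of [f]. *)
Lemma schwarz f i j x : smooth f ->
  (forall s, exists L, forall x, `|partial s f x| <= L) ->
  'D_(e i) (D j f) x = 'D_(e j) (D i f) x.
Proof.
move=> sf fb.
have [L1 H1] := fb [:: j; i; i]; have [L2 H2] := fb [:: j; j; i].
have [L3 H3] := fb [:: i; j; j]; have [L4 H4] := fb [:: i; i; j].
have key a b (La Lb : R) :
    (forall x, `|partial [:: b; a; a] f x| <= La) ->
    (forall x, `|partial [:: b; b; a] f x| <= Lb) -> forall h, 0 < h ->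
    `|f (h *: e a + (h *: e b + x)) - f (h *: e b + x) - (f (h *: e a + x) - f x)
      - h ^+ 2 * 'D_(e b) (D a f) x| <= (La + Lb) * h ^+ 3.
  move=> Ha Hb h h0; pose G y := f (h *: e b + y) + (-1) * f y.
  have sG : smooth G by apply: smoothD; [exact: smooth_shift|exact: smoothZ].
  have incr k : smooth k ->
      forall y, 'D_(e a) (fun y => k (h *: e b + y) + (-1) * k y) y =
        'D_(e a) k (h *: e b + y) - 'D_(e a) k y.
    move=> sk y.
    have := @partialD (fun y => k (h *: e b + y)) (fun y => (-1) * k y) a y
      (smooth_shift _ sk) (smoothZ _ sk).
    by move=> ->; rewrite (partial_shift k) (partialZ (-1) a y sk) mulN1r.
  have DG := incr f sf.
  have DDG y : 'D_(e a) (D a G) y = 'D_(e a) (D a f) (h *: e b + y) - 'D_(e a) (D a f) y.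
    rewrite -(incr _ (smooth_partial a sf)); congr ('D_(e a) _ y).
    by apply/funext => z; rewrite DG mulN1r.
  have t1 := @taylor G a (La * h) x h sG _.
  have {}t1 : `|G (h *: e a + x) - G x - h * 'D_(e a) G x| <= La * h ^+ 3.
    rewrite exprS mulrA [h ^+ 2]expr2 -expr2; apply: t1 => y; rewrite DDG.
    rewrite -[h in La * h](ger0_norm (ltW h0)).
    exact: (lipschitz y h (smooth_partial a (smooth_partial a sf)) Ha).
  have t2 : `|'D_(e a) f (h *: e b + x) - 'D_(e a) f x - h * 'D_(e b) (D a f) x| <= Lb * h ^+ 2.
    exact: (taylor x h (smooth_partial a sf) Hb).
  have {}t2 : `|h * 'D_(e a) G x - h ^+ 2 * 'D_(e b) (D a f) x| <= Lb * h ^+ 3.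
    by rewrite DG expr2 -mulrA -mulrBr normrM (ger0_norm (ltW h0)) exprS mulrCA ler_wpM2l// ltW.
  rewrite mulrDl; apply: le_trans (lerD t1 t2); apply: le_trans (ler_normD _ _).
  rewrite le_eqVlt; apply/orP; left; apply/eqP; congr `|_|.
  by rewrite /G [h *: e b + (h *: e a + x)]addrCA; ring.
apply: (@derivative_limit _ _ (L1 + L2 + (L3 + L4))) => h h0 _.
have k1 := key i j _ _ H1 H2 h h0; have k2 := key j i _ _ H3 H4 h h0.
have h2 : 0 < h ^+ 2 by rewrite exprn_gt0.
rewrite -(ler_pM2l h2) -{1}(ger0_norm (ltW h2)) -normrM mulrBr.
apply: le_trans (_ : (L1 + L2) * h ^+ 3 + (L3 + L4) * h ^+ 3 <= _); last first.
  by rewrite le_eqVlt; apply/orP; left; apply/eqP; ring.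
apply: le_trans (lerD k1 k2); apply: le_trans (ler_normB _ _).
rewrite le_eqVlt; apply/orP; left; apply/eqP; congr `|_|.
rewrite [h *: e j + (h *: e i + x)]addrCA.
have E (A A1 A2 A3 X Y h' : R) : h' * X - h' * Y =
  (A - A1 - (A2 - A3) - h' * Y) - (A - A2 - (A1 - A3) - h' * X) by ring.
exact: E.
Qed.
End smooth_algebra.

(** * Square integrable functions *)

Section square_integrable.
Context {disp : measure_display} {T : measurableType disp} {R : realType}.
Variables (mu : {measure set T -> \bar R}) (D : set T).
Hypotheses (mD : measurable D) (Dfin : (mu D < +oo)%E).
Implicit Types (f g : T -> R).

Definition sqi f := measurable_fun D f /\ (\int[mu]_(x in D) (f x ^+ 2)%:E < +oo)%E.

Let msq f : measurable_fun D f -> measurable_fun D (fun x => f x ^+ 2).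
Proof. exact: measurable_funX. Qed.

Lemma sqi_integrable2 f : sqi f -> mu.-integrable D (EFin \o (fun x => f x ^+ 2)).
Proof.
move=> [mf foo]; apply/integrableP; split; first exact/measurable_EFinP/msq.
apply: le_lt_trans foo; rewrite le_eqVlt; apply/orP; left; apply/eqP.
by apply: eq_integral => x _ /=; rewrite ger0_norm ?sqr_ge0.
Qed.

Lemma sqi_of_integrable f : measurable_fun D f ->
  mu.-integrable D (EFin \o (fun x => f x ^+ 2)) -> sqi f.
Proof.
move=> mf /integrableP[_ foo]; split=> //; apply: le_lt_trans foo.
rewrite le_eqVlt; apply/orP; left; apply/eqP.
by apply: eq_integral => x _ /=; rewrite ger0_norm ?sqr_ge0.
Qed.

Lemma integrable_dominated f g : measurable_fun D f ->
  (forall x, D x -> `|f x| <= g x) -> mu.-integrable D (EFin \o g) ->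
  mu.-integrable D (EFin \o f).
Proof.
move=> mf fg ig; apply: (le_integrable mD) ig => [|x Dx /=].
  exact/measurable_EFinP.
by rewrite lee_fin; apply: le_trans (fg x Dx) _; exact: ler_norm.
Qed.

Lemma integrable_sum2 f g : mu.-integrable D (EFin \o f) -> mu.-integrable D (EFin \o g) ->
  mu.-integrable D (EFin \o (fun x => f x + g x)).
Proof. by move=> fi gi; have := integrableD mD fi gi; apply: eq_integrable. Qed.

Lemma integrable_scale (a : R) f : mu.-integrable D (EFin \o f) ->
  mu.-integrable D (EFin \o (fun x => a * f x)).
Proof. by move=> fi; have := integrableZl mD a fi; apply: eq_integrable. Qed.

Lemma sqi_prod f g : sqi f -> sqi g -> mu.-integrable D (EFin \o (fun x => f x * g x)).
Proof.
move=> sf sg; apply: (@integrable_dominated _ (fun x => f x ^+ 2 + g x ^+ 2)).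
- by apply: measurable_funM; [exact: sf.1|exact: sg.1].
- move=> x _; rewrite ler_norml; have := sqr_ge0 (f x + g x); have := sqr_ge0 (f x - g x).
  by have := sqr_ge0 (f x); have := sqr_ge0 (g x); move=> *; apply/andP; split; lra.
- by apply: integrable_sum2; exact: sqi_integrable2.
Qed.

Lemma sqi_dominated f g : measurable_fun D f -> (forall x, D x -> `|f x| <= `|g x|) ->
  sqi g -> sqi f.
Proof.
move=> mf fg sg; apply: sqi_of_integrable => //.
apply: (@integrable_dominated _ (fun x => g x ^+ 2)); [exact: msq| |exact: sqi_integrable2].
move=> x Dx; rewrite normrX -[leRHS]real_normK ?num_real//.
by rewrite ler_pXn2r ?nnegrE//; exact: fg.
Qed.

Lemma sqiD f g : sqi f -> sqi g -> sqi (fun x => f x + g x).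
Proof.
move=> sf sg; apply: sqi_of_integrable.
  by apply: measurable_funD; [exact: sf.1|exact: sg.1].
apply: (@integrable_dominated _ (fun x => 2 * (f x ^+ 2 + g x ^+ 2))).
- by apply: msq; apply: measurable_funD; [exact: sf.1|exact: sg.1].
- move=> x _; rewrite ger0_norm ?sqr_ge0//.
  by have := sqr_ge0 (f x - g x); lra.
- by apply: integrable_scale; apply: integrable_sum2; exact: sqi_integrable2.
Qed.

Lemma sqiM_bounded (c : T -> R) (K : R) f : measurable_fun D c ->
  (forall x, D x -> `|c x| <= K) -> sqi f -> sqi (fun x => c x * f x).
Proof.
move=> mc cK sf; apply: (@sqi_dominated _ (fun x => K * f x)).
- by apply: measurable_funM => //; exact: sf.1.
- move=> x Dx; rewrite !normrM ler_wpM2r//; apply: le_trans (cK x Dx) _; exact: ler_norm.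
apply: sqi_of_integrable.
  by apply: measurable_funM; [exact: measurable_cst|exact: sf.1].
have := integrable_scale (K ^+ 2) (sqi_integrable2 sf).
by apply: eq_integrable => // x _ /=; rewrite exprMn.
Qed.

Lemma sqiZ (a : R) f : sqi f -> sqi (fun x => a * f x).
Proof. by move=> sf; apply: (@sqiM_bounded (fun=> a) `|a|). Qed.

Lemma bounded_integrable f (K : R) : measurable_fun D f -> (forall x, D x -> `|f x| <= K) ->
  mu.-integrable D (EFin \o f).
Proof.
move=> mf fK; apply: measurable_bounded_integrable => //.
by exists K; split; [exact: num_real|move=> M KM x Dx; exact: le_trans (fK x Dx) (ltW KM)].
Qed.

Lemma sqi_bounded f (K : R) : measurable_fun D f -> (forall x, D x -> `|f x| <= K) -> sqi f.
Proof.
move=> mf fK; apply: sqi_of_integrable => //.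
apply: (@bounded_integrable _ (K ^+ 2)); first exact: msq.
move=> x Dx; rewrite normrX ler_pXn2r ?nnegrE//; first exact: fK.
exact: le_trans (normr_ge0 _) (fK x Dx).
Qed.

Lemma sqi_integrable f : sqi f -> mu.-integrable D (EFin \o f).
Proof.
move=> sf; have s1 : sqi (fun=> 1) by apply: (@sqi_bounded _ 1) => // x _; rewrite normr1.
by have := sqi_prod s1 sf; apply: eq_integrable => // x _ /=; rewrite mul1r.
Qed.

Definition l2sq f : R := \int[mu]_(x in D) (f x ^+ 2).

Lemma l2sq_ge0 f : 0 <= l2sq f.
Proof. by apply: Rintegral_ge0 => x _; exact: sqr_ge0. Qed.

Lemma l2sq_EFin f : sqi f -> (l2sq f)%:E = (\int[mu]_(x in D) (f x ^+ 2)%:E)%E.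
Proof.
move=> /sqi_integrable2 i2; rewrite /l2sq /Rintegral fineK//.
exact: (integrable_fin_num mD i2).
Qed.

Lemma l2sq_L1 f : sqi f -> (\int[mu]_(x in D) `|f x|) ^+ 2 <= fine (mu D) * l2sq f.
Proof.
move=> sf; set m := fine (mu D); set I := \int[mu]_(x in D) `|f x|.
have m0 : 0 <= m by rewrite fine_ge0.
have sa : sqi (fun x => `|f x|).
  apply: (sqi_dominated _ _ sf); last by move=> x _; rewrite normr_id.
  by apply: measurableT_comp; [exact: normr_measurable|exact: sf.1].
have H (t : R) : 0 <= l2sq f - 2 * t * I + t ^+ 2 * m.
  have i1 : mu.-integrable D (EFin \o (fun x => f x ^+ 2)) by exact: sqi_integrable2.
  have i2 : mu.-integrable D (EFin \o (fun x => (- 2 * t) * `|f x|)).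
    by apply: integrable_scale; exact: sqi_integrable.
  have i3 : mu.-integrable D (EFin \o (fun=> t ^+ 2)).
    by apply: (@bounded_integrable _ (t ^+ 2)) => // x _; rewrite ger0_norm ?sqr_ge0.
  have <- : \int[mu]_(x in D) ((f x ^+ 2 + (- 2 * t) * `|f x|) + t ^+ 2) =
      l2sq f - 2 * t * I + t ^+ 2 * m.
    rewrite RintegralD//; last exact: integrable_sum2.
    rewrite RintegralD// RintegralZl//; last exact: sqi_integrable.
    by rewrite Rintegral_cst// -/I mulNr mulNr.
  apply: Rintegral_ge0 => x _; have := sqr_ge0 (`|f x| - t).
  by rewrite -[f x ^+ 2]real_normK ?num_real//; lra.
have I0 : 0 <= I by apply: Rintegral_ge0.
have [m00|mn0] := eqVneq m 0.
  have L0 := l2sq_ge0 f.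
  have := H ((l2sq f + 1) / (2 * I)); rewrite m00 mul0r mulr0 addr0 => _.
  have [->|In0] := eqVneq I 0; first by rewrite expr0n.
  have := H ((l2sq f + 1) / (2 * I)).
  have -> : 2 * ((l2sq f + 1) / (2 * I)) * I = l2sq f + 1 by field.
  by rewrite m00 mulr0; lra.
have mp : 0 < m by rewrite lt_neqAle eq_sym mn0.
have := H (I / m).
have -> : l2sq f - 2 * (I / m) * I + (I / m) ^+ 2 * m = l2sq f - I ^+ 2 / m by field.
by rewrite subr_ge0 ler_pdivrMr// mulrC.
Qed.

(** Riesz-Fischer for a sequence whose increments are summable: the increments
    are then summable in [L1], so the sequence converges almost everywhere, and
    Fatou's lemma identifies the limit in [L2]. *)
Lemma rapid_cauchy_limit (g : nat -> T -> R) : (forall k, sqi (g k)) ->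
  (forall k, l2sq (fun x => g k.+1 x - g k x) <= (4^-1) ^+ k) ->
  (forall m k, (m <= k)%N -> l2sq (fun x => g m x - g k x) <= 4 * (4^-1) ^+ m) ->
  exists2 f, sqi f & forall m, l2sq (fun x => g m x - f x) <= 4 * (4^-1) ^+ m.
Proof.
move=> sg inc close.
have sB k l : sqi (fun x => g k x - g l x).
  have := sqiD (sg k) (sqiZ (-1) (sg l)).
  by congr sqi; apply/funext => x; rewrite mulN1r.
have mg k : measurable_fun D (g k) := (sg k).1.
pose G x := (\sum_(n <oo) `|g n.+1 x - g n x|%:E)%E.
have mG : measurable_fun D G.
  apply: ge0_emeasurable_sum => // k _; apply/measurable_EFinP.
  by apply: measurableT_comp; [exact: normr_measurable|exact: (sB _ _).1].
have m0 : 0 <= fine (mu D) by rewrite fine_ge0.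
pose M := Num.sqrt (fine (mu D)).
have iG : (\int[mu]_(x in D) G x < +oo)%E.
  rewrite integral_nneseries//; last first.
    move=> k; apply/measurable_EFinP.
    by apply: measurableT_comp; [exact: normr_measurable|exact: (sB _ _).1].
  apply: (@le_lt_trans _ _ (\sum_(n <oo) (M * 2^-1 ^+ n)%:E)%E); last first.
    have := @is_cvg_geometric_series R M (2^-1); rewrite ger0_norm ?invr_ge0// => cv.
    have {}cv : cvgn (series (geometric M 2^-1)) by apply: cv; rewrite invf_lt1// ltr1n.
    have -> : (\sum_(n <oo) (M * 2^-1 ^+ n)%:E = (limn (series (geometric M 2^-1)))%:E)%E.
      apply/cvg_lim => //; rewrite [X in X @ _ --> _](_ : _ = EFin \o series (geometric M 2^-1)).
        by apply: cvg_EFin => //; exact: nearW.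
      by apply/funext => k; rewrite /= /series/= sumEFin.
    exact: ltry.
  apply: lee_nneseries => [k _ _|k _]; first by apply: integral_ge0 => x _; rewrite lee_fin.
  have ik : mu.-integrable D (EFin \o (fun x => `|g k.+1 x - g k x|)).
    by apply: integrable_norm; apply: sqi_integrable; exact: sB.
  have -> : (\int[mu]_(x in D) `|g k.+1 x - g k x|%:E)%E =
      (\int[mu]_(x in D) `|g k.+1 x - g k x|)%:E.
    by rewrite /Rintegral fineK//; exact: (integrable_fin_num mD ik).
  rewrite lee_fin -(@ler_pXn2r _ 2)// ?nnegrE ?mulr_ge0 ?sqrtr_ge0 ?exprn_ge0 ?invr_ge0//.
    apply: le_trans (l2sq_L1 (sB k.+1 k)) _.
    rewrite exprMn sqr_sqrtr// ler_wpM2l//; apply: le_trans (inc k) _.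
    by rewrite -exprM mulnC exprM expr2 -invfM -natrM.
  by apply: Rintegral_ge0.
have iG' : mu.-integrable D G.
  apply/integrableP; split=> //; apply: le_lt_trans iG.
  rewrite le_eqVlt; apply/orP; left; apply/eqP; apply: eq_integral => x _.
  by rewrite gee0_abs//; apply: nneseries_ge0.
have Gae := integrable_ae mD iG'.
pose A := D `&` [set x | (G x < +oo)%E].
have mA : measurable A by exact: (emeasurable_fun_infty_o mD mG).
pose h k x := g k x * \1_A x.
have cvh x : D x -> cvgn (h ^~ x).
  move=> Dx; rewrite /h indicE; have [xA|xA] := boolP (x \in A); last first.
    rewrite (_ : (fun n => _) = cst 0); first exact: is_cvg_cst.
    by apply/funext => k; rewrite mulr0.
  have [_ /= Gx] := set_mem xA.
  have cs : cvgn (series (fun n => g n.+1 x - g n x)).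
    apply: normed_cvg; apply: nondecreasing_is_cvgn.
      by apply: nondecreasing_series => n _; rewrite normr_ge0.
    exists (fine (G x)) => _ [n _ <-].
    have G0 : (0 <= G x)%E by apply: nneseries_ge0.
    rewrite -lee_fin fineK ?ge0_fin_numE//.
    rewrite /series/= -sumEFin /G; exact: nneseries_lim_ge.
  have -> : (fun n => g n x * (true : nat)%:R) = (fun n => series (fun n => g n.+1 x - g n x) n + g 0%N x).
    apply/funext => n; rewrite mulr1 /series/= telescope_sumr// subrK//.
  by apply: is_cvgD => //; exact: is_cvg_cst.
pose f x := limn (h ^~ x).
have hf x : D x -> h ^~ x @ \oo --> f x by exact: cvh.
have mh k : measurable_fun D (h k).
  by apply: measurable_funM => //; apply: measurable_funTS; exact: measurable_indic.
have mf : measurable_fun D f by exact: (measurable_fun_cvg mh).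
have aeq m : ae_eq mu D (fun x => ((g m x - f x) ^+ 2)%:E) (fun x => ((h m x - f x) ^+ 2)%:E).
  apply: filterS Gae => x Gx Dx; congr ((_ - _) ^+ 2)%:E.
  rewrite /h indicE mem_set ?mulr1//; split=> //=.
  by rewrite -ge0_fin_numE ?Gx//; apply: nneseries_ge0.
have mgf m : measurable_fun D (fun x => ((g m x - f x) ^+ 2)%:E).
  by apply/measurable_EFinP/msq; exact: measurable_funB.
have mhf m : measurable_fun D (fun x => ((h m x - f x) ^+ 2)%:E).
  by apply/measurable_EFinP/msq; exact: measurable_funB.
have bound m : (\int[mu]_(x in D) ((g m x - f x) ^+ 2)%:E <= (4 * 4^-1 ^+ m)%:E)%E.
  rewrite (ae_eq_integral _ _ _ _ _ (aeq m))//.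
  have mhh k : measurable_fun D (fun x => ((h m x - h k x) ^+ 2)%:E).
    by apply/measurable_EFinP/msq; exact: measurable_funB.
  have fat := @fatou _ _ _ mu D mD (fun k x => ((h m x - h k x) ^+ 2)%:E) mhh
    (fun k x _ => ltac:(by rewrite lee_fin sqr_ge0)).
  have E : (\int[mu]_(x in D) ((h m x - f x) ^+ 2)%:E =
      \int[mu]_(x in D) limn_einf (fun k => ((h m x - h k x) ^+ 2)%:E))%E.
    apply: eq_integral => x /set_mem Dx.
    have cv : (fun k => ((h m x - h k x) ^+ 2)%:E) @ \oo --> ((h m x - f x) ^+ 2)%:E.
      apply: cvg_EFin; first exact: nearW.
      have cB : (fun k => h m x - h k x) @ \oo --> h m x - f x.
        by apply: cvgB; [exact: cvg_cst|exact: hf].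
      by under eq_fun do rewrite /= expr2; rewrite expr2; exact: cvgM.
    by have /cvg_limn_einf_sup[-> _] := cv.
  rewrite E; apply: le_trans fat _.
  have ub : (limn_einf (fun k => \int[mu]_(x in D) ((h m x - h k x) ^+ 2)%:E) <=
      limn_esup (fun k => \int[mu]_(x in D) ((h m x - h k x) ^+ 2)%:E))%E by exact: limn_einf_sup.
  apply: le_trans ub _.
  apply: (@le_trans _ _ (esups (fun k => \int[mu]_(x in D) ((h m x - h k x) ^+ 2)%:E) m)%E).
    rewrite limn_esup_lim (cvg_lim _ (ereal_nonincreasing_cvgn (nonincreasing_esups _)))//.
    by apply: ereal_inf_lbound; exists m.
  apply: ub_ereal_sup => _ [k /= mk <-].
  apply: (@le_trans _ _ (\int[mu]_(x in D) ((g m x - g k x) ^+ 2)%:E)%E).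
    apply: ge0_le_integral => //.
    + by move=> x _; rewrite lee_fin sqr_ge0.
    + by apply/measurable_EFinP/msq; exact: (sB m k).1.
    + move=> x _; rewrite lee_fin /h -mulrBl exprMn indicE.
      by case: (_ \in _); rewrite /= ?expr1n ?mulr1// expr0n mulr0 sqr_ge0.
  by rewrite -l2sq_EFin// lee_fin close.
have sgf m : sqi (fun x => g m x - f x).
  split; first exact: measurable_funB.
  by apply: le_lt_trans (bound m) _; exact: ltry.
exists f.
  have := sqiD (sg 0%N) (sqiZ (-1) (sgf 0%N)).
  by congr sqi; apply/funext => x; rewrite mulN1r opprB addrC subrK.
by move=> m; rewrite -lee_fin l2sq_EFin.
Qed.
End square_integrable.

(** * Test functions and their density *)

Section l2_convergence.
Context {disp : measure_display} {T : measurableType disp} {R : realType}.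
Variables (mu : {measure set T -> \bar R}) (D : set T).
Hypotheses (mD : measurable D) (Dfin : (mu D < +oo)%E).
Implicit Types (f g : T -> R).

Lemma l2sq_dominated (F : nat -> T -> R) f g : (forall k, measurable_fun D (F k)) ->
  measurable_fun D f -> sqi mu D g -> (forall k x, D x -> `|F k x - f x| <= g x) ->
  (forall x, D x -> F ^~ x @ \oo --> f x) ->
  forall e, 0 < e -> exists N, forall k, (N <= k)%N -> l2sq mu D (fun x => F k x - f x) < e.
Proof.
move=> mF mf sg Fg Ff e e0.
have mFf k : measurable_fun D (fun x => (F k x - f x) ^+ 2).
  by apply: measurable_funX; exact: measurable_funB.
have [|||||_ _] := @dominated_convergence _ _ _ mu D mD
    (fun k x => ((F k x - f x) ^+ 2)%:E) (cst 0%E) (fun x => (g x ^+ 2)%:E).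
- by move=> k; exact/measurable_EFinP.
- exact: measurable_cst.
- apply/aeW => x Dx; apply: cvg_EFin; first exact: nearW.
  have cB : (fun k => F k x - f x) @ \oo --> (0 : R).
    by rewrite -(subrr (f x)); apply: cvgB; [exact: Ff|exact: cvg_cst].
  by have h := cvgM cB cB; rewrite mulr0 in h; under eq_fun do rewrite /= expr2; exact: h.
- exact: sqi_integrable2.
- apply/aeW => x k Dx /=; rewrite lee_fin ger0_norm ?sqr_ge0//.
  by rewrite -real_normK ?num_real// ler_pXn2r ?nnegrE//; [exact: Fg|exact: le_trans (normr_ge0 _) (Fg k x Dx)].
rewrite integral0 => /fine_cvg /cvgrPdist_lt /(_ e e0)[N _ HN].
exists N => k Nk; have := HN k Nk; rewrite /= sub0r normrN.
by move=> /(le_lt_trans (ler_norm _)).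
Qed.
End l2_convergence.

Section test_functions.
Context {R : realType} {d : nat}.
Local Notation pt := 'rV[R]_d.
Local Notation mu := (lebesgue_rV d).
Local Notation e_ := (@ev R d).
Variable D : set pt.
Hypotheses (oD : open D) (bD : bounded_set D).
Implicit Types (f g phi psi : pt -> R) (i j : 'I_d) (x : pt).

Lemma coord_le_norm x i : `|x ord0 i| <= `|x|.
Proof.
by rewrite [leRHS]/Num.norm /= mx_normrE; apply/bigmax_geP; right => /=; exists (ord0, i).
Qed.

Lemma domain_box : exists L : R, forall x, D x -> forall i, `|x ord0 i| <= L.
Proof.
have [M [_ HM]] := bD; exists (M + 1) => x Dx i.
by apply: le_trans (coord_le_norm x i) _; apply: HM => //; rewrite ltrDl.
Qed.

Lemma measurable_domain : measurable D. Proof. exact: open_measurable_rV. Qed.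

Lemma domain_fin : (mu D < +oo)%E.
Proof.
have [L HL] := domain_box; apply: le_lt_trans (lebesgue_rV_box_fin d L).
apply: le_measure; rewrite ?inE; [exact: measurable_domain| |exact: HL].
apply: measurable_forall => i.
apply: eq_measurable (measurable_coord_set i (measurable_itv `[- L, L])) _.
by apply/seteqP; split=> y; rewrite /= in_itv/= ler_norml.
Qed.

Local Notation mD := measurable_domain.
Local Notation int f := (\int[mu]_(x in D) f x).

Lemma compact_bounded_fun (K : set pt) f : compact K -> continuous f ->
  (forall x, ~ K x -> f x = 0) -> exists M, forall x, `|f x| <= M.
Proof.
move=> cK cf f0; have cfK : compact (f @` K).
  by apply: continuous_compact => //; exact: continuous_subspaceT.
have [M [_ HM]] := compact_bounded cfK; exists (Num.max 0 (M + 1)) => x.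
have [Kx|nKx] := pselect (K x).
  by rewrite le_max; apply/orP; right; apply: HM; [rewrite ltrDl|exists x].
by rewrite f0// normr0 le_max lexx.
Qed.

Lemma compact_rV_closed (K : set pt) : compact K -> closed K.
Proof. by apply: compact_closed; exact: norm_hausdorff. Qed.

Lemma test_of_support f (K : set pt) : smooth f -> compact K -> K `<=` D ->
  (forall x, ~ K x -> f x = 0) -> test_fun D f.
Proof.
move=> sf cK KD f0; have sK : closure [set x | f x != 0] `<=` K.
  rewrite [X in _ `<=` X](closure_id K).1; last exact: compact_rV_closed.
  apply: closure_subset => x /= fx; apply: contrapT => /f0 fx0.
  by rewrite fx0 eqxx in fx.
split=> //; last exact: subset_trans KD.
by apply: (subclosed_compact _ cK sK); exact: closed_closure.
Qed.

Lemma test_out f x : test_fun D f -> ~ D x -> f x = 0.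
Proof.
move=> [_ _ sD] nDx; apply/eqP/negPn/negP => fx; apply: nDx; apply: sD.
exact: subset_closure.
Qed.

Lemma test_smooth f : test_fun D f -> smooth f. Proof. by case. Qed.

Lemma test_partial1 f i : test_fun D f -> test_fun D (fun x => 'D_(e_ i) f x).
Proof.
move=> [sf cf fD]; apply: (test_of_support (smooth_partial i sf) cf fD).
move=> x nx; have : nbhs x (~` closure [set x | f x != 0]).
  by apply: open_nbhs_nbhs; split => //; apply: closed_openC; exact: closed_closure.
move=> nb; rewrite -(@near_eq_derive _ _ _ (cst 0) f x (e_ i)) ?derive_cst//.
apply: filterS nb => y ny; apply/esym/eqP/negPn/negP => fy; apply: ny.
exact: subset_closure.
Qed.

Lemma test_partial s f : test_fun D f -> test_fun D (partial s f).
Proof. by move=> tf; elim: s => [//|i s IH]; exact: test_partial1. Qed.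

Lemma test_bounded f : test_fun D f -> exists M, forall x, `|f x| <= M.
Proof.
move=> tf; have [sf cf _] := tf.
apply: (compact_bounded_fun cf (smooth_continuous sf)) => x nx.
by apply/eqP/negPn/negP => fx; apply: nx; exact: subset_closure.
Qed.

Lemma test_partials_bounded f s : test_fun D f -> exists M, forall x, `|partial s f x| <= M.
Proof. by move=> tf; apply: test_bounded; exact: test_partial. Qed.

Lemma test_mul f phi : smooth f -> test_fun D phi -> test_fun D (fun x => f x * phi x).
Proof.
move=> sf tp; have [sp cp pD] := tp.
apply: (test_of_support (smoothM sf sp) cp pD).
move=> x nx; rewrite (_ : phi x = 0) ?mulr0//.
by apply/eqP/negPn/negP => fx; apply: nx; exact: subset_closure.
Qed.

Lemma testD phi psi : test_fun D phi -> test_fun D psi -> test_fun D (fun x => phi x + psi x).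
Proof.
move=> [sf cf fD] [sg cg gD].
apply: (test_of_support (smoothD sf sg) (compactU cf cg)).
- by move=> x [/fD|/gD].
- move=> x nx; have p0 : phi x = 0.
    by apply/eqP/negPn/negP => fx; apply: nx; left; exact: subset_closure.
  have q0 : psi x = 0.
    by apply/eqP/negPn/negP => fx; apply: nx; right; exact: subset_closure.
  by rewrite p0 q0 addr0.
Qed.

Lemma testZ a phi : test_fun D phi -> test_fun D (fun x => a * phi x).
Proof. by apply: test_mul; apply/smooth_expr_smooth/SmoothCst. Qed.

Lemma test0 : test_fun D (fun=> 0).
Proof.
apply: (@test_of_support _ set0) => //; first by apply/smooth_expr_smooth/SmoothCst.
exact: compact0.
Qed.

Lemma smooth_measurable f : smooth f -> measurable_fun setT f.
Proof. by move=> /smooth_continuous; exact: continuous_measurable_rV. Qed.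

Lemma test_measurable phi : test_fun D phi -> measurable_fun D phi.
Proof. by move=> /test_smooth/smooth_measurable; exact: measurable_funTS. Qed.

Lemma test_sqi phi : test_fun D phi -> sqi mu D phi.
Proof.
move=> tp; have [M HM] := test_bounded tp.
by apply: (sqi_bounded mD domain_fin (K := M)) => //; exact: test_measurable.
Qed.

Lemma test_integrable phi : test_fun D phi -> mu.-integrable D (EFin \o phi).
Proof. by move=> tp; apply: sqi_integrable (test_sqi tp); [exact: mD|exact: domain_fin]. Qed.

Lemma integral_setT phi : (forall x, ~ D x -> phi x = 0) ->
  int phi = \int[mu]_x phi x.
Proof.
move=> p0; rewrite [LHS]Rintegral_mkcond; apply: eq_Rintegral => x _.
rewrite patchE; case: ifPn => // /negP xD; rewrite p0//.
by move=> Dx; apply: xD; exact: mem_set.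
Qed.

Lemma integral_translate f v : measurable_fun setT f ->
  mu.-integrable setT (EFin \o f) ->
  \int[mu]_x f (v + x) = \int[mu]_x f x.
Proof.
move=> mf fi; pose t (x : pt) : pt := v + x.
have mt : measurable_fun [set: pt] t.
  apply: measurable_fun_rV => i; rewrite /t; under eq_fun do rewrite mxE.
  by apply: measurable_funD; [exact: measurable_cst|exact: measurable_coord].
have E A : measurable A -> pushforward mu t A = mu A.
  move=> mA; have tE : t @^-1` A = (fun x => x + v) @^-1` A.
    by apply/seteqP; split=> x /=; rewrite /t addrC.
  by have := lebesgue_rV_translation v mA; rewrite -tE.
rewrite /Rintegral; congr fine.
have mtP : measurable_fun setT t := mt.
transitivity (\int[pushforward mu t]_x (f x)%:E)%E; last first.
  by apply: eq_measure_integral => A mA _; exact: E.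
rewrite integral_pushforward//; first exact/measurable_EFinP.
apply/integrableP; split; first by apply/measurable_EFinP; exact: measurableT_comp mf mt.
have /integrableP[_] := fi; apply: le_lt_trans.
have -> : (\int[mu]_(x in t @^-1` setT) `|((EFin \o f) \o t) x| =
    \int[pushforward mu t]_x `|(EFin \o f) x|)%E.
  rewrite ge0_integral_pushforward//.
  by apply: measurableT_comp => //; exact/measurable_EFinP.
rewrite le_eqVlt; apply/orP; left; apply/eqP.
by apply: eq_measure_integral => A mA _; exact: E.
Qed.

(** The integral of an increment of a test function vanishes by translation
    invariance, and it equals [h] times the integral of the derivative up to
    [h ^+ 2]. *)
Lemma int_partial0 phi i : test_fun D phi -> int (fun x => 'D_(e_ i) phi x) = 0.
Proof.
move=> tp; have tdp := test_partial1 i tp; have sp := test_smooth tp.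
have [L0 HL0] := domain_box; pose L := `|L0| + 1.
have [M HM] := test_partials_bounded [:: i; i] tp.
pose B : set pt := [set x | forall j, `|x ord0 j| <= L].
have mB : measurable B.
  apply: measurable_forall => j.
  apply: eq_measurable (measurable_coord_set j (measurable_itv `[- L, L])) _.
  by apply/seteqP; split=> y; rewrite /= in_itv/= ler_norml.
have Bfin : (mu B < +oo)%E by exact: lebesgue_rV_box_fin.
have DB : D `<=` B.
  move=> x Dx j; apply: le_trans (HL0 x Dx j) _; apply: le_trans (ler_norm _) _.
  by rewrite lerDl.
have out f x : test_fun D f -> ~ B x -> f x = 0.
  by move=> tf nBx; apply: (test_out tf) => /DB.
have toB f : (forall x, ~ B x -> f x = 0) -> \int[mu]_x f x = \int[mu]_(x in B) f x.
  move=> f0; rewrite [RHS]Rintegral_mkcond; apply: eq_Rintegral => x _.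
  by rewrite patchE; case: ifPn => // /negP xD; rewrite f0// => Bx; apply: xD; exact: mem_set.
have iB f : measurable_fun setT f -> (exists K, forall x, `|f x| <= K) ->
    mu.-integrable B (EFin \o f).
  move=> mf [K HK]; apply: (@bounded_integrable _ _ _ mu B mB Bfin _ K) => //.
  exact: measurable_funTS.
have iT f : measurable_fun setT f -> (exists K, forall x, `|f x| <= K) ->
    (forall x, ~ B x -> f x = 0) -> mu.-integrable setT (EFin \o f).
  move=> mf fK f0; have := iB f mf fK; rewrite (integrable_mkcond _ mB).
  apply: eq_integrable => // x _; rewrite patchE /=; case: ifPn => // /negP xB.
  by rewrite f0// => Bx; apply: xB; exact: mem_set.
have mp := smooth_measurable sp; have mdp := smooth_measurable (smooth_partial i sp).
apply: (@derivative_limit R _ _ (M * fine (mu B))) => h h0 h1.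
pose sh x := phi (h *: e_ i + x).
have msh : measurable_fun setT sh by apply: smooth_measurable; exact: smooth_shift.
have shout x : ~ B x -> sh x = 0.
  move=> nBx; apply: (test_out tp) => Dx; apply: nBx => j.
  have := HL0 _ Dx j; rewrite !mxE /= => le.
  have : `|h * (j == i)%:R| <= 1.
    by rewrite normrM (ger0_norm (ltW h0)) normr_nat; case: (_ == _); rewrite ?mulr1 ?mulr0.
  have := ler_normB (h * (j == i)%:R + x ord0 j) (h * (j == i)%:R).
  rewrite addrAC subrr add0r => h2 h3.
  by apply: le_trans h2 _; rewrite /L lerD//; apply: le_trans le (ler_norm _).
have pb := test_bounded tp; have dpb := test_bounded tdp.
have shb : exists K, forall x, `|sh x| <= K.
  by have [K HK] := pb; exists K => x; exact: HK.
have E0 : \int[mu]_(x in B) (sh x - phi x) = 0.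
  rewrite (RintegralB mB (iB _ msh shb) (iB _ mp pb)).
  rewrite -(toB _ shout) -(toB _ (fun x => out phi x tp)).
  rewrite (integral_translate _ mp (iT _ mp pb (fun x => out phi x tp))).
  by rewrite subrr.
have E1 : int (fun x => 'D_(e_ i) phi x) = \int[mu]_(x in B) 'D_(e_ i) phi x.
  rewrite (integral_setT (fun x => test_out tdp)) toB// => x nBx.
  exact: out _ _ tdp nBx.
rewrite subr0 -(ler_pM2l h0) -{1}(ger0_norm (ltW h0)) -normrM E1.
rewrite -(RintegralZl h mB (iB _ mdp dpb)).
rewrite -normrN -[X in `|X|]add0r -{1}E0.
have i1 : mu.-integrable B (EFin \o (fun x => sh x - phi x)).
  apply: iB; first exact: measurable_funB.
  have [K1 H1] := shb; have [K2 H2] := pb; exists (K1 + K2) => x.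
  by apply: le_trans (ler_normB _ _) _; rewrite lerD.
have i2 : mu.-integrable B (EFin \o (fun x => h * 'D_(e_ i) phi x)).
  exact: (integrable_scale mB h (iB _ mdp dpb)).
rewrite -(RintegralB mB i1 i2).
apply: le_trans (le_normr_Rintegral _ _) _ => //.
  by have := integrableB mB i1 i2; apply: eq_integrable.
have mc : measurable_fun B (fun x => sh x - phi x - h * 'D_(e_ i) phi x).
  apply: measurable_funTS; apply: measurable_funB; first exact: measurable_funB.
  by apply: measurable_funM => //; exact: measurable_cst.
have bnd x : `|sh x - phi x - h * 'D_(e_ i) phi x| <= M * h ^+ 2.
  exact: (taylor x h sp HM).
have iabs : mu.-integrable B (EFin \o (fun x => `|sh x - phi x - h * 'D_(e_ i) phi x|)).
  apply: (@bounded_integrable _ _ _ mu B mB Bfin _ (M * h ^+ 2)).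
    by apply: measurableT_comp => //; exact: normr_measurable.
  by move=> x _; rewrite normr_id.
have icst : mu.-integrable B (EFin \o (fun=> M * h ^+ 2)).
  by apply: (@bounded_integrable _ _ _ mu B mB Bfin _ `|M * h ^+ 2|).
apply: le_trans (le_Rintegral mB iabs icst _) _; first by move=> x _; exact: bnd.
by rewrite Rintegral_cst// le_eqVlt; apply/orP; left; apply/eqP; ring.
Qed.

Lemma int_by_parts f phi i : smooth f -> test_fun D phi ->
  int (fun x => f x * 'D_(e_ i) phi x) = - int (fun x => 'D_(e_ i) f x * phi x).
Proof.
move=> sf tp; have := int_partial0 i (test_mul sf tp).
under eq_Rintegral => x _ do rewrite (partialM i x sf (test_smooth tp)).
rewrite RintegralD; [|exact: mD| |]; last 2 first.
- by apply: test_integrable; apply: test_mul => //; exact: test_partial1.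
- have := test_integrable (test_mul (smooth_partial i sf) tp).
  by apply: eq_integrable => // [|x _ /=]; [exact: mD|rewrite mulrC].
move=> /eqP; rewrite addr_eq0 => /eqP ->; congr (- _).
by apply: eq_Rintegral => x _; rewrite mulrC.
Qed.
End test_functions.

Section l2_density.
Context {disp : measure_display} {T : measurableType disp} {R : realType}.
Variables (mu : {measure set T -> \bar R}) (D : set T).
Hypotheses (mD : measurable D) (Dfin : (mu D < +oo)%E).
Implicit Types (f g : T -> R).

Lemma l2sqD f g : sqi mu D f -> sqi mu D g ->
  l2sq mu D (fun x => f x + g x) <= 2 * l2sq mu D f + 2 * l2sq mu D g.
Proof.
move=> sf sg; have if2 := sqi_integrable2 sf; have ig2 := sqi_integrable2 sg.
have i1 := integrable_scale mD 2 if2; have i2 := integrable_scale mD 2 ig2.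
rewrite /l2sq -(RintegralZl 2 mD if2) -(RintegralZl 2 mD ig2) -(RintegralD mD i1 i2).
apply: (le_Rintegral mD (sqi_integrable2 (sqiD mD sf sg)) (integrable_sum2 mD i1 i2)).
by move=> x _; have := sqr_ge0 (f x - g x); nra.
Qed.

Lemma l2sqZ a f : sqi mu D f -> l2sq mu D (fun x => a * f x) = a ^+ 2 * l2sq mu D f.
Proof.
move=> sf; rewrite /l2sq -(RintegralZl _ mD (sqi_integrable2 sf)).
by apply: eq_Rintegral => x _; rewrite exprMn.
Qed.

Lemma sqiB f g : sqi mu D f -> sqi mu D g -> sqi mu D (fun x => f x - g x).
Proof.
move=> sf sg; have -> : (fun x => f x - g x) = (fun x => f x + -1 * g x).
  by apply/funext => x; rewrite mulN1r.
by apply: sqiD => //; exact: sqiZ.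
Qed.
End l2_density.

Section density.
Import HBNNSimple.
Context {R : realType} {d : nat}.
Local Notation pt := 'rV[R]_d.
Local Notation mu := (lebesgue_rV d).
Variable D : set pt.
Hypotheses (oD : open D) (bD : bounded_set D).
Implicit Types (f g phi psi : pt -> R) (i j : 'I_d) (x : pt) (A B : set pt).
Let mD := measurable_domain oD.
Let Dfin := domain_fin oD bD.
Local Notation sqi := (sqi mu D).
Local Notation l2sq := (l2sq mu D).

Definition test_limit A := exists psi : nat -> pt -> R,
  [/\ forall k, test_fun D (psi k), forall k x, 0 <= psi k x <= 1 &
      forall x, psi ^~ x @ \oo --> (\1_A x : R)].

Lemma test_limitI A B : test_limit A -> test_limit B -> test_limit (A `&` B).
Proof.
move=> [u [tu u01 ul]] [v [tv v01 vl]]; exists (fun k x => u k x * v k x); split.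
- by move=> k; apply: test_mul (tv k); exact: test_smooth (tu k).
- move=> k x; have /andP[? ?] := u01 k x; have /andP[? ?] := v01 k x.
  by apply/andP; split; nra.
- by move=> x; rewrite indicI; apply: cvgM.
Qed.

Lemma test_limitU A B : test_limit A -> test_limit B -> test_limit (A `|` B).
Proof.
move=> tA tB; have tAB := test_limitI tA tB.
move: tA tB tAB => [u [tu u01 ul]] [v [tv v01 vl]] _.
exists (fun k x => u k x + (1 + -1 * u k x) * v k x); split.
- move=> k; apply: testD (tu k) _; apply: test_mul (tv k).
  apply: smoothD (smoothZ _ (test_smooth (tu k))).
  by apply/smooth_expr_smooth/SmoothCst.
- move=> k x; have /andP[? ?] := u01 k x; have /andP[? ?] := v01 k x.
  by apply/andP; split; nra.
- move=> x; have -> : (\1_(A `|` B) x : R) = \1_A x + (1 + -1 * \1_A x) * \1_B x.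
    rewrite !indicE in_setU; case: (x \in A); case: (x \in B) => /=; ring.
  apply: cvgD (ul x) _; apply: cvgM (vl x); apply: cvgD; first exact: cvg_cst.
  by apply: cvgM (ul x); exact: cvg_cst.
Qed.

Lemma test_limit0 : test_limit set0.
Proof.
exists (fun _ _ => 0); split => [k|k x|x]; first exact: test0.
- by rewrite lexx ler01.
- by rewrite indicE in_set0; exact: cvg_cst.
Qed.

Lemma bump_limit (t : R) : (fun k : nat => bump 0 (k%:R * t)) @ \oo --> ((0 < t)%R%:R : R).
Proof.
case: ltP => [t0|t0]; last first.
  apply: cvg_near_cst; apply: nearW => k; rewrite bump_le0//.
  by rewrite mulr_ge0_le0.
have -> : (true%:R : R) = expR (- (t^-1 * 0)) by rewrite mulr0 oppr0 expR0.
have h1 : (fun k : nat => k.+1%:R^-1 : R) @ \oo --> (0 : R) by exact: cvg_harmonic.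
rewrite -cvg_shiftS.
have -> : [sequence bump 0 (k.+1%:R * t)]_k = (fun k : nat => expR (- (t^-1 * k.+1%:R^-1))).
  apply/funext => k; rewrite /= /bump mulr_gt0// expr0 mul1r invfM mulrC //.
apply: (@continuous_cvg _ _ _ _ _ _ expR); first exact: continuous_expR.
by apply: cvgN; apply: cvgM h1; exact: cvg_cst.
Qed.

Definition box_bump (c : pt) (r : R) (k : nat) : pt -> R := fun x =>
  \prod_i (bump 0 (k%:R * (x ord0 i - c ord0 i + r)) *
           bump 0 (k%:R * (c ord0 i + r - x ord0 i))).

Lemma smooth_prod (I : Type) (s : seq I) (F : I -> pt -> R) :
  (forall t, smooth (F t)) -> smooth (fun x => \prod_(t <- s) F t x).
Proof.
move=> sF; elim: s => [|t s IH].
  under eq_fun do rewrite big_nil; by apply/smooth_expr_smooth/SmoothCst.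
by under eq_fun do rewrite big_cons; exact: smoothM.
Qed.

Lemma smooth_box_bump c r k : smooth (box_bump c r k).
Proof.
apply: smooth_prod => i; apply/smooth_expr_smooth/SmoothMul.
- have -> : (fun x : pt => bump 0 (k%:R * (x ord0 i - c ord0 i + r))) =
     (fun x => bump 0 (k%:R * x ord0 i + k%:R * (r - c ord0 i))).
    by apply/funext => x; congr bump; ring.
  exact: SmoothBump.
- have -> : (fun x : pt => bump 0 (k%:R * (c ord0 i + r - x ord0 i))) =
     (fun x => bump 0 ((- k%:R) * x ord0 i + k%:R * (c ord0 i + r))).
    by apply/funext => x; congr bump; ring.
  exact: SmoothBump.
Qed.

Lemma box_bump_limit c r x : (fun k => box_bump c r k x) @ \oo --> (\1_(rbox c r) x : R).
Proof.
have -> : (\1_(rbox c r) x : R) = \prod_i ((0 < x ord0 i - c ord0 i + r)%R%:R *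
    (0 < c ord0 i + r - x ord0 i)%R%:R).
  rewrite indicE; case: (boolP (x \in rbox c r)) => [/set_mem xr|xr].
    rewrite big1// => i _; have := xr i; rewrite ltr_norml => /andP[? ?].
    have -> : 0 < x ord0 i - c ord0 i + r by lra.
    have -> : 0 < c ord0 i + r - x ord0 i by lra.
    by rewrite mulr1.
  have [i Hi] : exists i, ~ (`|c ord0 i - x ord0 i| < r).
    by apply: contrapT => /forallNP H; move/negP: xr; apply; apply: mem_set => i; apply: contrapT; exact: H.
  rewrite (bigD1 i)//=; apply/esym/eqP; rewrite !mulf_eq0; apply/orP; left.
  case: ltP => h1; last by rewrite eqxx.
  case: ltP => h2; last by rewrite eqxx orbT.
  by exfalso; apply: Hi; rewrite ltr_norml; apply/andP; split; lra.
rewrite /box_bump; elim: (index_enum _) => [|i s IH].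
  by rewrite big_nil; under eq_fun do rewrite big_nil; exact: cvg_cst.
rewrite big_cons; under eq_fun do rewrite big_cons.
by apply: cvgM IH; apply: cvgM; exact: bump_limit.
Qed.

Lemma box_bump01 c r k x : 0 <= box_bump c r k x <= 1.
Proof.
have B (t : R) : 0 <= bump 0 t <= 1 by rewrite bump_ge0 bump0_le1.
rewrite /box_bump; apply/andP; split.
  by apply: prodr_ge0 => i _; rewrite mulr_ge0 ?bump_ge0.
apply: prodr_ile1 => i _; have /andP[? ?] := B (k%:R * (x ord0 i - c ord0 i + r)).
have /andP[? ?] := B (k%:R * (c ord0 i + r - x ord0 i)).
by apply/andP; split; nra.
Qed.

Lemma box_bump_out c r k x : ~ rbox c r x -> box_bump c r k x = 0.
Proof.
move=> xr; have [i Hi] : exists i, ~ (`|c ord0 i - x ord0 i| < r).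
  by apply: contrapT => /forallNP H; apply: xr => i; apply: contrapT; exact: H.
apply/eqP; rewrite /box_bump (bigD1 i)//= !mulf_eq0; apply/orP; left.
have [h1|h1] := leP (x ord0 i - c ord0 i + r) 0.
  by rewrite bump_le0 ?eqxx// mulr_ge0_le0.
have [h2|h2] := leP (c ord0 i + r - x ord0 i) 0.
  by rewrite [bump 0 (_ * (c ord0 i + r - _))]bump_le0 ?eqxx ?orbT// mulr_ge0_le0.
by exfalso; apply: Hi; rewrite ltr_norml; apply/andP; split; lra.
Qed.

Lemma closed_cbox (c : pt) (r : R) : closed (cbox c r).
Proof.
rewrite -(setCK (cbox c r)); apply: open_closedC; apply/rV_openP => x xn.
have [i Hi] : exists i, ~ (`|c ord0 i - x ord0 i| <= r).
  by apply: contrapT => /forallNP H; apply: xn => i; apply: contrapT; exact: H.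
move/negP: Hi; rewrite -ltNge => Hi; exists (`|c ord0 i - x ord0 i| - r); first by rewrite subr_gt0.
move=> y xy yc; have := yc i; have := xy i.
have := ler_normD (c ord0 i - y ord0 i) (y ord0 i - x ord0 i).
rewrite addrA subrK (distrC (y ord0 i)) => h1 h2 h3; lra.
Qed.

Lemma cbox_compact (c : pt) (r : R) : compact (cbox c r).
Proof.
apply: bounded_closed_compact (@closed_cbox c r).
exists (`|c| + `|r|); split; first exact: num_real.
move=> M HM y yc; rewrite /Num.norm /= mx_normrE; apply/bigmax_leP; split=> /=.
  by apply: le_trans (ltW HM); rewrite addr_ge0.
move=> [i j] _ /=; rewrite ord1; apply: le_trans (ltW HM).
have := yc j; have := coord_le_norm c j; have := ler_norm r.
have := ler_normB (c ord0 j) (c ord0 j - y ord0 j); rewrite subKr => h1 h2 h3 h4; lra.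
Qed.

Lemma test_limit_box c r : cbox c r `<=` D -> test_limit (rbox c r).
Proof.
move=> cD; exists (box_bump c r); split=> [k|k x|x].
- apply: (test_of_support (smooth_box_bump c r k) (@cbox_compact c r) cD) => x xc.
  by apply: box_bump_out => xr; apply: xc => i; exact/ltW/xr.
- exact: box_bump01.
- exact: box_bump_limit.
Qed.

Lemma open_test_limits A : open A -> A `<=` D -> exists B : nat -> set pt,
  (forall k, test_limit (B k)) /\ A = \bigcup_k B k.
Proof.
move=> oA AD.
pose b (p : 'rV[rat]_d * rat) : set pt := rbox (map_mx ratr p.1) (ratr p.2).
pose B k : set pt := if unpickle k is Some p then
  if `[< cbox (map_mx ratr p.1) (ratr p.2) `<=` A >] then b p else set0 else set0.
exists B; split=> [k|].
  rewrite /B; case: (unpickle k) => [p|]; last exact: test_limit0.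
  case: asboolP => [pA|_]; last exact: test_limit0.
  by apply: test_limit_box; exact: subset_trans AD.
apply/seteqP; split=> x.
  move=> /(rational_box oA)[c [r [cx cA]]]; exists (pickle (c, r)) => //.
  by rewrite /B pickleK /=; case: asboolP.
move=> [k _]; rewrite /B; case: (unpickle k) => [p|//].
by case: asboolP => // pA px; apply: pA => i; exact/ltW/px.
Qed.

Lemma trace_sigma_algebra (T : Type) (h : pt -> T) (M : set (set pt)) : sigma_algebra D M ->
  sigma_algebra setT [set Y | M (h @^-1` Y `&` D)].
Proof.
move=> [M0 MC MU]; split=> /=.
- by rewrite preimage_set0 set0I.
- move=> Y MY; have := MC _ MY; congr M.
  by apply/seteqP; split=> x /=; [move=> [Dx nx]; split=> //; split=> // Yx; apply: nx|
    move=> [[_ nY] Dx]; split=> // -[]].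
- by move=> F MF; rewrite preimage_bigcup setI_bigcupl; exact: MU.
Qed.

Lemma measurable_generated A : measurable A -> A `<=` D -> <<s D, test_limit >> A.
Proof.
move=> mA AD; set M := <<s D, test_limit >>.
have tD B : test_limit B -> B `<=` D.
  move=> [psi [tpsi _ lim]] x Bx; apply: contrapT => nDx.
  have := lim x; rewrite indicE mem_set//.
  under eq_fun do rewrite (test_out (tpsi _) nDx).
  by move=> /(cvg_unique (@norm_hausdorff _ R) (cvg_cst 0)) /eqP; rewrite eq_sym oner_eq0.
have sM : sigma_algebra D M by exact: smallest_sigma_algebra.
have openM B : open B -> B `<=` D -> M B.
  move=> oB BD; have [F [tF ->]] := open_test_limits oB BD.
  have [_ _ MU] := sM; apply: MU => k; exact: sub_sigma_algebra.
rewrite -(setIidl AD); have sid := trace_sigma_algebra id sM.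
move: A mA {AD}; apply: smallest_sub; first exact: sid.
move=> B; rewrite -bigcup_seq => -[i _ [Y mY <-]] /=; rewrite setTI.
have si := trace_sigma_algebra (fun x : pt => x ord0 i) sM.
have : @measurable _ (measurableTypeR R) `<=` [set Y : set R | M ((fun x : pt => x ord0 i) @^-1` Y `&` D)].
  rewrite [X in X `<=` _]RGenOInfty.measurableE; apply: smallest_sub; first exact: si.
  move=> Z [a ->] /=; apply: openM; last exact: subIsetr.
  apply: openI => //; apply/rV_openP => x /=; rewrite in_itv/= andbT => xa.
  exists (x ord0 i - a); first by rewrite subr_gt0.
  by move=> y /(_ i); rewrite ltr_norml in_itv/= andbT => /andP[? ?]; lra.
by move=> /(_ Y mY).
Qed.

Definition dense f := sqi f /\ forall e, 0 < e -> exists phi, test_fun D phi /\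
  l2sq (fun x => f x - phi x) < e.

Lemma denseD f g : dense f -> dense g -> dense (fun x => f x + g x).
Proof.
move=> [sf df] [sg dg]; split=> [|e e0]; first exact: sqiD.
have [u [tu Hu]] := df (e / 4) ltac:(lra); have [v [tv Hv]] := dg (e / 4) ltac:(lra).
exists (fun x => u x + v x); split; first exact: testD.
have := l2sqD mD (sqiB mD sf (test_sqi oD bD tu)) (sqiB mD sg (test_sqi oD bD tv)).
have -> : (fun x => f x - u x + (g x - v x)) = (fun x => f x + g x - (u x + v x)).
  by apply/funext => x; ring.
move=> h; lra.
Qed.

Lemma denseZ a f : dense f -> dense (fun x => a * f x).
Proof.
move=> [sf df]; split=> [|e e0]; first exact: sqiZ.
have a0 : 0 < a ^+ 2 + 1 by rewrite ltr_wpDl ?sqr_ge0.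
have [u [tu Hu]] := df (e / (a ^+ 2 + 1)) (divr_gt0 e0 a0).
exists (fun x => a * u x); split; first exact: testZ.
have := l2sqZ mD a (sqiB mD sf (test_sqi oD bD tu)).
have -> : (fun x => a * (f x - u x)) = (fun x => a * f x - a * u x).
  by apply/funext => x; ring.
move=> ->; rewrite ltr_pdivlMr// in Hu; apply: le_lt_trans Hu.
by rewrite mulrC ler_wpM2l ?l2sq_ge0// lerDl.
Qed.

Lemma dense_limit (F : nat -> pt -> R) f g : (forall k, dense (F k)) ->
  measurable_fun D f -> sqi g -> (forall k x, D x -> `|F k x - f x| <= g x) ->
  (forall x, D x -> F ^~ x @ \oo --> f x) -> dense f.
Proof.
move=> dF mf sg Fg Ff.
have mF k : measurable_fun D (F k) by have [[]] := dF k.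
have sB : sqi (fun x => f x - F 0%N x).
  apply: (sqi_dominated mD) sg; first exact: measurable_funB.
  move=> x Dx; rewrite distrC; apply: le_trans (Fg 0%N x Dx) (ler_norm _).
have sf : sqi f.
  have := sqiD mD sB (dF 0%N).1; congr (sqi _).
  by apply/funext => x; rewrite subrK.
split=> // e e0; have [N HN] := l2sq_dominated mD mF mf sg Fg Ff (e := e / 4) ltac:(lra).
have := HN N (leqnn N) => {}HN; have [sN dN] := dF N.
have [u [tu Hu]] := dN (e / 4) ltac:(lra); exists u; split=> //.
have := l2sqD mD (sqiZ mD (-1) (sqiB mD sN sf)) (sqiB mD sN (test_sqi oD bD tu)).
rewrite (l2sqZ mD _ (sqiB mD sN sf)).
have -> : (fun x => -1 * (F N x - f x) + (F N x - u x)) = (fun x => f x - u x).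
  by apply/funext => x; ring.
by rewrite sqrrN expr1n mul1r => h; lra.
Qed.

(** Dynkin: the limits of test functions in test_limit form a pi-system that
    generates the measurable subsets of [D], and the sets with an approximable
    indicator form a lambda-system. *)
Lemma dense_indic A : measurable A -> A `<=` D -> dense (\1_A).
Proof.
move=> mA AD.
have mI (B : set pt) : measurable B -> measurable_fun D (\1_B : pt -> R).
  by move=> mB; exact: measurable_indic.
have dtest B : measurable B -> test_limit B -> dense (\1_B).
  move=> mB [psi [tpsi psi01 lim]].
  have sone : sqi (fun=> 1) by apply: (sqi_bounded mD Dfin (K := 1)) => // x _; rewrite normr1.
  apply: (dense_limit (F := psi) _ (mI _ mB) sone _ (fun x _ => lim x)).
    move=> k; split=> [|e e0]; first exact: test_sqi.
    exists (psi k); split=> //; rewrite /(l2sq _).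
    under eq_Rintegral do rewrite subrr expr0n /=.
    by rewrite Rintegral_cst ?mul0r.
  move=> k x Dx; have /andP[? ?] := psi01 k x; rewrite indicE ler_norml.
  by case: (x \in B) => /=; apply/andP; split; lra.
pose H : set (set pt) := [set B | [/\ B `<=` D, measurable B & dense (\1_B)]].
suff : <<s D, test_limit >> `<=` H by move=> /(_ _ (measurable_generated mA AD))[].
have Hincr (F : nat -> set pt) : nondecreasing_seq F -> (forall k, H (F k)) -> H (\bigcup_k F k).
  move=> ndF HF; split; first by apply: bigcup_sub => k _; have [] := HF k.
    by apply: bigcupT_measurable => k; have [] := HF k.
  have mU : measurable (\bigcup_k F k) by apply: bigcupT_measurable => k; have [] := HF k.
  have sone : sqi (fun=> 1) by apply: (sqi_bounded mD Dfin (K := 1)) => // x _; rewrite normr1.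
  apply: (dense_limit (F := fun k => \1_(F k)) _ (mI _ mU) sone).
  - by move=> k; have [] := HF k.
  - move=> k x _; rewrite !indicE.
    by do 2 case: (_ \in _) => /=; rewrite ?subrr ?subr0 ?sub0r ?normrN ?normr0 ?normr1.
  - move=> x _; have [[k _ Fx]|nx] := pselect ((\bigcup_k F k) x).
      apply: cvg_near_cst; exists k => // m /= km; rewrite !indicE !mem_set//.
        by exists k.
      by have /subsetPset := ndF _ _ km; apply.
    apply: cvg_near_cst; apply: nearW => m; rewrite !indicE !memNset// => Fx.
    by apply: nx; exists m.
have mtest B : test_limit B -> measurable B.
  move=> [psi [tpsi _ lim]].
  have mB : measurable_fun setT (\1_B : pt -> R).
    apply: (measurable_fun_cvg (h := psi)) => //.
    by move=> k; apply: smooth_measurable; exact: test_smooth (tpsi k).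
  have -> : B = (\1_B : pt -> R) @^-1` [set 1%R].
    apply/seteqP; split=> x /=; rewrite indicE; first by move=> Bx; rewrite mem_set.
    by case: (boolP (x \in B)) => [/set_mem //|_ /eqP]; rewrite eq_sym oner_eq0.
  by rewrite -[X in measurable X]setTI; apply: mB => //; exact: measurable_set1.
have tD B : test_limit B -> B `<=` D.
  move=> [psi [tpsi _ lim]] x Bx; apply: contrapT => nDx.
  have := lim x; rewrite indicE mem_set//.
  under eq_fun do rewrite (test_out (tpsi _) nDx).
  by move=> /(cvg_unique (@norm_hausdorff _ R) (cvg_cst 0)) /eqP; rewrite eq_sym oner_eq0.
apply: lambda_system_subset.
- by move=> B C; exact: test_limitI.
- split.
  + by move=> B [].
  + have [F [tF DF]] := open_test_limits oD (@subset_refl _ D).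
    rewrite DF -bigcup_bigsetU_bigcup; apply: Hincr; first by move=> a b ab; exact/subsetPset/subset_bigsetU.
    move=> k; have tk : test_limit (\big[setU/set0]_(i < k.+1) F i).
      by elim/big_rec : _ => [|i B _]; [exact: test_limit0|exact: test_limitU].
    by split; [exact: tD|exact: mtest|apply: dtest => //; exact: mtest].
  + move=> B C CB [BD mB dB] [CD mC dC]; split.
    * by apply: subset_trans BD; exact: subDsetl.
    * exact: measurableD.
    * have -> : (\1_(B `\` C) : pt -> R) = (fun x => \1_B x + -1 * \1_C x).
        apply/funext => x; rewrite !indicE in_setD.
        case: (boolP (x \in C)) => xC /=.
          by rewrite andbF (mem_set (CB x (set_mem xC))) mulN1r subrr.
        by rewrite andbT mulr0 addr0.
      by apply: denseD => //; exact: denseZ.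
  + by move=> F ndF HF; exact: Hincr.
- by move=> B tB; split; [exact: tD|exact: mtest|apply: dtest => //; exact: mtest].
- apply: smallest_sub tD; split => [|B BD|F FD].
  + exact: sub0set.
  + exact: subDsetl.
  + by apply: bigcup_sub => k _; exact: FD.
Qed.

(** Nonnegative functions are monotone limits of simple functions. *)
Lemma dense_nonneg f : sqi f -> (forall x, D x -> 0 <= f x) -> dense f.
Proof.
move=> sf f0; have [mf _] := sf.
have mEf : measurable_fun D (EFin \o f) by exact/measurable_EFinP.
pose F := nnsfun_approx mD mEf.
have F0 x : D x -> (0 <= (EFin \o f) x)%E by move=> Dx; rewrite /= lee_fin f0.
have Ff k x : D x -> 0 <= F k x <= f x.
  move=> Dx; rewrite fun_ge0 /=; have := le_approx k F0 Dx.
  by rewrite -nnsfun_approxE lee_fin.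
apply: (dense_limit (F := fun k => (F k : pt -> R) \_ D) (g := f)) => //.
- move=> k; have -> : (F k : pt -> R) \_ D = (fun x => \sum_(y \in range (F k)) y * \1_(F k @^-1` [set y] `&` D) x).
    apply/funext => x; rewrite patchE; case: ifPn => xD.
      rewrite [LHS]fimfunE; apply: eq_fsbigr => y _; rewrite !indicE in_setI xD andbT //.
    by rewrite fsbig1// => y _; rewrite indicE in_setI (negPf xD) andbF mulr0.
  under eq_fun do rewrite fsbig_finite//=.
  elim: (finmap.enum_fset _) => [|y s IH].
    under eq_fun do rewrite big_nil.
    have -> : (fun=> 0) = (fun x : pt => 0 * \1_D x) :> (pt -> R) by apply/funext => x; rewrite mul0r.
    by apply: denseZ; exact: dense_indic.
  under eq_fun do rewrite big_cons.
  apply: denseD IH; apply: denseZ; apply: dense_indic; last exact: subIsetr.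
  by apply: measurableI => //; exact: measurable_funPTI.
- move=> k x Dx; rewrite patchE mem_set//; have /andP[? ?] := Ff k x Dx.
  by rewrite ler_norml; apply/andP; split; lra.
- move=> x Dx; rewrite (_ : (fun k => _) = fun k => F k x); last first.
    by apply/funext => k; rewrite patchE mem_set.
  have := cvg_nnsfun_approx mD mEf F0 Dx.
  by move=> /fine_cvg.
Qed.

Lemma test_dense f : sqi f -> forall e, 0 < e -> exists phi, test_fun D phi /\
  l2sq (fun x => f x - phi x) < e.
Proof.
move=> sf; have [mf _] := sf; suff [] : dense f by [].
have spos : sqi (fun x => Num.max (f x) 0).
  apply: (sqi_dominated mD) sf; first exact: measurable_maxr.
  by move=> x _; case: (leP (f x) 0) => ?; rewrite ?normr0.
have sneg : sqi (fun x => Num.max (- f x) 0).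
  apply: (sqi_dominated mD) sf; first by apply: measurable_maxr => //; exact: measurableT_comp.
  by move=> x _; case: (leP (- f x) 0) => ?; rewrite ?normr0 ?normrN.
have -> : f = (fun x => Num.max (f x) 0 + -1 * Num.max (- f x) 0).
  by apply/funext => x; case: (leP (f x) 0); case: (leP (- f x) 0) => ? ?; lra.
apply: denseD; [|apply: denseZ]; apply: dense_nonneg => // x _; by rewrite le_max lexx orbT.
Qed.
End density.

(** * The complex space of square integrable functions *)

Section completeness.
Context {R : realType} {U : zmodType}.
Local Notation C := R[i].
Variables (W : set U) (sc : C -> U -> U) (ip : U -> U -> C).

Definition cauchy_seq (x : nat -> U) := forall e, 0 < e -> exists N, forall m k,
  (N <= m)%N -> (N <= k)%N -> sip_norm ip (x m - x k) < e.

Definition converges (x : nat -> U) y := forall e, 0 < e -> exists N, forall k,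
  (N <= k)%N -> sip_norm ip (x k - y) < e.

Definition complete := forall x, (forall k, W (x k)) -> cauchy_seq x ->
  exists2 y, W y & converges x y.

Hypothesis HS : semi_ip W sc ip.

(** A Cauchy sequence has a subsequence with geometrically small increments. *)
Lemma complete_of_rapid :
  (forall x, (forall k, W (x k)) ->
     (forall m k, (m <= k)%N -> sip_norm ip (x m - x k) <= 2^-1 ^+ m) ->
     exists2 y, W y & converges x y) -> complete.
Proof.
move=> H x Wx cx.
have /choice[N HN] (k : nat) : exists N, forall m j, (N <= m)%N -> (N <= j)%N ->
    sip_norm ip (x m - x j) < 2^-1 ^+ k by apply: cx; rewrite exprn_gt0.
pose M k := (k + \sum_(j < k.+1) N j)%N.
have NM j k : (j <= k)%N -> (N j <= M k)%N.
  move=> jk; apply: leq_trans (leq_addl _ _); have jk' : (j < k.+1)%N by [].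
  by rewrite (bigD1 (Ordinal jk')) //= leq_addr.
have [||y Wy Hy] := H (fun k => x (M k)).
- by move=> k; exact: Wx.
- move=> m k mk; apply/ltW/HN; [exact: NM (leqnn m)|exact: NM].
exists y => // e e0.
have [N1 HN1] := cx (e / 2) (divr_gt0 e0 (ltr0n _ 2)).
have [N2 HN2] := Hy (e / 2) (divr_gt0 e0 (ltr0n _ 2)).
exists (maxn N1 N2) => k; rewrite geq_max => /andP[k1 k2].
apply: le_lt_trans (sip_norm_dist HS (Wx k) (Wx (M k)) Wy) _.
have := HN2 k k2; have := HN1 k (M k) k1 (leq_trans k1 (leq_addr _ _)); lra.
Qed.
End completeness.

Section semi_ip_sub.
Context {R : realType} {U : zmodType}.
Local Notation C := R[i].
Variables (W V : set U) (sc : C -> U -> U) (ip : U -> U -> C).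
Hypothesis HS : semi_ip W sc ip.

Lemma semi_ip_sub : V `<=` W -> V 0 -> (forall a f g, V f -> V g -> V (sc a f + g)) ->
  semi_ip V sc ip.
Proof.
move=> VW V0 Vlin; split=> //; do ?[exact: (sip_sc1 HS)|exact: (sip_scN1 HS)|exact: (sip_sc0 HS)].
- by move=> a f g h /VW Wf /VW Wg /VW Wh; exact: (sip_lin HS).
- by move=> f g /VW Wf /VW Wg; exact: (sip_conj HS).
- by move=> f /VW; exact: (sip_ge0 HS).
Qed.

Lemma sip_null_l f g h : W f -> W g -> W h -> sip_norm ip (f - g) = 0 -> ip f h = ip g h.
Proof.
move=> Wf Wg Wh fg; apply/eqP; rewrite -subr_eq0 -(sipBl HS)//.
by rewrite (sip_norm0_ip HS (sipWB HS Wf Wg) Wh).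
Qed.

Lemma sip_null_r f g h : W f -> W g -> W h -> sip_norm ip (f - g) = 0 -> ip h f = ip h g.
Proof.
move=> Wf Wg Wh fg; rewrite (sip_conj HS Wf Wh) (sip_conj HS Wg Wh).
by rewrite (sip_null_l Wf Wg Wh fg).
Qed.

Lemma sip_norm_null f g : W f -> W g -> sip_norm ip (f - g) = 0 -> sip_norm ip f = sip_norm ip g.
Proof.
move=> Wf Wg fg; congr (Num.sqrt (complex.Re _)).
by rewrite (sip_null_l Wf Wg Wf fg) (sip_null_r Wf Wg Wg fg).
Qed.
End semi_ip_sub.

Section real_products.
Context {disp : measure_display} {T : measurableType disp} {R : realType}.
Variables (mu : {measure set T -> \bar R}) (D : set T).
Hypotheses (mD : measurable D) (Dfin : (mu D < +oo)%E).
Implicit Types (f g h : T -> R).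

Definition rip f g : R := \int[mu]_(x in D) (f x * g x).

Lemma ripC f g : rip f g = rip g f.
Proof. by apply: eq_Rintegral => x _; rewrite mulrC. Qed.

Lemma rip_lin a b f g h : sqi mu D f -> sqi mu D g -> sqi mu D h ->
  rip (fun x => a * f x + b * g x) h = a * rip f h + b * rip g h.
Proof.
move=> sf sg sh; have i1 := sqi_prod mD sf sh; have i2 := sqi_prod mD sg sh.
rewrite /rip -(RintegralZl a mD i1) -(RintegralZl b mD i2).
rewrite -(RintegralD mD (integrable_scale mD a i1) (integrable_scale mD b i2)).
by apply: eq_Rintegral => x _; rewrite mulrDl !mulrA.
Qed.

Lemma eq_rip f f' g g' : {in D, f =1 f'} -> {in D, g =1 g'} -> rip f g = rip f' g'.
Proof. by move=> ff gg; apply: eq_Rintegral => x xD; rewrite ff// gg. Qed.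
End real_products.

Section complex_l2.
Context {R : realType} {d : nat}.
Local Notation pt := 'rV[R]_d.
Local Notation C := R[i].
Local Notation fct := ('rV[R]_d -> R[i]).
Local Notation mu := (lebesgue_rV d).

Definition bdomain (D : set pt) := open D /\ bounded_set D.

Variable D : set pt.
Hypothesis hD : bdomain D.
Implicit Types (u v w f g : fct) (a : C).
Let oD := hD.1.
Let bD := hD.2.
Let mD := measurable_domain oD.
Let Dfin := domain_fin oD bD.
Local Notation sqi := (sqi mu D).
Local Notation l2sq := (l2sq mu D).
Local Notation rip := (rip mu D).
Local Notation re u := (fun x => Re (u x)).
Local Notation im u := (fun x => Im (u x)).

Definition cscale a u : fct := fun x => a * u x.

Let msq u : measurable_fun D (re u) -> measurable_fun D (im u) ->
  measurable_fun D (fun x => (Normc.normc (u x) ^+ 2)%:E).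
Proof.
move=> mr mi; apply/measurable_EFinP.
have -> : (fun x => normc (u x) ^+ 2) = (fun x => Re (u x) ^+ 2 + Im (u x) ^+ 2).
  by apply/funext => x; rewrite normcE2.
by apply: measurable_funD; exact: measurable_funX.
Qed.

Let mEsq f : measurable_fun D (re f) -> measurable_fun D (fun x => (Re (f x) ^+ 2)%:E).
Proof. by move=> mf; apply/measurable_EFinP; exact: measurable_funX. Qed.

Lemma L2P u : L2 D u <-> sqi (re u) /\ sqi (im u).
Proof.
split=> [[mr mi foo]|[[mr ro] [mi io]]].
  split; split=> //; apply: le_lt_trans foo; apply: ge0_le_integral => //.
  - by move=> x _; rewrite lee_fin sqr_ge0.
  - by apply/measurable_EFinP; exact: measurable_funX.
  - exact: msq.
  - by move=> x _; rewrite lee_fin normcE2 lerDl sqr_ge0.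
  - by move=> x _; rewrite lee_fin sqr_ge0.
  - by apply/measurable_EFinP; exact: measurable_funX.
  - exact: msq.
  - by move=> x _; rewrite lee_fin normcE2 lerDr sqr_ge0.
split=> //; have := integrable_sum2 mD (sqi_integrable2 (conj mr ro)) (sqi_integrable2 (conj mi io)).
move=> /integrableP[_]; apply: le_lt_trans; rewrite le_eqVlt; apply/orP; left; apply/eqP.
apply: eq_integral => x _ /=; rewrite normcE2 ger0_norm//.
by rewrite addr_ge0 ?sqr_ge0.
Qed.

Lemma Re_l2ip u v : L2 D u -> L2 D v ->
  Re (l2ip D u v) = rip (re u) (re v) + rip (im u) (im v).
Proof.
move=> /L2P[ru iu] /L2P[rv iv]; rewrite /l2ip /cintegral /= /rip.
rewrite -(RintegralD mD (sqi_prod mD ru rv) (sqi_prod mD iu iv)).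
by apply: eq_Rintegral => x _; rewrite cReM cRe_conj cIm_conj mulrN opprK.
Qed.

Lemma Im_l2ip u v : L2 D u -> L2 D v ->
  Im (l2ip D u v) = rip (im u) (re v) - rip (re u) (im v).
Proof.
move=> /L2P[ru iu] /L2P[rv iv]; rewrite /l2ip /cintegral /= /rip.
rewrite -(RintegralB mD (sqi_prod mD iu rv) (sqi_prod mD ru iv)).
by apply: eq_Rintegral => x _; rewrite cImM cRe_conj cIm_conj mulrN addrC.
Qed.

Lemma L2_lin a u v : L2 D u -> L2 D v -> L2 D (cscale a u + v).
Proof.
move=> /L2P[ru iu] /L2P[rv iv]; apply/L2P; split.
- have -> : re (cscale a u + v) =
    (fun x => Re a * Re (u x) + (- Im a * Im (u x) + Re (v x))).
    by apply/funext => x; rewrite /cscale /= ReD cReM mulNr addrA.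
  by do ![apply: sqiD => //|exact: sqiZ].
- have -> : im (cscale a u + v) =
    (fun x => Re a * Im (u x) + (Im a * Re (u x) + Im (v x))).
    by apply/funext => x; rewrite /cscale /= ImD cImM addrA.
  by do ![apply: sqiD => //|exact: sqiZ].
Qed.

Lemma L2_0 : L2 D 0.
Proof.
have s0 : sqi (fun=> 0) by apply: (sqi_bounded mD Dfin (K := 0)) => // x _; rewrite normr0.
by apply/L2P.
Qed.

Lemma L2_sip : semi_ip (L2 D) cscale (l2ip D).
Proof.
split.
- by move=> f; apply/funext => x; rewrite /cscale mul1r.
- by move=> f; apply/funext => x; rewrite /cscale mulN1r.
- by move=> a; apply/funext => x; rewrite /cscale mulr0.
- exact: L2_0.
- by move=> a f g; exact: L2_lin.
- move=> a f g h Lf Lg Lh; have Ll := L2_lin a Lf Lg.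
  have [[rf jf] [rg jg] [rh jh]] := And3 ((L2P f).1 Lf) ((L2P g).1 Lg) ((L2P h).1 Lh).
  have E1 k : sqi k -> rip (re (cscale a f + g)) k =
      Re a * rip (re f) k + (- Im a * rip (im f) k + rip (re g) k).
    move=> sk; have s2 : sqi (fun x => - Im a * Im (f x) + 1 * Re (g x)).
      by apply: (sqiD mD); exact: sqiZ.
    transitivity (rip (fun x => Re a * Re (f x) + 1 * (- Im a * Im (f x) + 1 * Re (g x))) k).
      by apply: eq_rip => // x _; rewrite /cscale /= ReD cReM; ring.
    by rewrite (rip_lin mD _ _ rf s2 sk) (rip_lin mD _ _ jf rg sk) !mul1r.
  have E2 k : sqi k -> rip (im (cscale a f + g)) k =
      Re a * rip (im f) k + (Im a * rip (re f) k + rip (im g) k).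
    move=> sk; have s2 : sqi (fun x => Im a * Re (f x) + 1 * Im (g x)).
      by apply: (sqiD mD); exact: sqiZ.
    transitivity (rip (fun x => Re a * Im (f x) + 1 * (Im a * Re (f x) + 1 * Im (g x))) k).
      by apply: eq_rip => // x _; rewrite /cscale /= ImD cImM; ring.
    by rewrite (rip_lin mD _ _ jf s2 sk) (rip_lin mD _ _ rf jg sk) !mul1r.
  apply: complexP.
    by rewrite ReD cReM !Re_l2ip// Im_l2ip// !E1// !E2//; ring.
  by rewrite ImD cImM !Im_l2ip// Re_l2ip// !E1// !E2//; ring.
- move=> f g Lf Lg; apply: complexP.
    by rewrite cRe_conj !Re_l2ip// ripC [rip (im g) _]ripC.
  by rewrite cIm_conj !Im_l2ip// opprB ripC; congr (_ - _); rewrite ripC.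
- move=> f Lf; rewrite Re_l2ip// addr_ge0//; apply: Rintegral_ge0 => x _; rewrite -expr2 sqr_ge0//.
Qed.

Local Notation nrm := (sip_norm (l2ip D)).

Lemma l2norm2 u : L2 D u -> nrm u ^+ 2 = l2sq (re u) + l2sq (im u).
Proof.
by move=> Lu; rewrite (sip_norm2 L2_sip)// Re_l2ip//.
Qed.

Lemma l2normE u : L2 D u -> l2norm D u = nrm u.
Proof.
move=> /[dup] Lu /L2P[ru iu]; rewrite /l2norm /sip_norm; congr Num.sqrt.
rewrite Re_l2ip// /rip -(RintegralD mD (sqi_prod mD ru ru) (sqi_prod mD iu iu)).
by apply: eq_Rintegral => x _; rewrite normcE2 !expr2.
Qed.

Lemma L2_complete : complete (L2 D) (l2ip D).
Proof.
apply: complete_of_rapid L2_sip _ => x Lx rx.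
have E m k : sqi (fun y => Re (x m y) - Re (x k y)) /\ sqi (fun y => Im (x m y) - Im (x k y)).
  have /L2P[rm jm] := Lx m; have /L2P[rk jk] := Lx k.
  by split; exact: (sqiB mD).
have B m k : (m <= k)%N -> l2sq (fun y => Re (x m y) - Re (x k y)) <= 4^-1 ^+ m /\
    l2sq (fun y => Im (x m y) - Im (x k y)) <= 4^-1 ^+ m.
  move=> mk; have := rx m k mk; rewrite -(@ler_pXn2r _ 2)// ?nnegrE ?sip_norm_ge0 ?exprn_ge0//.
  rewrite l2norm2; last exact: (sipWB L2_sip).
  have -> : 2^-1 ^+ m ^+ 2 = 4^-1 ^+ m :> R.
    by rewrite -exprM mulnC exprM expr2 -invfM -natrM.
  have -> : re (x m - x k) = (fun y => Re (x m y) - Re (x k y)).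
    by apply/funext => y; rewrite /= ReB.
  have -> : im (x m - x k) = (fun y => Im (x m y) - Im (x k y)).
    by apply/funext => y; rewrite /= ImB.
  have := l2sq_ge0 mu D (fun y => Re (x m y) - Re (x k y)).
  have := l2sq_ge0 mu D (fun y => Im (x m y) - Im (x k y)).
  by move=> h1 h2 h3; split; lra.
have p0 m : 0 <= 4^-1 ^+ m :> R by rewrite exprn_ge0.
have [] := @rapid_cauchy_limit _ _ _ mu D mD Dfin (fun k y => Re (x k y)).
- by move=> k; have /L2P[] := Lx k.
- move=> k; have [b _] := B k k.+1 (leqnSn k); apply: le_trans b.
  by rewrite le_eqVlt; apply/orP; left; apply/eqP; apply: eq_Rintegral => y _; rewrite -sqrrN opprB.
- by move=> m k mk; have [b _] := B m k mk; apply: le_trans b _; have := p0 m; lra.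
move=> f sf Hf.
have [] := @rapid_cauchy_limit _ _ _ mu D mD Dfin (fun k y => Im (x k y)).
- by move=> k; have /L2P[] := Lx k.
- move=> k; have [_ b] := B k k.+1 (leqnSn k); apply: le_trans b.
  by rewrite le_eqVlt; apply/orP; left; apply/eqP; apply: eq_Rintegral => y _; rewrite -sqrrN opprB.
- by move=> m k mk; have [_ b] := B m k mk; apply: le_trans b _; have := p0 m; lra.
move=> g sg Hg.
pose u : fct := fun y => f y +i* g y.
have Lu : L2 D u by apply/L2P.
exists u => // e e0.
have e20 : 0 < e ^+ 2 / 8 by rewrite divr_gt0 ?exprn_gt0.
have [N _ HN] : \forall k \near \oo, (4^-1 ^+ k : R) < e ^+ 2 / 8.
  have c0 : (fun k => 4^-1 ^+ k : R) @ \oo --> (0 : R).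
    by apply: cvg_expr; rewrite ger0_norm ?invf_lt1 ?ltr1n.
  by have /cvgrPdist_lt /(_ _ e20) := c0; apply: filterS => k; rewrite sub0r normrN ger0_norm.
exists N => k Nk; rewrite -(@ltr_pXn2r _ 2)// ?nnegrE ?sip_norm_ge0 ?(ltW e0)//.
rewrite l2norm2; last exact: (sipWB L2_sip).
have -> : re (x k - u) = (fun y => Re (x k y) - f y) by apply/funext => y; rewrite /= ReB.
have -> : im (x k - u) = (fun y => Im (x k y) - g y) by apply/funext => y; rewrite /= ImB.
have := Hf k; have := Hg k; have := HN k Nk; set p := 4^-1 ^+ k => /= h1 h2 h3; lra.
Qed.

Lemma ctest_L2 phi : ctest_fun D phi -> L2 D phi.
Proof. by move=> [tr ti]; apply/L2P; split; exact: test_sqi. Qed.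

Lemma ctest_dense u : L2 D u -> forall e, 0 < e -> exists phi, ctest_fun D phi /\ nrm (u - phi) < e.
Proof.
move=> Lu e e0; have /L2P[ru iu] := Lu.
have e20 : 0 < e ^+ 2 / 2 by rewrite divr_gt0 ?exprn_gt0.
have [f [tf Hf]] := test_dense oD bD ru e20.
have [g [tg Hg]] := test_dense oD bD iu e20.
exists (fun x => f x +i* g x); have tc : ctest_fun D (fun x => f x +i* g x) by [].
split=> //; rewrite -(@ltr_pXn2r _ 2)// ?nnegrE ?sip_norm_ge0 ?(ltW e0)//.
rewrite l2norm2; last by apply: (sipWB L2_sip) => //; exact: ctest_L2.
have -> : re (u - (fun x => f x +i* g x)) = (fun y => Re (u y) - f y).
  by apply/funext => y; rewrite /= ReB.
have -> : im (u - (fun x => f x +i* g x)) = (fun y => Im (u y) - g y).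
  by apply/funext => y; rewrite /= ImB.
lra.
Qed.

Definition rfun (phi : pt -> R) : fct := fun x => (phi x)%:C.

Lemma ctest_rfun phi : test_fun D phi -> ctest_fun D (rfun phi).
Proof. by move=> tp; split; [exact: tp|exact: test0]. Qed.

Lemma cfunE u : u = rfun (re u) + cscale 'i (rfun (im u)).
Proof.
apply/funext => x; change (u x = (Re (u x))%:C + 'i * (Im (u x))%:C).
by apply: complexP; rewrite ?ReD ?ImD ?cReM ?cImM /= ?mul0r ?mul1r ?mulr0 ?subr0 ?addr0 ?add0r.
Qed.

Lemma l2_fundamental u : L2 D u -> (forall phi, test_fun D phi -> l2ip D u (rfun phi) = 0) ->
  nrm u = 0.
Proof.
move=> Lu u0.
have uc phi : ctest_fun D phi -> l2ip D u phi = 0.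
  move=> [tr ti]; have Lr := ctest_L2 (ctest_rfun tr); have Li := ctest_L2 (ctest_rfun ti).
  rewrite (cfunE phi) (sipDr L2_sip)//; last exact: (sipWZ L2_sip).
  by rewrite (sipZr L2_sip)// !u0// mulr0 addr0.
have N0 := sip_norm_ge0 (l2ip D) u.
apply/eqP; rewrite eq_le N0 andbT; apply/ler_addgt0Pl => e e0; rewrite addr0.
have [phi [tp Hp]] := ctest_dense Lu e0; have Lp := ctest_L2 tp.
have : nrm u ^+ 2 <= nrm u * nrm (u - phi).
  rewrite (sip_norm2 L2_sip)// -[l2ip D u u]subr0 -(uc phi tp) -(sipBr L2_sip)//.
  apply: le_trans (ler_norm _) _; apply: le_trans (Re_le_normc _) _.
  by apply: (sip_CS L2_sip) => //; exact: (sipWB L2_sip).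
rewrite expr2; have [->|n0] := eqVneq (nrm u) 0; first by move=> _; exact: ltW.
by rewrite ler_pM2l ?lt_def ?n0// => le; exact: ltW (le_lt_trans le Hp).
Qed.

Lemma pairE u phi : cintegral D (fun x => u x * (phi x)%:C) = l2ip D u (rfun phi).
Proof.
by congr cintegral; apply/funext => x; rewrite /rfun; congr (_ * _); apply: complexP; rewrite ?cRe_conj ?cIm_conj /= ?oppr0.
Qed.

Lemma eq_l2ip u v w f : (forall x, D x -> u x = v x) -> (forall x, D x -> w x = f x) ->
  l2ip D u w = l2ip D v f.
Proof.
move=> uv wf; rewrite /l2ip /cintegral.
by congr (_ +i* _); apply: eq_Rintegral => x /set_mem Dx; rewrite uv// wf.
Qed.

Lemma eq_L2 u v : (forall x, D x -> u x = v x) -> L2 D u -> L2 D v.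
Proof.
move=> uv [mr mi foo]; split.
- by apply: eq_measurable_fun mr => x /set_mem Dx; rewrite uv.
- by apply: eq_measurable_fun mi => x /set_mem Dx; rewrite uv.
- by rewrite (eq_integral (fun x => (normc (u x) ^+ 2)%:E))// => x /set_mem Dx; rewrite uv.
Qed.

Lemma nrm_eq_on u v : L2 D u -> (forall x, D x -> u x = v x) -> nrm (u - v) = 0.
Proof.
move=> Lu uv; have Lv := eq_L2 uv Lu.
have -> : nrm (u - v) = nrm 0; last exact: (sip_norm0 L2_sip).
by congr (Num.sqrt (Re _)); apply: eq_l2ip => x Dx; rewrite -[LHS]/(u x - v x) uv// subrr.
Qed.
End complex_l2.

(** * Weak derivatives and Sobolev spaces *)

Section weak_derivatives.
Context {R : realType} {d : nat}.
Local Notation pt := 'rV[R]_d.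
Local Notation C := R[i].
Local Notation fct := ('rV[R]_d -> R[i]).
Local Notation mu := (lebesgue_rV d).
Variable D : set pt.
Hypothesis hD : bdomain D.
Implicit Types (u v w f g : fct) (a : C) (s : seq 'I_d) (k : nat) (phi psi : pt -> R).
Let oD := hD.1.
Let bD := hD.2.
Let LS := L2_sip hD.
Local Notation nrm := (sip_norm (l2ip D)).

Lemma test_L2 phi : test_fun D phi -> L2 D (rfun phi).
Proof. by move=> tp; apply: (ctest_L2 hD); exact: (ctest_rfun tp). Qed.

Lemma wderivP s u g : is_wderiv D s u g <-> forall phi, test_fun D phi ->
  l2ip D u (rfun (partial s phi)) = (-1) ^+ size s * l2ip D g (rfun phi).
Proof. by split=> H phi tp; have := H phi tp; rewrite !pairE. Qed.

Lemma wderiv_uniq s u g f : L2 D g -> L2 D f -> is_wderiv D s u g -> is_wderiv D s u f ->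
  nrm (g - f) = 0.
Proof.
move=> Lg Lf /wderivP Hg /wderivP Hf; apply: (l2_fundamental hD); first exact: (sipWB LS).
move=> phi tp; rewrite (sipBl LS)//; last exact: test_L2.
apply/eqP; rewrite subr_eq0; apply/eqP.
apply: (@mulfI _ ((-1) ^+ size s : C)); first by rewrite signr_eq0.
by rewrite -Hg// Hf.
Qed.

Lemma wderivE s u g : L2 D g -> is_wderiv D s u g ->
  [/\ L2 D (wderiv D s u), is_wderiv D s u (wderiv D s u) & nrm (wderiv D s u - g) = 0].
Proof.
move=> Lg Hg; have [|LW HW] := @xgetPex _ 0 [set f | L2 D f /\ is_wderiv D s u f].
  by exists g.
by split=> //; exact: wderiv_uniq HW Hg.
Qed.

Lemma is_wderiv_lin s a u v f g : L2 D u -> L2 D v -> L2 D f -> L2 D g ->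
  is_wderiv D s u f -> is_wderiv D s v g -> is_wderiv D s (cscale a u + v) (cscale a f + g).
Proof.
move=> Lu Lv Lf Lg /wderivP Hf /wderivP Hg; apply/wderivP => phi tp.
have L1 := test_L2 (test_partial s tp); have L2 := test_L2 tp.
by rewrite !(sip_lin LS)// Hf// Hg// mulrDr mulrCA.
Qed.

Lemma is_wderiv0 s : is_wderiv D s 0 0.
Proof.
apply/wderivP => phi tp.
by rewrite (sip0l LS (test_L2 (test_partial s tp))) (sip0l LS (test_L2 tp)) mulr0.
Qed.

Lemma wderiv_null s u v : L2 D u -> L2 D v -> nrm (u - v) = 0 -> wderiv D s u = wderiv D s v.
Proof.
move=> Lu Lv uv; rewrite /wderiv; congr (xget 0 _); apply/seteqP.
suff H u' v' : L2 D u' -> L2 D v' -> nrm (u' - v') = 0 ->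
    [set g | L2 D g /\ is_wderiv D s u' g] `<=` [set g | L2 D g /\ is_wderiv D s v' g].
  by split; apply: H => //; rewrite (sip_normBC LS).
move=> Lu' Lv' uv' g [Lg /wderivP Hg]; split=> //; apply/wderivP => phi tp.
by rewrite -Hg//; apply/esym/(sip_null_l LS) => //; exact/test_L2/test_partial.
Qed.

(** ** Classical derivatives of test functions *)

Lemma partial_cons i s phi : partial (i :: s) phi = fun x => 'D_(ev i) (partial s phi) x.
Proof. by []. Qed.

Lemma partial_cat s1 s2 phi : partial (s1 ++ s2) phi = partial s1 (partial s2 phi).
Proof. by rewrite /partial foldr_cat. Qed.

Lemma partial_swap i j phi : test_fun D phi -> partial [:: i; j] phi = partial [:: j; i] phi.
Proof.
move=> tp; apply/funext => x; apply: schwarz; first exact: test_smooth tp.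
by move=> s; exact: (test_partials_bounded s tp).
Qed.

Lemma partial_perm s t phi : test_fun D phi -> perm_eq s t -> partial s phi = partial t phi.
Proof.
move=> tp; elim: s t => [|i s IH] t; first by rewrite perm_sym => /perm_nilP ->.
move=> st; have it : i \in t by rewrite -(perm_mem st) mem_head.
case/splitPr: it st => t1 t2; rewrite perm_sym perm_catC /= perm_cons => st.
have {}st : perm_eq s (t1 ++ t2) by rewrite perm_sym perm_catC.
transitivity (partial (i :: t1 ++ t2) phi); first by rewrite !partial_cons (IH _ st).
rewrite -cat1s catA !partial_cat -[partial (i :: t2) phi]/(partial [:: i] (partial t2 phi)).
have := test_partial t2 tp; move: (partial t2 phi) => psi tpsi.
elim: t1 {st} => [//|j t1 IH1].
rewrite -[partial (_ :: _) (partial [:: i] psi)]/(partial [:: j] (partial t1 (partial [:: i] psi))).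
rewrite -IH1 /= -[RHS]/(partial [:: j; i] (partial t1 psi)).
by rewrite -partial_swap//; exact: test_partial.
Qed.

Lemma int_by_parts_seq s psi phi : test_fun D psi -> test_fun D phi ->
  \int[mu]_(x in D) (psi x * partial s phi x) =
  (-1) ^+ size s * \int[mu]_(x in D) (partial s psi x * phi x).
Proof.
elim: s psi => [|i s IH] psi tf tp; first by rewrite expr0 mul1r.
rewrite partial_cons (int_by_parts oD bD i (test_smooth tf) (test_partial s tp)).
rewrite (IH _ (test_partial1 i tf) tp) exprS -mulrA mulN1r; congr (- (_ * _)).
have -> : partial s (fun x => 'D_(ev i) psi x) = partial (i :: s) psi; last by [].
rewrite -[LHS]/(partial s (partial [:: i] psi)) -partial_cat; apply: (partial_perm tf).
by rewrite cats1 perm_rcons.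
Qed.

Definition cpartial s u : fct := fun x =>
  partial s (fun y => Re (u y)) x +i* partial s (fun y => Im (u y)) x.

Lemma ctest_cpartial s u : ctest_fun D u -> ctest_fun D (cpartial s u).
Proof. by move=> [tr ti]; split; exact: test_partial. Qed.

Lemma ctest_wderiv s u : ctest_fun D u -> is_wderiv D s u (cpartial s u).
Proof.
move=> [tr ti] phi tp; rewrite /cintegral.
have E (v : fct) psi : (fun x => Re (v x * (psi x)%:C)) = (fun x => Re (v x) * psi x).
  by apply/funext => x; rewrite cReM /= mulr0 subr0.
have F (v : fct) psi : (fun x => Im (v x * (psi x)%:C)) = (fun x => Im (v x) * psi x).
  by apply/funext => x; rewrite cImM /= mulr0 add0r.
rewrite !E !F !int_by_parts_seq//.
have sgn k : ((-1) ^+ k : C) = ((-1) ^+ k : R)%:C.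
  by rewrite rmorphXn /= rmorphN rmorph1.
by rewrite sgn; apply: complexP; rewrite ?cReM ?cImM /= ?mul0r ?subr0 ?addr0.
Qed.

(** ** Multi-indices *)

Definition mindex_of k s : {ffun 'I_d -> 'I_k.+1} := [ffun i => inord (count_mem i s)].

Lemma count_mindex_seq k (b : {ffun 'I_d -> 'I_k.+1}) i : count_mem i (mindex_seq b) = b i.
Proof.
rewrite /mindex_seq count_flatten -map_comp sumnE big_map big_enum /=.
rewrite (bigD1 i) //= count_nseq /= eqxx mul1n big1 ?addn0// => j ji.
by rewrite count_nseq /= (negPf ji).
Qed.

Lemma size_mindex_seq k (b : {ffun 'I_d -> 'I_k.+1}) : size (mindex_seq b) = mindex_deg b.
Proof.
rewrite /mindex_seq size_flatten /shape -map_comp sumnE big_map big_enum /=.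
by apply: eq_bigr => i _; rewrite size_nseq.
Qed.

Lemma mindex_ofP k s : (size s <= k)%N -> perm_eq (mindex_seq (mindex_of k s)) s.
Proof.
move=> sk; apply/allP => i _ /=; rewrite count_mindex_seq ffunE inordK//.
by rewrite ltnS (leq_trans (count_size _ _)).
Qed.

Lemma mindex_of_deg k s : (size s <= k)%N -> (mindex_deg (mindex_of k s) <= k)%N.
Proof. by move=> sk; rewrite -size_mindex_seq (perm_size (mindex_ofP sk)). Qed.

Lemma is_wderiv_perm s t u g : perm_eq s t -> is_wderiv D s u g -> is_wderiv D t u g.
Proof.
by move=> st H phi tp; rewrite -(perm_size st) -(partial_perm tp st); exact: H.
Qed.

Lemma wderiv_perm s t u : perm_eq s t -> wderiv D s u = wderiv D t u.
Proof.
move=> st; rewrite /wderiv; congr (xget 0 _); apply/seteqP; split=> g [Lg Hg]; split=> //.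
  exact: is_wderiv_perm Hg.
by apply: is_wderiv_perm Hg; rewrite perm_sym.
Qed.

(** ** The inner product of [H^k(D)] *)

Lemma HkW k u s : Hk D k u -> (size s <= k)%N ->
  L2 D (wderiv D s u) /\ is_wderiv D s u (wderiv D s u).
Proof. by move=> [_ H] sk; have [g [Lg Hg]] := H s sk; have [] := wderivE Lg Hg. Qed.

Lemma HkL2 k u : Hk D k u -> L2 D u. Proof. by case. Qed.

Lemma Hk_lin k a u v : Hk D k u -> Hk D k v -> Hk D k (cscale a u + v).
Proof.
move=> Hu Hv; split; first exact: (sip_W LS) (HkL2 Hu) (HkL2 Hv).
move=> s sk; have [L1 W1] := HkW Hu sk; have [L2' W2] := HkW Hv sk.
exists (cscale a (wderiv D s u) + wderiv D s v); split; first exact: (sip_W LS).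
by apply: is_wderiv_lin => //; [exact: HkL2 Hu|exact: HkL2 Hv].
Qed.

Lemma wderiv_lin k a u v s : Hk D k u -> Hk D k v -> (size s <= k)%N ->
  nrm (wderiv D s (cscale a u + v) - (cscale a (wderiv D s u) + wderiv D s v)) = 0.
Proof.
move=> Hu Hv sk; have [L1 W1] := HkW Hu sk; have [L2' W2] := HkW Hv sk.
have Lc := sip_W LS a L1 L2'.
have [] // := wderivE Lc (is_wderiv_lin a (HkL2 Hu) (HkL2 Hv) L1 L2' W1 W2).
Qed.

Lemma Hk_0 k : Hk D k 0.
Proof.
split; first exact: (sip_W0 LS).
by move=> s _; exists 0; split; [exact: (sip_W0 LS)|exact: is_wderiv0].
Qed.

Definition hip k u v : C := \sum_(b : {ffun 'I_d -> 'I_k.+1} | (mindex_deg b <= k)%N)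
  l2ip D (wderiv D (mindex_seq b) u) (wderiv D (mindex_seq b) v).

Let bsize k (b : {ffun 'I_d -> 'I_k.+1}) : (mindex_deg b <= k)%N -> (size (mindex_seq b) <= k)%N.
Proof. by rewrite size_mindex_seq. Qed.

Lemma Hk_sip k : semi_ip (Hk D k) cscale (hip k).
Proof.
split; do ?[exact: (sip_sc1 LS)|exact: (sip_scN1 LS)|exact: (sip_sc0 LS)].
- exact: Hk_0.
- by move=> a f g; exact: Hk_lin.
- move=> a f g h Hf Hg Hh; rewrite /hip mulr_sumr -big_split /=; apply: eq_bigr => b /bsize bk.
  have [L1 _] := HkW Hf bk; have [L2' _] := HkW Hg bk; have [L3 _] := HkW Hh bk.
  have [L4 _] := HkW (Hk_lin a Hf Hg) bk.
  rewrite -(sip_lin LS)//; apply: (sip_null_l LS) => //; first exact: (sip_W LS).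
  exact: wderiv_lin Hf Hg bk.
- move=> f g Hf Hg; rewrite /hip conjc_sum; apply: eq_bigr => b /bsize bk.
  by have [L1 _] := HkW Hf bk; have [L2' _] := HkW Hg bk; exact: (sip_conj LS).
- move=> f Hf; rewrite /hip Re_sum sumr_ge0// => b /bsize bk.
  by have [L1 _] := HkW Hf bk; exact: (sip_ge0 LS).
Qed.

Local Notation hnrm k := (sip_norm (hip k)).

Lemma HnormE k u : Hk D k u -> Hnorm D k u = hnrm k u.
Proof.
move=> Hu; rewrite /Hnorm /sip_norm; congr Num.sqrt; rewrite /hip Re_sum.
apply: eq_bigr => b /bsize bk; have [L1 _] := HkW Hu bk.
by rewrite (l2normE hD)// (sip_norm2 LS).
Qed.

Lemma wderiv_le k u s : Hk D k u -> (size s <= k)%N -> nrm (wderiv D s u) <= hnrm k u.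
Proof.
move=> Hu sk; rewrite -(wderiv_perm u (mindex_ofP sk)).
have Hb := mindex_of_deg sk.
rewrite -(@ler_pXn2r _ 2)// ?nnegrE ?sip_norm_ge0// (sip_norm2 (Hk_sip k))//.
rewrite (sip_norm2 LS (HkW Hu (bsize Hb)).1) /hip Re_sum (bigD1 (mindex_of k s))//=.
rewrite lerDl sumr_ge0// => b /andP[/bsize bk _].
by have [L1 _] := HkW Hu bk; exact: (sip_ge0 LS).
Qed.

Definition mindex_card k : R := #|{ffun 'I_d -> 'I_k.+1}|%:R + 1.

Lemma mindex_card_gt0 k : 0 < mindex_card k.
Proof. by rewrite ltr_wpDl. Qed.

Lemma Hnorm_bound k u B : Hk D k u -> 0 <= B ->
  (forall s, (size s <= k)%N -> nrm (wderiv D s u) <= B) -> hnrm k u <= mindex_card k * B.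
Proof.
move=> Hu B0 HB; have m0 := mindex_card_gt0 k.
rewrite -(@ler_pXn2r _ 2)// ?nnegrE ?sip_norm_ge0// ?mulr_ge0 ?(ltW m0)//.
rewrite (sip_norm2 (Hk_sip k))// /hip Re_sum exprMn.
apply: (@le_trans _ _ (\sum_(b : {ffun 'I_d -> 'I_k.+1}) B ^+ 2)).
  rewrite [leRHS](bigID (fun b => (mindex_deg b <= k)%N)).
  apply: ler_wpDr; first by rewrite sumr_ge0// => b _; rewrite sqr_ge0.
  apply: ler_sum => b /bsize bk; have [L1 _] := HkW Hu bk.
  by rewrite -(sip_norm2 LS)// ler_pXn2r// ?nnegrE ?sip_norm_ge0// HB.
rewrite sumr_const -mulr_natl ler_wpM2r ?sqr_ge0// /mindex_card.
have := ler0n R #|{ffun 'I_d -> 'I_k.+1}|; move: (#|_|%:R : R) => m; nra.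
Qed.

Lemma Hk_le k m u : (k <= m)%N -> Hk D m u -> Hk D k u.
Proof. by move=> km [Lu H]; split=> // s sk; apply: H; exact: leq_trans km. Qed.

Lemma hnrm_le k m u : (k <= m)%N -> Hk D m u -> hnrm k u <= mindex_card k * hnrm m u.
Proof.
move=> km Hu; apply: Hnorm_bound; [exact: Hk_le Hu|exact: sip_norm_ge0|].
by move=> s sk; apply: wderiv_le => //; exact: leq_trans km.
Qed.

Lemma wderiv_nil u : L2 D u -> L2 D (wderiv D [::] u) /\ nrm (wderiv D [::] u - u) = 0.
Proof.
move=> Lu; have [|//] := @wderivE [::] u u Lu.
by move=> phi tp; rewrite expr0 mul1r.
Qed.

Lemma nrm_wderiv_nil u : L2 D u -> nrm (wderiv D [::] u) = nrm u.
Proof. by move=> Lu; have [L1 N] := wderiv_nil Lu; exact: (sip_norm_null LS). Qed.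

Lemma l2_le_hnrm k u : Hk D k u -> nrm u <= hnrm k u.
Proof. by move=> Hu; rewrite -(nrm_wderiv_nil (HkL2 Hu)); exact: wderiv_le. Qed.

Lemma Hk0L2 u : L2 D u -> Hk D 0 u.
Proof.
move=> Lu; split=> // s; rewrite leqn0 => /nilP ->; exists u; split=> //.
by move=> phi tp; rewrite expr0 mul1r.
Qed.

Lemma Hnorm0E u : L2 D u -> Hnorm D 0 u = nrm u.
Proof.
move=> Lu; have Hu := Hk0L2 Lu; rewrite HnormE//; apply/eqP.
rewrite -(@eqrXn2 _ 2) ?sip_norm_ge0// (sip_norm2 (Hk_sip 0))// /hip Re_sum.
have b0 (b : {ffun 'I_d -> 'I_1}) : mindex_deg b = 0%N.
  by rewrite /mindex_deg big1// => i _; rewrite ord1.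
rewrite (eq_bigl xpredT) => [|b]; last by rewrite b0.
rewrite (eq_bigr (fun=> nrm u ^+ 2)); last first.
  move=> b _; have /nilP -> : nilp (mindex_seq b) by rewrite /nilp size_mindex_seq b0.
  by rewrite -(sip_norm2 LS) ?nrm_wderiv_nil//; exact: (wderiv_nil Lu).1.
by rewrite sumr_const card_ffun !card_ord exp1n.
Qed.

(** ** Completeness *)

Lemma is_wderiv_limit s (u g : nat -> fct) v f : (forall k, L2 D (u k)) -> (forall k, L2 D (g k)) ->
  L2 D v -> L2 D f -> (forall k, is_wderiv D s (u k) (g k)) ->
  converges (l2ip D) u v -> converges (l2ip D) g f -> is_wderiv D s v f.
Proof.
move=> Lu Lg Lv Lf H cu cg; apply/wderivP => phi tp.
have L1 := test_L2 tp; have L2' := test_L2 (test_partial s tp).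
apply/eqP; rewrite -subr_eq0 -normc_eq0 eq_le normc_ge0 andbT.
apply/ler_addgt0Pl => e e0; rewrite addr0.
pose A := nrm (rfun phi); pose B := nrm (rfun (partial s phi)).
have A0 : 0 <= A by exact: sip_norm_ge0. have B0 : 0 <= B by exact: sip_norm_ge0.
have q0 : 0 < e / (A + B + 1) by rewrite divr_gt0// ltr_wpDl ?addr_ge0.
have [N1 H1] := cu _ q0; have [N2 H2] := cg _ q0.
set k := maxn N1 N2; have {}H1 := H1 k (leq_maxl _ _); have {}H2 := H2 k (leq_maxr _ _).
have /wderivP Hk := H k.
have -> : l2ip D v (rfun (partial s phi)) - (-1) ^+ size s * l2ip D f (rfun phi) =
    - l2ip D (u k - v) (rfun (partial s phi)) + (-1) ^+ size s * l2ip D (g k - f) (rfun phi).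
  by rewrite !(sipBl LS)// Hk//; ring.
apply: le_trans (le_normcD _ _) _; rewrite normcN Normc.normcM.
have -> : normc ((-1) ^+ size s : C) = 1.
  have -> : ((-1) ^+ size s : C) = ((-1) ^+ size s : R)%:C.
    by rewrite rmorphXn /= rmorphN rmorph1.
  by rewrite normcR normrX normrN1 expr1n.
rewrite mul1r; apply: (@le_trans _ _ (nrm (u k - v) * B + nrm (g k - f) * A)).
  by apply: lerD; apply: (sip_CS LS) => //; exact: (sipWB LS).
have E : (e / (A + B + 1)) * (A + B + 1) = e.
  by rewrite divfK// gt_eqF// ltr_wpDl ?addr_ge0.
move: H1 H2 E; set p := e / _; set x := nrm _; set y := nrm _ => H1 H2 <-.
by have := ltW q0; rewrite -/p => p0; nra.
Qed.

(** Weak derivatives pass to [L2] limits. *)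
Lemma Hk_complete k : complete (Hk D k) (hip k).
Proof.
move=> x Hx cx; have HSk := Hk_sip k.
have cW s : (size s <= k)%N -> exists2 g, L2 D g & converges (l2ip D) (fun j => wderiv D s (x j)) g.
  move=> sk; apply: (L2_complete hD) => [j|e e0]; first exact: (HkW (Hx j) sk).1.
  have [N HN] := cx e e0; exists N => m j mN jN.
  apply: le_lt_trans (HN m j mN jN).
  have -> : nrm (wderiv D s (x m) - wderiv D s (x j)) = nrm (wderiv D s (x m - x j)).
    have [L1 _] := HkW (Hx m) sk; have [L2' _] := HkW (Hx j) sk.
    have [L3 _] := HkW (sipWB HSk (Hx m) (Hx j)) sk.
    apply: (sip_norm_null LS) => //; first exact: (sipWB LS).
    rewrite (sip_normBC LS)//; last exact: (sipWB LS).
    have := wderiv_lin (-1) (Hx j) (Hx m) sk.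
    by rewrite !(sip_scN1 LS) ![- _ + _]addrC.
  by apply: wderiv_le => //; exact: (sipWB HSk).
have [y Ly cy] := cW [::] (leq0n k).
have Wy s g : (size s <= k)%N -> L2 D g -> converges (l2ip D) (fun j => wderiv D s (x j)) g ->
    is_wderiv D s y g.
  move=> sk Lg cg; apply: (is_wderiv_limit (u := fun j => wderiv D [::] (x j))
    (g := fun j => wderiv D s (x j))) => //.
  - by move=> j; exact: (wderiv_nil (HkL2 (Hx j))).1.
  - by move=> j; exact: (HkW (Hx j) sk).1.
  - move=> j; apply/wderivP => phi tp; have [_ /wderivP <-//] := HkW (Hx j) sk.
    have [L1 N1] := wderiv_nil (HkL2 (Hx j)).
    by apply: (sip_null_l LS) => //; [exact: HkL2 (Hx j)|exact/test_L2/test_partial].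
have Hy : Hk D k y.
  by split=> // s sk; have [g Lg cg] := cW s sk; exists g; split=> //; exact: Wy cg.
exists y => // e e0.
have m0 := mindex_card_gt0 k.
have e10 : 0 < e / (mindex_card k + 1) by rewrite divr_gt0// addr_gt0.
have key (b : {ffun 'I_d -> 'I_k.+1}) : exists N, (mindex_deg b <= k)%N -> forall j, (N <= j)%N ->
    nrm (wderiv D (mindex_seq b) (x j - y)) < e / (mindex_card k + 1).
  have [bk|nbk] := boolP (mindex_deg b <= k)%N; last by exists 0%N.
  have sk := bsize bk; have [g Lg cg] := cW _ sk; have [N HN] := cg _ e10.
  exists N => _ j jN; apply: le_lt_trans (HN j jN).
  have [L1 _] := HkW (Hx j) sk; have [L2' _] := HkW Hy sk.
  have [L3 _] := HkW (sipWB HSk (Hx j) Hy) sk.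
  have [_ _ Ng] := wderivE Lg (Wy _ _ sk Lg cg).
  have N1 : nrm (wderiv D (mindex_seq b) (x j - y) -
      (wderiv D (mindex_seq b) (x j) - wderiv D (mindex_seq b) y)) = 0.
    have := wderiv_lin (-1) Hy (Hx j) sk.
    by rewrite !(sip_scN1 LS) ![- _ + _]addrC.
  rewrite (sip_norm_null LS L3 (sipWB LS L1 L2') N1).
  apply: le_trans (sip_norm_dist LS L1 Lg L2') _.
  by rewrite (sip_normBC LS Lg L2') Ng addr0.
have /choice[N HN] := key.
exists (\max_b N b) => j jN; have Hd := sipWB HSk (Hx j) Hy.
apply: (@le_lt_trans _ _ (mindex_card k * (e / (mindex_card k + 1)))).
  apply: Hnorm_bound => // [|s sk]; first exact: ltW.
  rewrite -(wderiv_perm _ (mindex_ofP sk)); apply/ltW/HN; first exact: mindex_of_deg.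
  by apply: leq_trans jN; exact: leq_bigmax.
have E : e / (mindex_card k + 1) * (mindex_card k + 1) = e.
  by rewrite divfK// gt_eqF// addr_gt0.
by move: e10 E; move: (e / _) => t t0 <-; nra.
Qed.

(** ** The space [H^k_0(D)] *)

Lemma ctest_Hk k u : ctest_fun D u -> Hk D k u.
Proof.
move=> tu; split; first exact: ctest_L2.
move=> s _; exists (cpartial s u); split; last exact: ctest_wderiv.
by apply: (ctest_L2 hD); exact: ctest_cpartial.
Qed.

Lemma Hk0P k u : Hk0 D k u <-> Hk D k u /\
  forall e, 0 < e -> exists g, ctest_fun D g /\ hnrm k (u - g) < e.
Proof.
split=> -[Hu H]; split=> // e e0; have [g [tp Hg]] := H e e0; exists g; split=> //;
  by move: Hg; rewrite HnormE//; apply: (sipWB (Hk_sip k)) => //; exact: ctest_Hk.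
Qed.

Lemma Hk0_Hk k u : Hk0 D k u -> Hk D k u. Proof. by case. Qed.

Lemma Hk0L k u : Hk0 D k u -> L2 D u. Proof. by move=> [/HkL2]. Qed.

Lemma ctest_lin a u v : ctest_fun D u -> ctest_fun D v -> ctest_fun D (cscale a u + v).
Proof.
move=> [ur ui] [vr vi]; split.
- have -> : (fun x => Re ((cscale a u + v) x)) =
    (fun x => Re a * Re (u x) + (- Im a * Im (u x) + Re (v x))).
    by apply/funext => x; rewrite /cscale /= ReD cReM mulNr addrA.
  by do ![apply: testD => //|exact: testZ].
- have -> : (fun x => Im ((cscale a u + v) x)) =
    (fun x => Re a * Im (u x) + (Im a * Re (u x) + Im (v x))).
    by apply/funext => x; rewrite /cscale /= ImD cImM addrA.
  by do ![apply: testD => //|exact: testZ].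
Qed.

Lemma ctest0 : ctest_fun D 0. Proof. by split; exact: test0. Qed.

Lemma ctest_Hk0 k u : ctest_fun D u -> Hk0 D k u.
Proof.
move=> tu; apply/Hk0P; split; first exact: ctest_Hk.
by move=> e e0; exists u; split=> //; rewrite subrr (sip_norm0 (Hk_sip k)).
Qed.

Lemma Hk0_lin k a u v : Hk0 D k u -> Hk0 D k v -> Hk0 D k (cscale a u + v).
Proof.
have aux (x y z e : R) : z + x < e / 2 -> y < e / 2 -> 0 <= x -> z + y < e by lra.
move=> /Hk0P[Hu Du] /Hk0P[Hv Dv]; have HSk := Hk_sip k; apply/Hk0P; split; first exact: Hk_lin.
move=> e e0; have c0 : 0 < normc a + 1 by rewrite ltr_wpDl// normc_ge0.
have [f [tf Hf]] := Du (e / 2 / (normc a + 1)) (divr_gt0 (divr_gt0 e0 (ltr0n _ 2)) c0).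
have [g [tg Hg]] := Dv (e / 2) (divr_gt0 e0 (ltr0n _ 2)).
exists (cscale a f + g); split; first exact: ctest_lin.
have -> : cscale a u + v - (cscale a f + g) = cscale a (u - f) + (v - g).
  by apply/funext => x; rewrite /cscale -[LHS]/(a * u x + v x - (a * f x + g x)) -[RHS]/(a * (u x - f x) + (v x - g x)); ring.
have W1 := sipWB HSk Hu (ctest_Hk k tf); have W2 := sipWB HSk Hv (ctest_Hk k tg).
apply: le_lt_trans (sip_normD HSk (sipWZ HSk a W1) W2) _; rewrite (sip_normZ HSk)//.
rewrite ltr_pdivlMr// in Hf.
rewrite mulrDr mulr1 [_ * normc a]mulrC in Hf.
exact: aux Hf Hg (sip_norm_ge0 _ _).
Qed.

Lemma Hk0_sip k : semi_ip (Hk0 D k) cscale (hip k).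
Proof.
apply: (semi_ip_sub (Hk_sip k)); [by move=> u []|exact/ctest_Hk0/ctest0|].
by move=> a f g; exact: Hk0_lin.
Qed.

Lemma Hk0_complete k : complete (Hk0 D k) (hip k).
Proof.
have aux (x y e : R) : x < e / 2 -> y < e / 2 -> x + y < e by lra.
move=> x Hx cx; have HSk := Hk_sip k.
have [y Hy cy] := Hk_complete (fun j => Hk0_Hk (Hx j)) cx.
exists y => //; apply/Hk0P; split=> // e e0; have e20 := divr_gt0 e0 (ltr0n R 2).
have [N HN] := cy _ e20; have /Hk0P[HN1 DN] := Hx N; have [f [tf Hf]] := DN _ e20.
exists f; split=> //; apply: le_lt_trans (sip_norm_dist HSk Hy HN1 (ctest_Hk k tf)) _.
rewrite (sip_normBC HSk Hy HN1); exact: aux (HN N (leqnn N)) Hf.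
Qed.

Lemma Hk0_le k m u : (k <= m)%N -> Hk0 D m u -> Hk0 D k u.
Proof.
move=> km /Hk0P[Hu Du]; apply/Hk0P; split; first exact: Hk_le Hu.
move=> e e0; have [f [tf Hf]] := Du (e / mindex_card k) (divr_gt0 e0 (mindex_card_gt0 k)).
exists f; split=> //; apply: le_lt_trans (hnrm_le km (sipWB (Hk_sip m) Hu (ctest_Hk m tf))) _.
by rewrite mulrC -ltr_pdivlMr// mindex_card_gt0.
Qed.

Lemma Hk_null k u v : Hk D k u -> L2 D v -> nrm (u - v) = 0 -> Hk D k v.
Proof.
move=> Hu Lv uv; split=> // s sk; have [L1 W1] := HkW Hu sk; exists (wderiv D s u); split=> //.
apply/wderivP => phi tp; have /wderivP <- // := W1.
by apply/esym/(sip_null_l LS) => //; [exact: HkL2 Hu|exact/test_L2/test_partial].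
Qed.

Lemma Hk0_null k u v : Hk0 D k u -> L2 D v -> nrm (u - v) = 0 -> Hk0 D k v.
Proof.
move=> /Hk0P[Hu Du] Lv uv; have Hv := Hk_null Hu Lv uv.
apply/Hk0P; split; first exact: Hv.
move=> e e0.
have [f [tf Df]] := Du e e0; exists f; split; first exact: tf.
apply: le_lt_trans Df; have HSk := Hk_sip k; have Hf := ctest_Hk k tf; have Lu := HkL2 Hu; have Lf := HkL2 Hf.
have E s : wderiv D s (u - f) = wderiv D s (v - f).
  apply: wderiv_null; [exact: (sipWB LS)|exact: (sipWB LS)|].
  by rewrite opprB addrA subrK.
have -> : hnrm k (v - f) = hnrm k (u - f); last exact: lexx.
have E2 : hip k (v - f) (v - f) = hip k (u - f) (u - f) by apply: eq_bigr => b _; rewrite E.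
by rewrite /sip_norm E2.
Qed.

Lemma hnrm_null k u v : Hk D k u -> L2 D v -> nrm (u - v) = 0 -> hnrm k u = hnrm k v.
Proof.
move=> Hu Lv uv; have E : hip k u u = hip k v v.
  by apply: eq_bigr => b _; rewrite (wderiv_null _ (HkL2 Hu) Lv uv).
by rewrite /sip_norm E.
Qed.
End weak_derivatives.

(** * Green's formula and the elliptic estimate *)

Section elliptic.
Context {R : realType} {d : nat}.
Local Notation pt := 'rV[R]_d.
Local Notation C := R[i].
Local Notation fct := ('rV[R]_d -> R[i]).
Variable D : set pt.
Hypothesis hD : bdomain D.
Implicit Types (u v w f g : fct) (a : C) (s : seq 'I_d) (k : nat) (phi psi : pt -> R) (i j : 'I_d).
Let oD := hD.1.
Let bD := hD.2.
Let mD := measurable_domain oD.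
Let Dfin := domain_fin oD bD.
Let LS := L2_sip hD.
Local Notation nrm := (sip_norm (l2ip D)).
Local Notation hnrm k := (sip_norm (hip D k)).

Lemma L2_rmul (c : pt -> R) (K : R) u : measurable_fun D c -> (forall x, D x -> `|c x| <= K) ->
  L2 D u -> L2 D (rmul c u).
Proof.
move=> mc cK /(L2P hD)[ru iu]; apply/(L2P hD); split.
- have -> : (fun x => Re (rmul c u x)) = (fun x => c x * Re (u x)).
    by apply/funext => x; rewrite /rmul cReM /= mul0r subr0.
  exact: (sqiM_bounded mD mc cK).
- have -> : (fun x => Im (rmul c u x)) = (fun x => c x * Im (u x)).
    by apply/funext => x; rewrite /rmul cImM /= mul0r addr0.
  exact: (sqiM_bounded mD mc cK).
Qed.

Lemma nrm_le (K : R) u v : 0 <= K -> L2 D u -> L2 D v ->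
  (forall x, D x -> normc (u x) <= K * normc (v x)) -> nrm u <= K * nrm v.
Proof.
move=> K0 Lu Lv uv; rewrite -(@ler_pXn2r _ 2)// ?nnegrE ?sip_norm_ge0 ?mulr_ge0 ?sip_norm_ge0//.
rewrite exprMn !(l2norm2 hD)//.
have /(L2P hD)[ru iu] := Lu; have /(L2P hD)[rv iv] := Lv.
have i1 := sqi_integrable2 ru; have i2 := sqi_integrable2 iu.
have i3 := sqi_integrable2 rv; have i4 := sqi_integrable2 iv.
rewrite /l2sq -(RintegralD mD i1 i2) -(RintegralD mD i3 i4).
have i34 := integrable_sum2 mD i3 i4.
rewrite -(RintegralZl (K ^+ 2) mD i34).
apply: (le_Rintegral mD (integrable_sum2 mD i1 i2) (integrable_scale mD (K ^+ 2) i34)).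
move=> x Dx; rewrite -!normcE2 -exprMn ler_pXn2r ?nnegrE ?normc_ge0 ?mulr_ge0 ?normc_ge0//.
exact: uv.
Qed.

Lemma nrm_rmul (c : pt -> R) (K : R) u : measurable_fun D c -> (forall x, D x -> `|c x| <= K) ->
  0 <= K -> L2 D u -> nrm (rmul c u) <= K * nrm u.
Proof.
move=> mc cK K0 Lu; apply: nrm_le => //; first exact: L2_rmul mc cK Lu.
by move=> x Dx; rewrite Normc.normcM normcR ler_wpM2r ?normc_ge0// cK.
Qed.

Lemma l2ip_rmul (c : pt -> R) u v : l2ip D (rmul c u) v = l2ip D u (rmul c v).
Proof.
have E x : rmul c u x * conjc (v x) = u x * conjc (rmul c v x).
  rewrite /rmul conjcM mulrCA -mulrA; congr (_ * (_ * _)).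
  by apply: complexP; rewrite ?cRe_conj ?cIm_conj /= ?oppr0.
by rewrite /l2ip /cintegral; congr (_ +i* _); apply: eq_Rintegral => x _; rewrite E.
Qed.

Lemma l2ip_suml (J : Type) (t : seq J) (F : J -> fct) g : (forall q, L2 D (F q)) -> L2 D g ->
  l2ip D (\sum_(q <- t) F q) g = \sum_(q <- t) l2ip D (F q) g.
Proof.
move=> LF Lg; elim: t => [|q t IH]; first by rewrite !big_nil (sip0l LS Lg).
rewrite !big_cons -IH; apply: (sipDl LS (LF q) _ Lg).
by apply: (sipW_sum LS) => q' _; exact: LF.
Qed.

Opaque wderiv l2ip.

(** ** Integration by parts *)

Lemma cpartial_split s g : cpartial s g =
  rfun (partial s (fun x => Re (g x))) + cscale 'i (rfun (partial s (fun x => Im (g x)))).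
Proof. exact: cfunE. Qed.

(** Antilinear functionals that are bounded on [H^k_0(D)] are determined by
    their values on test functions. *)
Lemma Hk0_ext k (F : fct -> C) (K : R) :
  (forall u v, Hk0 D k u -> Hk0 D k v -> F (u - v) = F u - F v) ->
  (forall v, Hk0 D k v -> normc (F v) <= K * hnrm k v) ->
  (forall phi : fct, ctest_fun D phi -> F phi = 0) -> forall v, Hk0 D k v -> F v = 0.
Proof.
move=> FB FK F0 v Hv; have /(Hk0P hD)[_ Dv] := Hv.
apply/eqP; rewrite -normc_eq0 eq_le normc_ge0 andbT; apply/ler_addgt0Pl => e e0; rewrite addr0.
have K0 : 0 < `|K| + 1 by rewrite ltr_wpDl.
have [g [tg Hg]] := Dv (e / (`|K| + 1)) (divr_gt0 e0 K0).
have Hg0 := ctest_Hk0 hD k tg; have Hd := sipWB (Hk0_sip hD k) Hv Hg0.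
have -> : F v = F (v - g) by rewrite (FB _ _ Hv Hg0) (F0 g tg) subr0.
apply: le_trans (FK _ Hd) _; rewrite ltr_pdivlMr// in Hg; apply: le_trans (ltW Hg).
rewrite mulrC ler_wpM2l ?sip_norm_ge0//.
by apply: le_trans (ler_norm _) _; rewrite lerDl.
Qed.

Lemma wderiv_ibp i u g : Hk D 2 u -> ctest_fun D g ->
  l2ip D (wderiv D [:: i] u) (cpartial [:: i] g) = - l2ip D (wderiv D [:: i; i] u) g.
Proof.
move=> Hu [tr ti]; have [L1 /wderivP W1] := HkW hD Hu (isT : (size [:: i] <= 2)%N).
have [L2' /wderivP W2] := HkW hD Hu (isT : (size [:: i; i] <= 2)%N).
have E phi : test_fun D phi -> l2ip D (wderiv D [:: i] u) (rfun (partial [:: i] phi)) =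
    - l2ip D (wderiv D [:: i; i] u) (rfun phi).
  move=> tp; have := W1 _ (test_partial [:: i] tp); have := W2 _ tp.
  rewrite /= expr2 mulrNN mulr1 mul1r expr1 mulN1r => -> ->.
  by rewrite opprK.
have T1 := test_L2 hD (test_partial [:: i] tr); have T2 := test_L2 hD (test_partial [:: i] ti).
have T3 := test_L2 hD tr; have T4 := test_L2 hD ti.
rewrite cpartial_split (sipDr LS T1 (sipWZ LS _ T2) L1) (sipZr LS _ T2 L1) !E//.
rewrite [in RHS](cfunE g) (sipDr LS T3 (sipWZ LS _ T4) L2') (sipZr LS _ T4 L2').
by rewrite opprD mulrN.
Qed.

Lemma ctest_wderiv_null s g : ctest_fun D g -> L2 D (wderiv D s g) /\
  nrm (wderiv D s g - cpartial s g) = 0.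
Proof.
move=> tg; have Lc := ctest_L2 hD (ctest_cpartial s tg).
by have [L1 _ N] := wderivE hD Lc (ctest_wderiv hD s tg).
Qed.

Lemma L2_laplacian u : Hk D 2 u -> L2 D (laplacian D u).
Proof.
by move=> Hu; apply: (sipW_sum LS) => i _; have [] := HkW hD Hu (isT : (size [:: i; i] <= 2)%N).
Qed.

Lemma wderiv_sub k s u v : Hk D k u -> Hk D k v -> (size s <= k)%N ->
  nrm (wderiv D s (u - v) - (wderiv D s u - wderiv D s v)) = 0.
Proof.
move=> Hu Hv sk; have := wderiv_lin hD (-1) Hv Hu sk.
by rewrite !(sip_scN1 LS) ![- _ + _]addrC.
Qed.

Lemma green_ibp i u g : Hk D 2 u -> Hk0 D 1 g ->
  l2ip D (wderiv D [:: i] u) (wderiv D [:: i] g) = - l2ip D (wderiv D [:: i; i] u) g.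
Proof.
move=> Hu Hg; have [L1 _] := HkW hD Hu (isT : (size [:: i] <= 2)%N).
have [L2' _] := HkW hD Hu (isT : (size [:: i; i] <= 2)%N).
pose F g := l2ip D (wderiv D [:: i] u) (wderiv D [:: i] g) + l2ip D (wderiv D [:: i; i] u) g.
suff : F g = 0 by move=> /eqP; rewrite addr_eq0 => /eqP.
have W1 f : Hk0 D 1 f -> L2 D (wderiv D [:: i] f).
  by move=> /(@Hk0_Hk R d D)Hf; have [] := HkW hD Hf (isT : (size [:: i] <= 1)%N).
apply: (@Hk0_ext 1 F (nrm (wderiv D [:: i] u) + nrm (wderiv D [:: i; i] u))) Hg.
- move=> f v Hf Hv; rewrite /F (sipBr LS (Hk0L Hf) (Hk0L Hv) L2').
  have N := wderiv_sub (Hk0_Hk Hf) (Hk0_Hk Hv) (isT : (size [:: i] <= 1)%N).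
  rewrite (sip_null_r LS (W1 _ (sipWB (Hk0_sip hD 1) Hf Hv)) (sipWB LS (W1 _ Hf) (W1 _ Hv)) L1 N).
  by rewrite (sipBr LS (W1 _ Hf) (W1 _ Hv) L1) opprD addrACA.
- move=> f Hf; rewrite /F; apply: le_trans (le_normcD _ _) _; rewrite mulrDl.
  have C1 := sip_CS LS L1 (W1 _ Hf); have C2 := sip_CS LS L2' (Hk0L Hf).
  apply: lerD.
    apply: le_trans C1 _; rewrite ler_wpM2l ?sip_norm_ge0//.
    exact: (@wderiv_le R d D hD 1 f [:: i] (Hk0_Hk Hf) isT).
  apply: le_trans C2 _; rewrite ler_wpM2l ?sip_norm_ge0//.
  exact: (@l2_le_hnrm R d D hD 1 f (Hk0_Hk Hf)).
- move=> phi tp; have [Lw Nw] := ctest_wderiv_null [:: i] tp.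
  rewrite /F (sip_null_r LS Lw (ctest_L2 hD (ctest_cpartial [:: i] tp)) L1 Nw).
  by rewrite wderiv_ibp// addNr.
Qed.

(** By density it is enough to test against smooth functions with compact
    support, for which this is the definition of weak derivatives. *)
Lemma green u g : Hk D 2 u -> Hk0 D 1 g -> grad_ip D u g = - l2ip D (laplacian D u) g.
Proof.
move=> Hu Hg; have Lg := Hk0L Hg.
have W2 i : L2 D (wderiv D [:: i; i] u) by have [] := HkW hD Hu (isT : (size [:: i; i] <= 2)%N).
rewrite /grad_ip; under eq_bigr do rewrite (green_ibp _ Hu Hg).
by rewrite sumrN /laplacian (l2ip_suml _ W2 Lg).
Qed.

Lemma grad_ip_conj u v : Hk D 1 u -> Hk D 1 v -> grad_ip D v u = conjc (grad_ip D u v).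
Proof.
move=> Hu Hv; rewrite /grad_ip conjc_sum; apply: eq_bigr => i _.
have [L1 _] := HkW hD Hu (isT : (size [:: i] <= 1)%N).
have [L2' _] := HkW hD Hv (isT : (size [:: i] <= 1)%N).
exact: (sip_conj LS L1 L2').
Qed.

Lemma green_r u g : Hk D 2 u -> Hk0 D 1 g -> grad_ip D g u = - l2ip D g (laplacian D u).
Proof.
move=> Hu Hg; rewrite (grad_ip_conj (Hk_le (isT : (1 <= 2)%N) Hu) (Hk0_Hk Hg)) green//.
by rewrite conjcN -(sip_conj LS (L2_laplacian Hu) (Hk0L Hg)).
Qed.

(** ** The elliptic estimate *)

Lemma cibp i f g : ctest_fun D f -> ctest_fun D g ->
  l2ip D f (cpartial [:: i] g) = - l2ip D (cpartial [:: i] f) g.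
Proof.
move=> tf [tr ti]; have /wderivP W := ctest_wderiv hD [:: i] tf.
have Lf := ctest_L2 hD tf; have Lpf := ctest_L2 hD (ctest_cpartial [:: i] tf).
have T1 := test_L2 hD (test_partial [:: i] tr); have T2 := test_L2 hD (test_partial [:: i] ti).
have T3 := test_L2 hD tr; have T4 := test_L2 hD ti.
rewrite cpartial_split (sipDr LS T1 (sipWZ LS _ T2) Lf) (sipZr LS _ T2 Lf) !W//.
rewrite [in RHS](cfunE g) (sipDr LS T3 (sipWZ LS _ T4) Lpf) (sipZr LS _ T4 Lpf).
by rewrite expr1 !mulN1r opprD mulrN.
Qed.

Lemma cpartial_perm s t g : ctest_fun D g -> perm_eq s t -> cpartial s g = cpartial t g.
Proof.
by move=> [tr ti] st; apply/funext => x; rewrite /cpartial (partial_perm tr st) (partial_perm ti st).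
Qed.

Lemma cpartial_cons i s u : cpartial (i :: s) u = cpartial [:: i] (cpartial s u).
Proof. by []. Qed.

Opaque cpartial.

(** Move one derivative from each factor to the other. *)
Lemma second_derivatives i j u : ctest_fun D u ->
  l2ip D (cpartial [:: i; j] u) (cpartial [:: i; j] u) =
  l2ip D (cpartial [:: i; i] u) (cpartial [:: j; j] u).
Proof.
move=> tu; have P s := ctest_cpartial s tu.
have C1 := cpartial_cons i [:: j] u.
have C2 : cpartial [:: i] (cpartial [:: i; j] u) = cpartial [:: j] (cpartial [:: i; i] u).
  rewrite -!cpartial_cons; apply: (@cpartial_perm [:: i; i; j] [:: j; i; i] u tu).
  by rewrite -[[:: i; i; j]]/([:: i; i] ++ [:: j]) -[[:: j; i; i]]/([:: j] ++ [:: i; i]) perm_catC.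
have C3 := cpartial_cons j [:: j] u.
have S1 := congr1 (l2ip D (cpartial [:: i; j] u)) C1.
have S2 := cibp i (P [:: i; j]) (P [:: j]).
have S3 := congr1 (fun w => - l2ip D w (cpartial [:: j] u)) C2.
have S4 := cibp j (P [:: i; i]) (P [:: j]).
have S5 := congr1 (l2ip D (cpartial [:: i; i] u)) C3.
exact: (etrans S1 (etrans S2 (etrans S3 (esym (etrans S5 S4))))).
Qed.

Definition claplacian u : fct := \sum_(i < d) cpartial [:: i; i] u.

Lemma ctest_laplacian u : ctest_fun D u ->
  L2 D (claplacian u) /\ nrm (laplacian D u - claplacian u) = 0.
Proof.
move=> tu; have W i := ctest_wderiv_null [:: i; i] tu.
have Lc i := ctest_L2 hD (ctest_cpartial [:: i; i] tu).
split; first by apply: (sipW_sum LS) => i _; exact: Lc.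
rewrite /laplacian /claplacian -sumrB; apply/eqP; rewrite eq_le sip_norm_ge0 andbT.
apply: (@le_trans _ _ (\sum_(i < d) nrm (wderiv D [:: i; i] u - cpartial [:: i; i] u))).
  by apply: (sip_norm_sum LS) => i _; exact: (sipWB LS (W i).1 (Lc i)).
by rewrite big1// => i _; exact: (W i).2.
Qed.

(** By second_derivatives, [(D_ii u, D_jj u)] is the squared norm of [D_ij u],
    so the squared norm of the Laplacian is the sum of all of these. *)
Lemma second_derivative_le i j u : ctest_fun D u -> nrm (cpartial [:: i; j] u) <= nrm (laplacian D u).
Proof.
move=> tu; have [Lc Nc] := ctest_laplacian tu.
have Ll := L2_laplacian (ctest_Hk hD 2 tu).
rewrite (sip_norm_null LS Ll Lc Nc).
have P s : L2 D (cpartial s u) := ctest_L2 hD (ctest_cpartial s tu).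
have E : nrm (claplacian u) ^+ 2 = \sum_(i < d) \sum_(j < d) nrm (cpartial [:: i; j] u) ^+ 2.
  rewrite (sip_norm2 LS)//.
  have -> : l2ip D (claplacian u) (claplacian u) =
      \sum_(i < d) \sum_(j < d) l2ip D (cpartial [:: i; i] u) (cpartial [:: j; j] u).
    have suml f : L2 D f -> l2ip D (claplacian u) f = \sum_(i < d) l2ip D (cpartial [:: i; i] u) f.
      by move=> Lf; rewrite /claplacian (l2ip_suml _ (fun i => P [:: i; i]) Lf).
    rewrite suml//; apply: eq_bigr => t _.
    rewrite (sip_conj LS Lc (P _)) suml// conjc_sum; apply: eq_bigr => t' _.
    by rewrite -(sip_conj LS).
  rewrite Re_sum; apply: eq_bigr => t _; rewrite Re_sum; apply: eq_bigr => t' _.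
  by rewrite -second_derivatives// (sip_norm2 LS).
rewrite -(@ler_pXn2r _ 2)// ?nnegrE ?sip_norm_ge0// E.
have nn t t' : 0 <= nrm (cpartial [:: t; t'] u) ^+ 2 by exact: sqr_ge0.
apply: (@le_trans _ _ (\sum_(t < d) nrm (cpartial [:: i; t] u) ^+ 2)).
  by rewrite [leRHS](bigD1 j) // lerDl; apply: sumr_ge0 => t _; exact: nn.
rewrite [leRHS](bigD1 i) // lerDl; apply: sumr_ge0 => t _; apply: sumr_ge0 => t' _; exact: nn.
Qed.

Transparent cpartial.

(** Integrate by parts against the coordinate [x i], whose derivative is one. *)
Lemma poincare i (L : R) u : 0 <= L -> (forall x, D x -> `|x ord0 i| <= L) -> ctest_fun D u ->
  nrm u <= 2 * L * nrm (cpartial [:: i] u).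
Proof.
move=> L0 HL tu; have [tr ti] := tu; pose c (x : pt) : R := x ord0 i.
have sc : smooth c by apply/smooth_expr_smooth/SmoothCoord.
have mc : measurable_fun D c by apply: measurable_funTS; exact: smooth_measurable.
have tcu : ctest_fun D (rmul c u).
  split.
  - have -> : (fun x => Re (rmul c u x)) = (fun x => c x * Re (u x)).
      by apply/funext => x; rewrite /rmul cReM /= mul0r subr0.
    exact: test_mul sc tr.
  - have -> : (fun x => Im (rmul c u x)) = (fun x => c x * Im (u x)).
      by apply/funext => x; rewrite /rmul cImM /= mul0r addr0.
    exact: test_mul sc ti.
have Dc x : 'D_(ev i) c x = 1.
  have := @is_derive_coord R d id 1 0 1 i x (ev i) (is_derive_id _ _).
  case=> _; rewrite ev_coord eqxx mulr1 mulr1 => <-; congr ('D_ _ _ _).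
  by apply/funext => y; rewrite mul1r addr0.
have Ec : cpartial [:: i] (rmul c u) = u + rmul c (cpartial [:: i] u).
  apply/funext => x; rewrite -[RHS]/(u x + rmul c (cpartial [:: i] u) x).
  apply: complexP.
  - rewrite ReD /rmul cReM /= mul0r subr0.
    have -> : (fun y => Re ((c y)%:C * u y)) = (fun y => c y * Re (u y)).
      by apply/funext => y; rewrite cReM /= mul0r subr0.
    by rewrite -/(ev i) (partialM _ _ sc (test_smooth tr)) Dc mulr1 addrC.
  - rewrite ImD /rmul cImM /= mul0r addr0.
    have -> : (fun y => Im ((c y)%:C * u y)) = (fun y => c y * Im (u y)).
      by apply/funext => y; rewrite cImM /= mul0r addr0.
    by rewrite -/(ev i) (partialM _ _ sc (test_smooth ti)) Dc mulr1 addrC.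
have Lu := ctest_L2 hD tu; have Lp := ctest_L2 hD (ctest_cpartial [:: i] tu).
have Lcp := L2_rmul mc HL Lp; have Lcu := L2_rmul mc HL Lu.
have := cibp i tcu tu; rewrite Ec (sipDl LS Lu Lcp Lu) => E.
have {}E : l2ip D u u = - (l2ip D (rmul c u) (cpartial [:: i] u) + l2ip D (rmul c (cpartial [:: i] u)) u).
  by rewrite E; ring.
have N : nrm u ^+ 2 <= nrm u * (2 * L * nrm (cpartial [:: i] u)).
  rewrite (sip_norm2 LS Lu) E; apply: le_trans (ler_norm _) _.
  apply: le_trans (Re_le_normc _) _; rewrite normcN; apply: le_trans (le_normcD _ _) _.
  have C1 := sip_CS LS Lcu Lp; have C2 := sip_CS LS Lcp Lu.
  have B1 := nrm_rmul mc HL L0 Lu; have B2 := nrm_rmul mc HL L0 Lp.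
  apply: le_trans (lerD C1 C2) _.
  apply: le_trans (lerD (ler_wpM2r (sip_norm_ge0 _ _) B1) (ler_wpM2r (sip_norm_ge0 _ _) B2)) _.
  by rewrite le_eqVlt; apply/orP; left; apply/eqP; ring.
have [->|n0] := eqVneq (nrm u) 0; first by rewrite !mulr_ge0 ?sip_norm_ge0.
move: N; rewrite expr2 ler_pM2l//; by rewrite lt_def n0 sip_norm_ge0.
Qed.

Lemma laplacian_le u : Hk D 2 u -> nrm (laplacian D u) <= d%:R * hnrm 2 u.
Proof.
move=> Hu; apply: (@le_trans _ _ (\sum_(i < d) nrm (wderiv D [:: i; i] u))).
  apply: (sip_norm_sum LS) => i _.
  by have [] := HkW hD Hu (isT : (size [:: i; i] <= 2)%N).
rewrite mulr_natl -[X in _ *+ X]card_ord -sumr_const; apply: ler_sum => i _.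
exact: (@wderiv_le R d D hD 2 u [:: i; i] Hu isT).
Qed.

Lemma laplacian_sub u v : Hk D 2 u -> Hk D 2 v ->
  nrm (laplacian D (u - v) - (laplacian D u - laplacian D v)) = 0.
Proof.
move=> Hu Hv; have Huv := sipWB (Hk_sip hD 2) Hu Hv.
have W w : Hk D 2 w -> forall i, L2 D (wderiv D [:: i; i] w).
  by move=> Hw i; have [] := HkW hD Hw (isT : (size [:: i; i] <= 2)%N).
rewrite /laplacian -sumrB -sumrB; apply/eqP; rewrite eq_le sip_norm_ge0 andbT.
apply: (@le_trans _ _ (\sum_(i < d) nrm (wderiv D [:: i; i] (u - v) -
    (wderiv D [:: i; i] u - wderiv D [:: i; i] v)))).
  apply: (sip_norm_sum LS) => i _; apply: (sipWB LS); first exact: W.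
  by apply: (sipWB LS); exact: W.
by rewrite big1// => i _; exact: (wderiv_sub Hu Hv (isT : (size [:: i; i] <= 2)%N)).
Qed.

Lemma laplacian_lin a u v : Hk D 2 u -> Hk D 2 v ->
  nrm (laplacian D (cscale a u + v) - (cscale a (laplacian D u) + laplacian D v)) = 0.
Proof.
move=> Hu Hv; have Huv := Hk_lin hD a Hu Hv.
have W w : Hk D 2 w -> forall i, L2 D (wderiv D [:: i; i] w).
  by move=> Hw i; have [] := HkW hD Hw (isT : (size [:: i; i] <= 2)%N).
have -> : cscale a (laplacian D u) = \sum_(i < d) cscale a (wderiv D [:: i; i] u).
  rewrite /laplacian; elim/big_rec2: _ => [|i x y _ <-]; first exact: (sip_sc0 LS).
  by apply/funext => t; rewrite /cscale -[LHS]/(a * (_ + _)) mulrDr.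
rewrite /laplacian -big_split -sumrB; apply/eqP; rewrite eq_le sip_norm_ge0 andbT.
apply: (@le_trans _ _ (\sum_(i < d) nrm (wderiv D [:: i; i] (cscale a u + v) -
    (cscale a (wderiv D [:: i; i] u) + wderiv D [:: i; i] v)))).
  apply: (sip_norm_sum LS) => i _; apply: (sipWB LS); first exact: W.
  by apply: (sip_W LS); exact: W.
by rewrite big1// => i _; exact: (wderiv_lin hD a Hu Hv (isT : (size [:: i; i] <= 2)%N)).
Qed.

(** For test functions poincare bounds the lower derivatives by second ones,
    and second_derivative_le bounds those; the rest is density. *)
Lemma elliptic (i0 : 'I_d) : exists2 K : R, 0 < K &
  forall u, Hk0 D 2 u -> hnrm 2 u <= K * nrm (laplacian D u).
Proof.
have aux (x y z t w c b e m : R) : 0 < c -> x <= y + z -> z <= c * t -> t <= w + b -> b <= m * y ->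
    y * (1 + c * m) < e -> x <= c * w + e.
  move=> c0 h1 h2 h3 h4 h5; apply: le_trans h1 _.
  have h6 : c * t <= c * (w + m * y) by apply: ler_wpM2l; [exact: ltW|lra].
  have h7 : y * (1 + c * m) = y + c * (m * y) by ring.
  rewrite mulrDr in h6; rewrite h7 in h5; lra.
have [L0 HL0] := domain_box bD; pose L := `|L0| + 1.
have L1 : 1 <= L by rewrite lerDr.
have HL x i : D x -> `|x ord0 i| <= L.
  by move=> Dx; apply: le_trans (HL0 x Dx i) _; apply: le_trans (ler_norm _) _; rewrite lerDl.
pose B := 4 * L ^+ 2.
have B1 : 1 <= B by rewrite /B; nra.
have LB : 2 * L <= B by rewrite /B; nra.
have m0 := @mindex_card_gt0 R d 2.
have ct u : ctest_fun D u -> hnrm 2 u <= mindex_card (R := R) (d := d) 2 * (B * nrm (laplacian D u)).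
  move=> tu; set N := nrm (laplacian D u); have N0 : 0 <= N by exact: sip_norm_ge0.
  apply: (Hnorm_bound hD (ctest_Hk hD 2 tu)); first by rewrite mulr_ge0//; lra.
  have P2 i j : nrm (cpartial [:: i; j] u) <= N by exact: second_derivative_le.
  have P1 j : nrm (cpartial [:: j] u) <= 2 * L * N.
    have := @poincare i0 L (cpartial [:: j] u) ltac:(lra) (fun x Dx => HL x i0 Dx) (ctest_cpartial [:: j] tu).
    move=> h; apply: le_trans h _; rewrite ler_wpM2l//; first lra.
    exact: (P2 i0 j).
  have P0 : nrm u <= B * N.
    have h := @poincare i0 L u ltac:(lra) (fun x Dx => HL x i0 Dx) tu.
    apply: le_trans h _; have := P1 i0; move: (nrm (cpartial _ _)) => t ht.
    by apply: (@le_trans _ _ (2 * L * (2 * L * N))); [rewrite ler_wpM2l//; lra|rewrite /B; nra].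
  have NB : N <= B * N by rewrite ler_peMl.
  have LN : 2 * L * N <= B * N by rewrite ler_wpM2r.
  have E s : nrm (wderiv D s u) = nrm (cpartial s u).
    have [Lw Nw] := ctest_wderiv_null s tu.
    exact: (sip_norm_null LS Lw (ctest_L2 hD (ctest_cpartial s tu)) Nw).
  case=> [|i [|j [|k s]]] // _; rewrite E.
  - have -> : cpartial [::] u = u by apply/funext => x; rewrite /cpartial /=; case: (u x).
    exact: P0.
  - exact: le_trans (P1 i) LN.
  - exact: le_trans (P2 i j) NB.
set K := mindex_card (R := R) (d := d) 2 * B.
have K0 : 0 < K by rewrite mulr_gt0//; lra.
exists K => // u Hu; have /(Hk0P hD)[Hu2 Du] := Hu.
have d0 : 0 < 1 + K * d%:R :> R by rewrite ltr_wpDr// mulr_ge0// ltW.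
apply/ler_addgt0Pl => e e0.
have [g [tg Hg]] := Du (e / (1 + K * d%:R)) (divr_gt0 e0 d0).
have Hg2 := ctest_Hk hD 2 tg; have Hd := sipWB (Hk_sip hD 2) Hu2 Hg2.
have Ll f : Hk D 2 f -> L2 D (laplacian D f) by exact: L2_laplacian.
have T1 : hnrm 2 u <= hnrm 2 (u - g) + hnrm 2 g.
  by have := sip_normD (Hk_sip hD 2) Hd Hg2; rewrite subrK.
have T2 := ct g tg; rewrite mulrA -/K in T2.
have T3 : nrm (laplacian D g) <= nrm (laplacian D u) + nrm (laplacian D (u - g)).
  have h := sip_normB LS (Ll _ Hu2) (Ll _ Hd).
  rewrite (sip_norm_null LS (Ll _ Hd) (sipWB LS (Ll _ Hu2) (Ll _ Hg2)) (laplacian_sub Hu2 Hg2)) in h *.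
  by have := sip_normB LS (Ll _ Hu2) (sipWB LS (Ll _ Hu2) (Ll _ Hg2)); rewrite subKr.
have T4 := laplacian_le Hd; rewrite ltr_pdivlMr// in Hg.
rewrite addrC; exact: aux K0 T1 T2 T3 T4 Hg.
Qed.
End elliptic.

(** * Mollification *)

Section box_measure.
Context {R : realType}.

Lemma lebesgue_rV_box_gt0 d (L : R) : 0 < L ->
  (0 < lebesgue_rV d [set x : 'rV[R]_d | forall i, (`|x ord0 i| <= L)%R])%E.
Proof.
move=> L0; elim: d => [|d IH].
  by rewrite /= diracE mem_set ?lte_fin ?ltr01// => -[].
rewrite /= /lebesgueS /pushforward.
have -> : rV_cons (d := d) @^-1` [set x | forall i, `|x ord0 i| <= L] =
    `[- L, L]%classic `*` [set x : 'rV[R]_d | forall i, `|x ord0 i| <= L].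
  apply/seteqP; split=> -[t y] /=.
    move=> H; split; last by move=> i; have := H (lift ord0 i); rewrite mxE liftK.
    by have := H ord0; rewrite mxE unlift_none in_itv/= ler_norml.
  move=> [tL yL] i; rewrite mxE; case: unliftP => [j _|_]; first exact: yL.
  by move: tL; rewrite in_itv/= ler_norml.
rewrite product_measure1E//; last first.
  apply: measurable_forall => i.
  apply: eq_measurable (measurable_coord_set i (measurable_itv `[- L, L])) _.
  by apply/seteqP; split=> y; rewrite /= in_itv/= ler_norml.
have l0 : (0 < @lebesgue_measure R `[(- L)%R, L]%classic)%E.
  have LL : - L < L by lra.
  by rewrite lebesgue_measure_itv /= lte_fin LL -EFinB lte_fin; lra.
exact: mule_gt0 l0 IH.
Qed.
End box_measure.

Section convolution.
Context {R : realType} {d : nat}.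
Local Notation pt := 'rV[R]_d.
Local Notation mu := (lebesgue_rV d).
Local Notation e_ := (@ev R d).
Variable D : set pt.
Hypotheses (oD : open D) (bD : bounded_set D).
Implicit Types (f g phi psi kap : pt -> R) (i j : 'I_d) (x y v : pt).
Let mD := measurable_domain oD.
Let Dfin := domain_fin oD bD.
Local Notation sqi := (sqi mu D).
Local Notation l2sq := (l2sq mu D).
Local Notation kernel := (test_fun [set: pt]).

Definition conv kap f : pt -> R := fun y => \int[mu]_(x in D) (f x * kap (y - x)).

Lemma reflect_measurable y : measurable_fun [set: pt] (fun x : pt => y - x).
Proof.
apply: measurable_fun_rV => i; under eq_fun do rewrite !mxE.
apply: measurable_funD; first exact: measurable_cst.
by apply: measurableT_comp => //; exact: measurable_coord.
Qed.

Lemma kernel_sqi kap y : kernel kap -> sqi (fun x => kap (y - x)).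
Proof.
move=> tk; have [M HM] := test_bounded tk.
apply: (sqi_bounded mD Dfin (K := M)); last by move=> x _; exact: HM.
apply: measurable_funTS; apply: measurableT_comp (reflect_measurable y).
by apply: smooth_measurable; exact: test_smooth tk.
Qed.

Lemma conv_integrable kap f y : kernel kap -> sqi f ->
  mu.-integrable D (EFin \o (fun x => f x * kap (y - x))).
Proof. by move=> tk sf; apply: (sqi_prod mD sf); exact: kernel_sqi. Qed.

Lemma norm_integrable f : sqi f -> mu.-integrable D (EFin \o (fun x => `|f x|)).
Proof. by move=> sf; apply: integrable_norm; exact: sqi_integrable sf. Qed.

Definition l1 f := \int[mu]_(x in D) `|f x|.

Lemma l1_ge0 f : 0 <= l1 f. Proof. by apply: Rintegral_ge0. Qed.

(** A pointwise bound on the kernel integrates to a bound on the convolution. *)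
Lemma conv_bound (h : pt -> R) f B : sqi f -> sqi h -> 0 <= B -> (forall x, `|h x| <= B) ->
  `|\int[mu]_(x in D) (f x * h x)| <= l1 f * B.
Proof.
move=> sf sh B0 hB; have ifh := sqi_prod mD sf sh.
apply: le_trans (le_normr_Rintegral mD ifh) _.
rewrite [l1 f * B]mulrC -(RintegralZl B mD (norm_integrable sf)).
have inn : mu.-integrable D (EFin \o (fun x => `|f x * h x|)) by exact: integrable_norm ifh.
apply: (le_Rintegral mD inn (integrable_scale mD B (norm_integrable sf))).
by move=> x _; rewrite normrM mulrC ler_wpM2r.
Qed.

Lemma is_derive_quadratic (F : pt -> R) x v (df c : R) :
  (forall h, `|F (h *: v + x) - F x - h * df| <= c * h ^+ 2) -> is_derive x v F df.
Proof.
move=> H; have c0 : 0 <= c by have := H 1; rewrite expr1n mulr1; exact: le_trans.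
have cv : (fun h => h^-1 *: ((F \o shift x) (h *: v) - F x)) @ 0^' --> df.
  apply/cvgrPdist_le => e e0; near=> h.
  have h0 : h != 0 by near: h; exact: nbhs_dnbhs_neq.
  have hn : 0 < `|h| by rewrite normr_gt0.
  rewrite -(ler_pM2l hn) -normrM mulrBr /= -[_ *: _]/(h^-1 * _) mulrA divff// mul1r.
  rewrite distrC; apply: le_trans (H h) _.
  rewrite -real_normK ?num_real// expr2 mulrA [`|h| * e]mulrC ler_wpM2r//.
  have hb : `|h| <= e / (c + 1).
    by near: h; apply: dnbhs0_le; rewrite divr_gt0// ltr_wpDl.
  have c1 : 0 < c + 1 by rewrite ltr_wpDl.
  rewrite ler_pdivlMr// in hb; nra.
have dF : derivable F x v by apply/cvg_ex; exists df.
by split=> //; rewrite /derive; apply/cvg_lim.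
Unshelve. all: by end_near. Qed.

Lemma conv_derive kap f i y : kernel kap -> sqi f ->
  is_derive y (e_ i) (conv kap f) (conv (fun x => 'D_(e_ i) kap x) f y).
Proof.
move=> tk sf; have tdk := test_partial1 i tk; have sk := test_smooth tk.
have [M HM] := test_partials_bounded [:: i; i] tk.
have M0 : 0 <= M := le_trans (normr_ge0 _) (HM 0).
apply: (@is_derive_quadratic _ _ _ _ (l1 f * M)) => h.
have i1 := conv_integrable (h *: e_ i + y) tk sf; have i2 := conv_integrable y tk sf.
have i3 := integrable_scale mD h (conv_integrable y tdk sf).
rewrite /conv -(RintegralZl h mD (conv_integrable y tdk sf)) -(RintegralB mD i1 i2).
have i12 : mu.-integrable D (EFin \o (fun x => f x * kap (h *: e_ i + y - x) - f x * kap (y - x))).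
  by have := integrableB mD i1 i2; apply: eq_integrable.
rewrite -(RintegralB mD i12 i3).
pose k x := kap (h *: e_ i + (y - x)) - kap (y - x) - h * 'D_(e_ i) kap (y - x).
have -> : \int[mu]_(x in D) (f x * kap (h *: e_ i + y - x) - f x * kap (y - x) -
    h * (f x * 'D_(e_ i) kap (y - x))) = \int[mu]_(x in D) (f x * k x).
  apply: eq_Rintegral => x _; rewrite /k addrA; move: (kap _) (kap _) ('D_ _ _ _) => a b c; ring.
rewrite -mulrA; apply: conv_bound => //.
- rewrite /k; apply: (sqiB mD); last exact: (sqiZ mD h (kernel_sqi y tdk)).
  apply: (sqiB mD); last exact: kernel_sqi.
  by under eq_fun do rewrite addrA; exact: kernel_sqi.
- by rewrite mulr_ge0// sqr_ge0.
- by move=> x; exact: (taylor (y - x) h sk HM).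
Qed.

Lemma partial_conv s kap f : kernel kap -> sqi f -> partial s (conv kap f) = conv (partial s kap) f.
Proof.
move=> tk sf; elim: s => [//|i s IH]; rewrite /= IH; apply/funext => y.
by have [_ ->] := conv_derive i y (test_partial s tk) sf.
Qed.

Lemma lipschitz_sum kap (L : R) (s : seq 'I_d) v x : smooth kap ->
  (forall i x, `|'D_(e_ i) kap x| <= L) -> 0 <= L ->
  `|kap (\sum_(i <- s) v ord0 i *: e_ i + x) - kap x| <= L * \sum_(i <- s) `|v ord0 i|.
Proof.
move=> sk HL L0; elim: s x => [|i s IH] x; first by rewrite !big_nil add0r subrr normr0 mulr0.
rewrite !big_cons -addrA mulrDr.
set w := \sum_(j <- s) _ + x.
have -> : kap (v ord0 i *: e_ i + w) - kap x = kap (v ord0 i *: e_ i + w) - kap w + (kap w - kap x).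
  by rewrite subrKA.
apply: le_trans (ler_normD _ _) _; apply: lerD; last exact: IH.
exact: (lipschitz w (v ord0 i) sk (HL i)).
Qed.

Lemma kernel_lipschitz kap : kernel kap -> exists2 L, 0 <= L & forall v x,
  `|kap (v + x) - kap x| <= L * `|v|.
Proof.
move=> tk; have /choice[L HL] : forall i, exists M, forall x, `|'D_(e_ i) kap x| <= M.
  by move=> i; exact: (test_partials_bounded [:: i] tk).
have L0 i : 0 <= L i := le_trans (normr_ge0 _) (HL i 0).
have S0 : 0 <= \sum_i L i by apply: sumr_ge0.
exists ((\sum_i L i) * d%:R); first by rewrite mulr_ge0.
move=> v x; have -> : v = \sum_(i < d) v ord0 i *: e_ i by rewrite [LHS]row_sum_delta.
have Li i y : `|'D_(e_ i) kap y| <= \sum_i L i.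
  by apply: le_trans (HL i y) _; rewrite (bigD1 i)//= lerDl sumr_ge0.
apply: le_trans (lipschitz_sum _ v x (test_smooth tk) Li S0) _.
rewrite -mulrA ler_wpM2l// -row_sum_delta mulr_natl -[X in _ *+ X]card_ord -sumr_const.
by apply: ler_sum => i _; exact: coord_le_norm.
Qed.

Lemma smooth_conv kap f : kernel kap -> sqi f -> smooth (conv kap f).
Proof.
move=> tk sf s; rewrite (partial_conv s tk sf).
have tks := test_partial s tk; split; last by move=> i x; have [] := conv_derive i x tks sf.
have [L L0 HL] := kernel_lipschitz tks.
apply/continuousP => A oA; apply/rV_openP => y /= Ay.
have /nbhs_ballP[e0 /= e00 eA] : nbhs (conv (partial s kap) f y) A by exact: open_nbhs_nbhs.
pose e := e0 / 2; have e_gt0 : 0 < e by rewrite divr_gt0.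
have c0 : 0 < l1 f * L + 1 by rewrite ltr_wpDl// mulr_ge0// l1_ge0.
have t0 : 0 < e / (l1 f * L + 1) by rewrite divr_gt0.
exists (e / (l1 f * L + 1)) => // z zy; apply: eA; rewrite -ball_normE /=.
have zb : `|y - z| <= e / (l1 f * L + 1).
  rewrite /Num.norm /= mx_normrE; apply/bigmax_leP; split=> /=; first exact: ltW.
  by move=> [i j] _ /=; rewrite ord1 !mxE; exact/ltW/zy.
apply: (@le_lt_trans _ _ e); last by rewrite /e; lra.
rewrite /conv -(RintegralB mD (conv_integrable y tks sf) (conv_integrable z tks sf)).
under eq_Rintegral do rewrite -mulrBr.
have B0 : 0 <= L * `|y - z| by rewrite mulr_ge0.
have sB : sqi (fun x => partial s kap (y - x) - partial s kap (z - x)).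
  by apply: (sqiB mD); exact: kernel_sqi.
have hB x : `|partial s kap (y - x) - partial s kap (z - x)| <= L * `|y - z|.
  by have := HL (y - z) (z - x); rewrite addrA subrK.
apply: le_trans (conv_bound sf sB B0 hB) _.
rewrite ler_pdivlMr// in zb; rewrite mulrA.
have := normr_ge0 (y - z); move: zb; move: `|y - z| (l1 f * L) => t w; lra.
Qed.

(** ** The mollifier *)

Lemma even_box_bump (r : R) x : box_bump 0 r 1 (- x) = box_bump 0 r 1 x.
Proof.
apply: eq_bigr => i _; rewrite !mxE mulrC; congr (bump _ _ * bump _ _); ring.
Qed.

Lemma box_bump_lower (r : R) x : 0 < r -> (forall i, `|x ord0 i| <= r / 2) ->
  (expR (- (2 / r)) ^+ 2) ^+ d <= box_bump 0 r 1 x.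
Proof.
move=> r0 xr; rewrite -[X in _ ^+ X]card_ord -prodr_const.
have B t : r / 2 <= t -> expR (- (2 / r)) <= bump 0 t.
  move=> rt; have t0 : 0 < t by apply: lt_le_trans rt; rewrite divr_gt0.
  rewrite /bump t0 expr0 mul1r ler_expR lerN2 -invf_div lef_pV2// posrE//.
  by rewrite divr_gt0.
apply: ler_prod => i _; rewrite exprn_ge0 ?expR_ge0//= expr2 !mxE !mul1r.
have := xr i; rewrite ler_norml => /andP[? ?].
by apply: ler_pM; rewrite ?expR_ge0//; apply: B; lra.
Qed.

Lemma box_bump_kernel (r : R) : kernel (box_bump 0 r 1).
Proof.
apply: (test_of_support (smooth_box_bump 0 r 1) (@cbox_compact R d 0 r)) => // x xc.
by apply: box_bump_out => xr; apply: xc => i; exact/ltW/xr.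
Qed.

Local Notation box r := [set x : pt | forall i, `|x ord0 i| <= r].

Let mbox (r : R) : measurable (box r).
Proof.
apply: measurable_forall => i.
apply: eq_measurable (measurable_coord_set i (measurable_itv `[- r, r])) _.
by apply/seteqP; split=> y; rewrite /= in_itv/= ler_norml.
Qed.

Let box_fin (r : R) : (mu (box r) < +oo)%E := lebesgue_rV_box_fin d r.

Lemma box_bump_out' (r : R) x : ~ box r x -> box_bump 0 r 1 x = 0.
Proof.
move=> nx; apply: box_bump_out => xr; apply: nx => i.
by have /ltW := xr i; rewrite mxE sub0r normrN.
Qed.

Lemma box_bump_integrable (r : R) : mu.-integrable setT (EFin \o box_bump (d := d) 0 r 1).
Proof.
have tk := box_bump_kernel r; have [M HM] := test_bounded tk.
have : mu.-integrable (box r) (EFin \o box_bump (d := d) 0 r 1).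
  apply: (@bounded_integrable _ _ _ mu _ (mbox r) (box_fin r) _ M) => //.
  by apply: measurable_funTS; apply: smooth_measurable; exact: test_smooth tk.
rewrite (integrable_mkcond _ (mbox r)); apply: eq_integrable => // x _.
rewrite patchE /=; case: ifPn => // /negP xB.
by rewrite box_bump_out'// => Bx; apply: xB; exact: mem_set.
Qed.

Lemma box_bump_integral_gt0 (r : R) : 0 < r -> 0 < \int[mu]_x box_bump (d := d) 0 r 1 x.
Proof.
move=> r0; set m := (expR (- (2 / r)) ^+ 2) ^+ d.
have m0 : 0 < m by rewrite exprn_gt0// exprn_gt0// expR_gt0.
have r20 : 0 < r / 2 by rewrite divr_gt0.
have fb : 0 < fine (mu (box (r / 2))).
  by rewrite fine_gt0// lebesgue_rV_box_gt0//=; exact: box_fin.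
apply: (@lt_le_trans _ _ (m * fine (mu (box (r / 2))))); first exact: mulr_gt0.
have i1 : mu.-integrable setT (EFin \o (fun x => m * \1_(box (r / 2)) x)).
  apply: (integrable_scale measurableT).
  apply/integrableP; split; first by apply/measurable_EFinP; exact: measurable_indic.
  under eq_integral => x _ do rewrite /= ger0_norm//.
  by rewrite integral_indic ?setIT//; exact: box_fin.
have -> : m * fine (mu (box (r / 2))) = \int[mu]_x (m * \1_(box (r / 2)) x).
  have i0 : mu.-integrable setT (EFin \o (\1_(box (r / 2)) : pt -> R)).
    apply/integrableP; split; first by apply/measurable_EFinP; exact: measurable_indic.
    under eq_integral => x _ do rewrite /= ger0_norm//.
    by rewrite integral_indic ?setIT//; exact: box_fin.
  rewrite (RintegralZl m measurableT i0); congr (_ * _).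
  by rewrite /Rintegral integral_indic ?setIT//.
apply: (le_Rintegral measurableT i1 (box_bump_integrable r)) => x _.
rewrite indicE; case: (boolP (x \in _)) => [/set_mem xb|_].
  by rewrite mulr1; exact: box_bump_lower.
by rewrite mulr0; have /andP[] := box_bump01 0 r 1 x.
Qed.

Definition moll (r : R) : pt -> R := fun x =>
  (\int[mu]_y box_bump (d := d) 0 r 1 y)^-1 * box_bump 0 r 1 x.

Lemma moll_kernel r : kernel (moll r).
Proof. exact: (testZ _ (box_bump_kernel r)). Qed.

Lemma moll_ge0 r x : 0 <= moll r x.
Proof.
apply: mulr_ge0; last by have /andP[] := box_bump01 0 r 1 x.
by rewrite invr_ge0; apply: Rintegral_ge0 => y _; have /andP[] := box_bump01 0 r 1 y.
Qed.

Lemma moll_even r x : moll r (- x) = moll r x.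
Proof. by rewrite /moll even_box_bump. Qed.

Lemma moll_out r x : ~ box r x -> moll r x = 0.
Proof. by move=> nx; rewrite /moll box_bump_out' ?mulr0. Qed.

Lemma moll_integrable r : mu.-integrable setT (EFin \o moll r).
Proof. by apply: (integrable_scale measurableT); exact: box_bump_integrable. Qed.

Lemma moll_measurable r : measurable_fun setT (moll r).
Proof. by apply: smooth_measurable; exact: test_smooth (moll_kernel r). Qed.

Lemma moll_integral r : 0 < r -> \int[mu]_x moll r x = 1.
Proof.
move=> r0; rewrite /moll (RintegralZl _ measurableT (box_bump_integrable r)) mulVf//.
by rewrite gt_eqF// box_bump_integral_gt0.
Qed.

Let mollB r y x : moll r (y - x) = moll r (- y + x).
Proof. by rewrite -moll_even opprB addrC. Qed.

Lemma moll_shift_integrable r y : mu.-integrable setT (EFin \o (fun x => moll r (y - x))).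
Proof.
have mm : measurable_fun setT (fun x => moll r (y - x)).
  exact: measurableT_comp (moll_measurable r) (reflect_measurable y).
pose L := r + `|y|.
have [M HM] := test_bounded (moll_kernel r).
have : mu.-integrable (box L) (EFin \o (fun x => moll r (y - x))).
  apply: (@bounded_integrable _ _ _ mu _ (mbox L) (box_fin L) _ M) => //.
  exact: measurable_funTS.
rewrite (integrable_mkcond _ (mbox L)); apply: eq_integrable => // x _.
rewrite patchE /=; case: ifPn => // /negP xB; rewrite moll_out// => H; apply: xB; apply: mem_set => i.
have := H i; rewrite !mxE => h1; have := coord_le_norm y i => h2.
have := ler_normB (y ord0 i) (y ord0 i - x ord0 i); rewrite subKr => h3.
by rewrite /L; apply: le_trans h3 _; rewrite addrC lerD.
Qed.

Lemma moll_shift_integral r y : 0 < r -> \int[mu]_x moll r (y - x) = 1.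
Proof.
move=> r0; rewrite -(moll_integral r0).
rewrite -(integral_translate (- y) (moll_measurable r) (moll_integrable r)).
by apply: eq_Rintegral => x _; rewrite mollB.
Qed.

Lemma conv_test psi : test_fun D psi -> exists2 L, 0 <= L & forall r y, 0 < r ->
  `|conv (moll r) psi y - psi y| <= L * r.
Proof.
move=> tp; have tk : kernel psi.
  by have [sp cp _] := tp; split.
have [L L0 HL] := kernel_lipschitz tk; exists L => // r y r0.
have sp := test_sqi oD bD tp.
have ext : conv (moll r) psi y = \int[mu]_x (psi x * moll r (y - x)).
  by apply: integral_setT => x nDx; rewrite (test_out tp nDx) mul0r.
have mp : measurable_fun setT psi by apply: smooth_measurable; exact: test_smooth tp.
have mm : measurable_fun setT (fun x => moll r (y - x)).
  exact: measurableT_comp (moll_measurable r) (reflect_measurable y).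
have [M HM] := test_bounded tp; have M0 : 0 <= M := le_trans (normr_ge0 _) (HM 0).
have im := moll_shift_integrable r y.
have i1 : mu.-integrable setT (EFin \o (fun x => psi x * moll r (y - x))).
  apply: (integrable_dominated measurableT (g := fun x => M * moll r (y - x))).
  - by apply: measurable_funM.
  - by move=> x _; rewrite normrM (ger0_norm (moll_ge0 _ _)) ler_wpM2r ?moll_ge0// HM.
  - exact: (integrable_scale measurableT M im).
have i2 := integrable_scale measurableT (psi y) im.
have -> : psi y = \int[mu]_x (psi y * moll r (y - x)).
  by rewrite (RintegralZl _ measurableT im) moll_shift_integral// mulr1.
rewrite ext -(RintegralB measurableT i1 i2).
have i12 : mu.-integrable setT (EFin \o (fun x => psi x * moll r (y - x) - psi y * moll r (y - x))).
  by have := integrableB measurableT i1 i2; apply: eq_integrable.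
apply: le_trans (le_normr_Rintegral measurableT i12) _.
have iL := integrable_scale measurableT (L * r) im.
have -> : L * r = \int[mu]_x ((L * r) * moll r (y - x)).
  by rewrite (RintegralZl _ measurableT im) moll_shift_integral// mulr1.
have inn : mu.-integrable setT (EFin \o (fun x => `|psi x * moll r (y - x) - psi y * moll r (y - x)|)).
  exact: integrable_norm i12.
apply: (le_Rintegral measurableT inn iL) => x _.
rewrite -mulrBl normrM (ger0_norm (moll_ge0 _ _)).
have [xb|/moll_out ->] := pselect (box r (y - x)); last by rewrite !mulr0.
rewrite ler_wpM2r ?moll_ge0// distrC.
have := HL (y - x) x; rewrite subrK => /le_trans; apply; rewrite ler_wpM2l//.
rewrite /Num.norm /= mx_normrE; apply/bigmax_leP; split=> /=; first exact: ltW.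
by move=> [i j] _ /=; rewrite ord1; exact: xb.
Qed.

(** Jensen's inequality for the probability density [moll r (y - x)], followed
    by an exchange of the two integrals. *)
Lemma young f r : 0 < r -> sqi f -> l2sq (conv (moll r) f) <= l2sq f.
Proof.
move=> r0 sf; pose f0 x : R := f x * \1_D x.
have mf0 : measurable_fun setT f0.
  have mfD : measurable_fun setT (f \_ D) by apply/(measurable_restrictT _ mD); exact: sf.1.
  apply: eq_measurable_fun mfD => x _; rewrite patchE /f0 indicE.
  by case: (x \in D); rewrite ?mulr1 ?mulr0.
pose G (p : pt * pt) : \bar R := (moll r (p.2 - p.1) * f0 p.1 ^+ 2)%:E.
have G0 p : (0 <= G p)%E by rewrite lee_fin mulr_ge0 ?moll_ge0 ?sqr_ge0.
have mG : measurable_fun setT G.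
  apply/measurable_EFinP; apply: measurable_funM.
    apply: (measurableT_comp (moll_measurable r)).
    apply: measurable_fun_rV => i; under eq_fun do rewrite !mxE.
    apply: measurable_funB.
      exact: (measurableT_comp (measurable_coord i) measurable_snd).
    exact: (measurableT_comp (measurable_coord i) measurable_fst).
  by apply: measurable_funX; exact: (measurableT_comp mf0 measurable_fst).
have FT := @fubini_tonelli _ _ _ _ _ mu mu G mG G0.
have sc : sqi (conv (moll r) f).
  have [M HM] := test_bounded (moll_kernel r).
  apply: (sqi_bounded mD Dfin (K := l1 f * M)).
    by apply: measurable_funTS; apply: smooth_measurable; exact: (smooth_conv (moll_kernel r) sf).
  move=> y _; apply: (conv_bound sf (kernel_sqi y (moll_kernel r))).
    exact: le_trans (normr_ge0 _) (HM 0).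
  by move=> x; exact: HM.
have jensen y : ((conv (moll r) f y ^+ 2)%:E <= \int[mu]_x G (x, y))%E.
  pose w x := moll r (y - x).
  have sw : sqi w by exact: kernel_sqi (moll_kernel r).
  pose A := conv (moll r) f y.
  have if2 : mu.-integrable D (EFin \o (fun x => w x * f x ^+ 2)).
    have [M HM] := test_bounded (moll_kernel r).
    apply: (integrable_dominated mD (g := fun x => M * f x ^+ 2)).
    - by apply: measurable_funM; [exact: sw.1|apply: measurable_funX; exact: sf.1].
    - move=> x _; rewrite normrM (ger0_norm (sqr_ge0 _)) ler_wpM2r ?sqr_ge0//; exact: HM.
    - exact: (integrable_scale mD M (sqi_integrable2 sf)).
  have iwf : mu.-integrable D (EFin \o (fun x => f x * w x)) := sqi_prod mD sf sw.
  have iw : mu.-integrable D (EFin \o w) := sqi_integrable mD Dfin sw.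
  have wle : \int[mu]_(x in D) w x <= 1.
    rewrite -(moll_shift_integral y r0).
    have iT := moll_shift_integrable r y.
    rewrite Rintegral_mkcond; apply: (le_Rintegral measurableT _ iT).
      by rewrite -restrict_EFin -integrable_mkcond.
    by move=> x _; rewrite patchE; case: ifP => // _; exact: moll_ge0.
  have -> : (\int[mu]_x G (x, y) = (\int[mu]_(x in D) (w x * f x ^+ 2))%:E)%E.
    rewrite /Rintegral fineK; last exact: (integrable_fin_num mD if2).
    rewrite [RHS]integral_mkcond; apply: eq_integral => x _; rewrite /G /= patchE /f0 indicE.
    by case: (x \in D); rewrite ?mulr1 // mulr0 expr0n /= mulr0.
  rewrite lee_fin -/A.
  have i1 := integrable_scale mD (- 2 * A) iwf; have i2 := integrable_scale mD (A ^+ 2) iw.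
  have i3 := integrable_sum2 mD if2 i1.
  have : 0 <= \int[mu]_(x in D) ((w x * f x ^+ 2 + (- 2 * A) * (f x * w x)) + A ^+ 2 * w x).
    apply: Rintegral_ge0 => x _; have := moll_ge0 r (y - x); rewrite -/(w x) => w0.
    have -> : w x * f x ^+ 2 + - 2 * A * (f x * w x) + A ^+ 2 * w x = w x * (f x - A) ^+ 2 by ring.
    by rewrite mulr_ge0// sqr_ge0.
  rewrite (RintegralD mD i3 i2) (RintegralD mD if2 i1) (RintegralZl _ mD iwf) (RintegralZl _ mD iw).
  rewrite -[\int[mu]_(x in D) (f x * w x)]/A.
  have := sqr_ge0 A; move: wle; move: (\int[mu]_(x in D) w x) (\int[mu]_(x in D) _) => p q; nra.
rewrite -lee_fin (l2sq_EFin mD sc) (l2sq_EFin mD sf).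
have mc2 : measurable_fun setT (fun y => (conv (moll r) f y ^+ 2)%:E).
  apply/measurable_EFinP; apply: measurable_funX.
  by apply: smooth_measurable; exact: (smooth_conv (moll_kernel r) sf).
have mI : measurable_fun setT (fun y => (\int[mu]_x G (x, y))%E).
  exact: (@measurable_fun_fubini_tonelli_G _ _ _ _ _ mu G mG G0).
apply: (@le_trans _ _ (\int[mu]_y \int[mu]_x G (x, y))%E).
  apply: (@le_trans _ _ (\int[mu]_y (conv (moll r) f y ^+ 2)%:E)%E).
    have sq0 (y : pt) : setT y -> (0 <= (conv (moll r) f y ^+ 2)%:E)%E by rewrite lee_fin sqr_ge0.
    exact: (@ge0_subset_integral _ _ _ mu D setT mD measurableT _ mc2 sq0 (@subsetT _ D)).
  apply: ge0_le_integral => //.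
  - by move=> y _; rewrite lee_fin sqr_ge0.
rewrite -FT [leRHS]integral_mkcond; apply: ge0_le_integral => //.
- by move=> x _; apply: integral_ge0.
- exact: (@measurable_fun_fubini_tonelli_F _ _ _ _ _ mu G mG G0).
- by apply/(measurable_restrictT _ mD); apply/measurable_EFinP; apply: measurable_funX; exact: sf.1.
move=> x _.
have ix : mu.-integrable setT (EFin \o (fun y => moll r (y - x))).
  have := moll_shift_integrable r x; apply: eq_integrable => // y _ /=.
  by rewrite -moll_even opprB.
have -> : (\int[mu]_y G (x, y) = (f0 x ^+ 2 * \int[mu]_y moll r (y - x))%:E)%E.
  rewrite -(RintegralZl _ measurableT ix) /Rintegral fineK; last first.
    exact: (integrable_fin_num measurableT (integrable_scale measurableT _ ix)).
  by apply: eq_integral => y _; rewrite /G /= mulrC.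
have -> : \int[mu]_y moll r (y - x) = 1.
  rewrite -(moll_shift_integral x r0); apply: eq_Rintegral => y _.
  by rewrite -moll_even opprB.
rewrite mulr1 patchE /f0 indicE; case: (x \in D) => /=; first by rewrite mulr1.
by rewrite mulr0 expr0n.
Qed.

Lemma conv_sqi f r : sqi f -> sqi (conv (moll r) f).
Proof.
move=> sf; have [M HM] := test_bounded (moll_kernel r).
apply: (sqi_bounded mD Dfin (K := l1 f * M)).
  by apply: measurable_funTS; apply: smooth_measurable; exact: (smooth_conv (moll_kernel r) sf).
move=> y _; apply: (conv_bound sf (kernel_sqi y (moll_kernel r))).
  exact: le_trans (normr_ge0 _) (HM 0).
by move=> x; exact: HM.
Qed.

Lemma convB r f g y : sqi f -> sqi g ->
  conv (moll r) (fun x => f x - g x) y = conv (moll r) f y - conv (moll r) g y.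
Proof.
move=> sf sg; have tk := moll_kernel r.
rewrite /conv -(RintegralB mD (conv_integrable y tk sf) (conv_integrable y tk sg)).
by apply: eq_Rintegral => x _; rewrite mulrBl.
Qed.

(** Test functions are Lipschitz, so for them the convergence is uniform; young
    and density extend it. *)
Lemma conv_cvg f e : sqi f -> 0 < e -> exists2 r0, 0 < r0 & forall r, 0 < r -> r < r0 ->
  l2sq (fun y => conv (moll r) f y - f y) < e.
Proof.
move=> sf e0; have [psi [tp Hp]] := test_dense oD bD sf (e := e / 16) ltac:(lra).
have [L L0 HL] := conv_test tp; have sp := test_sqi oD bD tp.
set m := fine (mu D); have m0 : 0 <= m by rewrite fine_ge0.
have c0 : 0 < 16 * (L ^+ 2 * m + 1) by rewrite mulr_gt0// ltr_wpDl// mulr_ge0// sqr_ge0.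
exists (Num.min 1 (e / (16 * (L ^+ 2 * m + 1)))); first by rewrite lt_min ltr01 divr_gt0.
move=> r r0; rewrite lt_min => /andP[r1 re].
have s1 := sqiB mD sf sp; have s2 := conv_sqi r s1.
have s3 : sqi (fun y => conv (moll r) psi y - psi y) by exact: (sqiB mD (conv_sqi r sp) sp).
have -> : (fun y => conv (moll r) f y - f y) =
    (fun y => (conv (moll r) (fun x => f x - psi x) y + (conv (moll r) psi y - psi y)) + -1 * (f y - psi y)).
  by apply/funext => y; rewrite convB//; ring.
have B1 := l2sqD mD (sqiD mD s2 s3) (sqiZ mD (-1) s1).
have B2 := l2sqD mD s2 s3.
rewrite (l2sqZ mD _ s1) sqrrN expr1n mul1r in B1.
have B3 := young r0 s1.
have B4 : l2sq (fun y => conv (moll r) psi y - psi y) <= (L * r) ^+ 2 * m.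
  have ic : mu.-integrable D (EFin \o (fun=> (L * r) ^+ 2)).
    apply: (@bounded_integrable _ _ _ mu D mD Dfin _ ((L * r) ^+ 2)) => // x _.
    by rewrite ger0_norm ?sqr_ge0.
  rewrite /l2sq -(Rintegral_cst mu mD); apply: (le_Rintegral mD (sqi_integrable2 s3) ic) => y _.
  rewrite -real_normK ?num_real// ler_pXn2r ?nnegrE ?mulr_ge0 ?(ltW r0)//.
  exact: HL.
have B5 : (L * r) ^+ 2 * m <= e / 16.
  rewrite ltr_pdivlMr// in re; rewrite exprMn.
  have r2 : r ^+ 2 <= r by rewrite expr2 ler_piMl ?ltW.
  have Lm : 0 <= L ^+ 2 * m by rewrite mulr_ge0// sqr_ge0.
  have : r ^+ 2 * (L ^+ 2 * m) <= r * (L ^+ 2 * m) by rewrite ler_wpM2r.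
  move: re; rewrite [L ^+ 2 * r ^+ 2 * m]mulrAC [L ^+ 2 * m * _]mulrC.
  move: (L ^+ 2 * m) => w; lra.
lra.
Qed.

(** ** Mollification and weak derivatives *)

Definition rwd s f g := forall phi, test_fun D phi ->
  \int[mu]_(x in D) (f x * partial s phi x) = (-1) ^+ size s * \int[mu]_(x in D) (g x * phi x).

Lemma is_derive_reflect kap i y x : smooth kap ->
  is_derive x (e_ i) (fun x => kap (y - x)) (- 'D_(e_ i) kap (y - x)).
Proof.
move=> sk; apply: is_derive_of_line.
have Dk := smooth_derive i (y - x) sk.
have : is_derive (- (0 : R)) 1 (fun t : R => kap (t *: e_ i + (y - x))) ('D_(e_ i) kap (y - x)).
  by apply: is_derive_line; rewrite oppr0 scale0r add0r.
move=> Dl; rewrite -mulrN1.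
have -> : (fun t : R => kap (y - (t *: e_ i + x))) = (fun t => kap (t *: e_ i + (y - x))) \o (fun t => - t).
  by apply/funext => t /=; congr kap; rewrite scaleNr opprD addrCA.
have Hn : is_derive (0 : R) (1 : R) (fun t : R => - t) (-1) by exact: (is_deriveN (is_derive_id (0 : R) 1)).
exact: (@is_derive1_comp _ (fun t => kap (t *: e_ i + (y - x))) (fun t : R => - t) _ _ _ Dl Hn).
Qed.

Lemma partial_reflect s kap y : smooth kap ->
  partial s (fun x => kap (y - x)) = (fun x => (-1) ^+ size s * partial s kap (y - x)).
Proof.
move=> sk; elim: s => [|i s IH]; first by apply/funext => x; rewrite expr0 mul1r.
rewrite /= IH; apply/funext => x.
have sps : smooth (partial s kap).
  by move=> t; have := sk (t ++ s); rewrite /partial foldr_cat.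
have [d1 d2] := is_derive_reflect i y x sps.
have -> : 'D_(delta_mx ord0 i) (fun x => (-1) ^+ size s * partial s kap (y - x)) x =
    (-1) ^+ size s * 'D_(e_ i) (fun x => partial s kap (y - x)) x.
  by rewrite -/(ev i) deriveMl.
by rewrite d2 exprS; ring.
Qed.

Lemma continuous_reflect kap y : continuous kap -> continuous (fun x => kap (y - x)).
Proof.
move=> ck; apply/continuousP => A oA; apply/rV_openP => x /= Ax.
move/continuousP: ck => ck.
have /rV_openP/(_ (y - x) Ax)[e e0 eA] : open (kap @^-1` A) by exact: ck.
exists e => // z zx; apply: eA => i; have := zx i; rewrite -normrN; congr (`|_| < _).
by rewrite !mxE; ring.
Qed.

Lemma smooth_reflect kap y : smooth kap -> smooth (fun x => kap (y - x)).
Proof.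
move=> sk s; have sps : smooth (partial s kap).
  by move=> t; have := sk (t ++ s); rewrite /partial foldr_cat.
rewrite partial_reflect//; split.
  apply: (@continuous_reflect (fun x => (-1) ^+ size s * partial s kap x)).
  by apply: smooth_continuous; exact: smoothZ.
move=> i x; have [d1 _] := is_derive_reflect i y x sps.
by apply: derivableM => //; exact: derivable_cst.
Qed.

Lemma reflect_test r y : 0 < r -> cbox y r `<=` D -> test_fun D (fun x => moll r (y - x)).
Proof.
move=> r0 yD; apply: (test_of_support _ (@cbox_compact R d y r) yD).
  by apply: smooth_reflect; exact: test_smooth (moll_kernel r).
by move=> x nx; apply: moll_out => H; apply: nx => i; have := H i; rewrite !mxE.
Qed.

(** When the box around [y] lies in [D], the kernel centred at [y] is a test
    function for the weak derivative of [f]. *)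
Lemma conv_wderiv s f g r y : sqi f -> 0 < r -> cbox y r `<=` D -> rwd s f g ->
  partial s (conv (moll r) f) y = conv (moll r) g y.
Proof.
move=> sf r0 yD fg; rewrite (partial_conv s (moll_kernel r) sf) /conv.
have := fg _ (reflect_test r0 yD).
rewrite (partial_reflect s y (test_smooth (moll_kernel r))).
under eq_Rintegral do rewrite mulrCA.
rewrite (RintegralZl _ mD (conv_integrable y (test_partial s (moll_kernel r)) sf)).
by move=> /mulfI; apply; rewrite signr_eq0.
Qed.
End convolution.

(** * Bounded functions with bounded weak derivatives *)

Section bounded_families.
Context {R : realType} {d : nat}.
Local Notation pt := 'rV[R]_d.
Local Notation mu := (lebesgue_rV d).
Local Notation e_ := (@ev R d).
Variable D : set pt.
Hypotheses (oD : open D) (bD : bounded_set D).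
Implicit Types (f g h phi psi : pt -> R) (F G : R -> pt -> R) (i j : 'I_d) (x y : pt) (M : R).
Let mD := measurable_domain oD.
Let Dfin := domain_fin oD bD.
Local Notation sqi := (sqi mu D).
Local Notation l2sq := (l2sq mu D).
Local Notation rwd := (@rwd R d D).
Local Notation int f := (\int[mu]_(x in D) f x).

Definition bmeas M f := measurable_fun D f /\ forall x, D x -> `|f x| <= M.

Lemma bmeas_sqi M f : bmeas M f -> sqi f.
Proof. by move=> [mf fM]; exact: (sqi_bounded mD Dfin mf fM). Qed.

Lemma bmeas_integrable M f : bmeas M f -> mu.-integrable D (EFin \o f).
Proof. by move=> [mf fM]; exact: (bounded_integrable mD Dfin mf fM). Qed.

Lemma bmeas_mul M N f g : 0 <= M -> bmeas M f -> bmeas N g -> bmeas (M * N) (fun x => f x * g x).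
Proof.
move=> M0 [mf fM] [mg gN]; split; first exact: measurable_funM.
by move=> x Dx; rewrite normrM; apply: ler_pM => //; [exact: fM|exact: gN].
Qed.

Lemma bmeas_add M N f g : bmeas M f -> bmeas N g -> bmeas (M + N) (fun x => f x + g x).
Proof.
move=> [mf fM] [mg gN]; split; first exact: measurable_funD.
by move=> x Dx; apply: le_trans (ler_normD _ _) _; apply: lerD; [exact: fM|exact: gN].
Qed.

Lemma bmeas_scale M (a : R) f : bmeas M f -> bmeas (`|a| * M) (fun x => a * f x).
Proof.
move=> [mf fM]; split; first by apply: measurable_funM => //; exact: measurable_cst.
by move=> x Dx; rewrite normrM ler_wpM2l// fM.
Qed.

(** A uniformly bounded family converging in [L2] as its parameter tends to 0;
    such families can be multiplied. *)
Definition bcvg F f := exists M, [/\ 0 <= M, forall r, 0 < r -> bmeas M (F r), bmeas M f &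
  forall e, 0 < e -> exists2 r0, 0 < r0 & forall r, 0 < r -> r < r0 ->
    l2sq (fun x => F r x - f x) < e].

Lemma bcvg_cst M f : 0 <= M -> bmeas M f -> bcvg (fun=> f) f.
Proof.
move=> M0 bf; exists M; split=> // e e0; exists 1 => // r _ _.
rewrite /(l2sq _); under eq_Rintegral do rewrite subrr expr0n /=.
by rewrite Rintegral_cst ?mul0r.
Qed.

Lemma bcvg_conv M f : 0 <= M -> bmeas M f -> bcvg (fun r => conv D (moll r) f) f.
Proof.
move=> M0 bf; have sf := bmeas_sqi bf; exists M; split=> //.
- move=> r r0; split; first by have [] := conv_sqi oD bD r sf.
  move=> y Dy; have ik := kernel_sqi oD bD y (moll_kernel r).
  have i1 := conv_integrable oD bD y (moll_kernel r) sf.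
  apply: le_trans (le_normr_Rintegral mD i1) _.
  have i2 : mu.-integrable D (EFin \o (fun x => moll r (y - x))) := sqi_integrable mD Dfin ik.
  have inn : mu.-integrable D (EFin \o (fun x => `|f x * moll r (y - x)|)) by exact: integrable_norm i1.
  apply: (@le_trans _ _ (\int[mu]_(x in D) (M * moll r (y - x)))).
    apply: (le_Rintegral mD inn (integrable_scale mD M i2)) => x Dx.
    by rewrite normrM (ger0_norm (moll_ge0 _ _)) ler_wpM2r ?moll_ge0//; exact: bf.2.
  rewrite (RintegralZl M mD i2) -[leRHS]mulr1 ler_wpM2l//.
  have iT := moll_shift_integrable r y; rewrite -(moll_shift_integral y r0).
  rewrite [leLHS]Rintegral_mkcond; apply: (le_Rintegral measurableT _ iT).
    by rewrite -restrict_EFin -integrable_mkcond.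
  by move=> x _; rewrite patchE; case: ifP => // _; exact: moll_ge0.
- by move=> e e0; exact: (conv_cvg oD bD sf e0).
Qed.

Lemma l2sq_le (u v : pt -> R) (c : R) : sqi u -> sqi v -> (forall x, D x -> `|u x| <= c * `|v x|) ->
  l2sq u <= c ^+ 2 * l2sq v.
Proof.
move=> su sv uv; have i1 := sqi_integrable2 su; have i2 := sqi_integrable2 sv.
rewrite /(l2sq _) -(RintegralZl _ mD i2); apply: (le_Rintegral mD i1 (integrable_scale mD _ i2)).
move=> x Dx; rewrite -[u x ^+ 2]real_normK ?num_real// -[v x ^+ 2]real_normK ?num_real// -exprMn.
by rewrite ler_pXn2r ?nnegrE ?uv//; exact: le_trans (normr_ge0 _) (uv x Dx).
Qed.

Lemma bcvg_mul F G f g : bcvg F f -> bcvg G g -> bcvg (fun r x => F r x * G r x) (fun x => f x * g x).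
Proof.
move=> [M [M0 FM fM Fc]] [N [N0 GN gN Gc]]; exists (M * N); split; first exact: mulr_ge0.
- by move=> r r0; apply: bmeas_mul => //; [exact: FM|exact: GN].
- exact: bmeas_mul.
move=> e e0; set c := M ^+ 2 + N ^+ 2 + 1.
have c0 : 0 < c by rewrite /c ltr_wpDl// addr_ge0 ?sqr_ge0.
have q0 : 0 < e / (4 * c) by rewrite divr_gt0// mulr_gt0.
have [r1 r10 H1] := Fc _ q0; have [r2 r20 H2] := Gc _ q0.
exists (Num.min r1 r2); first by rewrite lt_min r10.
move=> r r0; rewrite lt_min => /andP[rr1 rr2].
have sF := bmeas_sqi (FM r r0); have sf := bmeas_sqi fM.
have sG := bmeas_sqi (GN r r0); have sg := bmeas_sqi gN.
have sFf := sqiB mD sF sf; have sGg := sqiB mD sG sg.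
pose u x := (F r x - f x) * G r x; pose v x := f x * (G r x - g x).
have su : sqi u.
  have := sqiM_bounded mD (GN r r0).1 (GN r r0).2 sFf; congr (sqi _).
  by apply/funext => x; rewrite mulrC.
have sv : sqi v by exact: (sqiM_bounded mD fM.1 fM.2 sGg).
have -> : (fun x => F r x * G r x - f x * g x) = (fun x => u x + v x).
  by apply/funext => x; rewrite /u /v; ring.
have B := l2sqD mD su sv.
have Bu : l2sq u <= N ^+ 2 * l2sq (fun x => F r x - f x).
  apply: l2sq_le => // x Dx; rewrite /u normrM mulrC ler_wpM2r//; exact: (GN r r0).2.
have Bv : l2sq v <= M ^+ 2 * l2sq (fun x => G r x - g x).
  by apply: l2sq_le => // x Dx; rewrite /v normrM ler_wpM2r//; exact: fM.2.
have h1 := H1 r r0 rr1; have h2 := H2 r r0 rr2.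
have E : e / (4 * c) * (4 * c) = e by rewrite divfK// gt_eqF// mulr_gt0.
have aux (p q lu lv lf lg m n' : R) : 0 <= m -> 0 <= n' -> 0 <= p -> lf <= p -> lg <= p ->
    lu <= n' * lf -> lv <= m * lg -> 2 * lu + 2 * lv <= 2 * (n' * p) + 2 * (m * p).
  move=> m0 n0 p0 h3 h4 h5 h6.
  have : n' * lf <= n' * p by exact: ler_wpM2l.
  have : m * lg <= m * p by exact: ler_wpM2l.
  lra.
apply: le_lt_trans B _.
apply: le_lt_trans (aux _ 0 _ _ _ _ _ _ (sqr_ge0 M) (sqr_ge0 N) (ltW q0) (ltW h1) (ltW h2) Bu Bv) _.
rewrite -[ltRHS]E /c; move: (e / _) q0 => p p0.
have := mulr_ge0 (ltW p0) (sqr_ge0 M); have := mulr_ge0 (ltW p0) (sqr_ge0 N).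
rewrite mulrDr !mulrDr; move: (M ^+ 2) (N ^+ 2) => m n' h3 h4; lra.
Qed.

Lemma bcvg_add F G f g : bcvg F f -> bcvg G g -> bcvg (fun r x => F r x + G r x) (fun x => f x + g x).
Proof.
move=> [A [A0 FA fA Fc]] [B [B0 GB gB Gc]]; exists (A + B); split.
- exact: addr_ge0.
- by move=> r r0; apply: bmeas_add; [exact: FA|exact: GB].
- exact: bmeas_add.
- move=> t t0; have t40 : 0 < t / 4 by rewrite divr_gt0.
  have [r1 r10 H1] := Fc _ t40; have [r2 r20 H2] := Gc _ t40.
  exists (Num.min r1 r2); first by rewrite lt_min r10.
  move=> r r0; rewrite lt_min => /andP[h1 h2].
  have s1 := sqiB mD (bmeas_sqi (FA r r0)) (bmeas_sqi fA).
  have s2 := sqiB mD (bmeas_sqi (GB r r0)) (bmeas_sqi gB).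
  have := l2sqD mD s1 s2; have := H1 r r0 h1; have := H2 r r0 h2.
  set u := l2sq _; set v := l2sq _; set w := l2sq _ => k1 k2 k3.
  rewrite (_ : l2sq _ = w); first lra.
  by apply: eq_Rintegral => x _; congr (_ ^+ 2); ring.
Qed.

Lemma bcvg_at F f r : bcvg F f -> 0 < r -> mu.-integrable D (EFin \o F r).
Proof. by move=> [M [_ FM _ _]] r0; exact: bmeas_integrable (FM r r0). Qed.

Lemma bcvg_inv (delta : R) F f : 0 < delta -> bcvg F f -> (forall r x, 0 < r -> D x -> delta <= F r x) ->
  (forall x, D x -> delta <= f x) -> bcvg (fun r x => (F r x)^-1) (fun x => (f x)^-1).
Proof.
move=> d0 [M [M0 FM fM Fc]] Fd fd.
have minv g : measurable_fun D g -> (forall x, D x -> delta <= g x) -> bmeas delta^-1 (fun x => (g x)^-1).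
  move=> mg gd; split.
    apply: (eq_measurable_fun (fun x => expR (- ln (g x)))).
      by move=> x /set_mem Dx; rewrite expRN lnK// posrE (lt_le_trans d0 (gd x Dx)).
    apply: (measurableT_comp (@measurable_expR R)).
    by apply: measurable_funN; exact: (measurableT_comp (@measurable_ln R)).
  move=> x Dx; have gx := lt_le_trans d0 (gd x Dx).
  by rewrite ger0_norm ?invr_ge0 ?(ltW gx)// lef_pV2 ?posrE// gd.
have bF r (r0 : 0 < r) := minv _ (FM r r0).1 (Fd r ^~ r0).
have bf := minv _ fM.1 fd.
exists delta^-1; split; [by rewrite invr_ge0 ltW|exact: bF|exact: bf|].
move=> e e0; set c := (delta^-1 ^+ 2) ^+ 2.
have c0 : 0 < c by rewrite !exprn_gt0// invr_gt0.
have [r1 r10 H1] := Fc (e / c) (divr_gt0 e0 c0); exists r1 => // r r0 rr1.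
apply: (@le_lt_trans _ _ (c * l2sq (fun x => F r x - f x))); last first.
  by rewrite mulrC -ltr_pdivlMr//; exact: H1.
apply: l2sq_le.
- by apply: (sqiB mD); [exact: bmeas_sqi (bF r r0)|exact: bmeas_sqi bf].
- by apply: (sqiB mD); [exact: bmeas_sqi (FM r r0)|exact: bmeas_sqi fM].
move=> x Dx; have Fx := lt_le_trans d0 (Fd r x r0 Dx); have fx := lt_le_trans d0 (fd x Dx).
have -> : (F r x)^-1 - (f x)^-1 = ((F r x)^-1 * (f x)^-1) * (f x - F r x).
  by field; rewrite !gt_eqF.
rewrite normrM distrC ler_wpM2r// normrM expr2; apply: ler_pM => //.
  exact: (bF r r0).2.
exact: bf.2.
Qed.

Lemma bcvg_int F G f g (r1 : R) : bcvg F f -> bcvg G g -> 0 < r1 ->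
  (forall r, 0 < r -> r < r1 -> int (F r) = - int (G r)) -> int f = - int g.
Proof.
move=> cF cG r10 FG; apply/eqP; rewrite -subr_eq0 opprK -normr_eq0 eq_le normr_ge0 andbT.
have key H h : bcvg H h -> forall e, 0 < e -> exists2 r0, 0 < r0 & forall r, 0 < r -> r < r0 ->
    `|int (H r) - int h| < e.
  move=> [M [M0 HM hM Hc]] e e0; set m := fine (mu D).
  have m0 : 0 <= m by rewrite fine_ge0.
  have q0 : 0 < e ^+ 2 / (m + 1) by rewrite divr_gt0 ?exprn_gt0// ltr_wpDl.
  have [r0 r00 H0] := Hc _ q0; exists r0 => // r rp rr.
  have sB := sqiB mD (bmeas_sqi (HM r rp)) (bmeas_sqi hM).
  rewrite -(RintegralB mD (bmeas_integrable (HM r rp)) (bmeas_integrable hM)).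
  apply: le_lt_trans (le_normr_Rintegral mD (sqi_integrable mD Dfin sB)) _.
  have L1 := l2sq_L1 mD Dfin sB; rewrite -(@ltr_pXn2r _ 2)// ?nnegrE ?(ltW e0)//; last first.
    by apply: Rintegral_ge0.
  apply: le_lt_trans L1 _; rewrite -/m.
  have := H0 r rp rr; rewrite ltr_pdivlMr ?ltr_wpDl// => h1.
  have := l2sq_ge0 mu D (fun x => H r x - h x); move: h1; move: (l2sq _) => l h1 l0.
  by apply: le_lt_trans h1; rewrite mulrC ler_wpM2l// lerDl.
apply/ler_addgt0Pl => e e0; rewrite addr0.
have e20 : 0 < e / 2 by rewrite divr_gt0.
have [s1 s10 H1] := key _ _ cF _ e20; have [s2 s20 H2] := key _ _ cG _ e20.
pose r := Num.min r1 (Num.min s1 s2) / 2.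
have mn : 0 < Num.min r1 (Num.min s1 s2) by rewrite !lt_min r10 s10 s20.
have r0 : 0 < r by rewrite divr_gt0.
have : r < Num.min r1 (Num.min s1 s2) by rewrite /r; move: mn; move: (Num.min _ _) => t; lra.
rewrite !lt_min => /andP[l1 /andP[l2 l3]].
have := H1 r r0 l2; have := H2 r r0 l3; have := FG r r0 l1 => ->.
have := ler_normD (int f + int (G r)) (int g - int (G r)).
have -> : int f + int (G r) + (int g - int (G r)) = int f + int g by ring.
have -> : `|- int (G r) - int f| = `|int f + int (G r)| by rewrite -normrN; congr (`|_|); ring.
have -> : `|int (G r) - int g| = `|int g - int (G r)| by rewrite distrC.
move: (`|_|) (`|_|) (`|_|) => a b c; lra.
Qed.

(** ** Products and inverses *)

Lemma compact_margin (K : set pt) : compact K -> K `<=` D ->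
  exists2 e : R, 0 < e & forall x, K x -> cbox x e `<=` D.
Proof.
move=> cK KD; have /compact_near_coveringP ncK := cK.
have [] := ncK R (0^'+) (fun e x => cbox x e `<=` D) _; last first.
  move=> e /= e0 H; pose t := e / 2.
  have t0 : 0 < t by rewrite divr_gt0.
  exists t => // x Kx; apply: (H t) => //=.
  by rewrite /ball_ /= sub0r normrN ger0_norm ?(ltW t0)// /t; lra.
move=> x Kx; have [e e0 sD] := (rV_openP D).1 oD x (KD x Kx).
exists ([set y : pt | forall i, `|x ord0 i - y ord0 i| < e / 2], [set t : R | t < e / 2]).
  split=> /=.
    apply/nbhs_ballP; exists (e / 2) => /=; first by rewrite divr_gt0.
    by move=> y [_ xy] i; exact: xy.
  by apply: nbhs_right_lt; rewrite divr_gt0.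
move=> [y t] /= [xy te] z yz; apply: sD => i.
have := xy i; have := yz i; have := ler_normD (x ord0 i - y ord0 i) (y ord0 i - z ord0 i).
rewrite addrA subrK; move: te; move: (`|_|) (`|_|) (`|_|) => a b c; lra.
Qed.

Lemma test_supp psi : test_fun D psi -> exists2 e : R, 0 < e &
  forall x, psi x != 0 -> cbox x e `<=` D.
Proof.
move=> [_ cK KD]; have [e e0 H] := compact_margin cK KD; exists e => // x px.
by apply: H; exact: subset_closure.
Qed.

Lemma test_bmeas psi : test_fun D psi -> exists2 M, 0 <= M & bmeas M psi.
Proof.
move=> tp; have [M HM] := test_bounded tp; exists M; first exact: le_trans (normr_ge0 _) (HM 0).
by split=> [|x _]; [exact: test_measurable|exact: HM].
Qed.

Definition b1 M f (fs : 'I_d -> pt -> R) :=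
  [/\ 0 <= M, bmeas M f, forall i, bmeas M (fs i) & forall i, rwd [:: i] f (fs i)].

Lemma conv_partial_supp psi f fi i M : test_fun D psi -> bmeas M f -> rwd [:: i] f fi ->
  exists2 e : R, 0 < e & forall r, 0 < r -> r < e -> forall y,
    psi y * 'D_(e_ i) (conv D (moll r) f) y = psi y * conv D (moll r) fi y.
Proof.
move=> tp bf ffi; have [e e0 H] := test_supp tp; exists e => // r r0 re y.
have [->|py] := eqVneq (psi y) 0; first by rewrite !mul0r.
congr (_ * _); have yD : cbox y r `<=` D.
  by apply: subset_trans (H y py) => z yz t; apply: le_trans (yz t) (ltW re).
exact: (conv_wderiv oD bD (bmeas_sqi bf) r0 yD ffi).
Qed.

Lemma rwd1 f g i phi : rwd [:: i] f g -> test_fun D phi ->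
  \int[mu]_(x in D) (f x * 'D_(e_ i) phi x) = - \int[mu]_(x in D) (g x * phi x).
Proof. by move=> H tp; have := H phi tp; rewrite /= expr1 mulN1r. Qed.

(** Mollify [f]: near the support of a test function it becomes a smooth factor
    that can be absorbed in the test function, and bounded factors allow the
    passage to the limit. *)
Lemma b1_mul M N f g fs gs : b1 M f fs -> b1 N g gs -> exists M',
  b1 M' (fun x => f x * g x) (fun i x => fs i x * g x + f x * gs i x).
Proof.
move=> [M0 bf bfi df] [N0 bg bgi dg]; exists (M * N + M * N).
have MN : 0 <= M * N by exact: mulr_ge0.
have MN2 : M * N <= M * N + M * N by rewrite lerDl.
split; first exact: addr_ge0.
- have [m1 m2] := bmeas_mul M0 bf bg; split=> // x Dx; exact: le_trans (m2 x Dx) MN2.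
- by move=> i; apply: bmeas_add; exact: bmeas_mul.
move=> i psi tp; rewrite /= expr1 mulN1r.
have [P P0 bp] := test_bmeas tp; have tdp := test_partial1 i tp; have [Q Q0 bdp] := test_bmeas tdp.
have [e e0 He] := conv_partial_supp tp bf (df i).
have cf := bcvg_conv M0 bf; have cfi := bcvg_conv M0 (bfi i).
have C1 := bcvg_mul cf (bcvg_cst (mulr_ge0 N0 Q0) (bmeas_mul N0 bg bdp)).
have C2 := bcvg_mul cfi (bcvg_cst (mulr_ge0 N0 P0) (bmeas_mul N0 bg bp)).
have C3 := bcvg_mul cf (bcvg_cst (mulr_ge0 N0 P0) (bmeas_mul N0 (bgi i) bp)).
have C23 : bcvg (fun r x => conv D (moll r) (fs i) x * (g x * psi x) + conv D (moll r) f x * (gs i x * psi x))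
    (fun x => fs i x * (g x * psi x) + f x * (gs i x * psi x)).
  exact: bcvg_add.
have := @bcvg_int _ _ _ _ e C1 C23 e0.
have E1 : int (fun x => f x * (g x * 'D_(e_ i) psi x)) = \int[mu]_(x in D) (f x * g x * 'D_(delta_mx ord0 i) psi x).
  by apply: eq_Rintegral => x _; rewrite mulrA.
have E2 : int (fun x => fs i x * (g x * psi x) + f x * (gs i x * psi x)) =
    \int[mu]_(x in D) ((fs i x * g x + f x * gs i x) * psi x).
  by apply: eq_Rintegral => x _; rewrite mulrDl !mulrA.
rewrite E1 E2; apply=> r r0 re.
have sF := smooth_conv oD bD (moll_kernel r) (bmeas_sqi bf).
have tFp := test_mul sF tp.
have := rwd1 (dg i) tFp.
have I1 := bcvg_at C1 r0; have I2 := bcvg_at C2 r0; have I3 := bcvg_at C3 r0.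
rewrite (RintegralD mD I2 I3).
have -> : \int[mu]_(x in D) (g x * 'D_(e_ i) (fun x => conv D (moll r) f x * psi x) x) =
    \int[mu]_(x in D) (conv D (moll r) f x * (g x * 'D_(e_ i) psi x) + conv D (moll r) (fs i) x * (g x * psi x)).
  apply: eq_Rintegral => x _; rewrite (partialM i x sF (test_smooth tp)) (He r r0 re x).
  move: (conv _ _ _ _) (conv _ _ _ _) ('D_ _ _ _) => a b c; ring.
rewrite (RintegralD mD I1 I2).
have -> : \int[mu]_(x in D) (gs i x * (conv D (moll r) f x * psi x)) =
    \int[mu]_(x in D) (conv D (moll r) f x * (gs i x * psi x)).
  by apply: eq_Rintegral => x _; rewrite mulrCA.
move: (Rintegral _ _ _) (Rintegral _ _ _) (Rintegral _ _ _) => a b c; lra.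
Qed.

Lemma b1_mono M N f fs : M <= N -> b1 M f fs -> b1 N f fs.
Proof.
move=> MN [M0 [mf fM] bi di]; split=> //; first exact: le_trans MN.
  by split=> // x Dx; exact: le_trans (fM x Dx) MN.
by move=> i; have [mi iM] := bi i; split=> // x Dx; exact: le_trans (iM x Dx) MN.
Qed.

Lemma b1_scale M (a : R) f fs : b1 M f fs -> b1 (`|a| * M) (fun x => a * f x) (fun i x => a * fs i x).
Proof.
move=> [M0 bf bi di]; split; [exact: mulr_ge0|exact: bmeas_scale| |].
  by move=> i; exact: bmeas_scale.
move=> i psi tp; have [P P0 bp] := test_bmeas tp; have [Q Q0 bq] := test_bmeas (test_partial [:: i] tp).
have E h : (fun x => a * f x * h x) = (fun x => a * (f x * h x)) by apply/funext => x; rewrite mulrA.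
have E2 h : (fun x => a * fs i x * h x) = (fun x => a * (fs i x * h x)) by apply/funext => x; rewrite mulrA.
rewrite E E2 (RintegralZl a mD (bmeas_integrable (bmeas_mul M0 bf bq))).
by rewrite (RintegralZl a mD (bmeas_integrable (bmeas_mul M0 (bi i) bp))) di// mulrCA.
Qed.

Lemma test_b1 psi : test_fun D psi -> exists M, b1 M psi (fun i => partial [:: i] psi).
Proof.
move=> tp; have [P P0 bp] := test_bmeas tp.
have /choice[Q HQ] i : exists Q, 0 <= Q /\ bmeas Q (partial [:: i] psi).
  by have [Q Q0 bq] := test_bmeas (test_partial [:: i] tp); exists Q.
have S0 : 0 <= \sum_i Q i by apply: sumr_ge0 => i _; have [] := HQ i.
exists (P + \sum_i Q i); split; first exact: addr_ge0.
- by have [m1 m2] := bp; split=> // x Dx; apply: le_trans (m2 x Dx) _; rewrite lerDl.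
- move=> i; have [_ [m1 m2]] := HQ i; split=> // x Dx; apply: le_trans (m2 x Dx) _.
  apply: ler_wpDl => //; rewrite (bigD1 i)//= lerDl; apply: sumr_ge0 => j _; have [] := HQ j => //.
- move=> i phi tphi; rewrite /= expr1 mulN1r.
  exact: (int_by_parts oD bD i (test_smooth tp) tphi).
Qed.

(** Mollification of [a - delta] keeps [a] above [delta], so the mollified
    reciprocals are smooth and bounded uniformly. *)
Lemma b1_inv M (delta : R) a a_ : 0 < delta -> b1 M a a_ -> (forall x, D x -> delta <= a x) ->
  exists N, b1 N (fun x => (a x)^-1) (fun i x => -1 * (a_ i x * ((a x)^-1 * (a x)^-1))).
Proof.
move=> d0 [M0 ba bai da] ad.
have cst1 (c : R) : bmeas `|c| (fun=> c) by split.
pose g x := a x + - delta; have bg := bmeas_add ba (cst1 (- delta)).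
have Mg : 0 <= M + `|- delta| by rewrite addr_ge0.
have dg i : rwd [:: i] g (a_ i).
  move=> psi tp; rewrite -(da i psi tp) /g.
  have [Q Q0 bq] := test_bmeas (test_partial [:: i] tp).
  have I1 := bmeas_integrable (bmeas_mul M0 ba bq).
  have I2 := bmeas_integrable (bmeas_mul (normr_ge0 _) (cst1 (- delta)) bq).
  under eq_Rintegral do rewrite mulrDl.
  rewrite (RintegralD mD I1 I2) (RintegralZl (- delta) mD (bmeas_integrable bq)).
  by rewrite [X in _ * X](int_partial0 bD i tp) mulr0 addr0.
pose T r x := conv D (moll r) g x + delta.
have cT : bcvg T a.
  have := bcvg_add (bcvg_conv Mg bg) (bcvg_cst (normr_ge0 _) (cst1 delta)).
  by congr bcvg; apply/funext => x; rewrite /g subrK.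
have Td r x : delta <= T r x.
  rewrite /T lerDr; apply: Rintegral_ge0 => y Dy; rewrite mulr_ge0 ?moll_ge0// /g subr_ge0.
  exact: ad.
have cV := bcvg_inv d0 cT (fun r x _ _ => Td r x) ad.
have [N [N0 _ bV _]] := cV.
have bb := bmeas_scale (-1) (bmeas_mul M0 (bai _) (bmeas_mul N0 bV bV)).
exists (N + `|-1| * (M * (N * N))).
have E0 : 0 <= `|-1| * (M * (N * N)) by rewrite !mulr_ge0.
split; first exact: addr_ge0.
- by have [m1 m2] := bV; split=> // x Dx; apply: le_trans (m2 x Dx) _; rewrite lerDl.
- by move=> i; have [m1 m2] := bb i; split=> // x Dx; apply: le_trans (m2 x Dx) _; rewrite lerDr.
move=> i psi tp; rewrite /= expr1 mulN1r.
have [P P0 bp] := test_bmeas tp; have tdp := test_partial1 i tp; have [Q Q0 bdp] := test_bmeas tdp.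
have [e e0 He] := conv_partial_supp tp bg (dg i).
have cai := bcvg_conv M0 (bai i).
have C1 := bcvg_mul cV (bcvg_cst Q0 bdp).
have C2 := bcvg_mul (bcvg_cst (normr_ge0 _) (cst1 (-1)))
  (bcvg_mul (bcvg_mul cai (bcvg_mul cV cV)) (bcvg_cst P0 bp)).
have := @bcvg_int _ _ _ _ e C1 C2 e0.
have -> : int (fun x => -1 * (a_ i x * ((a x)^-1 * (a x)^-1) * psi x)) =
    \int[mu]_(x in D) (-1 * (a_ i x * ((a x)^-1 * (a x)^-1)) * psi x).
  by apply: eq_Rintegral => x _; rewrite mulrA.
apply=> r r0 re.
have sg : smooth (conv D (moll r) g) := smooth_conv oD bD (moll_kernel r) (bmeas_sqi bg).
have sc : smooth (fun _ : pt => delta) by apply/smooth_expr_smooth/SmoothCst.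
have sT : smooth (T r) by exact: smoothD.
have T0 x : T r x != 0 by rewrite gt_eqF// (lt_le_trans d0).
have sV := smoothV sT T0.
rewrite (int_by_parts oD bD i sV tp); congr (- _); apply: eq_Rintegral => x _.
rewrite (partialV i x sT T0) (partialD i x sg sc) partial_cst addr0.
have := He r r0 re x; move: (conv _ _ _ _) ('D_ _ _ _) (T r x) => u v w h.
have h' : v * psi x = u * psi x by rewrite mulrC h mulrC.
transitivity (- (w^-1 ^+ 2) * (v * psi x)); first by ring.
by rewrite h'; ring.
Qed.
End bounded_families.

(** * Multiplication operators on [H^2_0(D)] *)

Section multipliers.
Context {R : realType} {d : nat}.
Local Notation pt := 'rV[R]_d.
Local Notation C := R[i].
Local Notation fct := ('rV[R]_d -> R[i]).
Local Notation mu := (lebesgue_rV d).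
Local Notation e_ := (@ev R d).
Variable D : set pt.
Hypothesis hD : bdomain D.
Implicit Types (u v w : fct) (f g phi psi b : pt -> R) (s : seq 'I_d) (x y : pt) (M : R).
Let oD := hD.1.
Let bD := hD.2.
Let mD := measurable_domain oD.
Let Dfin := domain_fin oD bD.
Let LS := L2_sip hD.
Local Notation sqi := (sqi mu D).
Local Notation l2sq := (l2sq mu D).
Local Notation rwd := (@rwd R d D).
Local Notation bmeas := (@bmeas R d D).
Local Notation b1 := (@b1 R d D).

Lemma is_wderivRe s u v : is_wderiv D s u v <->
  rwd s (fun x => Re (u x)) (fun x => Re (v x)) /\ rwd s (fun x => Im (u x)) (fun x => Im (v x)).
Proof.
have E (z : fct) psi : (fun x => Re (z x * (psi x)%:C)) = (fun x => Re (z x) * psi x).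
  by apply/funext => x; rewrite cReM /= mulr0 subr0.
have F (z : fct) psi : (fun x => Im (z x * (psi x)%:C)) = (fun x => Im (z x) * psi x).
  by apply/funext => x; rewrite cImM /= mulr0 add0r.
have sgn k : ((-1) ^+ k : C) = ((-1) ^+ k : R)%:C by rewrite rmorphXn /= rmorphN rmorph1.
have P k (a c a' c' : R) : (a +i* c = (-1) ^+ k * (a' +i* c') :> C) <->
    (a = (-1) ^+ k * a' /\ c = (-1) ^+ k * c').
  rewrite sgn; split=> [H|[-> ->]].
    by split; [have := congr1 (fun z : C => Re z) H; rewrite cReM /= mul0r subr0|have := congr1 (fun z : C => Im z) H; rewrite cImM /= mul0r addr0].
  by apply: complexP; rewrite ?cReM ?cImM /= mul0r ?subr0 ?addr0.
split=> [H|[H1 H2]].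
  by split=> phi tp; have := H phi tp; rewrite /cintegral !E !F => /P[].
by move=> phi tp; rewrite /cintegral !E !F; apply/P; split; [exact: H1|exact: H2].
Qed.

(** ** Mollifying a compactly supported function *)

Lemma moll_box_kernel (r : R) : 0 < r -> test_fun (rbox (0 : pt) (2 * r)) (moll r).
Proof.
move=> r0; apply: (test_of_support (test_smooth (moll_kernel r)) (@cbox_compact R d 0 r)).
  by move=> x xr i; have := xr i; move: (`|_|) => t ht; lra.
move=> x nx; apply: moll_out => H; apply: nx => i.
by have := H i; rewrite mxE sub0r normrN.
Qed.

Lemma conv_partial_out s (r : R) g y : 0 < r -> sqi g ->
  (forall x, D x -> g x != 0 -> ~ rbox (0 : pt) (2 * r) (y - x)) -> conv D (partial s (moll r)) g y = 0.
Proof.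
move=> r0 sw H; transitivity (\int[mu]_(x in D) (0 : R)); last by rewrite Rintegral_cst// mul0r.
apply: eq_Rintegral => x /set_mem Dx; have [->|gx] := eqVneq (g x) 0; first by rewrite mul0r.
by rewrite (test_out (test_partial s (moll_box_kernel r0)) (H x Dx gx)) mulr0.
Qed.

(** A function supported in a compact subset of [D] can be mollified inside
    [D], which mollifies all its weak derivatives at once. *)
Lemma friedrichs (J : finType) (S : J -> seq 'I_d) (K : set pt) (ws : seq 'I_d -> pt -> R) :
  compact K -> K `<=` D -> sqi (ws [::]) ->
  (forall j, [/\ sqi (ws (S j)), rwd (S j) (ws [::]) (ws (S j)) & forall x, ~ K x -> ws (S j) x = 0]) ->
  (forall x, ~ K x -> ws [::] x = 0) ->
  forall e, 0 < e -> exists theta, test_fun D theta /\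
    forall j, l2sq (fun x => partial (S j) theta x - ws (S j) x) < e.
Proof.
move=> cK KD sw Hws w0 e e0; have [t t0 Ht] := compact_margin oD cK KD.
have /choice[r0 Hr0] j : exists r0, 0 < r0 /\ forall r, 0 < r -> r < r0 ->
    l2sq (fun y => conv D (moll r) (ws (S j)) y - ws (S j) y) < e.
  have [sj _ _] := Hws j; have [r0 r00 H] := conv_cvg oD bD sj e0; by exists r0.
pose r1 := \big[Num.min/t]_j r0 j.
have r10 : 0 < r1.
  by rewrite /r1; elim/big_rec : _ => // j y _ y0; rewrite lt_min y0 andbT; have [] := Hr0 j.
have r1t : r1 <= t.
  by rewrite /r1; elim/big_rec : _ => // j y _ yt; rewrite ge_min yt orbT.
have r1j j : r1 <= r0 j by rewrite /r1 (bigD1 j)//= ge_min lexx.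
pose r := r1 / 4; have rp : 0 < r by rewrite divr_gt0.
have rr1 : r < r1 by rewrite /r; lra.
have r4 : 4 * r <= t by rewrite /r; lra.
have nearK y : (exists2 x, K x & forall i, `|x ord0 i - y ord0 i| <= 3 * r) -> cbox y r `<=` D.
  move=> [x Kx xy] z yz; apply: (Ht x Kx) => i.
  have := xy i; have := yz i; have := ler_normD (x ord0 i - y ord0 i) (y ord0 i - z ord0 i).
  rewrite addrA subrK; move: (`|_|) (`|_|) (`|_|) => a b c; lra.
have out s y : ~ (exists2 x, K x & forall i, `|x ord0 i - y ord0 i| <= 3 * r) ->
    conv D (partial s (moll r)) (ws [::]) y = 0 .
  move=> ny; apply: conv_partial_out => // x Dx wx xy; apply: ny; exists x.
    by apply: contrapT => /w0 wx0; rewrite wx0 eqxx in wx.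
  by move=> i; have := xy i; rewrite !mxE sub0r normrN distrC; move: (`|_|) => a ha; lra.
have conv_out j y : ~ (exists2 x, K x & forall i, `|x ord0 i - y ord0 i| <= 3 * r) ->
    conv D (moll r) (ws (S j)) y = 0 .
  have [sj _ zj] := Hws j.
  move=> ny; apply: (@conv_partial_out [::]) => // x Dx wx xy; apply: ny; exists x.
    by apply: contrapT => /zj wx0; rewrite wx0 eqxx in wx.
  by move=> i; have := xy i; rewrite !mxE sub0r normrN distrC; move: (`|_|) => a ha; lra.
have sth := smooth_conv oD bD (moll_kernel r) sw.
set theta := conv D (moll r) (ws [::]) in sth *.
have cl : closure [set x | theta x != 0] `<=` D.
  move=> y cy; have [z [/= tz zy]] : [set x | theta x != 0] `&` [set z | forall i, `|y ord0 i - z ord0 i| < r] !=set0.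
    by apply: cy; apply/nbhs_ballP; exists r => //= z [_ yz] i; exact: yz.
  have Kz : exists2 x, K x & forall i, `|x ord0 i - z ord0 i| <= 3 * r.
    by apply: contrapT => /(out [::]) h; rewrite /theta h eqxx in tz.
  apply: (nearK z Kz) => i; rewrite distrC; exact/ltW/zy.
exists theta; split.
  split=> //; apply: bounded_closed_compact; last exact: closed_closure.
  by have [M [Mr HM]] := bD; exists M; split=> // x Mx y /cl Dy; exact: HM.
move=> j; have [sj dj zj] := Hws j.
have [_ Hj] := Hr0 j; apply: le_lt_trans (Hj r rp (lt_le_trans rr1 (r1j j))).
rewrite le_eqVlt; apply/orP; left; apply/eqP; apply: eq_Rintegral => y _.
congr ((_ - _) ^+ 2).
have [ny|ny] := pselect (exists2 x, K x & forall i, `|x ord0 i - y ord0 i| <= 3 * r).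
  exact: (conv_wderiv oD bD sw rp (nearK y ny) dj).
by rewrite conv_out// /theta (partial_conv oD bD (S j) (moll_kernel r) sw) out.
Qed.

(** ** Products with test functions *)

Definition b2 M b (bi : 'I_d -> pt -> R) (bij : 'I_d -> 'I_d -> pt -> R) :=
  b1 M b bi /\ forall i, b1 M (bi i) (bij i).

Definition mderiv b (bi : 'I_d -> pt -> R) (bij : 'I_d -> 'I_d -> pt -> R) s phi : pt -> R :=
  match s with
  | [::] => fun x => b x * phi x
  | [:: i] => fun x => bi i x * phi x + b x * partial [:: i] phi x
  | [:: i, j & _] => fun x => (bij i j x * phi x + bi i x * partial [:: j] phi x) +
      (bi j x * partial [:: i] phi x + b x * partial [:: j; i] phi x)
  end.

Lemma rwd_mderiv M b bi bij s phi : b2 M b bi bij -> test_fun D phi -> (size s <= 2)%N ->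
  sqi (mderiv b bi bij s phi) /\ rwd s (mderiv b bi bij [::] phi) (mderiv b bi bij s phi).
Proof.
move=> [B Bi] tp s2; have [P Hp] := test_b1 oD bD tp.
have [M1 [m1 bm bmi dm]] := b1_mul oD bD B Hp.
have sm f N : bmeas N f -> sqi f by exact: bmeas_sqi.
case: s s2 => [|i [|j [|? ?]]] // _.
- by split; [exact: sm bm|move=> psi _; rewrite expr0 mul1r].
- by split; [exact: sm (bmi i)|exact: dm].
have tpi := test_partial1 i tp; have [Q Hq] := test_b1 oD bD tpi.
have [M2 [m2 bm2 bmi2 dm2]] := b1_mul oD bD (Bi i) Hp.
have [M3 [m3 bm3 bmi3 dm3]] := b1_mul oD bD B Hq.
split; first by apply: (sm _ (M2 + M3)); exact: (bmeas_add (bmi2 j) (bmi3 j)).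
move=> psi tpsi; have tdj := test_partial1 j tpsi.
have := dm i _ tdj; rewrite /= expr1 mulN1r => ->.
have [N N0 bN] := test_bmeas tdj; have [N' N'0 bN'] := test_bmeas tpsi.
have I1 := bmeas_integrable oD bD (bmeas_mul m2 bm2 bN).
have I2 := bmeas_integrable oD bD (bmeas_mul m3 bm3 bN).
have I3 := bmeas_integrable oD bD (bmeas_mul m2 (bmi2 j) bN').
have I4 := bmeas_integrable oD bD (bmeas_mul m3 (bmi3 j) bN').
under eq_Rintegral do rewrite mulrDl.
rewrite (RintegralD mD I1 I2).
have := dm2 j _ tpsi; rewrite /= expr1 mulN1r => ->.
have := dm3 j _ tpsi; rewrite /= expr1 mulN1r => ->.
under [in RHS]eq_Rintegral do rewrite mulrDl.
rewrite expr2 mulrNN mulr1 mul1r opprD !opprK; apply/esym; exact: (RintegralD mD I3 I4).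
Qed.

Lemma mderiv_out b bi bij s phi x : test_fun D phi ->
  ~ closure [set x | phi x != 0] x -> mderiv b bi bij s phi x = 0.
Proof.
move=> tp nx; have z t : partial t phi x = 0.
  have [sp cp pD] := tp.
  have nb : nbhs x (~` closure [set x | phi x != 0]).
    by apply: open_nbhs_nbhs; split => //; apply: closed_openC; exact: closed_closure.
  have : \forall y \near x, partial t phi y = 0; last exact: nbhs_singleton.
  elim: t => [|i t IH].
    apply: filterS nb => y ny; apply/eqP/negPn/negP => fy; apply: ny.
    exact: subset_closure.
  have /nbhs_interior := IH; apply: filterS => y yn.
  rewrite partial_cons -(@near_eq_derive _ _ _ (cst 0) _ y (e_ i)) ?derive_cst//.
  by apply: filterS yn => z ->.
have phix : phi x = 0 by exact: (z [::]).
case: s => [|i [|j s]] /=; first by rewrite phix mulr0.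
  have z1 : 'D_(delta_mx ord0 i) phi x = 0 := z [:: i].
  by rewrite phix z1 !mulr0 addr0.
have z1 : 'D_(delta_mx ord0 i) phi x = 0 := z [:: i].
have z2 : 'D_(delta_mx ord0 j) phi x = 0 := z [:: j].
have z3 : 'D_(delta_mx ord0 j) (fun x => 'D_(delta_mx ord0 i) phi x) x = 0 := z [:: j; i].
by rewrite phix z1 z2 z3 !mulr0 !addr0.
Qed.

Definition cmderiv b bi bij s u : fct := fun x =>
  mderiv b bi bij s (fun y => Re (u y)) x +i* mderiv b bi bij s (fun y => Im (u y)) x.

Lemma cmderiv_wderiv M b bi bij u s : b2 M b bi bij -> ctest_fun D u -> (size s <= 2)%N ->
  L2 D (cmderiv b bi bij s u) /\ is_wderiv D s (rmul b u) (cmderiv b bi bij s u).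
Proof.
move=> B [tr ti] s2.
have Er : (fun x => Re (rmul b u x)) = mderiv b bi bij [::] (fun x => Re (u x)).
  by apply/funext => x; rewrite /rmul cReM /= mul0r subr0.
have Ei : (fun x => Im (rmul b u x)) = mderiv b bi bij [::] (fun x => Im (u x)).
  by apply/funext => x; rewrite /rmul cImM /= mul0r addr0.
have [s_r d_r] := rwd_mderiv B tr s2; have [s_i d_i] := rwd_mderiv B ti s2.
split; first by apply/(L2P hD); split; [exact: s_r|exact: s_i].
by apply/is_wderivRe; rewrite Er Ei; split; [exact: d_r|exact: d_i].
Qed.

Lemma ctest_rmul M b bi bij u : b2 M b bi bij -> ctest_fun D u -> Hk0 D 2 (rmul b u).
Proof.
move=> B tu; have [tr ti] := tu.
have W s : (size s <= 2)%N -> L2 D (cmderiv b bi bij s u) /\ is_wderiv D s (rmul b u) (cmderiv b bi bij s u).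
  by move=> s2; exact: cmderiv_wderiv B tu s2.
have Hb : Hk D 2 (rmul b u).
  split; last by move=> s s2; exists (cmderiv b bi bij s u); exact: W.
  have [L1 _] := W [::] isT; apply: (eq_L2 _ L1) => x Dx.
  by apply: complexP; rewrite /cmderiv /rmul ?cReM ?cImM /= mul0r ?subr0 ?addr0.
apply/(Hk0P hD); split=> // e e0.
pose J := {b : {ffun 'I_d -> 'I_3} | (mindex_deg b <= 2)%N}.
pose S (j : J) : seq 'I_d := mindex_seq (val j).
have S2 j : (size (S j) <= 2)%N by rewrite size_mindex_seq; exact: (valP j).
have m0 := @mindex_card_gt0 R d 2.
set t := e / (mindex_card (R := R) (d := d) 2 + 1).
have t0 : 0 < t by rewrite divr_gt0// addr_gt0.
have tE : t * (mindex_card (R := R) (d := d) 2 + 1) = e by rewrite divfK// gt_eqF// addr_gt0.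
have t20 : 0 < t ^+ 2 / 2 by rewrite divr_gt0// exprn_gt0.
have appr phi : test_fun D phi -> exists theta, test_fun D theta /\
    forall j, l2sq (fun x => partial (S j) theta x - mderiv b bi bij (S j) phi x) < t ^+ 2 / 2.
  move=> tp; have [sp cp pD] := tp.
  apply: (@friedrichs J S _ (fun s => mderiv b bi bij s phi) cp pD) => //.
  - by have [] := @rwd_mderiv M b bi bij [::] phi B tp isT.
  - move=> j; have [s1 d1] := rwd_mderiv B tp (S2 j).
    by split=> // x nx; exact: mderiv_out.
  - by move=> x nx; exact: mderiv_out.
have [f [tf Hf]] := appr _ tr; have [g [tg Hg]] := appr _ ti.
have tfg : ctest_fun D (fun x => f x +i* g x) by [].
exists (fun x => f x +i* g x); split; first exact: tfg.
have Hfg := ctest_Hk hD 2 tfg; have Hd := sipWB (Hk_sip hD 2) Hb Hfg.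
apply: (@le_lt_trans _ _ (mindex_card (R := R) (d := d) 2 * t)); last first.
  have lt1 (p q : R) : 0 < p -> q * p < p * (q + 1).
    by move=> p0; rewrite mulrDr mulr1 mulrC ltrDl.
  by rewrite -tE; exact: lt1.
apply: (Hnorm_bound hD Hd (ltW t0)) => s s2.
rewrite -(wderiv_perm _ _ (mindex_ofP s2)).
pose j : J := exist _ (mindex_of 2 s) (mindex_of_deg s2).
rewrite -[mindex_seq _]/(S j).
have [L1 W1] := W (S j) (S2 j).
have Lc := ctest_L2 hD (ctest_cpartial (S j) tfg); have Wc := ctest_wderiv hD (S j) tfg.
have Lr := HkL2 Hb; have Lf := HkL2 Hfg.
have Wd := is_wderiv_lin hD (-1) Lf Lr Lc L1 Wc W1.
rewrite !(sip_scN1 LS) ![- _ + _]addrC in Wd.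
have Ld := sipWB LS L1 Lc.
have [Lw _ Nw] := wderivE hD Ld Wd.
rewrite (sip_norm_null LS Lw Ld Nw).
rewrite -(@ler_pXn2r _ 2)// ?nnegrE ?sip_norm_ge0 ?(ltW t0)// (l2norm2 hD)//.
have -> : t ^+ 2 = t ^+ 2 / 2 + t ^+ 2 / 2 by field.
have sw (p q : pt -> R) : l2sq (fun x => p x - q x) = l2sq (fun x => q x - p x).
  by apply: eq_Rintegral => x _; rewrite -sqrrN opprB.
apply: lerD; apply: ltW.
  have := Hf j; rewrite sw; apply: le_lt_trans; rewrite le_eqVlt; apply/orP; left; apply/eqP.
  by apply: eq_Rintegral => x _; rewrite -[in LHS]/(Re (cmderiv b bi bij (S j) u x - cpartial (S j) (fun x => f x +i* g x) x)) ReB.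
have := Hg j; rewrite sw; apply: le_lt_trans; rewrite le_eqVlt; apply/orP; left; apply/eqP.
by apply: eq_Rintegral => x _; rewrite -[in LHS]/(Im (cmderiv b bi bij (S j) u x - cpartial (S j) (fun x => f x +i* g x) x)) ImB.
Qed.
End multipliers.

Section real_estimates.
Context {R : realDomainType}.
Implicit Types K M a c p e : R.

Lemma double_lt K a c p : 0 <= K -> 0 < p -> a < p -> c < p -> K * (a + c) < p * (2 * (K + 1)).
Proof.
move=> K0 pp ap cp; have h : K * (a + c) <= K * (p + p) by apply: ler_wpM2l; [exact: K0|lra].
have -> : p * (2 * (K + 1)) = K * (p + p) + 2 * p by ring.
by move: h; move: (K * _) (K * _) => z z'; lra.
Qed.

Lemma chain_le K a c p e (f g z h : R) : 0 <= K -> 0 < p -> p * (2 * (K + 1)) = e -> a <= c + f ->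
  c + c < e -> f <= K * g -> g <= z + h -> h < p -> a <= e + K * z.
Proof.
move=> K0 pp Ep h1 h2 h3 h4 h5.
have h6 : K * g <= K * (z + p) by apply: ler_wpM2l; [exact: K0|lra].
have E2 : p * (2 * (K + 1)) = 2 * (K * p) + 2 * p by ring.
rewrite mulrDr in h6; rewrite E2 in Ep; move: Ep h3 h6; move: (K * p) (K * z) (K * g) => q1 q2 q3; lra.
Qed.

Lemma half_le M a c p e : 0 <= M -> 0 < p -> p * (2 * (M + 1)) = e -> a + a < e -> c <= M * p -> a + c <= e.
Proof.
move=> M0 pp Ep h1 h2; have E2 : p * (2 * (M + 1)) = 2 * (M * p) + 2 * p by ring.
rewrite E2 in Ep; move: Ep h2; move: (M * p) => q; lra.
Qed.
End real_estimates.

Section multiplier_bound.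
Context {R : realType} {d : nat}.
Local Notation pt := 'rV[R]_d.
Local Notation C := R[i].
Local Notation fct := ('rV[R]_d -> R[i]).
Local Notation mu := (lebesgue_rV d).
Variable D : set pt.
Hypothesis hD : bdomain D.
Implicit Types (u v w : fct) (f g phi psi b a : pt -> R) (s : seq 'I_d) (x y : pt) (M : R).
Let oD := hD.1.
Let bD := hD.2.
Let mD := measurable_domain oD.
Let Dfin := domain_fin oD bD.
Let LS := L2_sip hD.
Local Notation rwd := (@rwd R d D).
Local Notation bmeas := (@bmeas R d D).
Local Notation b1 := (@b1 R d D).
Local Notation b2 := (@b2 R d D).
Local Notation nrm := (sip_norm (l2ip D)).
Local Notation hnrm k := (sip_norm (hip D k)).

Lemma bmeas_L2 M f u : bmeas M f -> L2 D u -> L2 D (rmul f u).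
Proof. by move=> [mf fM]; exact: (L2_rmul hD mf fM). Qed.

Lemma bmeas_nrm M f u : 0 <= M -> bmeas M f -> L2 D u -> nrm (rmul f u) <= M * nrm u.
Proof. by move=> M0 [mf fM] Lu; exact: (nrm_rmul hD mf fM M0 Lu). Qed.

Lemma ctest_cpartial_le s u : ctest_fun D u -> (size s <= 2)%N -> nrm (cpartial s u) <= hnrm 2 u.
Proof.
move=> tu s2; have [Lw Nw] := ctest_wderiv_null hD s tu.
rewrite -(sip_norm_null LS Lw (ctest_L2 hD (ctest_cpartial s tu)) Nw).
exact: (wderiv_le hD (ctest_Hk hD 2 tu) s2).
Qed.

Lemma Re_rmul f u x : Re (rmul f u x) = f x * Re (u x).
Proof. by rewrite /rmul cReM /= mul0r subr0. Qed.

Lemma Im_rmul f u x : Im (rmul f u x) = f x * Im (u x).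
Proof. by rewrite /rmul cImM /= mul0r addr0. Qed.

Lemma cmderiv_le M b bi bij u s : b2 M b bi bij -> ctest_fun D u -> (size s <= 2)%N ->
  nrm (cmderiv b bi bij s u) <= 4 * M * hnrm 2 u.
Proof.
move=> [[M0 bb bbi _] Bi] tu s2; have [tr ti] := tu.
have bbij i j : bmeas M (bij i j) by have [_ _ H _] := Bi i; exact: H.
have Lp t : L2 D (cpartial t u) := ctest_L2 hD (ctest_cpartial t tu).
set N := hnrm 2 u; have N0 : 0 <= N by exact: sip_norm_ge0.
have Lu := ctest_L2 hD tu.
have t0 f : bmeas M f -> L2 D (rmul f u) /\ nrm (rmul f u) <= M * N.
  move=> bf; split; first exact: bmeas_L2 bf Lu.
  apply: le_trans (bmeas_nrm M0 bf Lu) _; rewrite ler_wpM2l//.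
  exact: (l2_le_hnrm hD (ctest_Hk hD 2 tu)).
have t1 f t : (size t <= 2)%N -> bmeas M f ->
    L2 D (rmul f (cpartial t u)) /\ nrm (rmul f (cpartial t u)) <= M * N.
  move=> t2 bf; split; first exact: bmeas_L2 bf (Lp t).
  apply: le_trans (bmeas_nrm M0 bf (Lp t)) _; rewrite ler_wpM2l//.
  exact: ctest_cpartial_le.
have add v w c e : (L2 D v /\ nrm v <= c) -> (L2 D w /\ nrm w <= e) -> (L2 D (v + w) /\ nrm (v + w) <= c + e).
  move=> [Lv nv] [Lw nw]; split; first exact: (sipWD LS).
  exact: le_trans (sip_normD LS Lv Lw) (lerD nv nw).
have MN : 0 <= M * N by rewrite mulr_ge0.
have E2 : 4 * M * N = (M * N + M * N) + (M * N + M * N) by ring.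
case: s s2 => [|i [|j [|? ?]]] // _.
- have -> : cmderiv b bi bij [::] u = rmul b u.
    by apply/funext => x; apply: complexP; rewrite /cmderiv /rmul ?cReM ?cImM /= mul0r ?subr0 ?addr0.
  apply: le_trans (t0 _ bb).2 _; rewrite E2; move: MN; move: (M * N) => t tt; lra.
- have -> : cmderiv b bi bij [:: i] u = rmul (bi i) u + rmul b (cpartial [:: i] u).
    apply/funext => x; rewrite -[RHS]/(rmul (bi i) u x + rmul b (cpartial [:: i] u) x).
    by apply: complexP; rewrite ?ReD ?ImD /cmderiv /rmul ?cReM ?cImM /= !mul0r ?subr0 ?addr0.
  apply: le_trans (add _ _ _ _ (t0 _ (bbi i)) (t1 _ [:: i] isT bb)).2 _.
  rewrite E2; move: MN; move: (M * N) => t tt; lra.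
- have -> : cmderiv b bi bij [:: i; j] u = (rmul (bij i j) u + rmul (bi i) (cpartial [:: j] u)) +
      (rmul (bi j) (cpartial [:: i] u) + rmul b (cpartial [:: j; i] u)).
    apply/funext => x; rewrite -[RHS]/((rmul (bij i j) u x + rmul (bi i) (cpartial [:: j] u) x) +
      (rmul (bi j) (cpartial [:: i] u) x + rmul b (cpartial [:: j; i] u) x)).
    have Er (p q r t : C) : Re (p + q + (r + t)) = Re p + Re q + (Re r + Re t) by rewrite !ReD.
    have Ei (p q r t : C) : Im (p + q + (r + t)) = Im p + Im q + (Im r + Im t) by rewrite !ImD.
    apply: complexP; first by rewrite [RHS]Er !Re_rmul; exact: erefl.
    by rewrite [RHS]Ei !Im_rmul; exact: erefl.
  rewrite E2; apply: (add _ _ _ _ (add _ _ _ _ (t0 _ (bbij i j)) (t1 _ [:: j] isT (bbi i)))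
    (add _ _ _ _ (t1 _ [:: i] isT (bbi j)) (t1 _ [:: j; i] isT bb))).2.
Qed.

Lemma rmulB b u v : rmul b (u - v) = rmul b u - rmul b v.
Proof. by apply/funext => x; rewrite /rmul -[LHS]/((b x)%:C * (u x - v x)) mulrBr. Qed.

(** The Leibniz rule bounds the products with test functions. For a general
    [u] these products form a Cauchy sequence, whose limit is [rmul b u] since
    it is so in [L2]. *)
Lemma multiplier M b bi bij : b2 M b bi bij -> exists2 K : R, 0 <= K &
  forall u, Hk0 D 2 u -> Hk0 D 2 (rmul b u) /\ hnrm 2 (rmul b u) <= K * hnrm 2 u.
Proof.
have dbl (x y : R) : x < y / 2 -> x + x < y by lra.
move=> B; have [[M0 bb _ _] _] := B.
have m0 := @mindex_card_gt0 R d 2.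
set K := mindex_card (R := R) (d := d) 2 * (4 * M).
have K0 : 0 <= K by rewrite !mulr_ge0// ltW.
have ct u : ctest_fun D u -> Hk0 D 2 (rmul b u) /\ hnrm 2 (rmul b u) <= K * hnrm 2 u.
  move=> tu; have H0 := ctest_rmul hD B tu; split; first exact: H0.
  rewrite -mulrA; apply: (Hnorm_bound hD (Hk0_Hk H0)).
    by rewrite !mulr_ge0// sip_norm_ge0.
  move=> s s2; have [Lc Wc] := cmderiv_wderiv hD B tu s2.
  have [Lw _ Nw] := wderivE hD Lc Wc.
  rewrite (sip_norm_null LS Lw Lc Nw); exact: cmderiv_le B tu s2.
exists K; first exact: K0.
move=> u Hu; have /(Hk0P hD)[Hu2 Du] := Hu.
have HS := Hk0_sip hD 2.
have p0 (m : nat) : 0 < m.+1%:R^-1 :> R by rewrite invr_gt0.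
have /choice[phi Hphi] (m : nat) : exists g : fct, ctest_fun D g /\ hnrm 2 (u - g) < m.+1%:R^-1.
  exact: Du.
have t m := (Hphi m).1; have Ht m := ctest_Hk0 hD 2 (t m).
pose w m := rmul b (phi m).
have Hw m : Hk0 D 2 (w m) := (ct _ (t m)).1.
have lim (e : R) : 0 < e -> exists N : nat, forall m : nat, (N <= m)%N -> m.+1%:R^-1 < e.
  move=> e0; have [N _ HN] : \forall k \near \oo, (k.+1%:R^-1 : R) < e by exact: near_infty_natSinv_lt (PosNum e0).
  by exists N.
have tsub m k : ctest_fun D (phi m - phi k).
  have := ctest_lin (-1) (t k) (t m); rewrite (sip_scN1 LS) addrC; exact.
have wd m k : hnrm 2 (w m - w k) <= K * (hnrm 2 (u - phi m) + hnrm 2 (u - phi k)).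
  have -> : w m - w k = rmul b (phi m - phi k) by rewrite rmulB.
  apply: le_trans (ct _ (tsub m k)).2 _; rewrite ler_wpM2l//.
  have -> : phi m - phi k = (u - phi k) - (u - phi m) by rewrite opprB [RHS]addrC subrKA.
  have W1 := sipWB HS Hu (Ht m); have W2 := sipWB HS Hu (Ht k).
  by rewrite [leRHS]addrC; exact: (sip_normB HS W2 W1).
have cw : cauchy_seq (hip D 2) w.
  move=> e e0; have q0 : 0 < e / (2 * (K + 1)) by rewrite divr_gt0// mulr_gt0// ltr_wpDl.
  have [N HN] := lim _ q0; exists N => m k mN kN; apply: le_lt_trans (wd m k) _.
  have h1 := lt_trans (Hphi m).2 (HN m mN); have h2 := lt_trans (Hphi k).2 (HN k kN).
  have E : e / (2 * (K + 1)) * (2 * (K + 1)) = e by rewrite divfK// gt_eqF// mulr_gt0// ltr_wpDl.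
  rewrite -E; exact: double_lt K0 q0 h1 h2.
have [y Hy cy] := Hk0_complete hD Hw cw.
have Lu := Hk0L Hu; have Ly := Hk0L Hy; have Lb := bmeas_L2 bb Lu.
have Lw m := Hk0L (Hw m).
have null : nrm (y - rmul b u) = 0.
  apply/eqP; rewrite eq_le sip_norm_ge0 andbT; apply/ler_addgt0Pl => e e0; rewrite addr0.
  have [N1 H1] := cy (e / 2) (divr_gt0 e0 (ltr0n _ 2)).
  have q0 : 0 < e / (2 * (M + 1)) by rewrite divr_gt0// mulr_gt0// ltr_wpDl.
  have [N2 H2] := lim _ q0; pose m := maxn N1 N2.
  apply: le_trans (sip_norm_dist LS Ly (Lw m) Lb) _.
  have h1 : nrm (y - w m) < e / 2.
    rewrite (sip_normBC LS Ly (Lw m)); apply: le_lt_trans (H1 m (leq_maxl _ _)).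
    exact: (l2_le_hnrm hD (Hk0_Hk (sipWB HS (Hw m) Hy))).
  have h2 : nrm (w m - rmul b u) <= M * (e / (2 * (M + 1))).
    rewrite -rmulB; apply: le_trans (bmeas_nrm M0 bb (sipWB LS (ctest_L2 hD (t m)) Lu)) _.
    rewrite ler_wpM2l// (sip_normBC LS (ctest_L2 hD (t m)) Lu).
    apply: le_trans (l2_le_hnrm hD (Hk0_Hk (sipWB HS Hu (Ht m)))) _.
    exact/ltW/(lt_trans (Hphi m).2)/H2/leq_maxr.
  have E : e / (2 * (M + 1)) * (2 * (M + 1)) = e by rewrite divfK// gt_eqF// mulr_gt0// ltr_wpDl.
  exact: half_le M0 q0 E (dbl _ _ h1) h2.
split; first exact: (Hk0_null hD Hy Lb null).
rewrite -(hnrm_null hD (Hk0_Hk Hy) Lb null); apply/ler_addgt0Pl => e e0.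
have [N1 H1] := cy (e / 2) (divr_gt0 e0 (ltr0n _ 2)).
have q0 : 0 < e / (2 * (K + 1)) by rewrite divr_gt0// mulr_gt0// ltr_wpDl.
have [N2 H2] := lim _ q0; pose m := maxn N1 N2.
have T1 := sip_normB HS (Hw m) (sipWB HS (Hw m) Hy).
have Ey : w m - (w m - y) = y := subKr (w m) y.
rewrite Ey [leRHS]addrC in T1.
have T2 := H1 m (leq_maxl _ _); have T3 := (ct _ (t m)).2.
have T4 := sip_normB HS Hu (sipWB HS Hu (Ht m)).
have Eu : u - (u - phi m) = phi m := subKr u (phi m).
rewrite Eu in T4.
have T5 := lt_trans (Hphi m).2 (H2 m (leq_maxr _ _)).
have E : e / (2 * (K + 1)) * (2 * (K + 1)) = e by rewrite divfK// gt_eqF// mulr_gt0// ltr_wpDl.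
exact: chain_le K0 q0 E T1 (dbl _ _ T2) T3 T4 T5.
Qed.

(** ** The coefficients *)

Lemma b2_inv M (delta : R) a ai aij : 0 < delta -> b2 M a ai aij -> (forall x, D x -> delta <= a x) ->
  exists N bi bij, b2 N (fun x => (a x)^-1) bi bij.
Proof.
move=> d0 [A Ai] ad; have [N BN] := b1_inv oD bD d0 A ad.
have [N2 BN2] := b1_mul oD bD BN BN.
have /choice[h Hh] i : exists p : R * ('I_d -> pt -> R),
    b1 p.1 (fun x => -1 * (ai i x * ((a x)^-1 * (a x)^-1))) p.2.
  have [N3 BN3] := b1_mul oD bD (Ai i) BN2; have := b1_scale oD bD (-1) BN3 => H.
  by eexists (_, _); exact: H.
have S0 : 0 <= \sum_i (h i).1 by apply: sumr_ge0 => i _; have [] := Hh i.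
have N0 : 0 <= N by case: BN.
exists (N + \sum_i (h i).1), (fun i x => -1 * (ai i x * ((a x)^-1 * (a x)^-1))), (fun i => (h i).2); split.
  by apply: b1_mono BN; rewrite lerDl.
move=> i; apply: b1_mono (Hh i); apply: ler_wpDl => //; rewrite (bigD1 i)//= lerDl.
by apply: sumr_ge0 => j _; have [] := Hh j.
Qed.

(** The coefficients have essential bounds; the multiplier argument wants
    bounds at every point. *)
Lemma truncate g (K : R) : measurable_fun D g -> {ae mu, forall x, D x -> `|g x| <= K} ->
  exists g', bmeas `|K| g' /\ forall phi, test_fun D phi ->
    \int[mu]_(x in D) (g x * phi x) = \int[mu]_(x in D) (g' x * phi x).
Proof.
move=> mg gK; pose g' x := Num.max (- `|K|) (Num.min (g x) `|K|).
have mg' : measurable_fun D g'.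
  apply: measurable_maxr; first exact: measurable_cst.
  by apply: measurable_minr => //; exact: measurable_cst.
have K0 := normr_ge0 K.
exists g'; split.
  split=> // x _; rewrite /g' ler_norml le_max lexx /= ge_max ge_min lexx orbT andbT.
  by move: K0; move: `|K| => k; lra.
move=> phi tp; congr fine; apply: ae_eq_integral => //.
- by apply/measurable_EFinP; apply: measurable_funM => //; exact: test_measurable.
- by apply/measurable_EFinP; apply: measurable_funM => //; exact: test_measurable.
apply: filterS gK => x gx Dx; congr (_ * _)%:E; rewrite /g'.
have := le_trans (gx Dx) (ler_norm K); rewrite ler_norml => /andP[h1 h2].
by rewrite (min_idPl h2); apply/esym/max_idPr.
Qed.

Lemma W2inf_b2 (n : pt -> R) (delta : R) : 0 < delta -> refraction_index D n delta ->
  exists M ai aij, b2 M (fun x => n x - 1) ai aij.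
Proof.
move=> d0 [[mn Wn] nd [K nK]].
have bn : bmeas (1 + `|K|) n.
  split=> // x Dx; have h1 := nd x Dx; have h2 := nK x Dx.
  by rewrite ler_norml; apply/andP; split; have := ler_norm K; have := normr_ge0 K; lra.
have w s : (size s <= 2)%N -> exists p : R * (pt -> R), [/\ 0 <= p.1, bmeas p.1 p.2 & rwd s n p.2].
  move=> s2; have [g [mg [L gL] Hg]] := Wn s s2; have [g' [bg' Hg']] := truncate mg gL.
  exists (`|L|, g'); split; [exact: normr_ge0|exact: bg'|move=> phi tp].
  rewrite -(Hg' phi tp).
  by have [H _] := (is_wderivRe _ _ _ _).1 Hg; exact: H phi tp.
have /choice[p Hp] i : exists p : R * (pt -> R), [/\ 0 <= p.1, bmeas p.1 p.2 & rwd [:: i] n p.2] by exact: w.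
have /choice[pp Hpp] (ij : 'I_d * 'I_d) : exists p : R * (pt -> R),
    [/\ 0 <= p.1, bmeas p.1 p.2 & rwd [:: ij.1; ij.2] n p.2] by exact: w.
pose M := (2 + `|K|) + \sum_i (p i).1 + \sum_ij (pp ij).1.
have S1 : 0 <= \sum_i (p i).1 by apply: sumr_ge0 => i _; have [] := Hp i.
have S2 : 0 <= \sum_ij (pp ij).1 by apply: sumr_ge0 => ij _; have [] := Hpp ij.
have K0 := normr_ge0 K.
have M0 : 0 <= M by rewrite !addr_ge0.
have up N f : N <= M -> bmeas N f -> bmeas M f.
  by move=> NM [mf fN]; split=> // x Dx; exact: le_trans (fN x Dx) NM.
have bp i : bmeas M (p i).2.
  have [_ H _] := Hp i; apply: up H; rewrite /M addrAC; apply: ler_wpDl; first by rewrite !addr_ge0.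
  by rewrite (bigD1 i)//= lerDl; apply: sumr_ge0 => j _; have [] := Hp j.
have bpp ij : bmeas M (pp ij).2.
  have [_ H _] := Hpp ij; apply: up H; apply: ler_wpDl; first by rewrite !addr_ge0.
  by rewrite (bigD1 ij)//= lerDl; apply: sumr_ge0 => j _; have [] := Hpp j.
exists M, (fun i => (p i).2), (fun i j => (pp (i, j)).2); split.
  split=> //.
  - have b1n := bmeas_add bn (_ : bmeas 1 (fun=> -1)).
    apply: up (b1n _); last by split=> [|x _]; [exact: measurable_cst|rewrite normrN1].
    by rewrite /M; move: K0 S1 S2; move: `|K| (\sum_i _) (\sum_i _) => a b c; lra.
  - move=> i psi tp; have [_ _ H] := Hp i; rewrite -(H psi tp).
    have [Q Q0 bq] := test_bmeas (test_partial [:: i] tp).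
    have n0 : 0 <= 1 + `|K| by rewrite addr_ge0.
    have I1 := bmeas_integrable oD bD (bmeas_mul n0 bn bq).
    have I2 := bmeas_integrable oD bD bq.
    under eq_Rintegral do rewrite mulrBl mul1r.
    by rewrite (RintegralB mD I1 I2) [X in _ - X](int_partial0 bD i tp) subr0.
move=> i; split=> // j psi tp; have [_ _ H] := Hp i; have [_ _ HH] := Hpp (i, j).
have := HH psi tp; have := H _ (test_partial1 j tp).
rewrite /= !expr1 !mulN1r expr2 mulrNN mulr1 mul1r => -> h.
by rewrite -h opprK.
Qed.
End multiplier_bound.

(** * The sesquilinear forms *)

Lemma combine_le (R : realDomainType) (a b z k1 k2 m x y : R) : 0 <= x -> 0 <= y -> 0 <= k1 -> 0 <= k2 -> 0 <= m ->
  a <= k1 * x -> b <= k2 * x -> z <= (m + 1) * y -> a + b + z <= (k1 + k2 + m + 1) * (x + y).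
Proof.
move=> x0 y0 k10 k20 m0 h1 h2 h3; have -> : (k1 + k2 + m + 1) * (x + y) =
  k1 * x + k2 * x + (m + 1) * y + ((m + 1) * x + (k1 + k2) * y) by ring.
have h4 : 0 <= (m + 1) * x by rewrite mulr_ge0// addr_ge0.
have h5 : 0 <= (k1 + k2) * y by rewrite mulr_ge0// addr_ge0.
move: h1 h2 h3 h4 h5.
move: ((m + 1) * x) ((k1 + k2) * y) (k1 * x) (k2 * x) ((m + 1) * y) => p q r s t; lra.
Qed.

Section forms.
Context {R : realType} {d : nat}.
Local Notation pt := 'rV[R]_d.
Local Notation C := R[i].
Local Notation fct := ('rV[R]_d -> R[i]).
Local Notation fpair := (fct * fct)%type.
Local Notation mu := (lebesgue_rV d).
Variables (D : set pt) (n : pt -> R) (delta : R).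
Hypotheses (hD : bdomain D) (hdelta : 0 < delta) (hn : refraction_index D n delta) (i0 : 'I_d).
Implicit Types (u v w : fct) (f g h e : fpair).
Let oD := hD.1.
Let bD := hD.2.
Let mD := measurable_domain oD.
Let Dfin := domain_fin oD bD.
Let LS := L2_sip hD.
Let HS2 := Hk0_sip hD 2.
Local Notation nrm := (sip_norm (l2ip D)).
Local Notation hnrm k := (sip_norm (hip D k)).
Local Notation H02 := (Hk0 D 2).
Local Notation La := (laplacian D).

Let c : pt -> R := fun x => (n x - 1)^-1.
Let c' : pt -> R := fun x => n x / (n x - 1).

Lemma coeff_bounds : exists cm M : R, [/\ 0 < cm, 0 <= M, bmeas D M c, forall x, D x -> cm <= c x &
  bmeas D M c'].
Proof.
have [[mn _] nd [K nK]] := hn; have [M [ai [aij B]]] := W2inf_b2 hD hdelta hn.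
have nd1 x : D x -> delta <= n x - 1 by move=> Dx; have := nd x Dx; lra.
have [N [bi [bij [[N0 bc _ _] _]]]] := b2_inv hD hdelta B nd1.
have K0 : 0 < `|K| + 1 by rewrite ltr_wpDl.
have bn : bmeas D (`|K| + 1) n.
  split=> // x Dx; have h1 := nd x Dx; have h2 := nK x Dx.
  have n0 : 0 <= n x by have d0 := hdelta; lra.
  by rewrite (ger0_norm n0); have := ler_norm K; lra.
exists ((`|K| + 1)^-1), (N + (`|K| + 1) * N); split.
- by rewrite invr_gt0.
- by rewrite addr_ge0// mulr_ge0// ltW.
- have [m1 m2] := bc; split=> // x Dx; apply: le_trans (m2 x Dx) _.
  by rewrite lerDl mulr_ge0// ltW.
- move=> x Dx; have h1 := nd1 x Dx; have h2 := nK x Dx; have h3 := ler_norm K.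
  by have d0 := hdelta; rewrite /c lef_pV2 ?posrE//; lra.
- have [m1 m2] := bmeas_mul (ltW K0) bn bc; split=> // x Dx; apply: le_trans (m2 x Dx) _.
  by rewrite lerDr.
Qed.

(** One bound serves both coefficients because [n / (n - 1) = 1 + 1 / (n - 1)]. *)
Lemma coeff_multipliers : exists2 K : R, 0 <= K & forall u, H02 u ->
  [/\ H02 (rmul c u), hnrm 2 (rmul c u) <= K * hnrm 2 u, H02 (rmul c' u) &
      hnrm 2 (rmul c' u) <= K * hnrm 2 u].
Proof.
have [[mn _] nd [K nK]] := hn; have [M [ai [aij B]]] := W2inf_b2 hD hdelta hn.
have nd1 x : D x -> delta <= n x - 1 by move=> Dx; have := nd x Dx; lra.
have fld (z : R) : z - 1 != 0 -> 1 + (z - 1)^-1 = z / (z - 1) by move=> z0; field.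
have [N [bi [bij B']]] := b2_inv hD hdelta B nd1.
have [K1 K10 H] := multiplier hD B'; exists (K1 + 1); first exact: addr_ge0.
move=> u Hu; have [H1 H2] := H u Hu; have u0 := sip_norm_ge0 (hip D 2) u.
have Hs := sipWD HS2 Hu H1.
have E x : D x -> (u + rmul c u) x = rmul c' u x.
  move=> Dx; have h := nd1 x Dx; have n0 : n x - 1 != 0 by rewrite (gt_eqF (lt_le_trans hdelta h)).
  rewrite -[LHS]/(u x + (c x)%:C * u x) /rmul -[X in X + _]mul1r -mulrDl; congr (_ * _).
  have -> : (1 : C) = (1 : R)%:C by [].
  by rewrite -rmorphD /= /c /c'; congr (_%:C); exact: fld n0.
have Lc' := eq_L2 E (Hk0L Hs).
have N0 : nrm (u + rmul c u - rmul c' u) = 0 := nrm_eq_on hD (Hk0L Hs) E.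
split; [exact: H1| |exact: (Hk0_null hD Hs Lc' N0)|].
  by apply: le_trans H2 _; rewrite mulrDl mul1r lerDl.
rewrite -(hnrm_null hD (Hk0_Hk Hs) Lc' N0); apply: le_trans (sip_normD HS2 Hu H1) _.
by rewrite mulrDl mul1r addrC lerD2r.
Qed.

Lemma weight_bounds (cm M : R) u : 0 <= M -> bmeas D M c -> (forall x, D x -> cm <= c x) -> L2 D u ->
  cm * nrm u ^+ 2 <= Re (l2ip D (rmul c u) u) <= M * nrm u ^+ 2.
Proof.
move=> M0 bc cmc Lu; have Lcu := bmeas_L2 hD bc Lu; have /(L2P hD)[ru iu] := Lu.
rewrite (Re_l2ip hD Lcu Lu) (l2norm2 hD Lu).
have Er : (fun x => Re (rmul c u x)) = (fun x => c x * Re (u x)) by apply/funext => x; exact: Re_rmul.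
have Ei : (fun x => Im (rmul c u x)) = (fun x => c x * Im (u x)) by apply/funext => x; exact: Im_rmul.
rewrite Er Ei.
have key (f : pt -> R) : sqi mu D f -> cm * l2sq mu D f <= rip mu D (fun x => c x * f x) f <= M * l2sq mu D f.
  move=> sf; have scf := sqiM_bounded mD bc.1 bc.2 sf; have i1 := sqi_prod mD scf sf.
  have i2 := sqi_integrable2 sf.
  rewrite /l2sq /rip -(RintegralZl cm mD i2) -(RintegralZl M mD i2); apply/andP; split.
    apply: (le_Rintegral mD (integrable_scale mD cm i2) i1) => x Dx.
    by rewrite -mulrA -expr2 ler_wpM2r ?sqr_ge0// cmc.
  apply: (le_Rintegral mD i1 (integrable_scale mD M i2)) => x Dx.
  by rewrite -mulrA -expr2 ler_wpM2r ?sqr_ge0// (le_trans (ler_norm _))// bc.2.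
have /andP[h1 h2] := key _ ru; have /andP[h3 h4] := key _ iu.
by rewrite !mulrDr; apply/andP; split; exact: lerD.
Qed.

(** ** The inner product *)

Local Notation A := (formA D n).

Lemma normAE f : normA D n f = sip_norm A f. Proof. by []. Qed.

Opaque sip_norm hip laplacian Hnorm L2 Hk Hk0 rmul.

Local Notation B := (formB D n).
Local Notation Hp := (Hprod D).

Lemma HpL f : Hp f -> [/\ H02 f.1, L2 D (La f.1), L2 D (rmul c (La f.1)) & L2 D f.2].
Proof.
have [cm [M [_ _ bc _ _]]] := coeff_bounds.
move=> [H1 L2']; have Ll := L2_laplacian hD (Hk0_Hk H1).
by split=> //; exact: (bmeas_L2 hD bc).
Qed.

Lemma Hp_lin a f g : Hp f -> Hp g -> Hp (pscale a f + g).
Proof.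
move=> [f1 f2] [g1 g2]; split; first exact: (sip_W HS2 a f1 g1).
exact: (sip_W LS a f2 g2).
Qed.

Lemma formA_sip : semi_ip Hp (@pscale R d) A.
Proof.
have [cm [M [cm0 M0 bc cmc _]]] := coeff_bounds.
split.
- move=> f; rewrite /pscale; case: f => f1 f2 /=; congr pair; exact: (sip_sc1 LS).
- move=> f; rewrite /pscale; case: f => f1 f2 /=; congr pair; exact: (sip_scN1 LS).
- move=> a; rewrite /pscale /=; congr pair; exact: (sip_sc0 LS).
- by split; [exact: (sip_W0 HS2)|exact: (sip_W0 LS)].
- by move=> a f g; exact: Hp_lin.
- move=> a f g h Hf Hg Hh.
  have [f1 f2 f3 f4] := HpL Hf; have [g1 g2 g3 g4] := HpL Hg; have [h1 h2 h3 h4] := HpL Hh.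
  have [s1 s2 s3 s4] := HpL (Hp_lin a Hf Hg).
  rewrite /formA -[(pscale a f + g).2]/(cscale a f.2 + g.2) (sip_lin LS)//.
  have -> : l2ip D (rmul c (La (pscale a f + g).1)) (La h.1) =
      a * l2ip D (rmul c (La f.1)) (La h.1) + l2ip D (rmul c (La g.1)) (La h.1).
    have Lr := bmeas_L2 hD bc h2.
    rewrite (l2ip_rmul D c (La f.1)) (l2ip_rmul D c (La g.1)) (l2ip_rmul D c (La (pscale a f + g).1)).
    rewrite -(sip_lin LS a f2 g2 Lr).
    apply: (sip_null_l LS s2 (sip_W LS a f2 g2) Lr).
    exact: (laplacian_lin hD a (Hk0_Hk f1) (Hk0_Hk g1)).
  by rewrite mulrDr addrACA.
- move=> f g Hf Hg; have [f1 f2 f3 f4] := HpL Hf; have [g1 g2 g3 g4] := HpL Hg.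
  by rewrite /formA conjcD -(sip_conj LS f4 g4) -(sip_conj LS f3 g2) -l2ip_rmul.
- move=> f Hf; have [f1 f2 f3 f4] := HpL Hf; rewrite /formA ReD addr_ge0//; last exact: (sip_ge0 LS).
  have /andP[h1 _] := weight_bounds M0 bc cmc f2; apply: le_trans h1.
  by rewrite mulr_ge0 ?sqr_ge0// ltW.
Qed.

Local Notation nA := (sip_norm A).
Let AS := formA_sip.

Lemma normHE f : Hp f -> normH D f = hnrm 2 f.1 + nrm f.2.
Proof. by move=> [/Hk0_Hk f1 f2]; rewrite /normH (HnormE hD f1) (Hnorm0E hD f2). Qed.

(** The weight [1 / (n - 1)] lies between two positive constants, and the
    Laplacian controls the norm of [H^2_0(D)] by ellipticity. *)
Lemma norm_equivalence : exists2 K : R, 0 < K & forall f, Hp f ->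
  normH D f <= K * nA f /\ nA f <= K * normH D f.
Proof.
have [cm [M [cm0 M0 bc cmc _]]] := coeff_bounds.
have [Ke Ke0 Hell] := elliptic hD i0.
set s := Num.sqrt cm; have s0 : 0 < s by rewrite sqrtr_gt0.
set t := Num.sqrt M; have t0 : 0 <= t by exact: sqrtr_ge0.
exists (Ke / s + 1 + (t * d%:R + 1)).
  apply: addr_gt0; first by apply: addr_gt0; [exact: divr_gt0|exact: ltr01].
  by apply: (ltr_wpDl (mulr_ge0 t0 (ler0n _ _))); exact: ltr01.
move=> f Hf; have [f1 f2 f3 f4] := HpL Hf; rewrite normHE//.
have E : nA f ^+ 2 = Re (l2ip D (rmul c (La f.1)) (La f.1)) + nrm f.2 ^+ 2.
  by rewrite (sip_norm2 AS Hf) /formA ReD (sip_norm2 LS f4).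
have /andP[w1 w2] := weight_bounds M0 bc cmc f2.
have a0 : 0 <= nA f by exact: sip_norm_ge0.
have l0 := sip_norm_ge0 (l2ip D) (La f.1); have z0 := sip_norm_ge0 (l2ip D) f.2.
have h0 := sip_norm_ge0 (hip D 2) f.1.
have b1 : s * nrm (La f.1) <= nA f.
  rewrite -(@ler_pXn2r _ 2)// ?nnegrE ?mulr_ge0 ?(ltW s0)// exprMn sqr_sqrtr ?(ltW cm0)// E.
  by apply: le_trans w1 _; rewrite lerDl sqr_ge0.
have b2 : nrm f.2 <= nA f.
  rewrite -(@ler_pXn2r _ 2)// ?nnegrE// E lerDr; apply: le_trans w1.
  by rewrite mulr_ge0 ?sqr_ge0// ltW.
have b3 : nA f <= t * nrm (La f.1) + nrm f.2.
  have t1 : 0 <= t * nrm (La f.1) by rewrite mulr_ge0.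
  rewrite -(@ler_pXn2r _ 2)// ?nnegrE ?addr_ge0// E sqrrD exprMn (sqr_sqrtr M0).
  rewrite lerD2r; apply: le_trans w2 _; rewrite lerDl; apply: mulrn_wge0; exact: mulr_ge0.
have ell := Hell _ f1; have ll := laplacian_le hD (Hk0_Hk f1).
have td : 0 <= t * d%:R + 1 by rewrite addr_ge0// mulr_ge0.
have ks : 0 <= Ke / s + 1 by rewrite addr_ge0// divr_ge0// ltW.
split.
  rewrite mulrDl; apply: ler_wpDr; first exact: mulr_ge0.
  rewrite mulrDl mul1r; apply: lerD => //; apply: le_trans ell _.
  by rewrite -mulrA ler_wpM2l ?(ltW Ke0)// ler_pdivlMl.
apply: le_trans b3 _; rewrite mulrDl; apply: ler_wpDl; first by rewrite mulr_ge0// addr_ge0.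
rewrite mulrDl mul1r; apply: lerD; last by rewrite lerDr.
rewrite -mulrA ler_wpM2l// (le_trans ll)// ler_wpM2l//; by rewrite lerDl.
Qed.

(** ** The form [B] as an [L2] pairing *)

(** Green's formula moves all derivatives onto [f]. There are no boundary terms,
    as multiplication by the coefficients preserves [H^2_0(D)]. *)
Lemma formB_pairing : exists2 K : R, 0 <= K & forall f, Hp f -> exists F G : fct,
  [/\ L2 D F, L2 D G, nrm F <= K * normH D f, nrm G <= K * normH D f &
   forall g, Hp g -> B f g = l2ip D F g.1 + l2ip D f.1 g.2 /\
                     B g f = l2ip D g.1 G - l2ip D g.2 (rmul c' f.1)].
Proof.
have [cm [M [cm0 M0 bc cmc bc']]] := coeff_bounds; have [Km Km0 Hm] := coeff_multipliers.
have dR : 0 <= d%:R :> R by exact: ler0n.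
exists (d%:R * Km + M * d%:R + M + 1); first by rewrite !addr_ge0// mulr_ge0.
move=> f Hf; have [f1 f2 f3 f4] := HpL Hf.
have [m1 m2 m3 m4] := Hm _ f1.
have Lc := L2_laplacian hD (Hk0_Hk m1); have Lc' := L2_laplacian hD (Hk0_Hk m3).
have L3 := bmeas_L2 hD bc' f2; have L4 := bmeas_L2 hD bc' f4.
pose F := - La (rmul c f.1) - rmul c' (La f.1) - rmul c' f.2.
pose G := - rmul c (La f.1) - La (rmul c' f.1) + f.2.
have LF : L2 D F by apply: (sipWB LS _ L4); apply: (sipWB LS _ L3); exact: (sipWN LS).
have LG : L2 D G by apply: (sipWD LS _ f4); apply: (sipWB LS _ Lc'); exact: (sipWN LS).
have n1 := sip_norm_ge0 (hip D 2) f.1; have n2 := sip_norm_ge0 (l2ip D) f.2.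
have ll := laplacian_le hD (Hk0_Hk f1).
have B1 : nrm (La (rmul c f.1)) <= d%:R * Km * hnrm 2 f.1.
  by apply: le_trans (laplacian_le hD (Hk0_Hk m1)) _; rewrite -mulrA; exact: (ler_wpM2l dR m2).
have B2 : nrm (La (rmul c' f.1)) <= d%:R * Km * hnrm 2 f.1.
  by apply: le_trans (laplacian_le hD (Hk0_Hk m3)) _; rewrite -mulrA; exact: (ler_wpM2l dR m4).
have B3 : nrm (rmul c' (La f.1)) <= M * d%:R * hnrm 2 f.1.
  by apply: le_trans (bmeas_nrm hD M0 bc' f2) _; rewrite -mulrA; exact: (ler_wpM2l M0 ll).
have B4 : nrm (rmul c (La f.1)) <= M * d%:R * hnrm 2 f.1.
  by apply: le_trans (bmeas_nrm hD M0 bc f2) _; rewrite -mulrA; exact: (ler_wpM2l M0 ll).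
have B5 : nrm (rmul c' f.2) <= M * nrm f.2 by exact: (bmeas_nrm hD M0 bc' f4).
have K1 : 0 <= d%:R * Km by rewrite mulr_ge0. have K2 : 0 <= M * d%:R by rewrite mulr_ge0.
have N3 u v w : L2 D u -> L2 D v -> L2 D w -> nrm (- u - v + w) <= nrm u + nrm v + nrm w.
  move=> Lu Lv Lw; have Lnu := sipWN LS Lu; have Luv := sipWB LS Lnu Lv.
  apply: le_trans (sip_normD LS Luv Lw) _; rewrite lerD2r.
  by apply: le_trans (sip_normB LS Lnu Lv) _; rewrite (sip_normN LS).
exists F, G; split; [exact: LF|exact: LG| | |].
- rewrite normHE//; apply: le_trans (N3 _ _ _ Lc L3 (sipWN LS L4)) _.
  apply: (combine_le n1 n2 K1 K2 M0 B1 B3); rewrite (sip_normN LS L4).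
  by apply: le_trans B5 _; rewrite mulrDl mul1r lerDl; exact: n2.
- rewrite normHE//; apply: le_trans (N3 _ _ _ f3 Lc' f4) _.
  rewrite [nrm (rmul c _) + _]addrC.
  apply: (combine_le n1 n2 K1 K2 M0 B2 B4).
  by rewrite mulrDl mul1r lerDr; exact: (mulr_ge0 M0 n2).
move=> g Hg; have [g1 g2 g3 g4] := HpL Hg; have Lg1 := Hk0L g1; have Lf1 := Hk0L f1.
have [k1 _ k3 _] := Hm _ g1; have le1 := Hk0_le hD (isT : (1 <= 2)%N).
split; rewrite /formB.
- rewrite (green hD (Hk0_Hk m1) (le1 _ g1)) (green hD (Hk0_Hk f1) (le1 _ k3)) -!l2ip_rmul.
  rewrite /F (sipBl LS (sipWB LS (sipWN LS Lc) L3) L4 Lg1) (sipBl LS (sipWN LS Lc) L3 Lg1).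
  by rewrite (sipNl LS Lc Lg1).
- rewrite (green_r hD (Hk0_Hk f1) (le1 _ k1)) (green_r hD (Hk0_Hk m3) (le1 _ g1)) !l2ip_rmul.
  rewrite /G (sipDr LS (sipWB LS (sipWN LS f3) Lc') f4 Lg1) (sipBr LS (sipWN LS f3) Lc' Lg1).
  rewrite (sipNr LS f3 Lg1); ring.
Qed.
End forms.

(** * Regularity, approximation and duality *)

Section powers.
Context {R : realType}.
Implicit Types (x t K e : R) (k : nat).

Lemma exp_le_powR x t k : (0 < k)%N -> 0 <= x <= 1 -> 0 < t -> t <= k%:R -> x ^+ k <= x `^ t.
Proof.
move=> k0 /andP[x0 x1] t0 tk; have [->|xn] := eqVneq x 0.
  by rewrite expr0n eqn0Ngt k0 /= powR_ge0.
by rewrite -powR_mulrn//; apply: ger_powR => //; rewrite x1 lt_neqAle eq_sym xn x0.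
Qed.

Lemma powR_small t e K : 0 < t -> 0 < e -> 0 <= K -> exists2 x0 : R, 0 < x0 &
  forall x, 0 <= x -> x <= x0 -> K * x `^ t <= e.
Proof.
move=> t0 e0 K0; have K1 : 0 < K + 1 by rewrite ltr_wpDl.
exists ((e / (K + 1)) `^ t^-1); first by rewrite powR_gt0// divr_gt0.
move=> x x0 xle; have : x `^ t <= e / (K + 1).
  have -> : e / (K + 1) = ((e / (K + 1)) `^ t^-1) `^ t.
    by rewrite -powRrM mulVf ?gt_eqF// powRr1// divr_ge0// ltW.
  by apply: ge0_ler_powR; rewrite ?nnegrE ?powR_ge0// ltW.
rewrite ler_pdivlMr// mulrC => le; apply: le_trans le; rewrite mulrDl mul1r lerDl; exact: powR_ge0.
Qed.

Lemma le_of_sqr (a b : R) : 0 <= b -> a ^+ 2 <= b * a -> a <= b.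
Proof.
move=> b0 h; have [a0|a0] := lerP a 0; first exact: le_trans b0.
by move: h; rewrite expr2 ler_pM2r.
Qed.
End powers.

Section regularity.
Context {R : realType} {d : nat}.
Local Notation pt := 'rV[R]_d.
Local Notation C := R[i].
Local Notation fct := ('rV[R]_d -> R[i]).
Local Notation fpair := (fct * fct)%type.
Variables (D : set pt) (n : pt -> R) (delta : R).
Hypotheses (hD : bdomain D) (hdelta : 0 < delta) (hn : refraction_index D n delta) (i0 : 'I_d).
Implicit Types (u v w : fct) (f g e : fpair) (s k : nat) (B : R).
Let LS := L2_sip hD.
Let HS2 := Hk0_sip hD 2.
Let AS := formA_sip hD hdelta hn.
Local Notation nrm := (sip_norm (l2ip D)).
Local Notation hnrm k := (sip_norm (hip D k)).
Local Notation H02 := (Hk0 D 2).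
Local Notation La := (laplacian D).
Local Notation A := (formA D n).
Local Notation nA := (sip_norm A).
Local Notation Hp := (Hprod D).
Local Notation c := (fun x => (n x - 1)^-1).

Opaque sip_norm hip laplacian Hnorm L2 Hk Hk0 rmul l2ip wderiv Hneg_norm Hfrac Hfrac_norm.

(** ** Negative norms of square-integrable functions *)

Lemma Hneg_norm_le k (xi : fct -> C) B : 0 <= B ->
  (forall v, Hk0 D k v -> hnrm k v <= 1 -> normc (xi v) <= B) -> Hneg_norm D k xi <= B.
Proof.
move=> B0 H; apply: ge_sup.
  exists (normc (xi 0)), 0 => //; split; first exact: (sip_W0 (Hk0_sip hD k)).
  rewrite (HnormE hD (Hk_0 hD k)) (sip_norm0 (Hk_sip hD k)); exact: ler01.
move=> _ [v [Hv v1] <-]; apply: (H v Hv).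
by rewrite -(HnormE hD (Hk0_Hk Hv)).
Qed.

Lemma neg_ge k w v : L2 D w -> Hk0 D k v -> hnrm k v <= 1 ->
  normc (l2ip D w v) <= Hneg_norm D k (l2ip D w).
Proof.
move=> Lw Hv v1; apply: ub_le_sup; last first.
  by exists v => //; split; [exact: Hv|rewrite (HnormE hD (Hk0_Hk Hv))].
exists (nrm w) => _ [u [Hu u1] <-]; rewrite (HnormE hD (Hk0_Hk Hu)) in u1.
apply: le_trans (sip_CS LS Lw (Hk0L Hu)) _.
have := l2_le_hnrm hD (Hk0_Hk Hu) => h; rewrite -[leRHS]mulr1.
exact: (ler_wpM2l (sip_norm_ge0 _ w) (le_trans h u1)).
Qed.

Lemma neg_ge0 k w : L2 D w -> 0 <= Hneg_norm D k (l2ip D w).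
Proof.
move=> Lw; apply: le_trans (normc_ge0 _) (neg_ge Lw (sip_W0 (Hk0_sip hD k)) _).
by rewrite (sip_norm0 (Hk0_sip hD k)); exact: ler01.
Qed.

Lemma neg_le_nrm k w : L2 D w -> Hneg_norm D k (l2ip D w) <= nrm w.
Proof.
move=> Lw; apply: (Hneg_norm_le (sip_norm_ge0 _ w)) => v Hv v1.
apply: le_trans (sip_CS LS Lw (Hk0L Hv)) _; rewrite -[leRHS]mulr1.
exact: (ler_wpM2l (sip_norm_ge0 _ w) (le_trans (l2_le_hnrm hD (Hk0_Hk Hv)) v1)).
Qed.

Lemma neg_lin_le k a u v : L2 D u -> L2 D v ->
  Hneg_norm D k (l2ip D (cscale a u + v)) <=
  normc a * Hneg_norm D k (l2ip D u) + Hneg_norm D k (l2ip D v).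
Proof.
move=> Lu Lv; have a0 := normc_ge0 a.
apply: (Hneg_norm_le (addr_ge0 (mulr_ge0 a0 (neg_ge0 k Lu)) (neg_ge0 k Lv))) => x Hx x1.
rewrite (sip_lin LS a Lu Lv (Hk0L Hx)); apply: le_trans (le_normcD _ _) _.
rewrite Normc.normcM; apply: lerD; last exact: (neg_ge Lv Hx x1).
exact: (ler_wpM2l a0 (neg_ge Lu Hx x1)).
Qed.

Lemma normHsE s f : Hp f -> (s <= 2)%N -> normHs D s f = hnrm s f.1 + Hneg_norm D (2 - s) (l2ip D f.2).
Proof.
move=> [f1 _] s2; rewrite /normHs (HnormE hD (Hk_le s2 (Hk0_Hk f1))); congr (_ + Hneg_norm _ _ _).
Qed.

Lemma normHs_lin_le s a f g : Hp f -> Hp g -> (s <= 2)%N ->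
  normHs D s (pscale a f + g) <= normc a * normHs D s f + normHs D s g.
Proof.
move=> Hf Hg s2; rewrite (normHsE (Hp_lin hD a Hf Hg) s2) (normHsE Hf s2) (normHsE Hg s2).
have [f1 f2] := Hf; have [g1 g2] := Hg.
have k1 := Hk_le s2 (Hk0_Hk f1); have k2 := Hk_le s2 (Hk0_Hk g1).
rewrite mulrDr addrACA; apply: lerD; last exact: (neg_lin_le (2 - s) a f2 g2).
rewrite -(sip_normZ (Hk_sip hD s) a k1).
exact: (sip_normD (Hk_sip hD s) (sipWZ (Hk_sip hD s) a k1) k2).
Qed.

Lemma normHs_le_normH s f : Hp f -> (s <= 2)%N -> normHs D s f <= mindex_card (R := R) (d := d) s * normH D f + normH D f.
Proof.
move=> Hf s2; have [f1 f2] := Hf; rewrite (normHsE Hf s2) (normHE hD Hf).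
have m0 := @mindex_card_gt0 R d s.
have a0 := sip_norm_ge0 (hip D 2) f.1; have b0 := sip_norm_ge0 (l2ip D) f.2.
apply: lerD.
  apply: le_trans (hnrm_le hD s2 (Hk0_Hk f1)) _; apply: (ler_wpM2l (ltW m0)).
  by rewrite lerDl.
apply: le_trans (neg_le_nrm _ f2) _; by rewrite lerDr.
Qed.

(** ** Weak solutions and their approximation *)

Variables (r : nat -> R) (Cp : R) (I : Type) (S : I -> set fct) (h : I -> R) (p : nat) (Cap : R).
Hypotheses (hr0 : 0 < r 0%N <= 2) (hr1 : 0 < r 1%N <= 1) (hreg : regularity D n r Cp)
  (hS : fe_family D S h p r Cap).

Lemma r_gt0 s : (s < 2)%N -> 0 < r s.
Proof. by case: s => [|[|]]// _; [case/andP: hr0|case/andP: hr1]. Qed.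

Lemma r_le s : (s < 2)%N -> r s <= (2 - s)%:R.
Proof. by case: s => [|[|]]// _; [case/andP: hr0|case/andP: hr1]. Qed.

Lemma h_ge0 i : 0 <= h i.
Proof.
have [_ _ [m [K [mK _]]] _ _] := hS i; have [_ _ _ _ [k [x [y [_ _ <-]]]]] := mK.
exact: sqrtr_ge0.
Qed.

(** The weak equation is given for test functions and extends by continuity. *)
Lemma weak_solution s (xi : fct -> C) B : (s < 2)%N -> 0 <= B ->
  (forall a u v, Hk0 D s u -> Hk0 D s v -> xi (cscale a u + v) = conjc a * xi u + xi v) ->
  (forall v, Hk0 D s v -> normc (xi v) <= B * hnrm s v) ->
  exists psi, [/\ H02 psi,
    forall v, H02 v -> l2ip D (rmul c (La psi)) (La v) = xi v &
    forall i, exists vh, [/\ S i vh, H02 vh &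
      hnrm 2 (psi - vh) <= `|Cap| * h i `^ r s * (`|Cp| * B)]].
Proof.
move=> s2 B0 xl xB; have sl2 : (s <= 2)%N := ltnW s2.
have [cm [M [cm0 M0 bc cmc _]]] := coeff_bounds hD hdelta hn.
have xneg : Hneg D s xi.
  split; first exact: xl.
  by exists B => v Hv; rewrite (HnormE hD (Hk0_Hk Hv)); exact: xB.
have [psi [Fpsi Hpsi weak Fle]] := hreg s2 xneg.
have xle : Hneg_norm D s xi <= B.
  apply: (Hneg_norm_le B0) => v Hv v1; apply: le_trans (xB v Hv) _.
  by rewrite -[leRHS]mulr1; exact: (ler_wpM2l B0 v1).
have Lp := bmeas_L2 hD bc (L2_laplacian hD (Hk0_Hk Hpsi)).
have Cp0 := normr_ge0 Cp; have Ca0 := normr_ge0 Cap.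
have Fle2 : Hfrac_norm D (2 + r s) psi <= `|Cp| * B.
  apply: le_trans Fle _.
  have x0 : 0 <= Hneg_norm D s xi.
    apply: le_trans (normc_ge0 (xi 0)) _; apply: ub_le_sup.
      exists B => _ [v [Hv v1] <-]; rewrite (HnormE hD (Hk0_Hk Hv)) in v1.
      by apply: le_trans (xB v Hv) _; rewrite -[leRHS]mulr1; exact: (ler_wpM2l B0 v1).
    exists 0 => //; split; first exact: (sip_W0 (Hk0_sip hD s)).
    by rewrite (HnormE hD (Hk_0 hD s)) (sip_norm0 (Hk_sip hD s)); exact: ler01.
  apply: le_trans (ler_wpM2r x0 (ler_norm Cp)) _; exact: (ler_wpM2l Cp0 xle).
exists psi; split; first exact: Hpsi.
- move=> v Hv; apply/eqP; rewrite -subr_eq0; apply/eqP.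
  pose F v := l2ip D (rmul c (La psi)) (La v) - xi v.
  have mi := @mindex_card_gt0 R d s.
  apply: (@Hk0_ext R d D hD 2 F (nrm (rmul c (La psi)) * d%:R + B * mindex_card (R := R) (d := d) s) _ _ _ v Hv).
  + move=> u1 v1 Hu1 Hv1; have L1 := L2_laplacian hD (Hk0_Hk Hu1); have L2' := L2_laplacian hD (Hk0_Hk Hv1).
    have L3 := L2_laplacian hD (Hk0_Hk (sipWB HS2 Hu1 Hv1)).
    rewrite /F (sip_null_r LS L3 (sipWB LS L1 L2') Lp (laplacian_sub hD (Hk0_Hk Hu1) (Hk0_Hk Hv1))).
    rewrite (sipBr LS L1 L2' Lp).
    have -> : xi (u1 - v1) = xi u1 - xi v1.
      have := xl (-1) _ _ (Hk0_le hD sl2 Hv1) (Hk0_le hD sl2 Hu1).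
      rewrite (sip_scN1 LS) [- v1 + u1]addrC => ->.
      by rewrite conjcN conjc1 mulN1r addrC.
    have ac (x y z t : C) : x - y - (z - t) = x - z - (y - t) by ring.
    exact: ac.
  + move=> w Hw; have Lw := L2_laplacian hD (Hk0_Hk Hw).
    rewrite /F mulrDl; apply: le_trans (le_normcD _ _) _; rewrite normcN; apply: lerD.
      apply: le_trans (sip_CS LS Lp Lw) _; rewrite -mulrA.
      exact: (ler_wpM2l (sip_norm_ge0 _ _) (laplacian_le hD (Hk0_Hk Hw))).
    apply: le_trans (xB w (Hk0_le hD sl2 Hw)) _; rewrite -mulrA.
    exact: (ler_wpM2l B0 (hnrm_le hD sl2 (Hk0_Hk Hw))).
  + by move=> phi tp; rewrite /F (weak phi tp) subrr.
move=> i; have [SH _ _ Sr _] := hS i; have [vh [Svh vle]] := Sr s psi s2 Hpsi Fpsi.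
have Hvh := SH _ Svh; exists vh; split; [exact: Svh|exact: Hvh|].
rewrite -(HnormE hD (Hk0_Hk (sipWB HS2 Hpsi Hvh))); apply: le_trans vle _.
have hp := powR_ge0 (h i) (r s).
have F0 : 0 <= Hfrac_norm D (2 + r s) psi by exact: sqrtr_ge0.
apply: le_trans (ler_wpM2l (mulr_ge0 Ca0 hp) Fle2).
by apply: (ler_wpM2r F0); apply: (ler_wpM2r hp); exact: ler_norm.
Qed.

Lemma l2_approx k i v : (0 < k <= 2)%N -> Hk0 D k v ->
  exists vh, [/\ S i vh, H02 vh & nrm (v - vh) <= `|Cap| * h i ^+ k * hnrm k v].
Proof.
move=> k2 Hv; have [SH _ _ _ Sk] := hS i; have [vh [Svh vle]] := Sk k v k2 Hv.
have Hvh := SH _ Svh; exists vh; split; [exact: Svh|exact: Hvh|].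
have Lv := sipWB LS (Hk0L Hv) (Hk0L Hvh).
rewrite -(Hnorm0E hD Lv); apply: le_trans vle _; rewrite (HnormE hD (Hk0_Hk Hv)).
apply: (ler_wpM2r (sip_norm_ge0 _ _)); apply: ler_wpM2r; last exact: ler_norm.
exact: (exprn_ge0 k (h_ge0 i)).
Qed.

Lemma formA_split f e : formA D n f e = l2ip D (rmul c (La f.1)) (La e.1) + l2ip D f.2 e.2.
Proof. by []. Qed.

(** Each regularity exponent comes with its own solution and its own rate; the
    solutions differ by null elements, so one of them has both rates. *)
Lemma solve : exists2 K : R, 0 <= K & forall w v, L2 D w -> H02 v ->
  exists g, [/\ Hp g, forall e, Hp e -> A g e = l2ip D w e.1 + l2ip D v e.2,
    nA g <= K * (nrm w + hnrm 2 v) &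
    forall s i, (s < 2)%N -> h i <= 1 -> exists vh,
      [/\ fe_pairs (S i) vh, Hp vh & nA (g - vh) <= K * h i `^ r s * (nrm w + hnrm 2 v)]].
Proof.
have [K K0 HK] := norm_equivalence hD hdelta hn i0.
have Cp0 := normr_ge0 Cp; have Ca0 := normr_ge0 Cap.
exists (K * 1 + K * (`|Cap| * (`|Cp| + 1))).
  by rewrite addr_ge0// mulr_ge0 ?(ltW K0)// mulr_ge0// addr_ge0.
move=> w v Lw Hv; have w0 := sip_norm_ge0 (l2ip D) w; have v0 := sip_norm_ge0 (hip D 2) v.
have wv0 := addr_ge0 w0 v0.
have sol s : (s < 2)%N -> exists psi, [/\ H02 psi,
    forall v, H02 v -> l2ip D (rmul c (La psi)) (La v) = l2ip D w v &
    forall i, exists vh, [/\ S i vh, H02 vh &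
      hnrm 2 (psi - vh) <= `|Cap| * h i `^ r s * (`|Cp| * nrm w)]].
  move=> s2; apply: (weak_solution s2 w0).
    move=> a x y Hx Hy; have L1 := Hk0L Hx; have L2' := Hk0L Hy.
    by rewrite (sipDr LS (sipWZ LS a L1) L2' Lw) (sipZr LS a L1 Lw).
  move=> x Hx; apply: le_trans (sip_CS LS Lw (Hk0L Hx)) _.
  exact: (ler_wpM2l w0 (l2_le_hnrm hD (Hk0_Hk Hx))).
have [psi [Hpsi Wpsi _]] := sol 0%N isT.
have Lv := Hk0L Hv; pose g : fpair := (psi, v).
have Hg : Hp g by split; [exact: Hpsi|exact: Lv].
have Ag e : Hp e -> A g e = l2ip D w e.1 + l2ip D v e.2.
  by move=> [e1 e2]; rewrite formA_split (Wpsi _ e1).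
exists g; split; [exact: Hg|exact: Ag| |].
  have g0 := sip_norm_ge0 A g.
  have : nA g ^+ 2 <= (K * (nrm w + hnrm 2 v)) * nA g.
    rewrite (sip_norm2 AS Hg) (Ag g Hg) ReD.
    have ub x y : L2 D x -> L2 D y -> Re (l2ip D x y) <= nrm x * nrm y.
      move=> Lx Ly; apply: le_trans (sip_CS LS Lx Ly).
      exact: (le_trans (ler_norm _) (Re_le_normc _)).
    have [hg _] := HK g Hg; rewrite (normHE hD Hg) in hg.
    have a0 := sip_norm_ge0 (hip D 2) g.1; have b0 := sip_norm_ge0 (l2ip D) g.2.
    apply: le_trans (lerD (ub w g.1 Lw (Hk0L Hpsi)) (ub v g.2 Lv Lv)) _.
    have e1 := ler_wpM2l w0 (l2_le_hnrm hD (Hk0_Hk Hpsi)).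
    have e2 := ler_wpM2r b0 (l2_le_hnrm hD (Hk0_Hk Hv)).
    apply: le_trans (lerD e1 e2) _.
    rewrite mulrAC [K * _ * _]mulrC; apply: le_trans (ler_wpM2l wv0 hg).
    rewrite mulrDl !mulrDr; apply: lerD.
      by rewrite lerDl; exact: (mulr_ge0 w0 b0).
    by rewrite lerDr; exact: (mulr_ge0 v0 a0).
  move/(le_of_sqr (mulr_ge0 (ltW K0) wv0)) => le; apply: le_trans le _.
  apply: (ler_wpM2r wv0); rewrite mulr1 lerDl.
  by rewrite mulr_ge0 ?(ltW K0)// mulr_ge0// addr_ge0.
move=> s i s2 h1; have [psi' [Hpsi' Wpsi' app]] := sol s s2.
have [uh [Suh Huh uhle]] := app i.
have [zh [Szh Hzh zhle]] := l2_approx i (isT : (0 < 2 <= 2)%N) Hv.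
pose g' : fpair := (psi', v); have Hg' : Hp g' by split; [exact: Hpsi'|exact: Lv].
pose vh : fpair := (uh, zh); have Hvh : Hp vh by split; [exact: Huh|exact: (Hk0L Hzh)].
exists vh; split; [by split|exact: Hvh|].
have N0 : nA (g - g') = 0.
  have Hgg := sipWB AS Hg Hg'.
  apply/eqP; rewrite -sqrf_eq0 (sip_norm2 AS Hgg) (sipBl AS Hg Hg' Hgg) (Ag _ Hgg).
  have [e1 e2] := Hgg; rewrite (formA_split g') (Wpsi' _ e1) subrr; exact: eqxx.
have hp := powR_ge0 (h i) (r s).
apply: le_trans (sip_norm_dist AS Hg Hg' Hvh) _; rewrite N0 add0r.
have Hd := sipWB AS Hg' Hvh; have [_ h2] := HK _ Hd; apply: le_trans h2 _.
rewrite (normHE hD Hd) -[(g' - vh).1]/(psi' - uh) -[(g' - vh).2]/(v - zh).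
have hk : h i ^+ 2 <= h i `^ r s.
  apply: exp_le_powR => //; [by rewrite h_ge0|exact: r_gt0|].
  by apply: le_trans (r_le s2) _; rewrite ler_nat leq_subr.
have hk' : nrm (v - zh) <= `|Cap| * h i `^ r s * hnrm 2 v.
  by apply: le_trans zhle _; apply: (ler_wpM2r v0); exact: (ler_wpM2l Ca0 hk).
rewrite -[leRHS]mulrA mulrDl -mulrA -[X in _ <= X]addrC; apply: ler_wpDr.
  by rewrite mulr_ge0 ?(ltW K0)// mul1r mulr_ge0.
rewrite -mulrA; apply: (ler_wpM2l (ltW K0)); apply: le_trans (lerD uhle hk') _.
have -> : `|Cap| * (`|Cp| + 1) * (h i `^ r s * (nrm w + hnrm 2 v)) =
  `|Cap| * h i `^ r s * (`|Cp| * nrm w) + `|Cap| * h i `^ r s * hnrm 2 v +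
  (`|Cap| * h i `^ r s * nrm w + `|Cap| * h i `^ r s * (`|Cp| * hnrm 2 v)).
  move: (nrm w) (hnrm 2 v) (h i `^ r s) `|Cap| `|Cp| => *; ring.
have z1 := mulr_ge0 (mulr_ge0 Ca0 hp) w0.
have z2 := mulr_ge0 (mulr_ge0 Ca0 hp) (mulr_ge0 Cp0 v0).
by rewrite lerDl; exact: addr_ge0.
Qed.

(** Aubin and Nitsche: a Galerkin error is tested against the solution of the
    problem whose right-hand side is the error itself. *)
Lemma galerkin_duality : exists2 K : R, 0 <= K & forall s i e, (s < 2)%N -> h i <= 1 -> Hp e ->
  (forall g, fe_pairs (S i) g -> A e g = 0) -> normHs D s e <= K * h i `^ r s * nA e.
Proof.
have [K K0 HK] := norm_equivalence hD hdelta hn i0.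
have Cp0 := normr_ge0 Cp; have Ca0 := normr_ge0 Cap.
exists (K * (`|Cap| * `|Cp|) + K * `|Cap|).
  by rewrite addr_ge0// mulr_ge0 ?(ltW K0)// mulr_ge0.
move=> s i e s2 h1 He orth; have [e1 e2] := He; have sl2 : (s <= 2)%N := ltnW s2.
have hp := powR_ge0 (h i) (r s); have n0 := sip_norm_ge0 A e.
have [SH [S0 _] _ _ _] := hS i.
rewrite (normHsE He sl2).
have -> : (K * (`|Cap| * `|Cp|) + K * `|Cap|) * h i `^ r s * nA e =
  K * (`|Cap| * h i `^ r s * `|Cp|) * nA e + nA e * (K * (`|Cap| * h i `^ r s)).
  move: (nA e) (h i `^ r s) `|Cap| `|Cp| => *; ring.
have Hz v : H02 v -> Hp (v, 0) by move=> Hv; split; [exact: Hv|exact: (sip_W0 LS)].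
apply: lerD.
  have He1 := Hk0_le hD sl2 e1; have a0 := sip_norm_ge0 (hip D s) e.1.
  have KS := Hk0_sip hD s.
  have xl a u v : Hk0 D s u -> Hk0 D s v ->
      hip D s e.1 (cscale a u + v) = conjc a * hip D s e.1 u + hip D s e.1 v.
    by move=> Hu Hv; rewrite (sipDr KS (sipWZ KS a Hu) Hv He1) (sipZr KS a Hu He1).
  have xB v : Hk0 D s v -> normc (hip D s e.1 v) <= hnrm s e.1 * hnrm s v.
    by move=> Hv; exact: (sip_CS KS He1 Hv).
  have [psi [Hpsi Wpsi app]] := weak_solution s2 a0 xl xB.
  have [vh [Svh Hvh vle]] := app i.
  have b0 : 0 <= K * (`|Cap| * h i `^ r s * `|Cp|) * nA e.
    by apply: mulr_ge0 => //; apply: mulr_ge0; [exact: ltW|]; apply: mulr_ge0 => //; exact: mulr_ge0.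
  apply: (le_of_sqr b0).
  have P1 := Hz _ Hpsi; have P2 := Hz _ Hvh; have P3 := sipWB AS P1 P2.
  have E : hip D s e.1 e.1 = A ((psi, 0) - (vh, 0)) e.
    rewrite (sipBl AS P1 P2 He) [A (vh, 0) e](sip_conj AS He P2) (orth (vh, 0)) //.
    rewrite conjc0 subr0 formA_split -[(psi, 0).1]/psi (Wpsi _ e1) -[(psi, 0).2]/(0 : fct).
    by rewrite (sip0l LS e2) addr0.
  rewrite (sip_norm2 KS He1) E.
  apply: le_trans (le_trans (ler_norm _) (Re_le_normc _)) _.
  apply: le_trans (sip_CS AS P3 He) _.
  rewrite -!mulrA [nA e * _]mulrC !mulrA; apply: (ler_wpM2r n0).
  have [_ h2] := HK _ P3; apply: le_trans h2 _.
  rewrite -!mulrA; apply: (ler_wpM2l (ltW K0)); rewrite (normHE hD P3).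
  rewrite -[((psi, 0) - (vh, 0)).1]/(psi - vh) -[((psi, 0) - (vh, 0)).2]/((0 : fct) - 0) subr0.
  by rewrite (sip_norm0 LS) addr0 !mulrA; rewrite !mulrA in vle.
have b0 : 0 <= nA e * (K * (`|Cap| * h i `^ r s)).
  by apply: mulr_ge0 => //; apply: mulr_ge0; [exact: ltW|exact: mulr_ge0].
apply: (Hneg_norm_le b0) => v Hv v1.
have k2 : (0 < 2 - s <= 2)%N by rewrite subn_gt0 s2 leq_subr.
have [vh [Svh Hvh vle]] := l2_approx i k2 Hv.
have Hz2 x : L2 D x -> Hp (0, x) by move=> Lx; split; [exact: (sip_W0 HS2)|exact: Lx].
have P1 := Hz2 _ (Hk0L Hv); have P2 := Hz2 _ (Hk0L Hvh); have P3 := sipWB AS P1 P2.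
have L0 : A e (0, v) = l2ip D e.2 v.
  have [cm [M [cm0 M0 bc cmc _]]] := coeff_bounds hD hdelta hn.
  have Le := bmeas_L2 hD bc (L2_laplacian hD (Hk0_Hk e1)).
  have LL := L2_laplacian hD (Hk_0 hD 2).
  rewrite formA_split -[(0, v).1]/(0 : fct) -[(0, v).2]/v.
  have l0 : nrm (La 0 - 0) = 0.
    rewrite subr0; apply/eqP; rewrite eq_le sip_norm_ge0 andbT.
    by have := laplacian_le hD (Hk_0 hD 2); rewrite (sip_norm0 (Hk_sip hD 2)) mulr0.
  by rewrite (sip_null_r LS LL (sip_W0 LS) Le l0) (sip0r LS Le) add0r.
have -> : l2ip D e.2 v = A e ((0, v) - (0, vh)).
  by rewrite (sipBr AS P1 P2 He) (orth (0, vh)) // subr0 L0.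
apply: le_trans (sip_CS AS He P3) _; apply: (ler_wpM2l n0).
have [_ h2] := HK _ P3; apply: le_trans h2 _; apply: (ler_wpM2l (ltW K0)).
rewrite (normHE hD P3) -[((0, v) - (0, vh)).1]/((0 : fct) - 0) -[((0, v) - (0, vh)).2]/(v - vh) subr0.
rewrite (sip_norm0 HS2) add0r; apply: le_trans vle _.
have hk : h i ^+ (2 - s) <= h i `^ r s.
  by apply: exp_le_powR; [by case/andP: k2|rewrite h_ge0|exact: r_gt0|exact: r_le].
have ck := ler_wpM2l Ca0 hk; apply: le_trans ck.
rewrite -[leRHS]mulr1; apply: ler_wpM2l => //.
by apply: mulr_ge0 => //; exact: (exprn_ge0 _ (h_ge0 i)).
Qed.

(** ** The solution operators *)

(** By formB_pairing the data of both problems are a square integrable function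
    and an element of [H^2_0(D)]; this smoothness of the second component is
    what finite elements turn into a rate. *)
Lemma solution_operators : exists2 K : R, 0 <= K & forall f, Hp f -> exists g gs,
  [/\ Hp g /\ Hp gs, forall e, Hp e -> A g e = formB D n f e /\ A e gs = formB D n e f,
   nA g <= K * nA f &
   forall s i, (s < 2)%N -> h i <= 1 -> exists v vs : fpair,
     [/\ fe_pairs (S i) v /\ Hp v, fe_pairs (S i) vs /\ Hp vs,
      nA (g - v) <= K * h i `^ r s * nA f & nA (gs - vs) <= K * h i `^ r s * nA f]].
Proof.
have [K K0 HK] := norm_equivalence hD hdelta hn i0.
have [Ks Ks0 HKs] := solve; have [Kb Kb0 HB] := formB_pairing hD hdelta hn.
have [Km Km0 Hm] := coeff_multipliers hD hdelta hn.
pose K1 := (Kb + (1 + Km)) * K.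
have K10 : 0 <= K1 by rewrite mulr_ge0 ?(ltW K0)// !addr_ge0.
exists (Ks * K1); first exact: mulr_ge0.
move=> f Hf; have [f1 f2] := Hf; have [F [G [LF LG F0 G0 HFG]]] := HB f Hf.
have [m1 m2 m3 m4] := Hm _ f1; have m5 := sipWN HS2 m3.
have N0 := sip_norm_ge0 (l2ip D) f.2; have A0 := sip_norm_ge0 A f.
have [hf _] := HK f Hf.
have h1f : hnrm 2 f.1 <= normH D f by rewrite (normHE hD Hf) lerDl.
have H0 : 0 <= normH D f := le_trans (sip_norm_ge0 _ _) h1f.
have bound x y (a : R) : 0 <= a <= 1 + Km -> x <= Kb * normH D f -> y <= a * normH D f -> x + y <= K1 * nA f.
  move=> /andP[a0 a1] hx hy; apply: le_trans (lerD hx hy) _; rewrite -mulrDl /K1 -mulrA.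
  apply: le_trans (ler_wpM2l (addr_ge0 Kb0 a0) hf) _.
  by apply: ler_wpM2r; [exact: (mulr_ge0 (ltW K0) A0)|rewrite lerD2l].
have b1 : nrm F + hnrm 2 f.1 <= K1 * nA f.
  by apply: (bound _ _ 1 _ F0); [rewrite ler01 lerDl|rewrite mul1r].
have b2 : nrm G + hnrm 2 (- rmul (fun x => n x / (n x - 1)) f.1) <= K1 * nA f.
  apply: (bound _ _ Km _ G0); first by rewrite Km0 lerDr ler01.
  by rewrite (sip_normN HS2 m3); apply: le_trans m4 _; exact: (ler_wpM2l Km0 h1f).
have [g [Hg Ag gle gapp]] := HKs _ _ LF f1.
have [gs [Hgs Ags gsle gsapp]] := HKs _ _ LG m5.
exists g, gs; split.
- by split; [exact: Hg|exact: Hgs].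
- move=> e He; have [e1 e2] := He; have [B1 B2] := HFG e He; split.
    by rewrite (Ag e He) B1.
  rewrite (sip_conj AS Hgs He) (Ags e He) B2 conjcD.
  rewrite -(sip_conj LS LG (Hk0L e1)) -(sip_conj LS (Hk0L m5) e2).
  by rewrite (sipNr LS (Hk0L m3) e2).
- by apply: le_trans gle _; rewrite -mulrA; exact: (ler_wpM2l Ks0 b1).
move=> s i s2 hi; have [v [Sv Hv vle]] := gapp s i s2 hi.
have [vs [Svs Hvs vsle]] := gsapp s i s2 hi.
have hp := powR_ge0 (h i) (r s); have kh := mulr_ge0 Ks0 hp.
have E : Ks * K1 * h i `^ r s * nA f = Ks * h i `^ r s * (K1 * nA f).
  by rewrite (mulrAC Ks K1 (h i `^ r s)) -(mulrA (Ks * _)).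
exists v, vs; split; [by split|by split| |]; rewrite E.
  by apply: le_trans vle _; exact: (ler_wpM2l kh b1).
by apply: le_trans vsle _; exact: (ler_wpM2l kh b2).
Qed.
End regularity.

(** * Finite element spaces are finite dimensional *)

Section finite_dimension.
Context {R : realType} {d : nat}.
Local Notation pt := 'rV[R]_d.
Local Notation C := R[i].
Local Notation fct := ('rV[R]_d -> R[i]).
Local Notation mu := (lebesgue_rV d).
Variable D : set pt.
Hypothesis hD : bdomain D.
Implicit Types (u v w : fct).
Let oD := hD.1.
Let mD := measurable_domain oD.
Let LS := L2_sip hD.
Local Notation nrm := (sip_norm (l2ip D)).

Lemma nrm_null_set (N : set pt) u : mu.-negligible N -> L2 D u ->
  (forall x, D x -> ~ N x -> u x = 0) -> nrm u = 0.
Proof.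
move=> N0 Lu u0; apply/eqP; rewrite -sqrf_eq0 (l2norm2 hD Lu).
have /(L2P hD)[ru iu] := Lu.
have z (g : pt -> R) : sqi mu D g -> (forall x, D x -> ~ N x -> g x = 0) -> l2sq mu D g = 0.
  move=> sg g0; have -> : l2sq mu D g = \int[mu]_(x in D) (0 : R).
    congr fine; apply: ae_eq_integral => //.
      by have /integrableP[] := sqi_integrable2 sg.
    apply: negligibleS N0 => x /= H; apply: contrapT => nN; apply: H => Dx.
    by rewrite g0// expr0n.
  by rewrite /Rintegral integral0_eq.
by rewrite !z ?addr0// => x Dx nN; rewrite u0.
Qed.

(** The coefficients on all elements determine a piecewise polynomial up to the
    element boundaries, which are negligible. *)
Lemma piecewise_relation (hh : R) p m (K : 'I_m -> set pt) : mesh D hh K ->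
  exists M, forall v : 'I_M.+1 -> fct * fct,
  (forall j, [/\ L2 D (v j).1, L2 D (v j).2, piecewise_polynomial D p K (v j).1 &
     piecewise_polynomial D p K (v j).2]) ->
  exists c : 'I_M.+1 -> C, [/\ exists j, c j != 0,
    nrm (\sum_j cscale (c j) (v j).1) = 0 & nrm (\sum_j cscale (c j) (v j).2) = 0].
Proof.
move=> [Kk _ KD _ _]; set X : finType := (bool * 'I_m * {ffun 'I_d -> 'I_p.+1})%type.
exists #|X| => v Hv.
have /choice[a Ha] (jb : 'I_#|X|.+1 * bool) : exists a : 'I_m -> {ffun 'I_d -> 'I_p.+1} -> C,
    forall k x, D x -> (K k)° x -> (if jb.2 then (v jb.1).1 else (v jb.1).2) x =
      \sum_b a k b * (\prod_i x ord0 i ^+ b i)%:C.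
  have [_ _ p1 p2] := Hv jb.1.
  have /choice[a Ha] : forall k, exists a : {ffun 'I_d -> 'I_p.+1} -> C, forall x, D x -> (K k)° x ->
      (if jb.2 then (v jb.1).1 else (v jb.1).2) x = \sum_b a b * (\prod_i x ord0 i ^+ b i)%:C.
    move=> k; have [P [[a Pa] HP]] : exists P, polynomial_fun p P /\
        forall x, D x -> (K k)° x -> (if jb.2 then (v jb.1).1 else (v jb.1).2) x = P x.
      by case: (jb.2); [exact: p1|exact: p2].
    by exists a => x Dx Kx; rewrite (HP x Dx Kx) Pa.
  by exists a.
pose Q : 'M[C]_(#|X|.+1, #|X|) := \matrix_(j, y) a (j, (enum_val y).1.1) (enum_val y).1.2 (enum_val y).2.
have [c c0 cQ] := nontrivial_relation Q.
have coef bb k b : \sum_j c ord0 j * a (j, bb) k b = 0.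
  have := congr1 (fun T : 'rV[C]_#|X| => T ord0 (enum_rank (bb, k, b))) cQ.
  rewrite mxE [X in _ = X -> _]mxE => E; rewrite -[RHS]E; apply: eq_bigr => j _; by rewrite mxE enum_rankK.
have ev (F : 'I_#|X|.+1 -> fct) x : (\sum_j cscale (c ord0 j) (F j)) x = \sum_j c ord0 j * F j x.
  by rewrite fct_sumE.
pose F (j : nat) : set pt := if insub j is Some k then K k `\` (K k)° else set0.
have NN0 : mu.-negligible (\bigcup_j F j).
  apply: negligible_bigcup => j; rewrite /F; case: insubP => [k _ _|_]; last exact: negligible_set0.
  have [cK _ _ K0] := Kk k; apply/negligibleP; last exact: K0.
  apply: measurableD.
    have clK : closed (K k) by apply: compact_closed => //; exact: norm_hausdorff.
    by rewrite -[K k]setCK; apply: measurableC; apply: open_measurable_rV; exact: closed_openC.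
  by apply: open_measurable_rV; exact: open_interior.
have key bb : nrm (\sum_j cscale (c ord0 j) (if bb then (v j).1 else (v j).2)) = 0.
  apply: (nrm_null_set NN0).
    by apply: (sipW_sum LS) => j _; apply: (sipWZ LS); have [l1 l2 _ _] := Hv j; case: bb.
  move=> x Dx nN; rewrite ev.
  have [k _ Kx] : (\bigcup_k K k) x by rewrite KD; exact: subset_closure.
  have Kix : (K k)° x by apply: contrapT => nK; apply: nN; exists (val k) => //; rewrite /F valK.
  under eq_bigr => j _ do rewrite (Ha (j, bb) k x Dx Kix) mulr_sumr.
  rewrite exchange_big /= big1// => b _.
  under eq_bigr => j _ do rewrite mulrA.
  by rewrite -mulr_suml coef mul0r.
exists (fun j => c ord0 j); split; [|exact: (key true)|exact: (key false)].
apply: contrapT => H; move/eqP: c0; apply; apply/rowP => j; rewrite mxE.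
by apply/eqP; apply: contrapT => /negP cj; apply: H; exists j.
Qed.

End finite_dimension.

(** * The Hilbert space of classes modulo null elements *)

(** Elements of a semi-inner product space are identified when they define the
    same functional [ip f]; these functionals form a vector space. *)
Section quotient.
Context {R : realType} {U : zmodType}.
Local Notation C := R[i].
Variables (W : set U) (sc : C -> U -> U) (ip : U -> U -> C).
Hypothesis HS : semi_ip W sc ip.
Implicit Types (f g h : U) (a : C).

Definition functional f : U -> C := fun h => if `[< W h >] then ip f h else 0.

Definition functionals : {pred (U -> C)} := fun X => `[< exists2 f, W f & X = functional f >].

Lemma functional_lin a f g : W f -> W g -> functional (sc a f + g) = a *: functional f + functional g.
Proof.
move=> Wf Wg; apply/funext => h.
rewrite -[RHS]/(a * functional f h + functional g h) /functional.
case: asboolP => Wh; last by rewrite mulr0 addr0.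
by rewrite (sip_lin HS a Wf Wg Wh).
Qed.

Lemma functionals_closed : submod_closed functionals.
Proof.
split.
  apply/asboolP; exists 0; first exact: (sip_W0 HS).
  by apply/funext => h; rewrite /functional; case: asboolP => // Wh; rewrite (sip0l HS Wh).
move=> a _ _ /asboolP[f Wf ->] /asboolP[g Wg ->]; apply/asboolP.
by exists (sc a f + g); [exact: (sip_W HS)|rewrite functional_lin].
Qed.

HB.instance Definition _ := GRing.isSubmodClosed.Build C (U -> C) functionals functionals_closed.

Record quot := Quot { qval : U -> C; _ : qval \in functionals }.
HB.instance Definition _ := [isSub for qval].
HB.instance Definition _ := [Choice of quot by <:].
HB.instance Definition _ := [SubChoice_isSubLmodule of quot by <:].

Lemma quotient_exists : complete W ip -> exists (E : lmodType C) (ipE : E -> E -> C) (pi : U -> E),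
  [/\ hilbert ipE, forall x, exists2 f, W f & pi f = x,
      forall a f g, W f -> W g -> pi (sc a f + g) = a *: pi f + pi g,
      forall f g, W f -> W g -> ipE (pi f) (pi g) = ip f g &
      forall f, W f -> sip_norm ip f = 0 -> pi f = 0].
Proof.
move=> cW.
have mem f : W f -> functional f \in functionals by move=> Wf; apply/asboolP; exists f.
pose pi f : quot := if pselect (W f) is left Wf then Quot (mem f Wf) else 0.
have piE f : W f -> qval (pi f) = functional f by rewrite /pi; case: pselect.
have sur x : exists2 f, W f & pi f = x.
  have /asboolP[f Wf E] := valP x; exists f => //; apply: val_inj => /=.
  by rewrite (piE f Wf) -E.
have lin a f g : W f -> W g -> pi (sc a f + g) = a *: pi f + pi g.
  move=> Wf Wg; apply: val_inj.
  have Wfg := sip_W HS a Wf Wg.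
  have E : val (a *: pi f + pi g) = a *: val (pi f) + val (pi g) by first [by rewrite raddfD GRing.valZ | by rewrite linearP | by []].
  rewrite E -[val (pi (sc a f + g))]/(qval (pi (sc a f + g))) -[val (pi f)]/(qval (pi f)) -[val (pi g)]/(qval (pi g)).
  by rewrite (piE _ Wfg) (piE f Wf) (piE g Wg) functional_lin.
pose rep (x : quot) : U := s2val (cid2 (sur x)).
have Wrep x : W (rep x) by rewrite /rep; case: cid2.
have pirep x : pi (rep x) = x by rewrite /rep; case: cid2.
pose ipE (x y : quot) : C := ip (rep x) (rep y).
have fe f g h : W f -> W g -> pi f = pi g -> W h -> ip f h = ip g h.
  move=> Wf Wg E Wh; have := congr1 (fun x : quot => qval x h) E.
  by rewrite (piE f Wf) (piE g Wg) /functional; case: asboolP.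
have ipP f g : W f -> W g -> ipE (pi f) (pi g) = ip f g.
  move=> Wf Wg; rewrite /ipE.
  rewrite (fe (rep (pi f)) f _ (Wrep _) Wf (pirep _) (Wrep _)).
  rewrite (sip_conj HS (Wrep _) Wf) (fe (rep (pi g)) g f (Wrep _) Wg (pirep _) Wf).
  by rewrite -(sip_conj HS Wg Wf).
have null f : W f -> sip_norm ip f = 0 -> pi f = 0.
  move=> Wf f0; have W0 := sip_W0 HS.
  have p0 : pi 0 = 0.
    by have := lin (-1) 0 0 W0 W0; rewrite (sip_sc0 HS) addr0 scaleN1r addNr.
  rewrite -p0; apply: val_inj; rewrite -[LHS]/(qval (pi f)) -[RHS]/(qval (pi 0)) (piE f Wf) (piE 0 W0).
  apply/funext => h; rewrite /functional; case: asboolP => // Wh.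
  by rewrite (sip_norm0_ip HS Wf Wh f0) (sip0l HS Wh).
have nP f : W f -> sip_norm ipE (pi f) = sip_norm ip f.
  by move=> Wf; rewrite /sip_norm (ipP f f Wf Wf).
exists quot, ipE, pi; split=> //.
have HE : semi_ip [set: quot] (fun a x => a *: x) ipE.
  split=> //.
  - by move=> f; rewrite scale1r.
  - by move=> f; rewrite scaleN1r.
  - by move=> a; rewrite scaler0.
  - move=> a x y z _ _ _; have [f Wf <-] := sur x; have [g Wg <-] := sur y; have [h Wh <-] := sur z.
    by rewrite -(lin a f g Wf Wg) (ipP _ _ (sip_W HS a Wf Wg) Wh) (ipP f h Wf Wh) (ipP g h Wg Wh) (sip_lin HS a Wf Wg Wh).
  - by move=> x y _ _; exact: (sip_conj HS (Wrep x) (Wrep y)).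
  - by move=> x _; exact: (sip_ge0 HS (Wrep x)).
split; [exact: HE| |].
  by move=> x; have [f Wf <-] := sur x; rewrite (nP f Wf) => f0; exact: null.
move=> x cx.
have dist y z : sip_norm ip (rep y - rep z) = sip_norm ipE (y - z).
  have Wd := sipWB HS (Wrep y) (Wrep z).
  rewrite -(nP _ Wd); congr (sip_norm ipE _).
  by have := lin (-1) _ _ (Wrep z) (Wrep y); rewrite (sip_scN1 HS) [- rep z + _]addrC scaleN1r !pirep [- z + y]addrC.
have [|y Wy cy] := cW (fun k => rep (x k)) (fun k => Wrep (x k)).
  move=> e e0; have [N HN] := cx e e0; exists N => m k mN kN.
  by rewrite dist; exact: HN.
exists (pi y) => e e0; have [N HN] := cy e e0; exists N => k kN.
have Wd := sipWB HS (Wrep (x k)) Wy.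
have -> : x k - pi y = pi (rep (x k) - y).
  have := lin (-1) _ _ Wy (Wrep (x k)); rewrite (sip_scN1 HS) [- y + _]addrC scaleN1r pirep => ->.
  by rewrite addrC.
by rewrite (nP _ Wd); exact: HN.
Qed.
End quotient.

(** * The transmission problem in the Hilbert space *)

Section model.
Context {R : realType} {d : nat}.
Local Notation pt := 'rV[R]_d.
Local Notation C := R[i].
Local Notation fct := ('rV[R]_d -> R[i]).
Local Notation fpair := (fct * fct)%type.
Variables (D : set pt) (n : pt -> R) (delta : R).
Hypotheses (hD : bdomain D) (hdelta : 0 < delta) (hn : refraction_index D n delta) (i0 : 'I_d).
Variables (r : nat -> R) (Cp : R) (I : Type) (S : I -> set fct) (h : I -> R) (p : nat) (Cap : R).
Hypotheses (hr0 : 0 < r 0%N <= 2) (hr1 : 0 < r 1%N <= 1) (hreg : regularity D n r Cp)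
  (hS : fe_family D S h p r Cap).
Local Notation A := (formA D n).
Local Notation B := (formB D n).
Local Notation nA := (sip_norm A).
Local Notation Hp := (Hprod D).
Let AS := formA_sip hD hdelta hn.
Variables (E : lmodType C) (ipE : E -> E -> C) (pi : fpair -> E).
Hypotheses (HH : hilbert ipE) (sur : forall x, exists2 f, Hp f & pi f = x)
  (pi_lin : forall a f g, Hp f -> Hp g -> pi (pscale a f + g) = a *: pi f + pi g)
  (pi_ip : forall f g, Hp f -> Hp g -> ipE (pi f) (pi g) = A f g)
  (pi_null : forall f, Hp f -> nA f = 0 -> pi f = 0).
Local Notation nrm := (sip_norm ipE).
Implicit Types (f g e : fpair) (V M : set fpair) (x y : E) (s : nat).

Let Hp0 : Hp 0. Proof. exact: (sip_W0 AS). Qed.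

Lemma pi_nrm f : Hp f -> nrm (pi f) = nA f.
Proof. by move=> Hf; rewrite /sip_norm (pi_ip Hf Hf). Qed.
Opaque sip_norm hip laplacian Hnorm L2 Hk Hk0 rmul l2ip wderiv Hneg_norm Hfrac Hfrac_norm formA formB normH normHs.

Lemma pi0 : pi 0 = 0. Proof. by apply: (pi_null Hp0); exact: (sip_norm0 AS). Qed.

Lemma piZ a f : Hp f -> pi (pscale a f) = a *: pi f.
Proof. by move=> Hf; have := pi_lin a Hf Hp0; rewrite addr0 pi0 addr0. Qed.

Lemma piB f g : Hp f -> Hp g -> pi (f - g) = pi f - pi g.
Proof.
move=> Hf Hg; have := pi_lin (-1) Hg Hf.
by rewrite (sip_scN1 AS) [- g + _]addrC scaleN1r [- pi g + _]addrC.
Qed.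

Lemma pi_sum k (c : 'I_k -> C) (b : 'I_k -> fpair) : (forall j, Hp (b j)) ->
  Hp (\sum_j pscale (c j) (b j)) /\ pi (\sum_j pscale (c j) (b j)) = \sum_j c j *: pi (b j).
Proof.
move=> Hb; elim/big_rec2: _ => [|j x y _ [Hy <-]]; first by split; [exact: Hp0|exact: pi0].
by split; [exact: (sip_W AS)|exact: (pi_lin (c j) (Hb j) Hy)].
Qed.

Lemma pi_eq0 f : Hp f -> null D f <-> pi f = 0.
Proof.
have [K K0 HK] := norm_equivalence hD hdelta hn i0.
move=> Hf; have [h1 h2] := HK f Hf; split => [f0|f0].
  apply: (pi_null Hf); apply/eqP; rewrite eq_le sip_norm_ge0 andbT.
  by move: h2; rewrite f0 mulr0.
rewrite /null; apply/eqP; rewrite eq_le; apply/andP; split.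
  by move: h1; rewrite -(pi_nrm Hf) f0 (nrm0 HH) mulr0.
by rewrite (normHE hD Hf); apply: addr_ge0; exact: sip_norm_ge0.
Qed.

Definition rep x : fpair := s2val (cid2 (sur x)).
Lemma Hp_rep x : Hp (rep x). Proof. by rewrite /rep; case: cid2. Qed.
Lemma pi_rep x : pi (rep x) = x. Proof. by rewrite /rep; case: cid2. Qed.

(** ** Finite element spaces *)

Lemma fe_Hp i f : fe_pairs (S i) f -> Hp f.
Proof.
have [SH _ _ _ _] := hS i; move=> [f1 f2].
by split; [exact: SH|exact: (Hk0L (SH _ f2))].
Qed.

Lemma fe_subspace i : subspace (fe_pairs (S i)).
Proof.
have [_ [S0 Sl] _ _ _] := hS i; split; first by split.
by move=> a f g [f1 f2] [g1 g2]; split; exact: Sl.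
Qed.

Lemma lsub_image V : V `<=` Hp -> subspace V -> lsub (pi @` V).
Proof.
move=> VH [V0 Vl]; split; first by exists 0; [exact: V0|exact: pi0].
move=> a _ _ [f Vf <-] [g Vg <-]; exists (pscale a f + g); first exact: Vl.
exact: (pi_lin a (VH _ Vf) (VH _ Vg)).
Qed.

Lemma fe_dim i : exists k, dim_le (pi @` fe_pairs (S i)) k.
Proof.
have [SH _ [m [K [mK SP]]] _ _] := hS i.
have [M HM] := piecewise_relation hD p mK; exists M => v Hv.
have /choice[w Hw] : forall j, exists w, fe_pairs (S i) w /\ pi w = v j.
  by move=> j; have [w] := Hv j; exists w.
have Hpw j : Hp (w j) := fe_Hp (Hw j).1.
have [|c [c0 n1 n2]] := HM w.
  move=> j; have [[w1 w2] _] := Hw j.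
  by split; [exact: (Hk0L (SH _ w1))|exact: (Hk0L (SH _ w2))|exact: SP|exact: SP].
exists c; split; first exact: c0.
have -> : \sum_j c j *: v j = \sum_j c j *: pi (w j) by apply: eq_bigr => j _; rewrite (Hw j).2.
have [Hs <-] := pi_sum c Hpw; apply/(pi_eq0 Hs); rewrite /null (normHE hD Hs).
have -> : (\sum_j pscale (c j) (w j)).2 = \sum_j cscale (c j) (w j).2.
  by elim/big_rec2: _ => // j y x _ <-.
have E1 : (\sum_j pscale (c j) (w j)).1 = \sum_j cscale (c j) (w j).1.
  by elim/big_rec2: _ => // j y x _ <-.
rewrite n2 addr0; have H1 := Hk0_Hk Hs.1; rewrite E1 in H1 *.
have n1' : sip_norm (l2ip D) (\sum_j cscale (c j) (w j).1 - 0) = 0 by rewrite subr0.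
rewrite (hnrm_null hD H1 (sip_W0 (L2_sip hD)) n1'); exact: (sip_norm0 (Hk_sip hD 2)).
Qed.

Lemma sub_proj i V : subspace V -> V `<=` fe_pairs (S i) -> exists P, is_proj ipE (pi @` V) P.
Proof.
move=> Vs VS; have [M HM] := fe_dim i.
apply: (@proj_exists _ _ _ HH _ M); first by apply: lsub_image => // f /VS; exact: fe_Hp.
by move=> v Hv; apply: HM => j; have [f Vf <-] := Hv j; exists f => //; exact: VS.
Qed.

(** ** The solution operators *)

Definition rate (T : E -> E) (K : R) := forall s i x, (s < 2)%N -> h i <= 1 ->
  exists2 v, fe_pairs (S i) v & nrm (T x - pi v) <= K * h i `^ r s * nrm x.

Lemma operators : exists (T Ts : E -> E) (K : R), [/\ 0 <= K, adjoint ipE T Ts, bounded_op ipE T K,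
  forall f e, Hp f -> Hp e -> ipE (T (pi f)) (pi e) = B f e & rate T K /\ rate Ts K].
Proof.
have [K K0 HK] := solution_operators hD hdelta hn i0 hr0 hr1 hreg hS.
have /choice[G HG] x : exists G : fpair * fpair,
  [/\ Hp G.1 /\ Hp G.2, forall e, Hp e -> A G.1 e = B (rep x) e /\ A e G.2 = B e (rep x),
   nA G.1 <= K * nA (rep x) &
   forall s i, (s < 2)%N -> h i <= 1 -> exists v vs : fpair,
     [/\ fe_pairs (S i) v /\ Hp v, fe_pairs (S i) vs /\ Hp vs,
      nA (G.1 - v) <= K * h i `^ r s * nA (rep x) & nA (G.2 - vs) <= K * h i `^ r s * nA (rep x)]].
  have [g [gs H]] := HK _ (Hp_rep x); by exists (g, gs).
have nr x : nA (rep x) = nrm x by rewrite -(pi_nrm (Hp_rep x)) pi_rep.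
have H1 x : Hp (G x).1 by have [[]] := HG x.
have H2 x : Hp (G x).2 by have [[]] := HG x.
have TB x e : Hp e -> ipE (pi (G x).1) (pi e) = B (rep x) e.
  by move=> He; have [_ AB _ _] := HG x; rewrite (pi_ip (H1 x) He) (AB e He).1.
have TsB y e : Hp e -> ipE (pi e) (pi (G y).2) = B e (rep y).
  by move=> He; have [_ AB _ _] := HG y; rewrite (pi_ip He (H2 y)) (AB e He).2.
exists (fun x => pi (G x).1), (fun x => pi (G x).2), K; split.
- exact: K0.
- move=> x y; rewrite -[in LHS](pi_rep y) (TB x _ (Hp_rep y)).
  by rewrite -[in RHS](pi_rep x) (TsB y _ (Hp_rep x)).
- split; first exact: K0.
  by move=> x; rewrite (pi_nrm (H1 x)) -nr; have [] := HG x.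
- move=> f e Hf He; rewrite (TB _ e He).
  have [g [gs [[_ Hgs] AB _ _]]] := HK e He.
  rewrite -(AB _ (Hp_rep _)).2 -(AB f Hf).2 -(pi_ip (Hp_rep _) Hgs) -(pi_ip Hf Hgs).
  by rewrite pi_rep.
split=> s i x s2 h1; have [_ _ _ app] := HG x; have [v [vs [[Sv Hv] [Svs Hvs] a1 a2]]] := app s i s2 h1.
  by exists v; [exact: Sv|rewrite -(piB (H1 x) Hv) (pi_nrm (sipWB AS (H1 x) Hv)) -nr].
by exists vs; [exact: Svs|rewrite -(piB (H2 x) Hvs) (pi_nrm (sipWB AS (H2 x) Hvs)) -nr].
Qed.

Lemma rate_approximable T Ts K : 0 <= K -> rate T K -> rate Ts K ->
  (forall eta, 0 < eta -> exists i, h i <= eta) -> approximable ipE T Ts.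
Proof.
move=> K0 rT rTs small e e0.
have [x0 x00 Hx0] := powR_small (r_gt0 hr0 hr1 (isT : (0 < 2)%N)) e0 K0.
have m0 : 0 < Num.min x0 1 by rewrite lt_min x00 ltr01.
have [i hi] := small _ m0; rewrite le_min in hi; case/andP: hi => hi h1.
have [M HM] := fe_dim i.
have Vl : lsub (pi @` fe_pairs (S i)) := lsub_image (@fe_Hp i) (fe_subspace i).
have [k [v [ov Ev]]] := onb_exists HH Vl HM.
have Pv := oprojP HH ov; rewrite -Ev in Pv.
have b T' : rate T' K -> forall x, nrm (T' x - oproj ipE v (T' x)) <= e * nrm x.
  move=> rT' x; have [w Sw wle] := rT' 0%N i x isT h1.
  apply: le_trans (proj_best HH Vl Pv _ (_ : (pi @` fe_pairs (S i)) (pi w))) _; first by exists w.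
  apply: le_trans wle _; apply: (ler_wpM2r (sip_norm_ge0 _ x)).
  exact: (Hx0 _ (h_ge0 hS i) hi).
by exists k, v; split; [exact: ov|exact: b|exact: b].
Qed.

(** ** Weak norms *)

(** The weak norms are bounded by the energy norm, hence do not see null
    elements and can be computed on representatives. *)
Lemma weak_norms : exists2 K : R, 1 <= K & forall s, (s < 2)%N -> exists N : E -> R,
  seminorm_on ipE N K /\ forall f, Hp f -> N (pi f) = normHs D s f.
Proof.
have [K K0 HK] := norm_equivalence hD hdelta hn i0.
have mc s := @mindex_card_gt0 R d s.
pose m := mindex_card (R := R) (d := d) 0 + mindex_card (R := R) (d := d) 1.
have m0 : 0 <= m by rewrite addr_ge0// ltW.
exists (m * K + K + 1); first by rewrite lerDr addr_ge0 ?(ltW K0)// mulr_ge0// ltW.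
move=> s s2; have sl : (s <= 2)%N := ltnW s2.
have ub f : Hp f -> normHs D s f <= (m * K + K + 1) * nA f.
  move=> Hf; have n0 := sip_norm_ge0 A f; have [h1 _] := HK f Hf.
  have H0 : 0 <= normH D f by rewrite (normHE hD Hf); apply: addr_ge0; exact: sip_norm_ge0.
  have ms : mindex_card (R := R) (d := d) s <= m.
    by case: s s2 {sl} => [|[|]]// _; rewrite /m ?lerDl ?lerDr ltW.
  apply: le_trans (normHs_le_normH hD Hf sl) _.
  rewrite (mulrDl (m * K + K) 1) mul1r; apply: ler_wpDr; first exact: n0.
  rewrite (mulrDl (m * K) K).
  apply: lerD; last exact: h1.
  apply: le_trans (ler_wpM2r H0 ms) _; rewrite -mulrA; exact: (ler_wpM2l m0 h1).
have z f : Hp f -> nA f = 0 -> normHs D s f <= 0.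
  by move=> Hf f0; have := ub f Hf; rewrite f0 mulr0.
have lin := normHs_lin_le hD (s := s).
have le f g : Hp f -> Hp g -> pi f = pi g -> normHs D s f <= normHs D s g.
  move=> Hf Hg E0; have Hd := sipWB AS Hf Hg.
  have := lin 1 _ _ Hd Hg sl; rewrite (sip_sc1 AS) subrK Normc.normc1 mul1r => H.
  apply: le_trans H _; rewrite gerDr; apply: (z _ Hd).
  by rewrite -(pi_nrm Hd) (piB Hf Hg) E0 subrr (nrm0 HH).
have eq f : Hp f -> normHs D s (rep (pi f)) = normHs D s f.
  move=> Hf; apply/eqP; rewrite eq_le.
  by rewrite (le _ _ (Hp_rep _) Hf (pi_rep _)) (le _ _ Hf (Hp_rep _) (esym (pi_rep _))).
exists (fun x => normHs D s (rep x)); split; last exact: eq.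
have scal (b : C) x : normHs D s (rep (b *: x)) <= normc b * normHs D s (rep x).
  have Hx := Hp_rep x; have Hb := sipWZ AS b Hx.
  have <- : pi (pscale b (rep x)) = b *: x by rewrite (piZ b Hx) pi_rep.
  rewrite (eq _ Hb); have := lin b _ _ Hx Hp0 sl; rewrite addr0 => H; apply: le_trans H _.
  by rewrite gerDl; apply: (z _ Hp0); exact: (sip_norm0 AS).
split.
- by rewrite !addr_ge0 ?(ltW K0)// mulr_ge0// ltW.
- move=> x y; have Hx := Hp_rep x; have Hy := Hp_rep y.
  have E0 : pi (rep x + rep y) = x + y.
    by have := pi_lin 1 Hx Hy; rewrite (sip_sc1 AS) scale1r !pi_rep.
  rewrite -{1}E0 (eq _ (sipWD AS Hx Hy)).
  by have := lin 1 _ _ Hx Hy sl; rewrite (sip_sc1 AS) Normc.normc1 mul1r.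
- move=> b x; apply/eqP; rewrite eq_le scal andTb.
  have [->|b0] := eqVneq b 0.
    rewrite Normc.normc0 mul0r; have := scal 0 (0 *: x); rewrite Normc.normc0 mul0r !scale0r => _.
    have := lin (-1) _ _ (Hp_rep 0) (Hp_rep 0) sl.
    rewrite (sip_scN1 AS) addNr normcN Normc.normc1 mul1r.
    have e0 : normHs D s (rep 0) = normHs D s 0 by rewrite -{1}pi0 eq.
    by rewrite e0 -{1}[normHs D s 0]addr0 lerD2l.
  have nb : 0 < normc b by rewrite normc_gt0.
  have := scal b^-1 (b *: x); rewrite scalerA mulVf// scale1r => H.
  have E1 : normc b * normc b^-1 = 1 by rewrite -Normc.normcM mulfV// Normc.normc1.
  by have := ler_wpM2l (ltW nb) H; rewrite mulrA E1 mul1r.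
by move=> x; have := ub _ (Hp_rep x); rewrite -(pi_nrm (Hp_rep x)) pi_rep.
Qed.

(** ** Best approximation *)

Lemma approx_dist_ge0 V M : V 0 -> 0 <= approx_dist D V M.
Proof.
move=> V0; have N0 f : 0 <= normH D f by exact: (addr_ge0 (sqrtr_ge0 _) (sqrtr_ge0 _)).
have lb f : 0 <= inf [set normH D (f - g) | g in V].
  by apply: lb_le_inf; [exists (normH D (f - 0)), 0|move=> _ [g _ <-]; exact: N0].
rewrite /approx_dist; have [[f [Mf f1]]|ne] := pselect ([set f | M f /\ normH D f = 1] !=set0); last first.
  by move/set0P/negP: ne => /negPn/eqP ->; rewrite image_set0 sup0.
apply: le_trans (lb f) _; apply: ub_le_sup; last by exists f.
exists 1 => _ [g [_ g1] <-]; apply: (@le_trans _ _ (normH D (g - 0))).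
  by apply: ge_inf; [exists 0 => _ [e _ <-]; exact: N0|exists 0].
by rewrite subr0 g1.
Qed.

(** The supremum in approx_dist is over normalised elements, so [M] has to be
    stable under scaling around [f]. *)
Lemma approx_dist_le : exists2 K : R, 0 < K & forall V M f (P : E -> E), V `<=` Hp -> subspace V ->
  is_proj ipE (pi @` V) P -> Hp f -> ~ null D f -> (forall a, a != 0 -> M (pscale a f)) ->
  nrm (pi f - P (pi f)) <= K * approx_dist D V M * nrm (pi f).
Proof.
have [K K0 HK] := norm_equivalence hD hdelta hn i0.
exists (K * K); first exact: mulr_gt0.
move=> V M f P VH Vs HP Hf f0 Mf; have [V0 Vl] := Vs.
have Vl' : lsub (pi @` V) := lsub_image VH Vs.
have N0 g : 0 <= normH D g by exact: (addr_ge0 (sqrtr_ge0 _) (sqrtr_ge0 _)).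
have nf : 0 < normH D f by rewrite lt_neqAle N0 andbT eq_sym; apply/eqP.
pose a : C := ((normH D f)^-1)%:C.
have a0 : a != 0 by rewrite -normc_eq0 normcR normr_eq0 invr_eq0 gt_eqF.
have na : normc a = (normH D f)^-1 by rewrite normcR ger0_norm// invr_ge0.
have Hf' := sipWZ AS a Hf; set f' := pscale a f in Hf'.
have nf' : normH D f' = 1.
  rewrite (normHE hD Hf') -[f'.1]/(cscale a f.1) -[f'.2]/(cscale a f.2).
  have [f1 f2] := Hf.
  rewrite (sip_normZ (Hk0_sip hD 2) a f1) (sip_normZ (L2_sip hD) a f2) -mulrDr -(normHE hD Hf) na.
  by rewrite mulVf// gt_eqF.
have le1 : nrm (pi f' - P (pi f')) <= K * approx_dist D V M.
  apply: (@le_trans _ _ (K * inf [set normH D (f' - g) | g in V])); last first.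
    apply: (ler_wpM2l (ltW K0)); apply: ub_le_sup; last by exists f' => //; split; [exact: Mf|exact: nf'].
    exists 1 => _ [g [_ g1] <-]; apply: (@le_trans _ _ (normH D (g - 0))).
      by apply: ge_inf; [exists 0 => _ [e _ <-]; exact: N0|exists 0].
    by rewrite subr0 g1.
  rewrite -ler_pdivrMl//; apply: lb_le_inf; first by exists (normH D (f' - 0)), 0.
  move=> _ [g Vg <-]; rewrite ler_pdivrMl//; have Hg := VH _ Vg; have Hd := sipWB AS Hf' Hg.
  apply: le_trans (HK _ Hd).2; rewrite -(pi_nrm Hd) (piB Hf' Hg).
  by apply: (proj_best HH Vl' HP); exists g.
have E1 : pi f - P (pi f) = (normH D f)%:C *: (pi f' - P (pi f')).
  rewrite (piZ a Hf) (projZ HH Vl' HP) -scalerBr scalerA.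
  have -> : (normH D f)%:C * a = 1 by rewrite /a -rmorphM /= mulfV ?gt_eqF.
  by rewrite scale1r.
rewrite E1 (nrmZ HH) normcR (ger0_norm (N0 f)).
apply: le_trans (ler_wpM2l (N0 f) le1) _; rewrite (pi_nrm Hf).
have d0 := approx_dist_ge0 M V0.
rewrite mulrC -!mulrA; apply: (ler_wpM2l (ltW K0)); rewrite [K * (_ * _)]mulrCA.
by apply: (ler_wpM2l d0); exact: (HK f Hf).1.
Qed.

(** ** Galerkin projections *)

Section level.
Variables (Bf : fpair -> fpair -> C) (T Ts : E -> E).
Hypothesis hT : forall f e, Hp f -> Hp e -> ipE (T (pi f)) (pi e) = Bf f e.

(** The discrete source problem computes the orthogonal projection of [T]. *)
Lemma galerkin_proj F P l f g : F `<=` Hp -> subspace F -> is_proj ipE (pi @` F) P -> l != 0 ->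
  Hp f -> F g -> (forall e, F e -> A g e = l * Bf f e) -> P (T (pi f)) = l^-1 *: pi g.
Proof.
move=> FH Fs HP l0 Hf Fg Eg; have Fl := lsub_image FH Fs.
apply: (proj_uniq HH Fl HP); first by apply: (lsubZ _ Fl); exists g.
move=> _ [e Fe <-]; have He := FH _ Fe.
rewrite (ipBl HH) (ipZl HH) (hT Hf He) (pi_ip (FH _ Fg) He) (Eg e Fe) mulrA mulVf// mul1r.
exact: subrr.
Qed.

Lemma level_disc Z (eps : R) F1 V P q (lam : 'I_q -> C) (pr : 'I_q -> fpair) : 0 <= eps ->
  (forall x, exists2 v, F1 v & nrm (T x - pi v) <= eps * nrm x) ->
  (forall x, exists2 v, F1 v & nrm (Ts x - pi v) <= eps * nrm x) ->
  V `<=` Hp -> subspace V -> F1 `<=` V -> is_proj ipE (pi @` V) P ->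
  (forall j, lam j != 0 /\ Z (lam j)^-1) ->
  (forall j, V (pr j) /\ forall g, V g -> A (pr j) g = lam j * Bf (pr j) g) ->
  disc_level ipE T Ts Z (pi @` V) P eps (fun j => pi (pr j)) (fun j => (lam j)^-1).
Proof.
move=> eps0 rT rTs VH Vs FV HP Hl Hpr; have Vl := lsub_image VH Vs.
have b (T' : E -> E) : (forall x, exists2 v, F1 v & nrm (T' x - pi v) <= eps * nrm x) ->
    forall x, nrm (T' x - P (T' x)) <= eps * nrm x.
  move=> rT' x; have [v Fv vle] := rT' x; apply: le_trans vle.
  by apply: (proj_best HH Vl HP); exists v => //; exact: FV.
split; [exact: Vl|exact: HP|exact: eps0|exact: b rT|exact: b rTs| | |].
- by move=> j; exists (pr j) => //; exact: (Hpr j).1.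
- by move=> j; exact: (Hl j).2.
- move=> j; have [Vj Ej] := Hpr j.
  exact: (galerkin_proj VH Vs HP (Hl j).1 (VH _ Vj) Vj Ej).
Qed.
End level.

(** ** One of the two dual halves of the scheme *)

(** A general form [Bf] is allowed because the dual problem is the primal one for
    [fun f e => conjc (B e f)] with conjugate eigenvalues. *)
Lemma scheme_error (Bf : fpair -> fpair -> C) (T Ts : E -> E) (l mu : C) q (ef eg : 'I_q -> E)
    (Z : set C) (c K KT zmin zmax Bc : R) M :
  spectral_gap ipE T Ts mu ef eg Z c -> bounded_op ipE T K -> l * mu = 1 ->
  0 < zmin -> (forall z, Z z -> zmin <= normc z) -> (forall z, Z z -> normc z <= zmax) -> 0 <= zmax ->
  0 <= KT -> rate T KT -> rate Ts KT ->
  (forall f e, Hp f -> Hp e -> ipE (T (pi f)) (pi e) = Bf f e) ->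
  (forall f, Hp f -> ~ null D f -> (forall e, Hp e -> A f e = l * Bf f e) -> M f) ->
  0 < Bc ->
  exists Ce e0 Kr : R, [/\ 0 <= Ce, 0 < e0, 0 <= Kr &
  forall (N : nat) (idx : nat -> I) (Lv : nat -> set fpair) (PF PV : nat -> E -> E)
    (lam : nat -> 'I_q -> C) (pr hat : nat -> 'I_q -> fpair),
  let Fe m := fe_pairs (S (idx m)) in let dN := approx_dist D (Fe N) M in let H := h (idx 1) in
  (0 < N)%N -> H <= 1 -> (forall s, (s < 2)%N -> Kr * H `^ r s <= e0) ->
  (forall m, (0 < m <= N)%N -> [/\ subspace (Lv m), Lv m `<=` Fe m, Fe 1 `<=` Lv m,
     is_proj ipE (pi @` Fe m) (PF m) & is_proj ipE (pi @` Lv m) (PV m)]) ->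
  (forall m, (0 < m <= N)%N -> [/\ forall j, lam m j != 0 /\ Z (lam m j)^-1,
     forall j, Lv m (pr m j) /\ forall g, Lv m g -> A (pr m j) g = lam m j * Bf (pr m j) g,
     forall j, nA (pr m j) = 1 &
     forall b : 'I_q -> C, null D (\sum_j pscale (b j) (pr m j)) -> forall j, b j = 0]) ->
  Lv 1 = Fe 1 ->
  (forall m, (0 < m < N)%N -> approx_dist D (Fe m) M <= Bc * approx_dist D (Fe m.+1) M /\
     forall j, Lv m.+1 (hat m.+1 j) /\
       forall g, Fe m.+1 g -> A (hat m.+1 j) g = lam m j * Bf (pr m j) g) ->
  approx_ker ipE T mu (PV N) (Ce * dN) /\
  forall j, exists f, [/\ Hp f, ~ null D f, forall e, Hp e -> A f e = l * Bf f e,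
    normH D (pr N j - f) <= Ce * dN /\
    (forall s, (s < 2)%N -> normHs D s (pr N j - f) <= Ce * H `^ r s * dN) &
    forall a, 0 <= a -> (forall y, Ts y = conjc mu *: y -> nrm (y - PV N y) <= a * nrm y) ->
      normc (mu - (lam N j)^-1) <= Ce * dN * a]].
Proof.
move=> gap TK lmu zmin0 Zmin Zmax zmax0 KT0 rT rTs hT hM Bc0.
have mu0 : mu != 0 by apply/eqP => E0; move/eqP: lmu; rewrite E0 mulr0 eq_sym oner_eq0.
have l0 : l != 0 by apply/eqP => E0; move/eqP: lmu; rewrite E0 mul0r eq_sym oner_eq0.
have lmuE : l^-1 = mu by rewrite -[LHS]mulr1 -lmu mulKf.
have [e1 e10 H1] := multilevel_approx HH gap TK mu0 Zmax zmax0 Bc0.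
have [De [e2 [De0 e20 H2]]] := eigenfunction_error HH gap TK mu0 zmin0 Zmin Zmax zmax0.
have [Kn Kn0 HKn] := norm_equivalence hD hdelta hn i0.
have [Ka Ka0 HKa] := approx_dist_le.
have [Kd Kd0 HKd] := galerkin_duality hD hdelta hn i0 hr0 hr1 hreg hS.
have [CN CN1 HCN] := weak_norms; have CN0 : 0 <= CN := le_trans ler01 CN1.
pose Kr := KT + Kd; have Kr0 : 0 <= Kr := addr_ge0 KT0 Kd0.
pose c1 := 2 * Ka; pose c2 := Kn * (De * (2 * Ka)); pose c3 := CN * (De * Kr * (2 * Ka)); pose c4 := De * (2 * Ka).
have k2 : 0 <= 2 * Ka by rewrite mulr_ge0// ltW.
have c40 : 0 <= c4 by rewrite mulr_ge0.
have c20 : 0 <= c2 by rewrite mulr_ge0// ltW.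
have c30 : 0 <= c3 by rewrite mulr_ge0// mulr_ge0// mulr_ge0.
exists (c1 + c2 + c3 + c4), (Num.min e1 e2), Kr; split.
- by rewrite !addr_ge0.
- by rewrite lt_min e10 e20.
- exact: Kr0.
move=> N idx Lv PF PV lam pr hat Fe dN H N0 H1' small Hlv Hpr L1 Hstep.
have h0 : 0 <= H := h_ge0 hS _.
have Fs m : subspace (Fe m) := fe_subspace (idx m).
have FH m : Fe m `<=` Hp := @fe_Hp (idx m).
have dl0 m : 0 <= approx_dist D (Fe m) M by apply: approx_dist_ge0; exact: (Fs m).1.
have LH m : (0 < m <= N)%N -> Lv m `<=` Hp.
  by move=> mN; have [_ LF _ _ _] := Hlv m mN => f /LF; exact: FH.
have disc s m : (s < 2)%N -> (0 < m <= N)%N ->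
  disc_level ipE T Ts Z (pi @` Lv m) (PV m) (Kr * H `^ r s) (fun j => pi (pr m j)) (fun j => (lam m j)^-1).
  move=> s2 mN; have [Ls LF FL _ HPV] := Hlv m mN; have [Hl He _ _] := Hpr m mN.
  have up (T' : E -> E) : rate T' KT -> forall x, exists2 v, Fe 1 v & nrm (T' x - pi v) <= Kr * H `^ r s * nrm x.
    move=> rT' x; have [v Fv vle] := rT' s (idx 1) x s2 H1'; exists v; first exact: Fv.
    apply: le_trans vle _; apply: (ler_wpM2r (sip_norm_ge0 _ x)); apply: (ler_wpM2r (powR_ge0 _ _)).
    by rewrite /Kr lerDl.
  exact: (level_disc hT (mulr_ge0 Kr0 (powR_ge0 _ _)) (up _ rT) (up _ rTs) (LH m mN) Ls FL HPV Hl He).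
have kerE x : T x = mu *: x -> forall e, Hp e -> A (rep x) e = l * Bf (rep x) e.
  move=> Tx e He; rewrite -(hT _ _ (Hp_rep x) He) pi_rep Tx (ipZl HH) mulrA lmu mul1r.
  by rewrite -(pi_ip (Hp_rep x) He) pi_rep.
have apF m : (0 < m <= N)%N -> approx_ker ipE T mu (PF m) (Ka * approx_dist D (Fe m) M).
  move=> mN; have [_ _ _ HPF _] := Hlv m mN.
  split; first by rewrite mulr_ge0// ltW.
  move=> x Tx; have Hx := Hp_rep x.
  have Fl := lsub_image (@FH m) (Fs m).
  have [nl|nl] := pselect (null D (rep x)).
    have x0 : x = 0 by rewrite -(pi_rep x); apply/(pi_eq0 Hx).
    have F0 : (pi @` Fe m) 0 := Fl.1.
    by rewrite x0 (proj_id HH Fl HPF F0) subrr (nrm0 HH) mulr0.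
  have := HKa (Fe m) M (rep x) (PF m) (@FH m) (Fs m) HPF Hx nl _; rewrite pi_rep; apply => a a0.
  have Hax := sipWZ AS a Hx; apply: hM; first exact: Hax.
    move/(pi_eq0 Hax); rewrite (piZ a Hx) pi_rep => /eqP; rewrite scaler_eq0 (negbTE a0) /= => /eqP x0.
    by apply: nl; apply/(pi_eq0 Hx); rewrite pi_rep.
  move=> e He; rewrite -(hT _ _ Hax He) -(pi_ip Hax He) (piZ a Hx) pi_rep.
  have TZ : T (a *: x) = a *: T x := opZ HH (gap_adj gap) a x.
  by rewrite TZ Tx !(ipZl HH) [RHS]mulrCA (mulrA l) lmu mul1r.
have smalls s : (s < 2)%N -> Kr * H `^ r s <= e1 /\ Kr * H `^ r s <= e2.
  by move=> s2; have := small s s2; rewrite le_min => /andP.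
have apV : approx_ker ipE T mu (PV N) (2 * (Ka * dN)).
  apply: (H1 N (fun m => pi @` Fe m) (fun m => pi @` Lv m) PF PV (fun m j => pi (pr m j))
    (fun m j => (lam m j)^-1) (fun m => Ka * approx_dist D (Fe m) M) (Kr * H `^ r 0%N)).
  - exact: (smalls 0%N isT).1.
  - by move=> m mN; exact: disc.
  - move=> m mN b Eb; have [_ He _ fr] := Hpr m mN.
    have Hprm j : Hp (pr m j) := LH m mN _ (He j).1.
    have [Hs Es] := pi_sum b Hprm; apply: fr; apply/(pi_eq0 Hs); by rewrite Es.
  - by move=> m mN; have [_ _ _ HPF _] := Hlv m mN; split; [exact: (lsub_image (@FH m) (Fs m))|exact: HPF|exact: apF].
  - by rewrite L1.
  - move=> m mN; have [dle Hhat] := Hstep m mN; have /andP[m0 mlt] := mN.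
    have mN1 : (0 < m <= N)%N by rewrite m0 ltnW.
    have mN2 : (0 < m.+1 <= N)%N by [].
    split; first by rewrite mulrCA; exact: (ler_wpM2l (ltW Ka0) dle).
    move=> j; have [Hl He _ _] := Hpr m mN1; have [Ls LF _ HPF _] := Hlv _ mN2.
    have [Lh Eh] := Hhat j.
    rewrite (galerkin_proj hT (@FH m.+1) (Fs m.+1) HPF (Hl j).1 (LH m mN1 _ (He j).1) (LF _ Lh) Eh).
    by apply: (lsubZ _ (lsub_image (LH _ mN2) Ls)); exists (hat m.+1 j).
  - by rewrite N0 leqnn.
have NN : (0 < N <= N)%N by rewrite N0 leqnn.
have dN0 : 0 <= dN := dl0 N.
split.
  split; first by rewrite mulr_ge0// !addr_ge0.
  move=> x Tx; apply: le_trans (apV.2 x Tx) _; apply: (ler_wpM2r (sip_norm_ge0 _ x)).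
  rewrite mulrA; apply: (ler_wpM2r dN0); rewrite /c1 -!addrA lerDl; exact: (addr_ge0 c20 (addr_ge0 c30 c40)).
move=> j; have [Hl He n1 _] := Hpr N NN; have [Ls LF FL _ HPV] := Hlv N NN.
have Hprj := LH N NN _ (He j).1.
have u1 : nrm (pi (pr N j)) = 1 by rewrite (pi_nrm Hprj).
have [E1 E2 E3 _] := H2 _ _ _ _ _ _ (disc 0%N N isT NN) (smalls 0%N isT).2 apV j u1.
set Qu := eigproj ipE ef eg (pi (pr N j)) in E1 E2 *.
have TQ : T Qu = mu *: Qu := T_eigproj HH gap _.
have HQ := Hp_rep Qu; have Hd := sipWB AS Hprj HQ.
have pd : pi (pr N j - rep Qu) = pi (pr N j) - Qu by rewrite (piB Hprj HQ) pi_rep.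
exists (rep Qu); split.
- exact: HQ.
- by move/(pi_eq0 HQ); rewrite pi_rep; apply/eqP.
- exact: kerE.
- split.
    apply: le_trans (HKn _ Hd).1 _; rewrite -(pi_nrm Hd) pd.
    apply: le_trans (ler_wpM2l (ltW Kn0) E1) _.
    have -> : Kn * (De * (2 * (Ka * dN))) = c2 * dN by rewrite /c2 !mulrA.
    apply: (ler_wpM2r dN0); rewrite -!addrA addrCA lerDl.
    exact: (addr_ge0 k2 (addr_ge0 c30 c40)).
  move=> s s2; have [Nw [SN EN]] := HCN s s2; have hp := powR_ge0 H (r s).
  have [_ _ _ W] := H2 _ _ _ _ _ _ (disc s N s2 NN) (smalls s s2).2 apV j u1.
  rewrite -(EN _ Hd) pd; apply: le_trans (W Nw CN SN _) _.
    move=> w Hw; have Hrw := Hp_rep w.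
    rewrite -(pi_rep w) (EN _ Hrw) (pi_nrm Hrw).
    have orth g : fe_pairs (S (idx 1)) g -> A (rep w) g = 0.
      move=> Fg; rewrite -(pi_ip Hrw (fe_Hp Fg)) pi_rep; apply: Hw; exists g => //; exact: FL.
    apply: le_trans (HKd s (idx 1) _ s2 H1' Hrw orth) _.
    apply: (ler_wpM2r (sip_norm_ge0 _ _)); rewrite mulrA; apply: (ler_wpM2r hp).
    apply: (@le_trans _ _ (1 * Kr)); first by rewrite mul1r /Kr lerDr.
    exact: (ler_wpM2r Kr0 CN1).
  have -> : CN * (De * (Kr * H `^ r s) * (2 * (Ka * dN))) = c3 * H `^ r s * dN.
    by rewrite /c3; move: (H `^ r s) => t; ring.
  apply: (ler_wpM2r dN0); apply: (ler_wpM2r hp); rewrite (addrAC (c1 + c2) c3) lerDr.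
  exact: (addr_ge0 (addr_ge0 k2 c20) c40).
- move=> a a0 Ha; apply: le_trans (E3 a a0 Ha) _; apply: (ler_wpM2r a0).
  have -> : De * (2 * (Ka * dN)) = c4 * dN by rewrite /c4 !mulrA.
  apply: (ler_wpM2r dN0); rewrite lerDr; exact: (addr_ge0 (addr_ge0 k2 c20) c30).
Qed.

(** ** The spectral gap around the eigenvalue *)

Section gap.
Variables (T Ts : E -> E) (K : R) (l : C) (q : nat) (rho : R).
Hypotheses (hT : forall f e, Hp f -> Hp e -> ipE (T (pi f)) (pi e) = B f e)
  (TT : adjoint ipE T Ts) (TK : bounded_op ipE T K) (Tap : approximable ipE T Ts)
  (hmult : alg_multiplicity D Hp (sol D n Hp) l^-1 q)
  (hascent : has_ascent D Hp (sol D n Hp) l^-1 1)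
  (hrho : isolating D n l rho).

Let l0 : l != 0.
Proof. by have [r0 rl _] := hrho; rewrite -normc_gt0 (lt_trans r0). Qed.

Lemma sol_pi f g : Hp f -> sol D n Hp f g -> pi g = T (pi f).
Proof.
move=> Hf [Hg Eg]; apply: (ip_inj HH) => z; have [e He <-] := sur z.
by rewrite (pi_ip Hg He) (hT Hf He); exact: Eg.
Qed.

Lemma sol_rep f : Hp f -> sol D n Hp f (rep (T (pi f))).
Proof.
move=> Hf; split=> [|e He]; first exact: Hp_rep.
by rewrite -(pi_ip (Hp_rep _) He) pi_rep (hT Hf He).
Qed.

Local Notation mu := l^-1.
Local Notation ker k := (ker_pow D Hp (sol D n Hp) mu k).

Lemma ker_Hp k f : ker k f -> Hp f. Proof. by case: k => [|k] []. Qed.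

Lemma pi_defect f g : Hp f -> Hp g -> pi (g - pscale mu f) = pi g - mu *: pi f.
Proof. by move=> Hf Hg; rewrite (piB Hg (sipWZ AS mu Hf)) (piZ mu Hf). Qed.

Lemma ker1P f : Hp f -> ker 1 f <-> T (pi f) = mu *: pi f.
Proof.
move=> Hf; split=> [[_ [g [sg [Hd nd]]]]|Tf].
  have [Hg _] := sg; move/(pi_eq0 Hd): nd; rewrite (pi_defect Hf Hg) (sol_pi Hf sg).
  by move/eqP; rewrite subr_eq0 => /eqP.
have sg := sol_rep Hf; have [Hg _] := sg; have Hd := sipWB AS Hg (sipWZ AS mu Hf).
split; first exact: Hf.
exists (rep (T (pi f))); split; first exact: sg.
split; first exact: Hd.
by apply/(pi_eq0 Hd); rewrite (pi_defect Hf Hg) pi_rep Tf subrr.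
Qed.

(** Ascent one stops the chain of kernels at its first step. *)
Lemma ker_ker1 k f : ker k f -> ker 1 f.
Proof.
elim: k f => [|k IH] f.
  move=> [Hf /(pi_eq0 Hf) f0]; apply/(ker1P Hf).
  by rewrite f0 (op0 HH TT) scaler0.
move=> [Hf [g [sg kg]]]; have [H21 _] := hascent; apply: H21.
split; first exact: Hf.
by exists g; split; [exact: sg|exact: IH].
Qed.

(** The disc stays away from zero, so inversion is continuous on it. *)
Lemma reciprocal_compact : ultra_compact [set z : C | z != 0 /\ normc (z^-1 - l) <= rho].
Proof.
have [r0 rl _] := hrho; move=> U z HU Hz.
have lo w : normc (w - l) <= rho -> normc l - rho <= normc w.
  by move=> H; rewrite lerBlDr; have := normc_triangle l w; rewrite normcB; lra.
have [|w Hw] := @ultra_complex_lim R U (fun k => (z k)^-1) (normc l + rho) HU.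
  by move=> k; have [_ H] := Hz k; have := normc_triangle (z k)^-1 l; lra.
have Fu : Filter U by exact: filter_filter.
have Pu : ProperFilter U by exact: ultra_proper.
have wr : normc (w - l) <= rho.
  apply/ler_addgt0Pr => e e0; have [k Hk] := filter_ex (Hw e e0).
  have [_ H] := Hz k; have := le_normcD (w - (z k)^-1) ((z k)^-1 - l).
  by rewrite subrKA (normcB w (z k)^-1) => H2; move: Hk => /= Hk; lra.
have gap0 : 0 < normc l - rho by rewrite subr_gt0.
have w0 : w != 0 by rewrite -normc_gt0; exact: lt_le_trans gap0 (lo _ wr).
exists w^-1; first by split; [rewrite invr_eq0|rewrite invrK].
move=> e e0; have e1 : 0 < e * (normc l - rho) ^+ 2 by rewrite mulr_gt0// exprn_gt0.
apply: filterS (Hw _ e1) => k /= Hk; have [zk0 zk] := Hz k.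
have nw := lo _ wr; have nz := lo _ zk.
have wp := lt_le_trans gap0 nw; have zp := lt_le_trans gap0 nz.
have -> : z k - w^-1 = ((z k)^-1 - w) * (- (((z k)^-1)^-1 * w^-1)).
  by rewrite invrK mulrN mulrBl (mulKf zk0) [w * _]mulrCA (mulfV w0) mulr1 opprB.
rewrite Normc.normcM normcN Normc.normcM.
have nV (x : C) : x != 0 -> normc x^-1 = (normc x)^-1.
  move=> x0; apply: (mulfI (_ : normc x != 0)); first by rewrite normc_eq0.
  by rewrite -Normc.normcM !mulfV ?normc_eq0// Normc.normc1.
rewrite (nV (z k)^-1) ?invr_eq0// (nV w w0) -invfM ltr_pdivrMr; last exact: mulr_gt0.
apply: lt_le_trans Hk _; apply: (ler_wpM2l (ltW e0)); rewrite expr2.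
exact: (ler_pM (ltW gap0) (ltW gap0) nz nw).
Qed.

Lemma spectral_gap_at : exists (ef eg : 'I_q -> E) (Z : set C) (c zmin zmax : R),
  [/\ spectral_gap ipE T Ts mu ef eg Z c, 0 < zmin /\ 0 <= zmax,
      forall z, Z z -> zmin <= normc z, forall z, Z z -> normc z <= zmax &
      forall z, normc (z - l) <= rho -> z != 0 /\ Z z^-1].
Proof.
have [r0 rl iso] := hrho.
pose Z : set C := [set z : C | z != 0 /\ normc (z^-1 - l) <= rho].
have nV (x : C) : x != 0 -> normc x = (normc x^-1)^-1.
  move=> x0; have h0 : normc x^-1 != 0 by rewrite normc_eq0 invr_eq0.
  by apply: (mulIf h0); rewrite -Normc.normcM mulfV// Normc.normc1 mulVf.
have lr : 0 < normc l + rho by rewrite addr_gt0// (lt_trans r0).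
have lrV : 0 < (normc l + rho)^-1 by rewrite invr_gt0.
have gap0 : 0 < normc l - rho by rewrite subr_gt0.
have bd z : Z z -> normc l - rho <= normc z^-1 <= normc l + rho.
  move=> [_ H]; have h1 := normc_triangle z^-1 l; have h2 := normc_triangle l z^-1.
  rewrite normcB in h2; apply/andP; split; lra.
have Zmin z : Z z -> (normc l + rho)^-1 <= normc z.
  move=> Zz; have [z0 _] := Zz; have /andP[h1 h2] := bd z Zz.
  by rewrite (nV z z0) lef_pV2 ?posrE//; exact: lt_le_trans gap0 h1.
have Zmax z : Z z -> normc z <= (normc l - rho)^-1.
  move=> Zz; have [z0 _] := Zz; have /andP[h1 h2] := bd z Zz.
  by rewrite (nV z z0) lef_pV2 ?posrE//; exact: lt_le_trans gap0 h1.
have mu0 : mu != 0 by rewrite invr_eq0.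
have [b [Hb fr sp]] := hmult.
have Hbp j : Hp (b j) by have [k _ /ker_Hp] := Hb j.
have Tb j : T (pi (b j)) = mu *: pi (b j).
  by apply/(ker1P (Hbp j)); have [k _ /ker_ker1] := Hb j.
have bfree (c : 'I_q -> C) : \sum_i c i *: pi (b i) = 0 -> forall i, c i = 0.
  have [Hs <-] := pi_sum c Hbp; move/(pi_eq0 Hs); exact: fr.
have bspan x : T x = mu *: x -> lspan (fun j => pi (b j)) x.
  have [f Hf <-] := sur x => /(ker1P Hf) kf; have [|c nc] := sp f; first by exists 1.
  exists c; have [Hs <-] := pi_sum c Hbp.
  by move/(pi_eq0 (sipWB AS Hf Hs)): nc; rewrite (piB Hf Hs) => /eqP; rewrite subr_eq0 => /eqP.
have asc x : T (T x - mu *: x) = mu *: (T x - mu *: x) -> T x = mu *: x.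
  have [f Hf <-] := sur x => Tx; apply/(ker1P Hf); have [H21 _] := hascent; apply: H21.
  have sg := sol_rep Hf; have [Hg _] := sg; have Hd := sipWB AS Hg (sipWZ AS mu Hf).
  split; first exact: Hf.
  exists (rep (T (pi f))); split; first exact: sg.
  by apply/(ker1P Hd); rewrite (pi_defect Hf Hg) pi_rep.
have Zmu : Z mu by split; [exact: mu0|rewrite invrK subrr Normc.normc0 ltW].
have Zreg z x : Z z -> z != mu -> T x = z *: x -> x = 0.
  move=> [z0 zr] zmu Tx; apply: contrapT => x0.
  have Hx := Hp_rep x.
  have eig : eigenfunction D n Hp z^-1 (rep x).
    split; [exact: Hx|by move/(pi_eq0 Hx); rewrite pi_rep|].
    move=> e He; rewrite -(hT Hx He) pi_rep Tx (ipZl HH) mulrA mulVf// mul1r.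
    by rewrite -(pi_ip Hx He) pi_rep.
  have zl : z^-1 != l by apply: contra zmu => /eqP <-; rewrite invrK.
  by have := iso _ _ eig zl; rewrite ltNge zr.
have [eg [c gap]] := spectral_gap_exists HH TT Tap (ex_intro _ K TK) mu0 Tb bfree bspan asc
  reciprocal_compact lrV Zmin Zmu Zreg.
exists (fun j => pi (b j)), eg, Z, c, (normc l + rho)^-1, (normc l - rho)^-1; split.
- exact: gap.
- by split; [rewrite invr_gt0|rewrite invr_ge0 ltW].
- exact: Zmin.
- exact: Zmax.
- move=> z zl; have z0 : z != 0.
    apply/eqP => E0; move: zl; rewrite E0 sub0r normcN => h1; lra.
  by split; [exact: z0|split; [rewrite invr_eq0|rewrite invrK]].
Qed.
End gap.
End model.

Section completeness.
Context {R : realType} {d : nat}.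
Variables (D : set 'rV[R]_d) (n : 'rV[R]_d -> R) (delta : R).
Hypotheses (hD : bdomain D) (hdelta : 0 < delta) (hn : refraction_index D n delta) (i0 : 'I_d).

Lemma Hprod_complete : complete (Hprod D) (formA D n).
Proof.
have AS := formA_sip hD hdelta hn.
have [K K0 HK] := norm_equivalence hD hdelta hn i0.
move=> x Hx cx.
have Hd m k : Hprod D (x m - x k) := sipWB AS (Hx m) (Hx k).
have both m k : sip_norm (hip D 2) ((x m).1 - (x k).1) <= K * sip_norm (formA D n) (x m - x k) /\
    sip_norm (l2ip D) ((x m).2 - (x k).2) <= K * sip_norm (formA D n) (x m - x k).
  have [h1 _] := HK _ (Hd m k); rewrite (normHE hD (Hd m k)) in h1.
  split; apply: le_trans h1.
    by rewrite lerDl; exact: sip_norm_ge0.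
  by rewrite lerDr; exact: sip_norm_ge0.
have c1 : cauchy_seq (hip D 2) (fun k => (x k).1).
  move=> e e0; have [N HN] := cx (e / K) (divr_gt0 e0 K0); exists N => m k mN kN.
  apply: le_lt_trans (both m k).1 _; have := HN m k mN kN; by rewrite ltr_pdivlMr// mulrC.
have c2 : cauchy_seq (l2ip D) (fun k => (x k).2).
  move=> e e0; have [N HN] := cx (e / K) (divr_gt0 e0 K0); exists N => m k mN kN.
  apply: le_lt_trans (both m k).2 _; have := HN m k mN kN; by rewrite ltr_pdivlMr// mulrC.
have [y1 Hy1 l1] := Hk0_complete hD (fun k => (Hx k).1) c1.
have [y2 Hy2 l2] := L2_complete hD (fun k => (Hx k).2) c2.
have Hy : Hprod D (y1, y2) by split.
exists (y1, y2); first exact: Hy.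
move=> e e0; have e2 : 0 < e / K / 2 by rewrite !divr_gt0.
have [N1 H1] := l1 _ e2; have [N2 H2] := l2 _ e2.
exists (maxn N1 N2) => k; rewrite geq_max => /andP[k1 k2].
have He := sipWB AS (Hx k) Hy; have [_ h2] := HK _ He; apply: le_lt_trans h2 _.
rewrite (normHE hD He) mulrC -ltr_pdivlMr//.
rewrite [ltRHS]splitr; exact: (ltrD (H1 k k1) (H2 k k2)).
Qed.
End completeness.

(** * The error of the multigrid scheme *)

Section correction.
Context {R : realType} {d : nat}.
Local Notation C := R[i].
Local Notation fpair := (('rV[R]_d -> C) * ('rV[R]_d -> C))%type.
Variables (D : set 'rV[R]_d) (n : 'rV[R]_d -> R).
Implicit Types (f g : fpair) (X Y : set fpair).

Lemma pscale1 f : pscale 1 f = f.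
Proof. by case: f => f1 f2; rewrite /pscale; congr pair; apply/funext => x; rewrite /= mul1r. Qed.

Lemma cspan_gen X f : X f -> cspan X f.
Proof.
move=> Xf; exists 1%N, (fun=> 1), (fun=> f); split; first by [].
by rewrite big_ord1 pscale1.
Qed.

Lemma cspan0 X : cspan X 0.
Proof. by exists 0%N, (fun=> 0), (fun=> 0); split; [case|rewrite big_ord0]. Qed.

(** The added solutions may be combined with zero, so the coarse space and each
    of them lie in the space of the level. *)
Lemma level_facts (I : Type) (S : I -> set ('rV[R]_d -> C)) q (X : mg_data I q) m :
  (forall i, subspace (fe_pairs (S i))) -> (0 < m)%N ->
  level_space X 1 = fe_at S X 1 -> (forall k, (0 < k < m)%N -> correction_step D n S X k) ->
  [/\ subspace (level_space X m), level_space X m `<=` fe_at S X m, fe_at S X 1 `<=` level_space X m &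
   forall j, (1 < m)%N -> level_space X m (prhat_at X m j) /\ level_space X m (duhat_at X m j)].
Proof.
move=> Ss m0 L1 Hc; case: m m0 Hc => [|[|m]] // _ Hc.
  by rewrite L1; split; [exact: (Ss (mesh_at X 1))| | |].
have [_ _ Vs VF sub] := Hc m.+1 (leqnn _); have [S0 _] := Ss (mesh_at X 1).
split; [exact: Vs|exact: VF| |].
  by move=> f Ff; apply: sub; exists f => //; exists 0; [exact: cspan0|rewrite addr0].
move=> j _; split; apply: sub; exists 0 => //.
  by exists (prhat_at X m.+2 j); [apply: cspan_gen; left; exists j|rewrite add0r].
by exists (duhat_at X m.+2 j); [apply: cspan_gen; right; exists j|rewrite add0r].
Qed.
End correction.

Lemma eigenvalue_le (R : realType) (l z mu : R[i]) (rho e : R) : l != 0 -> z != 0 -> mu = l^-1 ->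
  Normc.normc (z - l) <= rho -> Normc.normc (mu - z^-1) <= e ->
  Normc.normc (l - z) <= Normc.normc l * (Normc.normc l + rho) * e.
Proof.
move=> l0 z0 -> zl h.
have -> : l - z = - (l * z) * (l^-1 - z^-1).
  by rewrite mulNr mulrBr mulrAC mulfV// mul1r -mulrA mulfV// mulr1 opprB.
rewrite Normc.normcM normcN Normc.normcM.
apply: ler_pM => //; [by rewrite mulr_ge0// normc_ge0|exact: normc_ge0|].
apply: ler_wpM2l; first exact: normc_ge0.
have := normc_triangle z l; lra.
Qed.

Opaque sip_norm hip laplacian Hnorm L2 Hk Hk0 rmul l2ip wderiv Hneg_norm Hfrac Hfrac_norm formA formB normH normHs.

Theorem theorem3p2 (R : realType) (d : nat) (hd : d = 2%N \/ d = 3%N)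
  (D : set 'rV[R]_d) (hD : domain D)
  (n : 'rV[R]_d -> R) (delta : R) (hdelta : 0 < delta)
  (hn : refraction_index D n delta)
  (r : nat -> R) (hr0 : 0 < r 0%N <= 2) (hr1 : 0 < r 1%N <= 1)
  (Cp : R) (hreg : regularity D n r Cp)
  (l : R[i]) (q : nat) (rho : R)
  (hl : exists f, eigenfunction D n (Hprod D) l f)
  (hmult : alg_multiplicity D (Hprod D) (sol D n (Hprod D)) l^-1 q)
  (hascent : has_ascent D (Hprod D) (sol D n (Hprod D)) l^-1 1)
  (hrho : isolating D n l rho)
  (I : Type) (S : I -> set ('rV[R]_d -> R[i])) (h : I -> R) (p : nat) (Cap : R)
  (hS : fe_family D S h p r Cap)
  (beta c1 c2 CA cA : R) (hbeta : 1 < beta)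
  (hc1 : 0 < c1) (hc2 : 0 < c2) (hcA : 0 < cA) :
  exists C H0 : R, [/\ 0 < C, 0 < H0 &
    forall X : mg_data I q,
      let N := levels X in
      let H := coarse_size h X in
      let dN := delta_at D n S X l N in
      let dsN := dual_delta_at D n S X l N in
      H <= H0 ->
      multigrid D n S X l rho beta c1 c2 ->
      (forall m, (1 <= m < N)%N ->
         quasi_biorthogonal D n h X (r 0%N) CA cA m /\
         forall j, has_ascent D (level_space X m) (sol D n (level_space X m))
                     (lam_at X m j)^-1 1) ->
      forall j : 'I_q, exists f fs,
        [/\ eigenfunction D n (Hprod D) l f /\
            dual_eigenfunction D n (Hprod D) (conjc l) fs,
            normH D (pr_at X N j - f) <= C * dN /\
            (forall s, (s < 2)%N ->
               normHs D s (pr_at X N j - f) <= C * H `^ r s * dN),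
            normH D (du_at X N j - fs) <= C * dsN,
            forall s, (s < 2)%N ->
               normHs D s (du_at X N j - fs) <= C * H `^ r s * dsN &
            Normc.normc (l - lam_at X N j) <= C * dN * dsN]].
Proof.
have bD : bdomain D by case: hD.
have d0 : (0 < d)%N by case: hd => ->.
pose i0 : 'I_d := Ordinal d0.
(* without arbitrarily small meshes, [H0] can be put below all mesh sizes *)
have [small|large] := pselect (forall eta : R, 0 < eta -> exists i, h i <= eta); last first.
  have /not_existsP : ~ (forall eta : R, ~ (0 < eta /\ forall i, eta < h i)).
    move=> H; apply: large => eta eta0; apply: contrapT => ne; apply: (H eta); split => // i.
    by rewrite ltNge; apply/negP => hi; apply: ne; exists i.
  move=> [eta [eta0 Heta]]; exists 1, eta; split=> // X N H dN dsN HH0.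
  by have := Heta (mesh_at X 1); rewrite ltNge HH0.
have AS := formA_sip bD hdelta hn.
have [E [ipE [pi [HH sur pl pip pn]]]] := quotient_exists AS (Hprod_complete bD hdelta hn i0).
have [T [Ts [K [K0 TT TK hT [rT rTs]]]]] := operators bD hdelta hn i0 hr0 hr1 hreg hS sur pl pip.
have Tap := rate_approximable bD hdelta hn i0 hr0 hr1 hS HH pl pip pn K0 rT rTs small.
have [rho0 rhol _] := hrho.
have l0 : l != 0 by rewrite -normc_gt0 (lt_trans rho0).
have [ef [eg [Z [c [zmin [zmax [gap [zmin0 zmax0] Zmin Zmax Zl]]]]]]] :=
  spectral_gap_at bD hdelta hn i0 HH sur pl pip pn hT TT TK Tap hmult hascent hrho.
have hTs f e : Hprod D f -> Hprod D e -> ipE (Ts (pi f)) (pi e) = conjc (formB D n e f).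
  by move=> Hf He; rewrite (ipC HH) -TT (hT e f He Hf).
have B0 : 0 < beta / c1 by rewrite divr_gt0// (lt_trans ltr01).
have lmu : l * l^-1 = 1 by rewrite mulfV.
have lmus : conjc l * conjc l^-1 = 1 by rewrite -conjcM lmu conjc1.
have TsK := bounded_adjoint HH TT TK.
have Zmin' z : [set conjc z | z in Z] z -> zmin <= Normc.normc z.
  by move=> [y Zy <-]; rewrite normc_conj; exact: Zmin.
have Zmax' z : [set conjc z | z in Z] z -> Normc.normc z <= zmax.
  by move=> [y Zy <-]; rewrite normc_conj; exact: Zmax.
have HM f : Hprod D f -> ~ null D f -> (forall e, Hprod D e -> formA D n f e = l * formB D n f e) ->
    eigenspace D n l f by move=> *; apply: cspan_gen; split.
have dualE f : Hprod D f -> ~ null D f ->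
    (forall e, Hprod D e -> formA D n f e = conjc l * conjc (formB D n e f)) ->
    dual_eigenfunction D n (Hprod D) (conjc l) f.
  move=> Hf nf Ef; split; [exact: Hf|exact: nf|move=> e He].
  by rewrite (sip_conj AS Hf He) (Ef e He) conjcM [X in _ * X]conjcK.
have HMs f : Hprod D f -> ~ null D f ->
    (forall e, Hprod D e -> formA D n f e = conjc l * conjc (formB D n e f)) ->
    dual_eigenspace D n (conjc l) f.
  by move=> *; apply: cspan_gen; exact: dualE.
have [C1 [e1 [K1 [C10 e10 K10 side1]]]] := scheme_error bD hdelta hn i0 hr0 hr1 hreg hS HH sur pl pip pn
  gap TK lmu zmin0 Zmin Zmax zmax0 K0 rT rTs hT HM B0.
have [C2 [e2 [K2 [C20 e20 K20 side2]]]] := scheme_error bD hdelta hn i0 hr0 hr1 hreg hS HH sur pl pip pn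
  (spectral_gapC HH gap) TsK lmus zmin0 Zmin' Zmax' zmax0 K0 rTs rT hTs HMs B0.
have e0 : 0 < Num.min e1 e2 by rewrite lt_min e10 e20.
have [x0 x00 Hx0] := powR_small (r_gt0 hr0 hr1 (isT : (0 < 2)%N)) e0 (addr_ge0 K10 K20).
have [x1 x10 Hx1] := powR_small (r_gt0 hr0 hr1 (isT : (1 < 2)%N)) e0 (addr_ge0 K10 K20).
(* [Cl] converts the error of the reciprocals into that of the eigenvalues *)
pose Cl := Normc.normc l * (Normc.normc l + rho) * (C1 * C2).
have lr0 : 0 <= Normc.normc l + rho by rewrite addr_ge0 ?normc_ge0// ltW.
have Cl0 : 0 <= Cl by rewrite !mulr_ge0// normc_ge0.
exists (C1 + C2 + Cl + 1), (Num.min (Num.min x0 x1) 1); split.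
- by rewrite ltr_wpDl// !addr_ge0.
- by rewrite !lt_min x00 x10 ltr01.
move=> X N H dN dsN HH0 mg _.
have [N1 Hd L1 Hlev Hcor] := mg.
move: HH0; rewrite !le_min => /andP[/andP[hx0 hx1] h1].
have H0 : 0 <= H := h_ge0 hS _.
have smallK s : (s < 2)%N -> (K1 + K2) * H `^ r s <= Num.min e1 e2.
  by case: s => [|[|]]// _; [exact: Hx0|exact: Hx1].
have small1 s : (s < 2)%N -> K1 * H `^ r s <= e1.
  move=> s2; have := smallK s s2; rewrite le_min mulrDl => /andP[h2 _].
  by apply: le_trans h2; rewrite lerDl; exact: (mulr_ge0 K20 (powR_ge0 _ _)).
have small2 s : (s < 2)%N -> K2 * H `^ r s <= e2.
  move=> s2; have := smallK s s2; rewrite le_min mulrDl => /andP[_ h2].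
  by apply: le_trans h2; rewrite lerDr; exact: (mulr_ge0 K10 (powR_ge0 _ _)).
have Ss i : subspace (fe_pairs (S i)) := fe_subspace hS i.
have FH i : fe_pairs (S i) `<=` Hprod D by move=> f; exact: (fe_Hp hS).
have LF m : (0 < m <= N)%N -> [/\ subspace (level_space X m), level_space X m `<=` fe_at S X m,
    fe_at S X 1 `<=` level_space X m &
    forall j, (1 < m)%N -> level_space X m (prhat_at X m j) /\ level_space X m (duhat_at X m j)].
  move=> /andP[m0 mN]; apply: (@level_facts _ _ D n) => // k /andP[k0 km]; apply: Hcor.
  by rewrite k0 (leq_trans km).
have LH m : (0 < m <= N)%N -> level_space X m `<=` Hprod D.
  by move=> mN; have [_ LFm _ _] := LF m mN => f /LFm; exact: FH.
pose prj (V : set (('rV[R]_d -> R[i]) * ('rV[R]_d -> R[i]))) : E -> E :=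
  if pselect (exists P, is_proj ipE (pi @` V) P) is left exP then projT1 (cid exP) else id.
have prjP V i : subspace V -> V `<=` fe_pairs (S i) -> is_proj ipE (pi @` V) (prj V).
  move=> Vs VS; have [P HP] := sub_proj bD hdelta hn i0 hS HH pl pip pn Vs VS.
  rewrite /prj; case: pselect => [exP|ne]; first exact: (projT2 (cid exP)).
  by case: ne; exists P.
pose PF m := prj (fe_at S X m); pose PV m := prj (level_space X m).
have lv m : (0 < m <= N)%N -> [/\ subspace (level_space X m), level_space X m `<=` fe_at S X m,
    fe_at S X 1 `<=` level_space X m, is_proj ipE (pi @` fe_at S X m) (PF m) &
    is_proj ipE (pi @` level_space X m) (PV m)].
  move=> mN; have [Vs VF FV _] := LF m mN; split; [exact: Vs|exact: VF|exact: FV| |].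
    by apply: (prjP _ (mesh_at X m)) => //; exact: Ss.
  exact: (prjP _ _ Vs VF).
have lamZ m : (0 < m <= N)%N -> forall j, lam_at X m j != 0 /\ Z (lam_at X m j)^-1.
  by move=> mN j; have [[Hz _] _ _ _] := Hlev m mN; exact: Zl (Hz j).
have lamZs m : (0 < m <= N)%N -> forall j, conjc (lam_at X m j) != 0 /\ [set conjc z | z in Z] (conjc (lam_at X m j))^-1.
  move=> mN j; have [z0 Zz] := lamZ m mN j; split; first by rewrite conjc_eq0.
  by exists (lam_at X m j)^-1 => //; exact: conjcV.
have nAE f : sip_norm (formA D n) f = normA D n f by rewrite normAE.
have pr_lv m : (0 < m <= N)%N -> [/\ forall j, lam_at X m j != 0 /\ Z (lam_at X m j)^-1,
    forall j, level_space X m (pr_at X m j) /\ forall g, level_space X m g ->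
      formA D n (pr_at X m j) g = lam_at X m j * formB D n (pr_at X m j) g,
    forall j, sip_norm (formA D n) (pr_at X m j) = 1 &
    forall b : 'I_q -> R[i], null D (\sum_j pscale (b j) (pr_at X m j)) -> forall j, b j = 0].
  move=> mN; have [_ He [_ fr _] _] := Hlev m mN; split; [exact: lamZ| | |exact: fr].
    by move=> j; have [[Vj _ Ej] _ _ _] := He j.
  by move=> j; have [_ _ nj _] := He j; rewrite nAE.
have du_lv m : (0 < m <= N)%N -> [/\ forall j, conjc (lam_at X m j) != 0 /\ [set conjc z | z in Z] (conjc (lam_at X m j))^-1,
    forall j, level_space X m (du_at X m j) /\ forall g, level_space X m g ->
      formA D n (du_at X m j) g = conjc (lam_at X m j) * conjc (formB D n g (du_at X m j)),
    forall j, sip_norm (formA D n) (du_at X m j) = 1 &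
    forall b : 'I_q -> R[i], null D (\sum_j pscale (b j) (du_at X m j)) -> forall j, b j = 0].
  move=> mN; have [_ He _ [_ fr _]] := Hlev m mN; split; [exact: lamZs| | |exact: fr].
    move=> j; have [_ [Vj _ Ej] _ _] := He j; split; first exact: Vj.
    move=> g Vg; rewrite (sip_conj AS (LH m mN _ Vg) (LH m mN _ Vj)) (Ej g Vg) conjcM.
    by rewrite [conjc (conjc (conjc _))]conjcK.
  by move=> j; have [_ _ _ nj] := He j; rewrite nAE.
have ratio (a b : R) : c1 * (beta^-1 * a) <= b -> a <= beta / c1 * b.
  move=> hab; have b0 : 0 < beta := lt_trans ltr01 hbeta.
  have := ler_wpM2l (ltW B0) hab; congr (_ <= _); field.
  by rewrite !gt_eqF.
have st1 m : (0 < m < N)%N -> approx_dist D (fe_at S X m) (eigenspace D n l) <=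
      beta / c1 * approx_dist D (fe_at S X m.+1) (eigenspace D n l) /\
    forall j, level_space X m.+1 (prhat_at X m.+1 j) /\ forall g, fe_at S X m.+1 g ->
      formA D n (prhat_at X m.+1 j) g = lam_at X m j * formB D n (pr_at X m j) g.
  move=> mN; have [_ /andP[hdl _] _] := Hd m mN; split; first exact: ratio hdl.
  have /andP[m0 mlt] := mN; have [_ _ _ hh] := LF m.+1 mlt; have [Hp' _ _ _ _] := Hcor m mN.
  by move=> j; split; [exact: (hh j m0).1|exact: (Hp' j).2].
have st2 m : (0 < m < N)%N -> approx_dist D (fe_at S X m) (dual_eigenspace D n (conjc l)) <=
      beta / c1 * approx_dist D (fe_at S X m.+1) (dual_eigenspace D n (conjc l)) /\
    forall j, level_space X m.+1 (duhat_at X m.+1 j) /\ forall g, fe_at S X m.+1 g ->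
      formA D n (duhat_at X m.+1 j) g = conjc (lam_at X m j) * conjc (formB D n g (du_at X m j)).
  move=> mN; have [_ _ /andP[hdl _]] := Hd m mN; split; first exact: ratio hdl.
  have /andP[m0 mlt] := mN; have [_ _ _ hh] := LF m.+1 mlt; have [_ Hp' _ _ _] := Hcor m mN.
  move=> j; split; first exact: (hh j m0).2.
  move=> g Fg; have [Fh Eh] := Hp' j.
  by rewrite (sip_conj AS (FH _ _ Fg) (FH _ _ Fh)) (Eh g Fg) conjcM.
have [[ap1p ap1] E1] := side1 N (mesh_at X) (level_space X) PF PV (lam_at X) (pr_at X) (prhat_at X)
  N1 h1 small1 lv pr_lv L1 st1.
have [[ap2p ap2] E2] := side2 N (mesh_at X) (level_space X) PF PV (fun m j => conjc (lam_at X m j)) (du_at X) (duhat_at X)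
  N1 h1 small2 lv du_lv L1 st2.
have dN0 : 0 <= dN by apply: approx_dist_ge0; exact: (Ss _).1.
have dsN0 : 0 <= dsN by apply: approx_dist_ge0; exact: (Ss _).1.
have CC1 : C1 <= C1 + C2 + Cl + 1 by rewrite -!addrA lerDl; exact: (addr_ge0 C20 (addr_ge0 Cl0 ler01)).
have CC2 : C2 <= C1 + C2 + Cl + 1 by rewrite -!addrA addrCA lerDl; exact: (addr_ge0 C10 (addr_ge0 Cl0 ler01)).
have CC3 : Cl <= C1 + C2 + Cl + 1 by rewrite addrAC lerDr; exact: (addr_ge0 (addr_ge0 C10 C20) ler01).
move=> j; have [f [Hf nf Ef [n1 n1s] ev]] := E1 j; have [fs [Hfs nfs Efs [n2 n2s] _]] := E2 j.
have hp s := powR_ge0 H (r s).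
exists f, fs; split.
- by split; [split; [exact: Hf|exact: nf|exact: Ef]|exact: dualE].
- split; first by apply: le_trans n1 _; exact: (ler_wpM2r dN0 CC1).
  move=> s s2; apply: le_trans (n1s s s2) _; apply: (ler_wpM2r dN0); exact: (ler_wpM2r (hp s) CC1).
- by apply: le_trans n2 _; exact: (ler_wpM2r dsN0 CC2).
- move=> s s2; apply: le_trans (n2s s s2) _; apply: (ler_wpM2r dsN0); exact: (ler_wpM2r (hp s) CC2).
have NN : (0 < N <= N)%N by rewrite N1 leqnn.
have [[Hz _] _ _ _] := Hlev N NN.
have ev' := ev _ ap2p ap2.
apply: le_trans (eigenvalue_le l0 (lamZ N NN j).1 erefl (Hz j) ev') _.
have -> : Normc.normc l * (Normc.normc l + rho) * (C1 * dN * (C2 * dsN)) = Cl * dN * dsN.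
  by rewrite /Cl; move: (dN) (dsN) => *; ring.
by apply: (ler_wpM2r dsN0); exact: (ler_wpM2r dN0 CC3).
Qed.
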